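(* (1) For every integer $j$ let $$f_{2,j}(\tau)=4E_{1,-4}(\tau)+(-1)^j2\sqrt{-1}\big(E_{1,-4}(\tau/2)-E_{1,-4}((\tau+1)/2)\big).$$ Then for all integers $j$ and $\tau\in\mathcal{H}$: $f_{2,j}^4(\tau)=F_{2,j}(\tau)$, $f_{2,j}(\tau)f_{2,j+1}(\tau)=E_{2,2}(\tau)$, $f_{2,j}\big(((-1)^j+\sqrt{-1})/2\big)=0$, $f_{2,j}(\tau+1)=f_{2,j+1}(\tau)$, and $f_{2,j}(-1/(2\tau))=((-1)^j-\sqrt{-1})\,\tau f_{2,j+1}(\tau)$. (2) For every integer $j$ let $$g_{2,j}(\tau)=\sum_{0\le i\le 3}(1-2\delta_{i,j})E_{1,-8}((\tau+i)/4).$$ Then for all integers $j$ and $\tau\in\mathcal{H}$: $g_{2,j}^2(\tau)=G_{2,j}(\tau)$, $\prod_{0\le k\le 3}g_{2,k}(\tau)=E_{2,4}(\tau)$, $g_{2,j}\big((4-j)+\sqrt{-2}/2\big)=0$, $g_{2,j}(\tau+1)=g_{2,j+1}(\tau)$, and $g_{2,j}(-1/(2\tau))=\varepsilon_j\sqrt{-2}\,\tau g_{2,j}(\tau)$, where $\varepsilon_j=1$ if $4\mid j$ and $\varepsilon_j=-1$ if $4\nmid j$.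
   Context: $\mathcal{H}$ is the upper half-plane, $q=e^{2\pi i\tau}$, $\eta(\tau)=q^{1/24}\prod_{n\ge1}(1-q^n)$, $E_2=1-24\sum_{n\ge1}\sigma_1(n)q^n$, $E_4=1+240\sum_{n\ge1}\sigma_3(n)q^n$. $E_{2,2}(\tau)=2E_2(2\tau)-E_2(\tau)$, $E_{2,4}(\tau)=(4E_4(2\tau)-E_4(\tau))/3$, $\eta_2(\tau)=\eta(\tau)\eta(2\tau)$, $F_{2,j}=E_{2,4}-(-1)^j\sqrt{-256}\,\eta_2^4$, $G_{2,j}=E_{2,2}-4i^j\eta_2^2$. For a negative discriminant $D\in\{-4,-8\}$ with Kronecker symbol $\left(\frac{D}{\cdot}\right)$: $E_{1,-4}(\tau)=\frac14+\sum_{n\ge1}\big(\sum_{d\mid n}\left(\frac{-4}{d}\right)\big)q^n$ (so $E_{1,-4}=\theta^2/4$ with $\theta=\sum_{n\in\mathbb Z}q^{n^2}$) and $E_{1,-8}(\tau)=\frac12+\sum_{n\ge1}\big(\sum_{d\mid n}\left(\frac{-8}{d}\right)\big)q^n$. $\delta_{i,j}=1$ if $i\equiv j\pmod 4$ and $0$ otherwise. $\sqrt{-1}=i$, $\sqrt{-2}=i\sqrt2$, $\sqrt{-256}=16i$.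
   Formalization: The identity f_{2,j}^4 = F_{2,j} is false with √−256 = 16i (the q^{1/2} coefficients are (−1)^j·16i and −(−1)^j·16i); it is replaced by f_{2,j}^4 = F_{2,j+1}, i.e. the sign of √−256 in F is flipped. *)

(* Defs.v *)
(* Stdlib reals and Coquelicot's complex numbers; MathComp is used only for
   [prime.divisors] and [prime.prime_decomp]. *)
From Stdlib Require Import Reals ZArith List.
From Coquelicot Require Import Coquelicot.
From mathcomp Require prime.

Open Scope C_scope.

Definition Cexp (z : C) : C := exp (Re z) * (cos (Im z), sin (Im z)).

Definition Cpowz (z : C) (m : Z) : C :=
  match m with
  | Z0 => 1
  | Zpos p => z ^ Pos.to_nat p
  | Zneg p => / (z ^ Pos.to_nat p)
  end.

Definition CLim_seq (u : nat -> C) : C :=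
  (real (Lim_seq (fun n => Re (u n))), real (Lim_seq (fun n => Im (u n)))).

Definition CSeries (a : nat -> C) : C :=
  (Series (fun n => Re (a n)), Series (fun n => Im (a n))).

(* [Cprod u n] is the product of [u k] for k < n. *)
Fixpoint Cprod (u : nat -> C) (n : nat) : C :=
  match n with
  | O => 1
  | S m => Cprod u m * u m
  end.

(* e(z) = exp(2 pi i z), so that q^r = e(r tau) for every rational r. *)
Definition e (z : C) : C := Cexp (2 * PI * Ci * z).

(* c0 + sum_{n >= 1} a(n) q^n *)
Definition qseries (c0 : C) (a : nat -> C) (tau : C) : C :=
  c0 + CSeries (fun n => a (S n) * e tau ^ S n).

Definition sigma (k n : nat) : nat :=
  fold_right Nat.add 0%nat (map (fun d => Nat.pow d k) (prime.divisors n)).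

(* Legendre symbol, for p an odd prime. *)
Definition legendre (a : Z) (p : nat) : Z :=
  (if a mod Z.of_nat p =? 0 then 0
   else if existsb (fun x => (Z.of_nat x ^ 2 - a) mod Z.of_nat p =? 0)
                   (List.seq 0 p)
   then 1 else -1)%Z.

Definition kronecker_prime (a : Z) (p : nat) : Z :=
  (if Nat.eqb p 2 then
     if a mod 2 =? 0 then 0
     else if orb (a mod 8 =? 1) (a mod 8 =? 7) then 1 else -1
   else legendre a p)%Z.

(* Kronecker symbol (a/n), for n >= 1, by multiplicativity in n. *)
Definition kronecker (a : Z) (n : nat) : Z :=
  fold_right (fun pe r => (kronecker_prime a (fst pe) ^ Z.of_nat (snd pe) * r)%Z)
    1%Z (prime.prime_decomp n).

(* sum_{d | n} (D/d) *)
Definition kronecker_divisor_sum (D : Z) (n : nat) : Z :=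
  fold_right Z.add 0%Z (map (kronecker D) (prime.divisors n)).

Definition eta (tau : C) : C :=
  e (tau / 24) * CLim_seq (Cprod (fun n => 1 - e tau ^ S n)).

Definition E2 (tau : C) : C := qseries 1 (fun n => - 24 * INR (sigma 1 n)) tau.
Definition E4 (tau : C) : C := qseries 1 (fun n => 240 * INR (sigma 3 n)) tau.

Definition E22 (tau : C) : C := 2 * E2 (2 * tau) - E2 tau.
Definition E24 (tau : C) : C := (4 * E4 (2 * tau) - E4 tau) / 3.
Definition eta2 (tau : C) : C := eta tau * eta (2 * tau).

(* sqrt(-256) = 16 i.  Beware of the sign: F2 j tau = 1 - (-1)^j 16 i q^(1/2) + ...
   whereas (f2 j tau)^4 = 1 + (-1)^j 16 i q^(1/2) + ... for [f2] below, so that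
   the fourth power of f2 j is F2 (j + 1). *)
Definition F2 (j : Z) (tau : C) : C :=
  E24 tau - Cpowz (- 1) j * (16 * Ci) * eta2 tau ^ 4.

Definition G2 (j : Z) (tau : C) : C :=
  E22 tau - 4 * Cpowz Ci j * eta2 tau ^ 2.

(* E_{1,-4} and E_{1,-8} *)
Definition E1m4 (tau : C) : C :=
  qseries (1 / 4) (fun n => IZR (kronecker_divisor_sum (- 4) n)) tau.
Definition E1m8 (tau : C) : C :=
  qseries (1 / 2) (fun n => IZR (kronecker_divisor_sum (- 8) n)) tau.

Definition sqrtm2 : C := Ci * sqrt 2.

Definition delta4 (i j : Z) : Z := (if (i - j) mod 4 =? 0 then 1 else 0)%Z.

Definition f2 (j : Z) (tau : C) : C :=
  4 * E1m4 tau + Cpowz (- 1) j * 2 * Ci * (E1m4 (tau / 2) - E1m4 ((tau + 1) / 2)).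

Definition g2 (j : Z) (tau : C) : C :=
  sum_n (fun i : nat => IZR (1 - 2 * delta4 (Z.of_nat i) j)
                        * E1m8 ((tau + INR i) / 4)) 3.

Definition eps (j : Z) : C := if (j mod 4 =? 0)%Z then 1 else - 1.

(* Main.v *)
Require Import Defs.
From Stdlib Require Import Ranalysis5 Reals ZArith List Lia Lra Permutation ClassicalEpsilon Psatz.
From Coquelicot Require Import Coquelicot.
From mathcomp Require all_boot all_algebra all_solvable all_field.

(* Let a = th3(tau), b = th2(tau), c = th3(2 tau), d = th2(2 tau) be theta constants with nome q = e(tau),
   so that a^2 = c^2 + d^2 and b^2 = 2 c d.  Every function of the theorem is a polynomial in these:
     4 E_{1,-4}(tau) = a^2,  2 E_{1,-8}(tau) = a c,  E_{2,2} = a^4 + b^4,  2 eta_2^2 = a b (c^2 - d^2),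
     E_4 = a^8 + 14 a^4 b^4 + b^8,  E_{2,4} = a^8 - 6 a^4 b^4 + b^8,
   whence f_{2,j} = a^2 + (-1)^j i b^2 and g_{2,j} = a c - (-1)^j a d - i^j b c - i^{3j} b d; the identities
   to prove are then polynomial consequences of the two relations above.
   The first two formulas come from Kronecker's identity for Sum x^n / (1 + q^n): it makes the quotient of the
   two sides invariant under tau -> 2 tau, and that quotient tends to 1 at i oo.  E_{2,2} and E_4 come in the
   same way from Liouville's elementary identity, and the eta quotient from the Jacobi triple product.
   For tau -> - 1 / (4 tau) one sums a lattice series by rows and by columns, using the partial fractions of
   1 / sin and cot; this determines the multiplier of th3 up to a sign, found by continuity in tau.
   The zeros follow from the transformation laws at a fixed point. *)

(** * -4 and -8 as quadratic residues *)

(** No valence formula or contour integral is used. They are replaced by one remark: 2^k tau tends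
    to i oo, so a function that is invariant under doubling and has a limit at i oo equals that
    limit. Hence every identity is first brought into a form that links tau to 2 tau, and even the
    absence of zeros of the theta constants, needed to divide, is proved by doubling. Series are
    unconditional sums over arbitrary index types, so that parity splittings, rotations of Z x Z and
    regroupings are bijections of the index type. The Kronecker symbol is defined through
    factorisation; it becomes an explicit character once -4 and -8 are known as residues modulo p,
    which is read off from the action of Frobenius on an eighth root of unity. The inversion of
    f_{2,j} involves only the square of the multiplier of th3, so its sign never matters there. That
    of g_{2,j} involves the product of the multipliers at tau/2 and tau/4, and it is for this
    product alone that continuity in tau is developed. *)

Module QuadraticResidues.

Set Implicit Arguments.
Unset Strict Implicit.

Import all_boot all_algebra all_solvable all_field.
Import GRing.Theory.
Local Open Scope ring_scope.

(** The residues 0, ..., p - 1 are already p distinct roots of X^p - X; a further root [w] would be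
    one too many. *)
Lemma Frobenius_fixed_nat (K : fieldType) (p : nat) (w : K) : p \in [pchar K] ->
  w ^+ p = w -> exists2 x : nat, (x < p)%N & w = x%:R.
Proof.
move=> chK wp.
have p_pr := pcharf_prime chK.
have fixN (x : nat) : (x%:R : K) ^+ p = x%:R by rewrite -(pFrobenius_autE chK) pFrobenius_aut_nat.
pose s := [seq (i%:R : K) | i <- iota 0 p].
case: (boolP (w \in s)) => [/mapP[x]|wNs].
  by rewrite mem_iota add0n => /andP[_ xp] ->; exists x.
have us : uniq (w :: s).
  rewrite /= wNs map_inj_in_uniq ?iota_uniq // => i j.
  rewrite !mem_iota !add0n => /andP[_ ip] /andP[_ jp] /eqP eij.
  wlog lij : i j ip jp eij / (i <= j)%N.
    by move=> H; case/orP: (leq_total i j) => l; [exact: H|apply/esym/H => //; rewrite eq_sym].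
  move: eij; rewrite eq_sym -subr_eq0 -natrB // -(dvdn_pcharf chK) => d.
  apply/eqP; rewrite eqn_leq lij /= -subn_eq0; apply: contraLR d => n0.
  by rewrite gtnNdvd ?lt0n // (leq_ltn_trans (leq_subr _ _)).
have rt : all (root ('X^p - 'X : {poly K})) (w :: s).
  apply/allP => x; rewrite inE => /orP[/eqP->|/mapP[i _ ->]];
  by rewrite rootE !hornerE ?wp ?fixN subrr.
have szp : size ('X^p - 'X : {poly K}) = p.+1.
  by rewrite size_polyDl ?size_polyXn // size_polyN size_polyX ltnS prime_gt1.
have p0 : ('X^p - 'X : {poly K}) != 0 by rewrite -size_poly_gt0 szp.
by have := max_poly_roots p0 rt us; rewrite szp /= size_map size_iota ltnn.
Qed.

(** A square root [w] of -c in an extension lies in the prime field exactly when Frobenius fixes it.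
    This reduces quadratic residues to computing [w ^+ p]. *)
Lemma square_root_mod (K : fieldType) (p c : nat) (w : K) : p \in [pchar K] ->
  w ^+ 2 = - c%:R -> (exists2 x : nat, (x < p)%N & (p %| x ^ 2 + c)%N) <-> w ^+ p = w.
Proof.
move=> chK w2; split=> [[x _ px]|/(Frobenius_fixed_nat chK)[x xp wx]].
  have fixN (y : nat) : (y%:R : K) ^+ p = y%:R by rewrite -(pFrobenius_autE chK) pFrobenius_aut_nat.
  move: px; rewrite (dvdn_pcharf chK) natrD natrX addr_eq0 -w2 => /eqP xw.
  have /orP[/eqP->|/eqP->] : (w == x%:R) || (w == - x%:R) by rewrite -eqf_sqr xw.
    exact: fixN.
  by rewrite -(pFrobenius_autE chK) pFrobenius_autN pFrobenius_aut_nat.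
exists x => //; rewrite (dvdn_pcharf chK) natrD natrX -wx w2 addrC subrr //.
Qed.

(** 8 divides p^2 - 1, so the cyclic group of units of the field with p^2 elements has an element of
    order 8. *)
Lemma root8_exists (p : nat) : prime p -> odd p ->
  exists (K : finFieldType) (z : K), p \in [pchar K] /\ z ^+ 4 = -1.
Proof.
move=> p_pr p_odd; have [K chK cK] := pPrimePowerField p_pr (isT : 0 < 2)%N.
exists K.
have p2_gt1 : (1 < p ^ 2)%N by rewrite -(exp1n 2) ltn_exp2r // prime_gt1.
have n_gt0 : (0 < (p ^ 2).-1)%N by rewrite -ltnS prednK // ltnW.
have : has (p ^ 2).-1.-primitive_root (enum (predC1 (0 : K))).
  apply: has_prim_root => //; last by rewrite -cardE cardC1 cK.
    apply/allP => x; rewrite mem_enum !inE => x0; rewrite unity_rootE.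
    apply/eqP/(mulfI x0); rewrite -exprS prednK ?mulr1; last exact: ltnW.
    by rewrite -cK expf_card.
  exact: enum_uniq.
case/hasP => g _ gp.
(* With p = 2 h + 1, p^2 - 1 = 4 h (h + 1), and h (h + 1) is even. *)
have d8 : (8 %| (p ^ 2).-1)%N.
  have pE : p = (2 * p./2 + 1)%N by rewrite -[LHS]odd_double_half p_odd mul2n addnC.
  have -> : ((p ^ 2).-1 = 4 * (p./2 * p./2.+1))%N.
    by rewrite {1}pE sqrnD exp1n muln1 addnAC addn1 /= expnMn mulnA; change (2 ^ 2)%N with 4%N; change (2 * 2)%N with 4%N; rewrite -mulnn -mulnDr mulnSr.
  by rewrite -[8%N]/(4 * 2)%N (dvdn_pmul2l (p := 4)) // dvdn2 oddM /= andbN.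
have zp := dvdn_prim_root gp d8.
exists (g ^+ ((p ^ 2).-1 %/ 8)); split=> //.
set z := g ^+ _ in zp *.
have z8 : (z ^+ 4) ^+ 2 = 1 by rewrite -exprM; exact: prim_expr_order zp.
move/eqP: z8; rewrite sqrf_eq1 => /orP[|/eqP//].
by rewrite -(prim_order_dvd zp).
Qed.

Lemma pchar_nat_neq0 (K : fieldType) (p k : nat) : p \in [pchar K] -> ~~ (p %| k)%N -> (k%:R : K) != 0.
Proof. by move=> chK; rewrite (dvdn_pcharf chK). Qed.

Lemma odd_prime_dvd_pow2 (p k : nat) : prime p -> odd p -> ~~ (p %| 2 ^ k)%N.
Proof.
move=> pp op; rewrite Euclid_dvdX // negb_and -leqNgt; apply/orP; left.
by rewrite dvdn_prime2 //; apply/eqP => E; move: op; rewrite E.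
Qed.

(** For z^4 = -1 the element 2 z^2 is a square root of -4, and Frobenius sends it to 2 (z^2)^p,
    which depends only on p mod 4. *)
Lemma residue_m4 (p : nat) : prime p -> odd p ->
  (exists2 x : nat, (x < p)%N & (p %| x ^ 2 + 4)%N) <-> (p %% 4 = 1)%N.
Proof.
move=> pp op; have [K [z [chK z4]]] := root8_exists pp op.
have two0 : (2%:R : K) != 0 by exact: (pchar_nat_neq0 chK (odd_prime_dvd_pow2 1 pp op)).
have z8 : (z ^+ 2) ^+ 4 = 1 by rewrite -exprM (exprM z 4 2) z4 sqrrN expr1n.
have z0 : z != 0.
  by apply/eqP => E; move/eqP: z4; rewrite E expr0n /= eq_sym oppr_eq0 oner_eq0.
have w2 : (2%:R * z ^+ 2) ^+ 2 = - 4%:R :> K.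
  by rewrite exprMn -exprM z4 -natrX mulrN1.
rewrite (square_root_mod chK w2).
have -> : (2%:R * z ^+ 2) ^+ p = 2%:R * (z ^+ 2) ^+ (p %% 4).
  rewrite exprMn expr_mod //; congr (_ * _).
  by rewrite -(pFrobenius_autE chK) pFrobenius_aut_nat.
have o4 : odd (p %% 4) by rewrite odd_mod.
split=> [/(mulfI two0)|->]; last by rewrite expr1.
have : (p %% 4 < 4)%N by rewrite ltn_mod.
case: (p %% 4)%N o4 => [|[|[|[|k]]]] //= _ _ /eqP.
rewrite exprS -exprM z4 mulrN1 eq_sym -subr_eq0 opprK -mulr2n -mulr_natl mulf_eq0 (negPf two0).
by rewrite expf_eq0 (negPf z0).
Qed.

(** Since (z + z^3)^2 = z^2 - 2 - z^2 = -2, the element 2 (z + z^3) is a square root of -8.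
    Frobenius replaces z by z^p, which swaps z and z^3 or fixes them for p = 1, 3 mod 8, and changes
    the sign otherwise. *)
Lemma residue_m8 (p : nat) : prime p -> odd p ->
  (exists2 x : nat, (x < p)%N & (p %| x ^ 2 + 8)%N) <-> (p %% 8 = 1)%N \/ (p %% 8 = 3)%N.
Proof.
move=> pp op; have [K [z [chK z4]]] := root8_exists pp op.
have two0 : (2%:R : K) != 0 by exact: (pchar_nat_neq0 chK (odd_prime_dvd_pow2 1 pp op)).
have z8 : z ^+ 8 = 1 by rewrite (exprM z 4 2) z4 sqrrN expr1n.
have z5 : z ^+ 5 = - z by rewrite (exprD z 4 1) z4 mulN1r.
have z7 : z ^+ 7 = - z ^+ 3 by rewrite (exprD z 4 3) z4 mulN1r.
pose w : K := 2%:R * (z + z ^+ 3).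
have w2 : w ^+ 2 = - 8%:R.
  rewrite /w exprMn (sqrrD z) -exprM (exprD z 4 2) z4 mulN1r -exprS z4 addrAC subrr add0r.
  by rewrite mulNrn mulrN -natrX -natrM.
have w0 : w != 0.
  have -> : (w == 0) = (w ^+ 2 == 0) by rewrite expf_eq0.
  rewrite w2 oppr_eq0; exact: (pchar_nat_neq0 chK (odd_prime_dvd_pow2 3 pp op)).
rewrite (square_root_mod chK w2).
have fixN (y : nat) : (y%:R : K) ^+ p = y%:R by rewrite -(pFrobenius_autE chK) pFrobenius_aut_nat.
have wp : w ^+ p = 2%:R * (z ^+ (p %% 8) + (z ^+ (p %% 8)) ^+ 3).
  rewrite /w exprMn fixN expr_mod // -(pFrobenius_autE chK).
  rewrite (pFrobenius_autD_comm chK (mulrC _ _)) !(pFrobenius_autE chK) -!exprM.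
  by rewrite (mulnC 3).
have o8 : odd (p %% 8) by rewrite odd_mod.
have wN : w = - w -> False.
  move/eqP; rewrite -subr_eq0 opprK -mulr2n -mulr_natl mulf_eq0 (negPf two0) (negPf w0) //.
rewrite wp; have : (p %% 8 < 8)%N by rewrite ltn_mod.
case: (p %% 8)%N o8 => [|[|[|[|[|[|[|[|k]]]]]]]] //= _ _; split.
- by left.
- by rewrite expr1.
- by right.
- move=> _; rewrite -exprM (exprD z 8 1) z8 mul1r expr1 addrC //.
- rewrite z5 exprNn -signr_odd /= expr1 mulN1r -opprD mulrN -/w => /esym/wN //.
- by case.
- rewrite z7 exprNn -signr_odd /= expr1 mulN1r -exprM (exprD z 8 1) z8 mul1r expr1 -opprD addrC mulrN -/w => /esym/wN //.
- by case.
Qed.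

Lemma dvdn_divide (d m : nat) : (d %| m)%N <-> Nat.divide d m.
Proof. by split=> [/dvdnP|H]; [|apply/dvdnP]. Qed.

Lemma modn_modulo (m d : nat) : (0 < d)%N -> (m %% d)%N = Nat.modulo m d.
Proof.
move=> d0; apply: (Nat.mod_unique m d (m %/ d)%N).
  by apply/ltP; rewrite ltn_mod.
by rewrite [LHS](divn_eq m d) mulnC.
Qed.

Lemma odd_modulo (p : nat) : prime p -> p <> 2%N -> odd p.
Proof. by move=> pp p2; case: (even_prime pp). Qed.

Lemma NoDup_divisors (n : nat) : NoDup (divisors n).
Proof.
have: uniq (divisors n) by exact: divisors_uniq.
elim: (divisors n) => [|x s IH] /=; first by constructor.
case/andP=> xs us; constructor; last exact: IH.
move=> H; case/negP: xs; elim: s H {IH us} => //= y s IH [->|/IH]; rewrite inE ?eqxx // => ->.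
by rewrite orbT.
Qed.

Lemma In_mem (x : nat) (s : list nat) : List.In x s <-> x \in s.
Proof.
elim: s => //= y s IH; rewrite inE; split.
  by case=> [->|/IH->]; rewrite ?eqxx ?orbT.
by case/orP=> [/eqP->|/IH]; [left|right].
Qed.

Lemma In_divisors (n d : nat) : List.In d (divisors (S n)) <-> Nat.divide d (S n).
Proof. by rewrite In_mem -dvdn_divisors // dvdn_divide. Qed.

Lemma kronecker_fold (D : Z) (chi : nat -> Z) :
  chi 1%N = Zpos xH -> (forall m n, chi (m * n)%N = Z.mul (chi m) (chi n)) ->
  (forall p, prime p -> kronecker_prime D p = chi p) ->
  forall n, (0 < n)%N -> kronecker D n = chi n.
Proof.
move=> chi1 chiM chip n n0; rewrite {2}(prod_prime_decomp n0) /kronecker.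
have: forall f, f \in prime_decomp n -> prime f.1.
  by case=> p k /mem_prime_decomp[].
elim: (prime_decomp n) => [|[p k] s IH] H; first by rewrite big_nil.
rewrite big_cons chiM /= IH; last by move=> f fs; apply: H; rewrite inE fs orbT.
congr Z.mul; rewrite chip; last by apply: (H (p, k)); rewrite inE eqxx.
elim: k {H} => [|k IHk]; first by rewrite expn0 chi1.
by rewrite expnS chiM -IHk Nat2Z.inj_succ Z.pow_succ_r //; exact: Nat2Z.is_nonneg.
Qed.

End QuadraticResidues.

Open Scope C_scope.

(** * Unconditional sums *)

Definition lsum {I : Type} (f : I -> C) (l : list I) : C :=
  fold_right (fun i s => f i + s) 0 l.

Definition rsum {I : Type} (g : I -> R) (l : list I) : R :=
  fold_right (fun i s => g i + s)%R 0%R l.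

(** Convergence along the directed set of finite subsets, given by lists without repetition. No
    enumeration of the index type is chosen, so sums over Z, Z x Z and disjoint unions are treated
    alike. *)
Definition has_sum {I : Type} (f : I -> C) (s : C) : Prop :=
  forall eps : R, (0 < eps)%R ->
  exists l0 : list I, forall l, NoDup l -> incl l0 l ->
    (Cmod (lsum f l - s) < eps)%R.

Definition sum_le {I : Type} (g : I -> R) (M : R) : Prop :=
  forall l : list I, NoDup l -> (rsum g l <= M)%R.

Definition abs_sum {I : Type} (f : I -> C) : Prop :=
  exists M, sum_le (fun i => Cmod (f i)) M.

Definition eq_em {I : Type} (x y : I) : {x = y} + {x <> y} :=
  excluded_middle_informative (x = y).

(** The value is arbitrary unless some [has_sum] is known. *)
Definition csum {I : Type} (f : I -> C) : C :=
  epsilon (inhabits (RtoC 0)) (has_sum f).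

Lemma lsum_app {I} (f : I -> C) l1 l2 : lsum f (l1 ++ l2) = lsum f l1 + lsum f l2.
Proof. induction l1 as [|x l1 IH]; simpl; [ring|rewrite IH; ring]. Qed.

Lemma rsum_app {I} (f : I -> R) l1 l2 : rsum f (l1 ++ l2) = (rsum f l1 + rsum f l2)%R.
Proof. induction l1 as [|x l1 IH]; simpl; [ring|rewrite IH; ring]. Qed.

Lemma lsum_perm {I} (f : I -> C) l1 l2 : Permutation l1 l2 -> lsum f l1 = lsum f l2.
Proof. induction 1; simpl; try ring; congruence. Qed.

Lemma rsum_perm {I} (f : I -> R) l1 l2 : Permutation l1 l2 -> rsum f l1 = rsum f l2.
Proof. induction 1; simpl; try ring; congruence. Qed.

Lemma lsum_ext {I} (f g : I -> C) l : (forall i, In i l -> f i = g i) -> lsum f l = lsum g l.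
Proof.
  induction l as [|x l IH]; simpl; intros H; auto.
  rewrite (H x), IH; auto.
Qed.

Lemma rsum_le {I} (f g : I -> R) l :
  (forall i, In i l -> f i <= g i)%R -> (rsum f l <= rsum g l)%R.
Proof.
  induction l as [|x l IH]; simpl; intros H; [lra|].
  apply Rplus_le_compat; auto.
Qed.

Lemma rsum_ge0 {I} (g : I -> R) l : (forall i, 0 <= g i)%R -> (0 <= rsum g l)%R.
Proof. intros H; induction l as [|x l IH]; simpl; [lra|]. specialize (H x). lra. Qed.

Lemma Cmod_lsum {I} (f : I -> C) l : (Cmod (lsum f l) <= rsum (fun i => Cmod (f i)) l)%R.
Proof.
  induction l as [|x l IH]; simpl; [rewrite Cmod_0; lra|].
  eapply Rle_trans; [apply Cmod_triangle|]. lra.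
Qed.

Lemma lsum_plus {I} (f g : I -> C) l : lsum (fun i => f i + g i) l = lsum f l + lsum g l.
Proof. induction l as [|x l IH]; simpl; [ring|rewrite IH; ring]. Qed.

Lemma lsum_scal {I} c (f : I -> C) l : lsum (fun i => c * f i) l = c * lsum f l.
Proof. induction l as [|x l IH]; simpl; [ring|rewrite IH; ring]. Qed.

Lemma rsum_scal {I} c (f : I -> R) l : rsum (fun i => c * f i)%R l = (c * rsum f l)%R.
Proof. induction l as [|x l IH]; simpl; [ring|rewrite IH; ring]. Qed.

Lemma lsum_map {I J} (h : J -> I) (f : I -> C) l : lsum f (map h l) = lsum (fun j => f (h j)) l.
Proof. induction l as [|x l IH]; simpl; [ring|rewrite IH; ring]. Qed.

Lemma rsum_map {I J} (h : J -> I) (f : I -> R) l : rsum f (map h l) = rsum (fun j => f (h j)) l.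
Proof. induction l as [|x l IH]; simpl; [ring|rewrite IH; ring]. Qed.

Lemma lsum_zero {I} (f : I -> C) l : (forall i, In i l -> f i = 0) -> lsum f l = 0.
Proof.
  induction l as [|x l IH]; simpl; intros H; auto.
  rewrite (H x), IH; auto; ring.
Qed.

Lemma NoDup_diff {I} (l0 l : list I) : NoDup l0 -> NoDup l -> incl l0 l ->
  exists l', NoDup l' /\ Permutation l (l0 ++ l') /\ (forall x, In x l' -> ~ In x l0).
Proof.
  intros N0 N Hi.
  exists (filter (fun x => if in_dec eq_em x l0 then false else true) l).
  assert (Hf : forall x, In x (filter (fun x => if in_dec eq_em x l0 then false else true) l)
             <-> In x l /\ ~ In x l0).
  { intros x. rewrite filter_In. destruct (in_dec eq_em x l0); split; intros [? ?]; split; auto; try discriminate; tauto. }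
  split; [now apply NoDup_filter|]. split; [|intros x; rewrite Hf; tauto].
  apply NoDup_Permutation; auto.
  - apply NoDup_app; auto; [now apply NoDup_filter|]. intros x H0. rewrite Hf. tauto.
  - intros x. rewrite in_app_iff, Hf. specialize (Hi x).
    destruct (in_dec eq_em x l0); tauto.
Qed.

Lemma rsum_incl {I} (g : I -> R) (l0 l : list I) : (forall i, 0 <= g i)%R ->
  NoDup l0 -> NoDup l -> incl l0 l -> (rsum g l0 <= rsum g l)%R.
Proof.
  intros Hg N0 N Hi. destruct (NoDup_diff l0 l N0 N Hi) as (l' & _ & P & _).
  rewrite (rsum_perm _ _ _ P), rsum_app. pose proof (rsum_ge0 g l' Hg). lra.
Qed.

Definition union {I : Type} (l1 l2 : list I) := nodup eq_em (l1 ++ l2).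

Lemma union_NoDup {I} (l1 l2 : list I) : NoDup (union l1 l2).
Proof. apply NoDup_nodup. Qed.

Lemma union_l {I} (l1 l2 : list I) : incl l1 (union l1 l2).
Proof. intros x H. apply nodup_In, in_app_iff. now left. Qed.

Lemma union_r {I} (l1 l2 : list I) : incl l2 (union l1 l2).
Proof. intros x H. apply nodup_In, in_app_iff. now right. Qed.

#[export] Hint Resolve union_NoDup union_l union_r : core.

Lemma Cmod_lt_eq (x y : C) : (forall eps, 0 < eps -> Cmod (x - y) < eps)%R -> x = y.
Proof.
  intros H. apply Ceq_minus, Cmod_eq_0.
  destruct (Req_dec (Cmod (x - y)) 0) as [|N]; auto.
  pose proof (Cmod_ge_0 (x - y)). specialize (H (Cmod (x - y))). lra.
Qed.

Lemma Cmod_minus_sym (x y : C) : Cmod (x - y) = Cmod (y - x).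
Proof. rewrite <- Cmod_opp. f_equal. ring. Qed.

Lemma Cmod_tri3 (x y z : C) : (Cmod (x - z) <= Cmod (x - y) + Cmod (y - z))%R.
Proof. replace (x - z) with ((x - y) + (y - z)) by ring. apply Cmod_triangle. Qed.

Lemma has_sum_unique {I} (f : I -> C) s t : has_sum f s -> has_sum f t -> s = t.
Proof.
  intros Hs Ht. apply Cmod_lt_eq. intros eps He.
  destruct (Hs (eps / 2)%R) as [l1 H1]; [lra|].
  destruct (Ht (eps / 2)%R) as [l2 H2]; [lra|].
  specialize (H1 (union l1 l2)). specialize (H2 (union l1 l2)).
  pose proof (Cmod_tri3 s (lsum f (union l1 l2)) t) as T.
  rewrite (Cmod_minus_sym s (lsum f _)) in T.
  specialize (H1 (union_NoDup _ _) (union_l _ _)).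
  specialize (H2 (union_NoDup _ _) (union_r _ _)).
  lra.
Qed.

Lemma csum_eq {I} (f : I -> C) s : has_sum f s -> csum f = s.
Proof.
  intros H. apply (has_sum_unique f); auto.
  unfold csum. apply epsilon_spec. now exists s.
Qed.

Lemma csum_ex {I} (f : I -> C) : (exists s, has_sum f s) -> has_sum f (csum f).
Proof. intros [s H]. now rewrite (csum_eq f s). Qed.

Lemma has_sum_ext {I} (f g : I -> C) s : (forall i, f i = g i) -> has_sum f s -> has_sum g s.
Proof.
  intros E H eps He. destruct (H eps He) as [l0 H0]. exists l0. intros l N Hi.
  rewrite (lsum_ext g f); auto.
Qed.

Lemma has_sum_plus {I} (f g : I -> C) s t :
  has_sum f s -> has_sum g t -> has_sum (fun i => f i + g i) (s + t).
Proof.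
  intros Hs Ht eps He.
  destruct (Hs (eps / 2)%R) as [l1 H1]; [lra|].
  destruct (Ht (eps / 2)%R) as [l2 H2]; [lra|].
  exists (l1 ++ l2). intros l N Hi. apply incl_app_inv in Hi. destruct Hi as [Ha Hb].
  rewrite lsum_plus.
  replace (lsum f l + lsum g l - (s + t)) with ((lsum f l - s) + (lsum g l - t)) by ring.
  eapply Rle_lt_trans; [apply Cmod_triangle|].
  specialize (H1 l N Ha). specialize (H2 l N Hb). lra.
Qed.

Lemma has_sum_scal {I} c (f : I -> C) s :
  has_sum f s -> has_sum (fun i => c * f i) (c * s).
Proof.
  intros Hs eps He.
  pose proof (Cmod_ge_0 c).
  destruct (Hs (eps / (Cmod c + 1))%R) as [l1 H1].
  { apply Rdiv_lt_0_compat; lra. }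
  exists l1. intros l N Hi. rewrite lsum_scal.
  replace (c * lsum f l - c * s) with (c * (lsum f l - s)) by ring.
  rewrite Cmod_mult. specialize (H1 l N Hi).
  pose proof (Cmod_ge_0 (lsum f l - s)).
  apply Rle_lt_trans with ((Cmod c) * (eps / (Cmod c + 1)))%R.
  { apply Rmult_le_compat_l; lra. }
  replace (Cmod c * (eps / (Cmod c + 1)))%R with (eps - eps / (Cmod c + 1))%R by (field; lra).
  assert (0 < eps / (Cmod c + 1))%R by (apply Rdiv_lt_0_compat; lra). lra.
Qed.

Lemma has_sum_opp {I} (f : I -> C) s : has_sum f s -> has_sum (fun i => - f i) (- s).
Proof.
  intros H. replace (- s) with (- (1) * s) by ring.
  apply has_sum_ext with (fun i => - (1) * f i); [intros; ring|now apply has_sum_scal].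
Qed.

Lemma has_sum_minus {I} (f g : I -> C) s t :
  has_sum f s -> has_sum g t -> has_sum (fun i => f i - g i) (s - t).
Proof. intros Hs Ht. apply has_sum_plus; auto. now apply has_sum_opp. Qed.

Lemma has_sum_scal_r {I} c (f : I -> C) s :
  has_sum f s -> has_sum (fun i => f i * c) (s * c).
Proof.
  intros H. rewrite Cmult_comm.
  apply has_sum_ext with (fun i => c * f i); [intros; ring|now apply has_sum_scal].
Qed.

Lemma has_sum_finite {I} (f : I -> C) l0 :
  NoDup l0 -> (forall i, ~ In i l0 -> f i = 0) -> has_sum f (lsum f l0).
Proof.
  intros N0 H0 eps He. exists l0. intros l N Hi.
  destruct (NoDup_diff l0 l N0 N Hi) as (l' & _ & P & Hd).
  rewrite (lsum_perm _ _ _ P), lsum_app.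
  rewrite (lsum_zero f l'); [|intros i Hi'; apply H0; auto].
  replace (lsum f l0 + 0 - lsum f l0) with (RtoC 0) by ring. now rewrite Cmod_0.
Qed.

Lemma has_sum_single {I} (f : I -> C) i0 s : f i0 = s -> (forall i, i <> i0 -> f i = 0) -> has_sum f s.
Proof.
  intros <- H. replace (f i0) with (lsum f (i0 :: nil)) by (simpl; ring).
  apply has_sum_finite.
  - constructor; [intros []|constructor].
  - intros i Hi. apply H. intros ->. apply Hi. now left.
Qed.

Lemma has_sum_0 {I} : has_sum (fun _ : I => RtoC 0) 0.
Proof. apply (has_sum_finite (fun _ : I => RtoC 0) nil); auto. constructor. Qed.

(** The sum is the supremum of the finite partial sums, which increase with the finite set. *)
Lemma has_sum_nonneg {I} (g : I -> R) M : (forall i, 0 <= g i)%R -> sum_le g M ->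
  exists s, has_sum (fun i => RtoC (g i)) (RtoC s).
Proof.
  intros Hg HM.
  set (E := fun x => exists l, NoDup l /\ x = rsum g l).
  destruct (completeness E) as [s [Hub Hlub]].
  - exists M. intros x (l & N & ->). now apply HM.
  - exists 0%R. exists nil. split; [constructor|reflexivity].
  - exists s. intros eps He.
    assert (exists l0, NoDup l0 /\ s - eps < rsum g l0)%R as (l0 & N0 & H0).
    { apply Classical_Prop.NNPP. intros Hn.
      assert (s <= s - eps)%R; [|lra].
      apply Hlub. intros x (l & N & ->).
      apply Rnot_lt_le. intros Hlt. apply Hn. now exists l. }
    exists l0. intros l N Hi.
    assert (E1 : forall l, lsum (fun i => RtoC (g i)) l = RtoC (rsum g l)).
    { induction l1 as [|x l1 IH]; simpl; auto. rewrite IH. now rewrite RtoC_plus. }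
    rewrite E1, <- RtoC_minus, Cmod_R.
    assert (rsum g l <= s)%R by (apply Hub; now exists l).
    pose proof (rsum_incl g l0 l Hg N0 N Hi).
    apply Rabs_def1; lra.
Qed.

Lemma sum_le_mono {I} (f g : I -> R) M :
  (forall i, f i <= g i)%R -> sum_le g M -> sum_le f M.
Proof.
  intros H HM l N. eapply Rle_trans; [|apply (HM l N)]. apply rsum_le; auto.
Qed.

Lemma abs_sum_ex {I} (f : I -> C) : abs_sum f -> exists s, has_sum f s.
Proof.
  intros [M HM].
  (* To be used with [h] the real and the imaginary part: positive and negative parts are summed
     separately. *)
  assert (K : forall h : C -> R, (forall z, Rabs (h z) <= Cmod z)%R ->
     exists s : R, has_sum (fun i => RtoC (h (f i))) (RtoC s)).
  { intros h Hh.
    destruct (has_sum_nonneg (fun i => Rmax (h (f i)) 0) M) as [s1 H1].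
    { intros. apply Rmax_r. }
    { eapply sum_le_mono; [|apply HM]. intros i. specialize (Hh (f i)).
      pose proof (Rle_abs (h (f i))). pose proof (Cmod_ge_0 (f i)).
      simpl. apply Rmax_lub; lra. }
    destruct (has_sum_nonneg (fun i => Rmax (- h (f i)) 0) M) as [s2 H2].
    { intros. apply Rmax_r. }
    { eapply sum_le_mono; [|apply HM]. intros i. specialize (Hh (f i)).
      pose proof (Rle_abs (- h (f i))). rewrite Rabs_Ropp in H. pose proof (Cmod_ge_0 (f i)).
      simpl. apply Rmax_lub; lra. }
    exists (s1 - s2)%R. rewrite RtoC_minus.
    eapply has_sum_ext; [|apply (has_sum_minus _ _ _ _ H1 H2)].
    intros i. simpl. rewrite <- RtoC_minus. f_equal.
    unfold Rmax. destruct (Rle_dec (h (f i)) 0), (Rle_dec (- h (f i)) 0); lra. }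
  destruct (K Re) as [s1 H1]; [apply re_le_Cmod|].
  destruct (K Im) as [s2 H2].
  { intros z. eapply Rle_trans; [apply Rmax_r|]. apply Rmax_Cmod. }
  exists (s1 + Ci * s2).
  eapply has_sum_ext; [|apply (has_sum_plus _ _ _ _ H1 (has_sum_scal Ci _ _ H2))].
  intros i. simpl. destruct (f i) as [x y]. unfold Ci, Cmult, Cplus, RtoC; simpl. f_equal; ring.
Qed.

Lemma abs_sum_has {I} (f : I -> C) : abs_sum f -> has_sum f (csum f).
Proof. intros H. now apply csum_ex, abs_sum_ex. Qed.

Lemma abs_sum_le {I} (f g : I -> C) :
  (forall i, Cmod (f i) <= Cmod (g i))%R -> abs_sum g -> abs_sum f.
Proof. intros H [M HM]. exists M. exact (sum_le_mono _ _ M H HM). Qed.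

Lemma abs_sum_le_R {I} (f : I -> C) (g : I -> R) M :
  (forall i, Cmod (f i) <= g i)%R -> sum_le g M -> abs_sum f.
Proof. intros H HM. exists M. exact (sum_le_mono _ _ M H HM). Qed.

Lemma sum_le_scal {I} c (g : I -> R) M : (0 <= c)%R -> sum_le g M ->
  sum_le (fun i => c * g i)%R (c * M)%R.
Proof. intros Hc H l N. rewrite rsum_scal. apply Rmult_le_compat_l; auto. Qed.

Lemma abs_sum_scal {I} c (f : I -> C) : abs_sum f -> abs_sum (fun i => c * f i).
Proof.
  intros [M HM]. exists (Cmod c * M)%R.
  eapply sum_le_mono; [|apply (sum_le_scal (Cmod c) _ _ (Cmod_ge_0 c) HM)].
  intros i; simpl. rewrite Cmod_mult; lra.
Qed.

Lemma sum_le_inj {I J} (h : J -> I) (g : I -> R) M :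
  (forall x y, h x = h y -> x = y) -> sum_le g M -> sum_le (fun j => g (h j)) M.
Proof.
  intros Hinj HM l N. rewrite <- rsum_map. apply HM.
  apply FinFun.Injective_map_NoDup; auto.
Qed.

Lemma abs_sum_inj {I J} (h : J -> I) (f : I -> C) :
  (forall x y, h x = h y -> x = y) -> abs_sum f -> abs_sum (fun j => f (h j)).
Proof.
  intros Hinj [M HM]. exists M.
  apply (sum_le_inj h (fun i => Cmod (f i)) M); auto.
Qed.

Lemma has_sum_inj {I J} (h : J -> I) (f : I -> C) s :
  (forall x y, h x = h y -> x = y) -> (forall i, (forall j, h j <> i) -> f i = 0) ->
  has_sum f s <-> has_sum (fun j => f (h j)) s.
Proof.
  intros Hinj H0.
  (* The part of [l] inside the image of [h] is pulled back to a list [lj]; the rest of [l]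
     contributes 0. *)
  assert (Hpre : forall l, NoDup l -> exists lj, NoDup lj /\ incl (map h lj) l /\
     (forall i, In i l -> (exists j, h j = i) -> In i (map h lj)) /\ lsum f l = lsum f (map h lj)).
  { induction l as [|x l IH]; intros N.
    - exists nil. repeat split; auto; [constructor|intros ? []].
    - inversion N as [|? ? Hx Nl]; subst. destruct (IH Nl) as (lj & Nj & Hi & Hs & E).
      destruct (excluded_middle_informative (exists j, h j = x)) as [[j Hj]|Hn].
      + exists (j :: lj). repeat split.
        * constructor; auto. intros Hin. apply Hx, Hi. rewrite <- Hj. now apply in_map.
        * simpl. rewrite Hj. intros y [->|Hy]; [now left|right; auto].
        * simpl. rewrite Hj. intros y [->|Hy]; [now left|right; auto].
        * simpl. now rewrite Hj, E.
      + exists lj. repeat split; auto.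
        * intros y Hy; right; auto.
        * intros y [->|Hy] Hex; [tauto|auto].
        * simpl. rewrite H0, E; [ring|]. intros j Hj. apply Hn. now exists j. }
  split; intros H eps He; destruct (H eps He) as [l0 Hl].
  - destruct (Hpre (nodup eq_em l0)) as (lj & Nj & Hi & Hs & E); [apply NoDup_nodup|].
    exists lj. intros l N Hinc.
    destruct (NoDup_diff (map h lj) (map h l)) as (l' & N' & P & Hd).
    { now apply FinFun.Injective_map_NoDup. }
    { now apply FinFun.Injective_map_NoDup. }
    { now apply incl_map. }
    rewrite <- lsum_map.
    (* The indices of [l0] outside the image are appended, at no cost for the sum, so that the list
       contains [l0]. *)
    set (rest := filter (fun x => if excluded_middle_informative (exists j, h j = x) then false else true) (nodup eq_em l0)).
    assert (Hrest : forall x, In x rest <-> In x l0 /\ ~ exists j, h j = x).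
    { intros x. unfold rest. rewrite filter_In, nodup_In.
      destruct (excluded_middle_informative (exists j, h j = x)); split; intros [? ?]; split; auto; try discriminate; tauto. }
    assert (E2 : lsum f (map h l) = lsum f (map h l ++ rest)).
    { rewrite lsum_app, (lsum_zero f rest); [ring|]. intros i Hin. apply H0.
      apply Hrest in Hin. intros j Hj. apply Hin. now exists j. }
    rewrite E2. apply Hl.
    + apply NoDup_app.
      * now apply FinFun.Injective_map_NoDup.
      * unfold rest. apply NoDup_filter, NoDup_nodup.
      * intros x Hx. rewrite Hrest. apply in_map_iff in Hx. destruct Hx as (j & Hj & _).
        intros [_ Hn]. apply Hn. now exists j.
    + intros x Hx. apply in_app_iff.
      destruct (excluded_middle_informative (exists j, h j = x)) as [Hex|Hn].
      * left. apply (incl_map h Hinc). apply Hs; auto. now apply nodup_In.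
      * right. apply Hrest. split; auto.
  - exists (map h l0). intros l N Hinc.
    destruct (Hpre l N) as (lj & Nj & Hi & Hs & E).
    rewrite E, lsum_map. apply Hl; auto.
    intros j Hj. assert (Hin : In (h j) (map h lj)).
    { apply Hs; [apply Hinc; now apply in_map|now exists j]. }
    apply in_map_iff in Hin. destruct Hin as (j' & Hj' & Hin). now rewrite <- (Hinj _ _ Hj').
Qed.

Lemma has_sum_bij {I J} (h : J -> I) (k : I -> J) (f : I -> C) s :
  (forall j, k (h j) = j) -> (forall i, h (k i) = i) ->
  has_sum f s <-> has_sum (fun j => f (h j)) s.
Proof.
  intros K1 K2. apply has_sum_inj.
  - intros x y E. rewrite <- (K1 x), <- (K1 y). now rewrite E.
  - intros i Hn. exfalso. apply (Hn (k i)). apply K2.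
Qed.

Lemma has_sum_fibre {I J} (p : I -> J) (f : I -> C) (r : J -> C) s :
  has_sum f s ->
  (forall j, has_sum (fun i => if eq_em (p i) j then f i else 0) (r j)) ->
  has_sum r s.
Proof.
  intros Hf Hr eps He.
  destruct (Hf (eps / 2)%R) as [l0 H0]; [lra|].
  exists (map p l0). intros lj Nj Hinc.
  set (F := fun j i => if eq_em (p i) j then f i else 0).
  set (Fd := fun j (i : I) => if eq_em (p i) j then true else false).
  (* One finite piece per fibre, containing the part of [l0] over that point and within [delta] of
     the fibre sum. The pieces are disjoint, hence can be concatenated. *)
  assert (A : forall (delta : R), (0 < delta)%R -> forall lj, NoDup lj ->
     exists l, NoDup l /\ (forall i, In i l0 -> In (p i) lj -> In i l) /\
      (forall i, In i l -> In (p i) lj) /\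
      (Cmod (lsum f l - lsum r lj) <= delta * INR (length lj))%R).
  { intros delta Hd. clear lj Nj Hinc. induction lj as [|j lj IH]; intros Nj.
    - exists nil. split; [constructor|]. split; [intros i _ []|]. split; [intros i []|].
      simpl. replace (0 - 0) with (RtoC 0) by ring. rewrite Cmod_0. lra.
    - inversion Nj as [|? ? Hj Nj']; subst. destruct (IH Nj') as (l & Nl & H1 & H2 & H3).
      destruct (Hr j delta Hd) as [m0 Hm].
      set (m := filter (Fd j) (union m0 l0)).
      assert (Hmin : forall i, In i m <-> In i (union m0 l0) /\ p i = j).
      { intros i. unfold m, Fd. rewrite filter_In. destruct (eq_em (p i) j); split; intros [? ?]; split; auto; try discriminate; tauto. }
      exists (l ++ m). repeat split.
      + apply NoDup_app; auto.
        * apply NoDup_filter; auto.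
        * intros x Hx. rewrite Hmin. intros [_ E]. apply Hj. rewrite <- E. auto.
      + intros i Hi [E|Hin]; apply in_app_iff.
        * right. apply Hmin. split; auto. now apply union_r.
        * left; auto.
      + intros i Hi. apply in_app_iff in Hi. destruct Hi as [Hi|Hi]; [right; auto|].
        left. symmetry. now apply Hmin.
      + rewrite lsum_app. simpl lsum. simpl length. rewrite S_INR.
        replace (lsum f l + lsum f m - (r j + lsum r lj))
          with ((lsum f l - lsum r lj) + (lsum f m - r j)) by ring.
        eapply Rle_trans; [apply Cmod_triangle|].
        assert (E : lsum f m = lsum (F j) (union m0 l0)).
        { unfold m. clear. unfold F, Fd. induction (union m0 l0) as [|x u IHu]; simpl; auto.
          destruct (eq_em (p x) j); simpl; rewrite IHu; ring. }
        rewrite E. specialize (Hm (union m0 l0) (union_NoDup _ _) (union_l _ _)).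
        unfold F. lra. }
  set (n := INR (length lj)).
  assert (0 <= n)%R by apply pos_INR.
  destruct (A (eps / 2 / (n + 1))%R) with (lj := lj) as (l & Nl & H1 & H2 & H3); auto.
  { apply Rdiv_lt_0_compat; lra. }
  assert (Hl : incl l0 l). { intros i Hi. apply H1; auto. apply Hinc. now apply in_map. }
  specialize (H0 l Nl Hl).
  rewrite Cmod_minus_sym in H3.
  eapply Rle_lt_trans; [apply (Cmod_tri3 _ (lsum f l))|].
  fold n in H3.
  assert (eps / 2 / (n + 1) * n <= eps / 2)%R.
  { replace (eps / 2 / (n + 1) * n)%R with (eps / 2 - eps / 2 / (n + 1))%R by (field; lra).
    assert (0 < eps / 2 / (n + 1))%R by (apply Rdiv_lt_0_compat; lra). lra. }
  lra.
Qed.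

Lemma has_sum_rows {J K} (f : J * K -> C) (r : J -> C) s :
  has_sum f s -> (forall j, has_sum (fun k => f (j, k)) (r j)) -> has_sum r s.
Proof.
  intros Hf Hr. apply (has_sum_fibre fst f r s Hf).
  intros j. apply (has_sum_inj (fun k => (j, k))).
  - intros x y E. now inversion E.
  - intros [j' k] Hn. simpl. destruct (eq_em j' j) as [->|]; auto. exfalso. now apply (Hn k).
  - eapply has_sum_ext; [|apply Hr]. intros k. simpl.
    destruct (eq_em j j); [auto|tauto].
Qed.

Lemma has_sum_swap {J K} (f : J * K -> C) s :
  has_sum f s <-> has_sum (fun p => f (snd p, fst p)) s.
Proof.
  apply (has_sum_bij (fun p : K * J => (snd p, fst p)) (fun p => (snd p, fst p))); intros [x y]; auto.
Qed.

Lemma has_sum_cols {J K} (f : J * K -> C) (r : K -> C) s :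
  has_sum f s -> (forall k, has_sum (fun j => f (j, k)) (r k)) -> has_sum r s.
Proof.
  intros Hf Hr. apply has_sum_swap in Hf. apply (has_sum_rows _ r s Hf). exact Hr.
Qed.

Lemma rsum_prod {J K} (g : J * K -> R) l1 l2 :
  rsum g (list_prod l1 l2) = rsum (fun j => rsum (fun k => g (j, k)) l2) l1.
Proof.
  induction l1 as [|x l1 IH]; simpl; auto.
  now rewrite rsum_app, rsum_map, IH.
Qed.

Lemma NoDup_prod {J K} (l1 : list J) (l2 : list K) :
  NoDup l1 -> NoDup l2 -> NoDup (list_prod l1 l2).
Proof.
  intros N1 N2. induction N1 as [|x l1 Hx N1 IH]; simpl; [constructor|].
  apply NoDup_app; auto.
  - apply FinFun.Injective_map_NoDup; auto. intros y z E. now inversion E.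
  - intros [u v] Hu Hp. apply in_map_iff in Hu. destruct Hu as (y & E & _). inversion E; subst.
    apply in_prod_iff in Hp. tauto.
Qed.

(** Any finite set of pairs is enclosed in a rectangle, which is summed row by row. *)
Lemma sum_le_prod {J K} (g : J * K -> R) (m : J -> R) M :
  (forall p, 0 <= g p)%R -> (forall j, sum_le (fun k => g (j, k)) (m j)) -> sum_le m M ->
  sum_le g M.
Proof.
  intros Hg Hm HM l N.
  set (l1 := nodup eq_em (map fst l)). set (l2 := nodup eq_em (map snd l)).
  apply Rle_trans with (rsum g (list_prod l1 l2)).
  - apply rsum_incl; auto.
    + apply NoDup_prod; apply NoDup_nodup.
    + intros [x y] Hin. apply in_prod_iff. unfold l1, l2. rewrite !nodup_In.
      split; apply in_map_iff; now exists (x, y).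
  - rewrite rsum_prod. eapply Rle_trans; [|apply (HM l1); apply NoDup_nodup].
    apply rsum_le. intros j _. apply Hm. apply NoDup_nodup.
Qed.

Lemma sum_le_mult {J K} (g : J -> R) (h : K -> R) M N :
  (forall j, 0 <= g j)%R -> (forall k, 0 <= h k)%R -> (0 <= N)%R ->
  sum_le g M -> sum_le h N -> sum_le (fun p : J * K => g (fst p) * h (snd p))%R (M * N)%R.
Proof.
  intros Hg Hh HN H1 H2.
  apply sum_le_prod with (m := fun j => (N * g j)%R).
  - intros. apply Rmult_le_pos; auto.
  - intros j. simpl. rewrite Rmult_comm. apply sum_le_scal; auto.
  - rewrite Rmult_comm. apply sum_le_scal; auto.
Qed.

Lemma sum_le_ge0 {I} (g : I -> R) M : sum_le g M -> (0 <= M)%R.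
Proof. intros H. apply (H nil). constructor. Qed.

Lemma abs_sum_mult {J K} (f : J -> C) (g : K -> C) :
  abs_sum f -> abs_sum g -> abs_sum (fun p : J * K => f (fst p) * g (snd p)).
Proof.
  intros [M HM] [N HN]. exists (M * N)%R.
  apply sum_le_mono with (fun p : J * K => Cmod (f (fst p)) * Cmod (g (snd p)))%R.
  - intros; simpl. rewrite Cmod_mult. lra.
  - apply (sum_le_mult (fun j => Cmod (f j)) (fun k => Cmod (g k))); auto using Cmod_ge_0.
    now apply sum_le_ge0 in HN.
Qed.

(** Absolute convergence gives the existence of the double sum; its rows then identify the value. *)
Lemma has_sum_mult {J K} (f : J -> C) (g : K -> C) s t :
  abs_sum f -> abs_sum g -> has_sum f s -> has_sum g t ->
  has_sum (fun p : J * K => f (fst p) * g (snd p)) (s * t).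
Proof.
  intros Af Ag Hf Hg. pose proof (abs_sum_has _ (abs_sum_mult f g Af Ag)) as H.
  rewrite <- (has_sum_unique (fun j => f j * t) (csum (fun p : J * K => f (fst p) * g (snd p)))).
  - exact H.
  - apply (has_sum_rows _ _ _ H). intros j. simpl. now apply has_sum_scal.
  - now apply has_sum_scal_r.
Qed.

Lemma has_sum_sum {A B} (f : A + B -> C) s t :
  has_sum (fun a => f (inl a)) s -> has_sum (fun b => f (inr b)) t -> has_sum f (s + t).
Proof.
  intros Hs Ht.
  set (f1 := fun x : A + B => match x with inl a => f (inl a) | inr _ => RtoC 0 end).
  set (f2 := fun x : A + B => match x with inr a => f (inr a) | inl _ => RtoC 0 end).
  apply has_sum_ext with (fun x => f1 x + f2 x).
  { intros [a|b]; simpl; ring. }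
  apply has_sum_plus.
  - apply (has_sum_inj inl); auto.
    + intros x y E; now inversion E.
    + intros [a|b] Hn; auto. exfalso; now apply (Hn a).
  - apply (has_sum_inj inr); auto.
    + intros x y E; now inversion E.
    + intros [a|b] Hn; auto. exfalso; now apply (Hn b).
Qed.

Lemma sum_le_sum {A B} (g : A + B -> R) M N :
  (forall x, 0 <= g x)%R ->
  sum_le (fun a => g (inl a)) M -> sum_le (fun b => g (inr b)) N -> sum_le g (M + N).
Proof.
  intros Hg H1 H2 l Nd.
  assert (exists l1 l2, NoDup l1 /\ NoDup l2 /\ (forall a, In a l1 -> In (inl a) l) /\
     (forall a, In a l2 -> In (inr a) l) /\
    rsum g l = rsum (fun a => g (inl a)) l1 + rsum (fun b => g (inr b)) l2)%R
   as (l1 & l2 & N1 & N2 & _ & _ & E).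
  { clear - Nd. induction Nd as [|x l Hx Nd IH].
    - exists nil, nil. repeat split; simpl; auto; try constructor. ring.
    - destruct IH as (l1 & l2 & N1 & N2 & I1 & I2 & E). destruct x as [a|b].
      + exists (a :: l1), l2. split; [constructor; auto|]. split; [auto|].
        split; [intros a' [->|]; simpl; auto|]. split; [simpl; auto|]. simpl. rewrite E. ring.
      + exists l1, (b :: l2). split; [auto|]. split; [constructor; auto|].
        split; [simpl; auto|]. split; [intros a' [->|]; simpl; auto|]. simpl. rewrite E. ring. }
  rewrite E. specialize (H1 l1 N1). specialize (H2 l2 N2). lra.
Qed.

(** Dominated convergence along an arbitrary filter. It serves for tau -> i oo, for n -> oo and for
    tau -> z. *)
Lemma tannery {T I} (F : (T -> Prop) -> Prop) {FF : Filter F} (f : T -> I -> C) (s : T -> C)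
  (a : I -> C) (S : C) (g : I -> R) M :
  (forall i, 0 <= g i)%R -> sum_le g M ->
  F (fun t => forall i, (Cmod (f t i) <= g i)%R) ->
  (forall i eps, (0 < eps)%R -> F (fun t => (Cmod (f t i - a i) < eps)%R)) ->
  (forall i, (Cmod (a i) <= g i)%R) ->
  F (fun t => has_sum (f t) (s t)) -> has_sum a S ->
  forall eps, (0 < eps)%R -> F (fun t => (Cmod (s t - S) < eps)%R).
Proof.
  intros Hg HM Hdom Hlim Ha Hs HS eps He.
  destruct (has_sum_nonneg g M Hg HM) as [G HG].
  (* Two partial sums of [g] over sets containing [l0] differ by less than eps/4, so this bounds
     every dominated tail. The final estimate is eps/8 + eps/4 + eps/4 + eps/4 + eps/8. *)
  destruct (HG (eps / 8)%R) as [l0 H0]; [lra|].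
  set (L := union l0 nil).
  assert (Hfin : F (fun t => forall i, In i L -> (Cmod (f t i - a i) < eps / 4 / (INR (length L) + 1))%R)).
  { assert (P : (0 < eps / 4 / (INR (length L) + 1))%R).
    { apply Rdiv_lt_0_compat; [lra|]. pose proof (pos_INR (length L)); lra. }
    revert P. generalize (eps / 4 / (INR (length L) + 1))%R as delta. intros delta P.
    clear -FF Hlim P. induction L as [|x L IH].
    - apply filter_forall. intros t i [].
    - generalize (filter_and _ _ (Hlim x delta P) IH). apply filter_imp.
      intros t [H1 H2] i [<-|Hi]; auto. }
  assert (Htail : forall (h : I -> C) l, NoDup l -> incl L l ->
     (forall i, Cmod (h i) <= g i)%R -> (Cmod (lsum h l - lsum h L) <= eps / 4)%R).
  { intros h l N Hi Hh. destruct (NoDup_diff L l) as (l' & N' & P & Hd); auto.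
    { apply union_NoDup. }
    rewrite (lsum_perm _ _ _ P), lsum_app.
    replace (lsum h L + lsum h l' - lsum h L) with (lsum h l') by ring.
    eapply Rle_trans; [apply Cmod_lsum|].
    apply Rle_trans with (rsum g l'); [apply rsum_le; auto|].
    assert (E1 : forall l, lsum (fun i => RtoC (g i)) l = RtoC (rsum g l)).
    { induction l1 as [|x l1 IH]; simpl; auto. rewrite IH. now rewrite RtoC_plus. }
    pose proof (H0 L (union_NoDup _ _) (union_l _ _)) as K1.
    assert (K2 : (Cmod (lsum (fun i => RtoC (g i)) l - RtoC G) < eps / 8)%R).
    { apply H0; auto. intros x Hx. apply Hi. now apply union_l. }
    rewrite E1, <- RtoC_minus, Cmod_R in K1, K2.
    rewrite (rsum_perm _ _ _ P), rsum_app in K2.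
    apply Rabs_def2 in K1. apply Rabs_def2 in K2. lra. }
  generalize (filter_and _ _ Hdom (filter_and _ _ Hfin Hs)). apply filter_imp.
  intros t (D & Fin & St).
  destruct (St (eps / 8)%R) as [l1 H1]; [lra|].
  destruct (HS (eps / 8)%R) as [l2 H2]; [lra|].
  set (l := union L (union l1 l2)).
  assert (K1 : (Cmod (lsum (f t) l - s t) < eps / 8)%R).
  { apply H1; [apply union_NoDup|]. intros x Hx. apply union_r. now apply union_l. }
  assert (K2 : (Cmod (lsum a l - S) < eps / 8)%R).
  { apply H2; [apply union_NoDup|]. intros x Hx. apply union_r. now apply union_r. }
  assert (K3 := Htail (f t) l (union_NoDup _ _) (union_l _ _) D).
  assert (K4 := Htail a l (union_NoDup _ _) (union_l _ _) Ha).
  assert (K5 : (Cmod (lsum (f t) L - lsum a L) <= eps / 4)%R).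
  { apply Rle_trans with (eps / 4 / (INR (length L) + 1) * INR (length L))%R.
    - revert Fin. generalize (eps / 4 / (INR (length L) + 1))%R as delta. clear.
      intros delta. induction L as [|x L IH]; intros Fin.
      + simpl. replace (0 - 0) with (RtoC 0) by ring. rewrite Cmod_0. lra.
      + simpl lsum. simpl length. rewrite S_INR.
        replace (f t x + lsum (f t) L - (a x + lsum a L))
          with ((f t x - a x) + (lsum (f t) L - lsum a L)) by ring.
        eapply Rle_trans; [apply Cmod_triangle|].
        assert (Cmod (f t x - a x) < delta)%R by (apply Fin; now left).
        assert (Cmod (lsum (f t) L - lsum a L) <= delta * INR (length L))%R.
        { apply IH. intros i Hi. apply Fin. now right. }
        lra.
    - pose proof (pos_INR (length L)) as Pn. set (n := INR (length L)) in *.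
      replace (eps / 4 / (n + 1) * n)%R with (eps / 4 - eps / 4 / (n + 1))%R by (field; lra).
      assert (0 < eps / 4 / (n + 1))%R by (apply Rdiv_lt_0_compat; lra). lra. }
  replace (s t - S) with
    (- (lsum (f t) l - s t) + (lsum (f t) l - lsum (f t) L) + (lsum (f t) L - lsum a L)
     + - (lsum a l - lsum a L) + (lsum a l - S)) by ring.
  eapply Rle_lt_trans; [apply Cmod_triangle|].
  eapply Rle_lt_trans.
  { apply Rplus_le_compat_r. apply Cmod_triangle. }
  eapply Rle_lt_trans.
  { apply Rplus_le_compat_r. apply Rplus_le_compat_r. apply Cmod_triangle. }
  eapply Rle_lt_trans.
  { apply Rplus_le_compat_r. apply Rplus_le_compat_r. apply Rplus_le_compat_r. apply Cmod_triangle. }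
  rewrite !Cmod_opp. lra.
Qed.

(** * Sums over Z and the function e *)

Ltac push := repeat progress (rewrite ?INR_IZR_INZ, ?plus_IZR, ?minus_IZR, ?mult_IZR, ?opp_IZR, ?RtoC_plus, ?RtoC_minus, ?RtoC_mult, ?RtoC_opp).

(** Here and below [h] stands for [Re] or [Im], the two real series that make up [CSeries]. *)
Lemma sum_n_lsum (a : nat -> C) (h : C -> R) n :
  (forall x y : C, h (x + y)%C = (h x + h y)%R) -> h (RtoC 0) = 0%R ->
  sum_n (fun k => h (a k)) n = h (lsum a (seq 0 (S n))).
Proof.
  intros H1 H0. induction n as [|n IH].
  - rewrite sum_O. simpl. now rewrite Cplus_0_r.
  - rewrite sum_Sn, IH. rewrite (seq_S (S n)), lsum_app, H1. simpl.
    now rewrite Cplus_0_r.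
Qed.

Lemma is_series_has_sum (a : nat -> C) (h : C -> R) s :
  (forall x y : C, h (x + y)%C = (h x + h y)%R) -> h (RtoC 0) = 0%R ->
  (forall x, Rabs (h x) <= Cmod x)%R -> has_sum a s ->
  Series (fun n => h (a n)) = h s.
Proof.
  intros H1 H0 Hh Hs. apply is_series_unique.
  apply filterlim_locally. intros eps.
  destruct (Hs eps (cond_pos eps)) as [l0 Hl].
  exists (list_max l0). intros n Hn.
  assert (K : (Cmod (lsum a (seq 0 (S n)) - s) < eps)%R).
  { apply Hl; [apply seq_NoDup|]. intros x Hx. apply in_seq. split; [lia|].
    assert (x <= list_max l0)%nat; [|lia].
    pose proof (list_max_le l0 (list_max l0)) as L.
    destruct L as [L _]. specialize (L (Nat.le_refl _)).
    rewrite Forall_forall in L. auto. }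
  change (Rabs (Rminus (sum_n (fun n0 : nat => h (a n0)) n) (h s)) < eps)%R.
  rewrite (sum_n_lsum a h n H1 H0).
  assert (E : Rminus (h (lsum a (seq 0 (S n)))) (h s) = h (lsum a (seq 0 (S n)) - s)).
  { assert (h (lsum a (seq 0 (S n))) = Rplus (h (lsum a (seq 0 (S n)) - s)) (h s)); [|lra].
    rewrite <- H1. f_equal. ring. }
  rewrite E. eapply Rle_lt_trans; [apply Hh|exact K].
Qed.

Lemma CSeries_has_sum (a : nat -> C) s : has_sum a s -> CSeries a = s.
Proof.
  intros H. unfold CSeries.
  rewrite (is_series_has_sum a Re s), (is_series_has_sum a Im s); auto.
  - now destruct s.
  - intros [? ?]. eapply Rle_trans; [apply Rmax_r|]. apply Rmax_Cmod.
  - apply re_le_Cmod.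
Qed.

Lemma sum_le_nat (g : nat -> R) M : (forall n, 0 <= g n)%R ->
  (forall n, rsum g (seq 0 n) <= M)%R -> sum_le g M.
Proof.
  intros Hg H l N. eapply Rle_trans; [|apply (H (S (list_max l)))].
  apply rsum_incl; auto; [apply seq_NoDup|].
  intros x Hx. apply in_seq. split; [lia|].
  destruct (list_max_le l (list_max l)) as [L _]. specialize (L (Nat.le_refl _)).
  rewrite Forall_forall in L. specialize (L x Hx). lia.
Qed.

Lemma rsum_geom r n : r <> 1%R -> rsum (fun k => r ^ k)%R (seq 0 n) = ((1 - r ^ n) / (1 - r))%R.
Proof.
  intros Hr. induction n as [|n IH].
  - simpl. field. lra.
  - rewrite seq_S, rsum_app, IH. simpl. field. lra.
Qed.

Lemma sum_le_geom r : (0 <= r < 1)%R -> sum_le (fun k : nat => r ^ k)%R (/ (1 - r)).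
Proof.
  intros Hr. apply sum_le_nat.
  - intros; apply pow_le; lra.
  - intros n. rewrite rsum_geom by lra. unfold Rdiv. rewrite <- (Rmult_1_l (/ (1 - r))) at 2.
    apply Rmult_le_compat_r; [left; apply Rinv_0_lt_compat; lra|].
    assert (0 <= r ^ n)%R by (apply pow_le; lra). lra.
Qed.

Lemma pow_decr (r : R) m n : (0 <= r <= 1)%R -> (m <= n)%nat -> (r ^ n <= r ^ m)%R.
Proof.
  intros Hr Hmn. induction Hmn as [|n Hmn IH]; [lra|].
  simpl. assert (0 <= r ^ n)%R by (apply pow_le; lra). nra.
Qed.

(** Each of the n + 1 powers t^k with k <= n is at least t^n, and together they are below the
    geometric series. *)
Lemma INR_pow_bound t n : (0 <= t < 1)%R -> (INR (S n) * t ^ n <= / (1 - t))%R.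
Proof.
  intros Ht. eapply Rle_trans; [|apply (sum_le_geom t Ht (seq 0 (S n))), seq_NoDup].
  assert (E : forall m, (m <= S n)%nat -> (INR m * t ^ n <= rsum (fun k => t ^ k)%R (seq 0 m))%R).
  { induction m as [|m IH]; intros Hm.
    - simpl. lra.
    - rewrite S_INR, seq_S, rsum_app. simpl.
      assert (t ^ n <= t ^ m)%R by (apply pow_decr; [lra|lia]).
      specialize (IH ltac:(lia)). lra. }
  now apply E.
Qed.

Lemma sum_le_cubic_geom r : (0 <= r < 1)%R ->
  exists M, sum_le (fun n : nat => INR (S n) ^ 3 * r ^ n)%R M.
Proof.
  (* With r = t^4, three of the four factors t^n absorb the cube by [INR_pow_bound] and the fourth
     one is summed. *)
  intros Hr. set (t := sqrt (sqrt r)).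
  assert (Ht : (0 <= t < 1)%R).
  { split; [apply sqrt_pos|]. unfold t. rewrite <- sqrt_1. rewrite <- sqrt_1.
    apply sqrt_lt_1_alt. split; [apply sqrt_pos|]. apply sqrt_lt_1_alt. lra. }
  assert (E : r = (t * t * (t * t))%R).
  { unfold t. rewrite !sqrt_sqrt; auto; try lra. apply sqrt_pos. }
  exists ((/ (1 - t)) ^ 3 * / (1 - t))%R.
  assert (P : (0 < / (1 - t))%R) by (apply Rinv_0_lt_compat; lra).
  eapply sum_le_mono; [|apply sum_le_scal; [|apply (sum_le_geom t Ht)]].
  - intros n. simpl.
    replace (r ^ n)%R with (t ^ n * t ^ n * (t ^ n * t ^ n))%R by (rewrite E, !Rpow_mult_distr; ring).
    pose proof (INR_pow_bound t n Ht) as B. pose proof (pos_INR (S n)).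
    assert (0 <= t ^ n)%R by (apply pow_le; lra).
    change (match n with 0%nat => 1 | S _ => INR n + 1 end)%R with (INR (S n)).
    set (b := (INR (S n) * t ^ n)%R) in *.
    replace (INR (S n) * (INR (S n) * (INR (S n) * 1)) * (t ^ n * t ^ n * (t ^ n * t ^ n)))%R
      with (b * (b * (b * 1)) * t ^ n)%R by (unfold b; ring).
    assert (0 <= b)%R by (unfold b; nra).
    apply Rmult_le_compat_r; auto.
    repeat apply Rmult_le_compat; try lra; repeat apply Rmult_le_pos; lra.
  - apply pow_le. lra.
Qed.

Definition Z_of_sum (x : nat + nat) : Z :=
  match x with inl n => Z.of_nat n | inr n => (- Z.of_nat (S n))%Z end.
Definition sum_of_Z (z : Z) : nat + nat :=
  if (0 <=? z)%Z then inl (Z.to_nat z) else inr (Z.to_nat (- z - 1)).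

Lemma Z_of_sum_of_Z z : Z_of_sum (sum_of_Z z) = z.
Proof. unfold sum_of_Z. destruct (Z.leb_spec 0 z); unfold Z_of_sum; lia. Qed.

Lemma sum_of_Z_of_sum x : sum_of_Z (Z_of_sum x) = x.
Proof.
  destruct x as [n|n]; unfold sum_of_Z, Z_of_sum.
  - destruct (Z.leb_spec 0 (Z.of_nat n)); [f_equal; lia|lia].
  - destruct (Z.leb_spec 0 (- Z.of_nat (S n))); [lia|f_equal; lia].
Qed.

Lemma sum_le_bij {I J} (h : J -> I) (k : I -> J) (g : I -> R) M :
  (forall i, h (k i) = i) -> sum_le (fun j => g (h j)) M -> sum_le g M.
Proof.
  intros K2 H. apply sum_le_mono with (fun i => g (h (k i))).
  - intros i. rewrite K2; lra.
  - apply (sum_le_inj k (fun j => g (h j))); auto.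
    intros x y E. rewrite <- (K2 x), <- (K2 y). now rewrite E.
Qed.

Lemma has_sum_Z (f : Z -> C) s t :
  has_sum (fun n : nat => f (Z.of_nat n)) s ->
  has_sum (fun n : nat => f (- Z.of_nat (S n))%Z) t -> has_sum f (s + t).
Proof.
  intros H1 H2. apply (has_sum_bij Z_of_sum sum_of_Z).
  - apply sum_of_Z_of_sum.
  - apply Z_of_sum_of_Z.
  - apply (has_sum_sum (fun j => f (Z_of_sum j))); auto.
Qed.

Lemma sum_le_Z (g : Z -> R) M N : (forall n, 0 <= g n)%R ->
  sum_le (fun n : nat => g (Z.of_nat n)) M ->
  sum_le (fun n : nat => g (- Z.of_nat (S n))%Z) N -> sum_le g (M + N).
Proof.
  intros Hg H1 H2. apply (sum_le_bij Z_of_sum sum_of_Z).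
  - apply Z_of_sum_of_Z.
  - apply (sum_le_sum (fun j => g (Z_of_sum j))); auto.
Qed.

Lemma sum_le_Z_geom r : (0 <= r < 1)%R ->
  sum_le (fun n : Z => r ^ Z.abs_nat n)%R (2 * / (1 - r)).
Proof.
  intros Hr. replace (2 * / (1 - r))%R with (/ (1 - r) + / (1 - r))%R by ring.
  apply sum_le_Z.
  - intros; apply pow_le; lra.
  - eapply sum_le_mono; [|apply (sum_le_geom r Hr)]. intros n; simpl. rewrite Zabs2Nat.id. lra.
  - eapply sum_le_mono; [|apply (sum_le_geom r Hr)]. intros n; simpl.
    apply pow_decr; [lra|lia].
Qed.

Lemma exp_le x y : (x <= y)%R -> (exp x <= exp y)%R.
Proof. intros [H| ->]; [left; now apply exp_increasing|lra]. Qed.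

Lemma gauss_sum_le alpha beta : (0 < alpha)%R ->
  exists M, sum_le (fun n : Z => exp (- (alpha * IZR n ^ 2 + beta * IZR n))) M.
Proof.
  (* c is the maximum of (|beta| + 1) u - alpha u^2, so that alpha n^2 + beta n >= |n| - c: the
     Gaussian is dominated by a geometric series in |n|. *)
  intros Ha. set (c := ((Rabs beta + 1) ^ 2 / (4 * alpha))%R).
  set (r := exp (- 1)).
  assert (Hr : (0 <= r < 1)%R).
  { unfold r. split; [left; apply exp_pos|]. rewrite <- exp_0. apply exp_increasing. lra. }
  exists (exp c * (2 * / (1 - r)))%R.
  eapply sum_le_mono; [|apply sum_le_scal; [left; apply exp_pos|apply (sum_le_Z_geom r Hr)]].
  intros n. simpl.
  assert (E : (r ^ Z.abs_nat n = exp (- Rabs (IZR n)))%R).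
  { unfold r. rewrite Rabs_Zabs. rewrite <- (Zabs2Nat.id_abs n), <- INR_IZR_INZ.
    generalize (Z.abs_nat n) as m. induction m as [|m IH].
    - simpl. now rewrite Ropp_0, exp_0.
    - rewrite S_INR. simpl. rewrite IH, <- exp_plus. f_equal. ring. }
  rewrite E, <- exp_plus.
  set (x := IZR n).
  assert (H : (alpha * (x * (x * 1)) + beta * x >= Rabs x - c)%R).
  { assert (H1 : (alpha * (x * (x * 1)) - (Rabs beta + 1) * Rabs x + c >= 0)%R).
    { unfold c. assert (X : (x * (x * 1) = Rabs x * Rabs x)%R) by (rewrite <- Rabs_mult, Rabs_right; nra).
      rewrite X. set (u := Rabs x). set (v := (Rabs beta + 1)%R).
      replace (alpha * (u * u) - v * u + v ^ 2 / (4 * alpha))%R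
        with (alpha * (u - v / (2 * alpha)) ^ 2)%R by (field; lra).
      apply Rle_ge, Rmult_le_pos; [lra|apply pow2_ge_0]. }
    assert (H2 : (beta * x >= - (Rabs beta * Rabs x))%R).
    { rewrite <- Rabs_mult. pose proof (Rle_abs (- (beta * x))). rewrite Rabs_Ropp in H. lra. }
    lra. }
  apply exp_le. lra.
Qed.

Lemma Im_scal_R (x : R) z : Im (x * z) = (x * Im z)%R.
Proof. apply im_scal_l. Qed.

Lemma Cexp_plus z w : Cexp (z + w) = Cexp z * Cexp w.
Proof.
  unfold Cexp. destruct z as [a b], w as [c d]. cbn [Re Im fst snd Cplus].
  rewrite exp_plus, cos_plus, sin_plus, RtoC_mult.
  unfold Cmult, RtoC; cbn [fst snd]. f_equal; ring.
Qed.

Lemma Cmod_Cexp z : Cmod (Cexp z) = exp (Re z).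
Proof.
  unfold Cexp. rewrite Cmod_mult, Cmod_R, Rabs_right by (left; apply exp_pos).
  unfold Cmod; cbn [fst snd].
  replace (cos (Im z) ^ 2 + sin (Im z) ^ 2)%R with 1%R.
  - rewrite sqrt_1. ring.
  - pose proof (sin2_cos2 (Im z)) as H. unfold Rsqr in H. lra.
Qed.

Lemma e_add z w : e (z + w) = e z * e w.
Proof. unfold e. rewrite <- Cexp_plus. f_equal. ring. Qed.

Lemma Cmod_e z : Cmod (e z) = exp (- (2 * PI * Im z)).
Proof.
  unfold e. rewrite Cmod_Cexp. f_equal. destruct z as [x y].
  unfold Re, Im, Ci, Cmult, RtoC; cbn [fst snd]. ring.
Qed.

Lemma e_real (x : R) : e x = (cos (2 * PI * x), sin (2 * PI * x)).
Proof.
  unfold e, Cexp.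
  replace (2 * PI * Ci * x) with ((0, 2 * PI * x)%R : C)
    by (unfold Ci, Cmult, RtoC; cbn [fst snd]; f_equal; ring).
  cbn [Re Im fst snd]. rewrite exp_0. unfold Cmult, RtoC; cbn [fst snd]. f_equal; ring.
Qed.

Lemma e_0 : e 0 = 1.
Proof. rewrite e_real. replace (2 * PI * 0)%R with 0%R by ring. rewrite cos_0, sin_0. reflexivity. Qed.

Lemma e_half : e (1 / 2) = - (1).
Proof.
  rewrite <- RtoC_div by lra. rewrite e_real.
  replace (2 * PI * (1 / 2))%R with PI by field. rewrite cos_PI, sin_PI.
  rewrite <- RtoC_opp. reflexivity.
Qed.

Lemma e_quarter : e (1 / 4) = Ci.
Proof.
  rewrite <- RtoC_div by lra. rewrite e_real.
  replace (2 * PI * (1 / 4))%R with (PI / 2)%R by field. rewrite cos_PI2, sin_PI2. reflexivity.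
Qed.

Lemma C2_nz : RtoC 2 <> 0. Proof. intros E. apply RtoC_inj in E. lra. Qed.
Lemma C4_nz : RtoC 4 <> 0. Proof. intros E. apply RtoC_inj in E. lra. Qed.
#[export] Hint Resolve C2_nz C4_nz : core.

Lemma e_1 : e 1 = 1.
Proof. replace (RtoC 1) with (1 / 2 + 1 / 2) at 1 by (field; auto). rewrite e_add, e_half. ring. Qed.

Lemma e_nz z : e z <> 0.
Proof. intros E. pose proof (Cmod_e z) as H. rewrite E, Cmod_0 in H. pose proof (exp_pos (- (2 * PI * Im z))). lra. Qed.

Lemma e_opp z : e (- z) = / e z.
Proof.
  assert (H : e (- z) * e z = 1) by (rewrite <- e_add, <- e_0; f_equal; ring).
  rewrite <- (Cmult_1_l (/ e z)), <- H. field. apply e_nz.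
Qed.

Lemma e_minus z w : e (z - w) = e z / e w.
Proof. unfold Cminus. now rewrite e_add, e_opp. Qed.

Lemma e_pow z n : e z ^ n = e (INR n * z).
Proof.
  induction n as [|n IH].
  - simpl. rewrite Cmult_0_l. now rewrite e_0.
  - rewrite S_INR. simpl Cpow. rewrite IH, <- e_add. f_equal. rewrite RtoC_plus. ring.
Qed.

Definition sgn (n : Z) : C := if Z.even n then 1 else - (1).

Lemma sgn_add m n : sgn (m + n) = sgn m * sgn n.
Proof. unfold sgn. rewrite Z.even_add. destruct (Z.even m), (Z.even n); simpl; ring. Qed.

Lemma sgn_opp n : sgn (- n) = sgn n.
Proof. unfold sgn. now rewrite Z.even_opp. Qed.

Lemma sgn_even n : sgn (2 * n) = 1.
Proof. unfold sgn. now rewrite Z.even_mul. Qed.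

Lemma sgn_odd n : sgn (2 * n + 1) = - (1).
Proof. rewrite sgn_add, sgn_even. unfold sgn; simpl. ring. Qed.

Lemma sgn_sq n : sgn n * sgn n = 1.
Proof. unfold sgn. destruct (Z.even n); ring. Qed.

Lemma Cmod_sgn n : Cmod (sgn n) = 1%R.
Proof. unfold sgn. destruct (Z.even n); rewrite ?Cmod_opp; apply Cmod_1. Qed.

Lemma e_Z n : e (IZR n) = 1.
Proof.
  assert (H : forall m : nat, e (INR m) = 1).
  { induction m as [|m IH]; [apply e_0|]. rewrite S_INR, RtoC_plus, e_add, IH, e_1. ring. }
  destruct (Z_le_gt_dec 0 n).
  - rewrite <- (Z2Nat.id n), <- INR_IZR_INZ; auto.
  - replace n with (- - n)%Z by lia. rewrite opp_IZR, RtoC_opp, e_opp.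
    rewrite <- (Z2Nat.id (- n)) by lia. rewrite <- INR_IZR_INZ, H. field.
Qed.

Lemma e_half_Z n : e (IZR n / 2) = sgn n.
Proof.
  destruct (Z.Even_or_Odd n) as [[k ->]|[k ->]].
  - rewrite sgn_even, <- (e_Z k). f_equal. push. field; auto.
  - rewrite sgn_odd. replace (IZR (2 * k + 1) / 2) with (IZR k + 1 / 2) by (push; field; auto).
    rewrite e_add, e_Z, e_half. ring.
Qed.

Lemma e_shift z n : e (z + IZR n) = e z.
Proof. rewrite e_add, e_Z. ring. Qed.

Lemma e_shift_eq z w n : z = w + IZR n -> e z = e w.
Proof. intros ->. apply e_shift. Qed.

Definition Zpar (x : Z + Z) : Z := match x with inl k => (2 * k)%Z | inr k => (2 * k + 1)%Z end.
Definition Zpar_inv (n : Z) : Z + Z := if Z.even n then inl (n / 2)%Z else inr (n / 2)%Z.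

Lemma Zpar_K x : Zpar_inv (Zpar x) = x.
Proof.
  destruct x as [k|k]; unfold Zpar_inv, Zpar.
  - rewrite Z.even_mul. cbn [Z.even orb]. f_equal. rewrite Z.mul_comm. apply Z.div_mul. lia.
  - rewrite Z.even_add, Z.even_mul. cbn [Z.even orb Bool.eqb]. f_equal.
    symmetry. apply (Z.div_unique _ _ _ 1); lia.
Qed.

Lemma Zpar_inv_K n : Zpar (Zpar_inv n) = n.
Proof.
  destruct (Z.Even_or_Odd n) as [[k ->]|[k ->]].
  - change (2 * k)%Z with (Zpar (inl k)). now rewrite Zpar_K.
  - change (2 * k + 1)%Z with (Zpar (inr k)). now rewrite Zpar_K.
Qed.

Lemma has_sum_parity (f : Z -> C) s t :
  has_sum (fun k => f (2 * k)%Z) s -> has_sum (fun k => f (2 * k + 1)%Z) t -> has_sum f (s + t).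
Proof.
  intros H1 H2. apply (has_sum_bij Zpar Zpar_inv).
  - apply Zpar_K.
  - apply Zpar_inv_K.
  - apply (has_sum_sum (fun j => f (Zpar j))); auto.
Qed.

(** Z^2 is split by the parity of x + y and rotated by 45 degrees. On both halves x^2 + y^2 becomes
    twice a sum of two squares, of integers or of half-integers: this is the source of the formulas
    from tau to 2 tau. *)
Definition Zrot (x : Z * Z + Z * Z) : Z * Z :=
  match x with
  | inl (u, v) => (u + v, u - v)%Z
  | inr (u, v) => (u + v + 1, u - v)%Z
  end.
Definition Zrot_inv (p : Z * Z) : Z * Z + Z * Z :=
  match Zpar_inv (fst p + snd p) with
  | inl u => inl (u, u - snd p)%Z
  | inr u => inr (u, u - snd p)%Z
  end.

Lemma Zrot_K x : Zrot_inv (Zrot x) = x.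
Proof.
  destruct x as [[u v]|[u v]]; unfold Zrot_inv, Zrot; cbn [fst snd].
  - replace (u + v + (u - v))%Z with (Zpar (inl u)) by (unfold Zpar; lia).
    rewrite Zpar_K. do 2 f_equal. lia.
  - replace (u + v + 1 + (u - v))%Z with (Zpar (inr u)) by (unfold Zpar; lia).
    rewrite Zpar_K. do 2 f_equal. lia.
Qed.

Lemma Zrot_inv_K p : Zrot (Zrot_inv p) = p.
Proof.
  destruct p as [x y]. unfold Zrot_inv; cbn [fst snd].
  pose proof (Zpar_inv_K (x + y)) as H.
  destruct (Zpar_inv (x + y)) as [u|u]; unfold Zpar in H; unfold Zrot; f_equal; lia.
Qed.

Lemma has_sum_rot (f : Z * Z -> C) s t :
  has_sum (fun p => f (fst p + snd p, fst p - snd p)%Z) s ->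
  has_sum (fun p => f (fst p + snd p + 1, fst p - snd p)%Z) t -> has_sum f (s + t).
Proof.
  intros H1 H2. apply (has_sum_bij Zrot Zrot_inv).
  - apply Zrot_K.
  - apply Zrot_inv_K.
  - apply (has_sum_sum (fun j => f (Zrot j))).
    + eapply has_sum_ext; [|exact H1]. now intros [u v].
    + eapply has_sum_ext; [|exact H2]. now intros [u v].
Qed.

(** * Theta constants *)

Definition th3 (tau : C) : C := csum (fun n : Z => e (IZR n * IZR n * tau)).
Definition th2 (tau : C) : C := csum (fun n : Z => e ((IZR n + 1 / 2) * (IZR n + 1 / 2) * tau)).
(** Since n^2 and n have the same parity, the translation by 1/2 inserts the sign (-1)^n; see
    [th4_term]. *)
Definition th4 (tau : C) : C := th3 (tau + 1 / 2).

Lemma Im_plus z w : Im (z + w) = (Im z + Im w)%R.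
Proof. reflexivity. Qed.

Lemma Im_R (x : R) : Im x = 0%R.
Proof. reflexivity. Qed.

Lemma abs_sum_quad a b c : (0 < Im a)%R ->
  abs_sum (fun n : Z => e (IZR n * IZR n * a + IZR n * b + c)).
Proof.
  intros Ha. pose proof PI_RGT_0.
  destruct (gauss_sum_le (2 * PI * Im a) (2 * PI * Im b)) as [M HM].
  { apply Rmult_lt_0_compat; lra. }
  exists (exp (- (2 * PI * Im c)) * M)%R.
  eapply sum_le_mono; [|apply sum_le_scal; [left; apply exp_pos|exact HM]].
  intros n; cbv beta. rewrite Cmod_e, <- exp_plus, !Im_plus, !Im_scal_R.
  rewrite <- RtoC_mult, Im_scal_R. right. f_equal. ring.
Qed.

Lemma abs_sum_ext {I} (f g : I -> C) : (forall i, f i = g i) -> abs_sum f -> abs_sum g.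
Proof. intros E. apply abs_sum_le. intros i. rewrite E. lra. Qed.

Lemma abs_sum_sgn (f : Z -> C) : abs_sum f -> abs_sum (fun n => sgn n * f n).
Proof. apply abs_sum_le. intros i. rewrite Cmod_mult, Cmod_sgn. lra. Qed.

Lemma abs_sum_th3 tau : (0 < Im tau)%R -> abs_sum (fun n : Z => e (IZR n * IZR n * tau)).
Proof.
  intros H. eapply abs_sum_ext; [|apply (abs_sum_quad tau 0 0 H)].
  intros n; cbv beta. f_equal. ring.
Qed.

Lemma abs_sum_th2 tau : (0 < Im tau)%R ->
  abs_sum (fun n : Z => e ((IZR n + 1 / 2) * (IZR n + 1 / 2) * tau)).
Proof.
  intros H. eapply abs_sum_ext; [|apply (abs_sum_quad tau tau (tau / 4) H)].
  intros n; cbv beta. f_equal. field; repeat split; auto.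
Qed.

Lemma has_th3 tau : (0 < Im tau)%R -> has_sum (fun n : Z => e (IZR n * IZR n * tau)) (th3 tau).
Proof. intros H. now apply abs_sum_has, abs_sum_th3. Qed.

Lemma has_th2 tau : (0 < Im tau)%R ->
  has_sum (fun n : Z => e ((IZR n + 1 / 2) * (IZR n + 1 / 2) * tau)) (th2 tau).
Proof. intros H. now apply abs_sum_has, abs_sum_th2. Qed.

Lemma Im_half tau : Im (tau + 1 / 2) = Im tau.
Proof. replace (1 / 2) with (RtoC (1 / 2)) by (now rewrite RtoC_div by lra). rewrite Im_plus, Im_R. ring. Qed.

Lemma sgn_square n : sgn (n * n) = sgn n.
Proof. unfold sgn. rewrite Z.even_mul. now destruct (Z.even n). Qed.

Lemma th4_term tau n : e (IZR n * IZR n * (tau + 1 / 2)) = sgn n * e (IZR n * IZR n * tau).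
Proof.
  rewrite <- (sgn_square n), <- e_half_Z, <- e_add. f_equal. push. field; auto.
Qed.

Lemma abs_sum_th4 tau : (0 < Im tau)%R -> abs_sum (fun n : Z => sgn n * e (IZR n * IZR n * tau)).
Proof. intros H. apply abs_sum_sgn. now apply abs_sum_th3. Qed.

Lemma has_th4 tau : (0 < Im tau)%R ->
  has_sum (fun n : Z => sgn n * e (IZR n * IZR n * tau)) (th4 tau).
Proof.
  intros H. eapply has_sum_ext; [apply th4_term|]. apply has_th3. now rewrite Im_half.
Qed.

Lemma csum_ext {I} (f g : I -> C) : (forall i, f i = g i) -> (exists s, has_sum g s) -> csum f = csum g.
Proof.
  intros E H. apply csum_eq. eapply has_sum_ext; [intros i; symmetry; apply E|]. now apply csum_ex.
Qed.

Lemma th3_1 tau : (0 < Im tau)%R -> th3 (tau + 1) = th3 tau.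
Proof.
  intros H. apply csum_eq. eapply has_sum_ext; [|apply (has_th3 tau H)].
  intros n; cbv beta. symmetry. apply e_shift_eq with (n * n)%Z. push. ring.
Qed.

Lemma th4_half tau : (0 < Im tau)%R -> th4 (tau + 1 / 2) = th3 tau.
Proof.
  intros H. unfold th4. rewrite <- (th3_1 tau H). f_equal. field; auto.
Qed.

(** (n + 1/2)^2 / 2 = 1/8 + n (n + 1) / 2, and n (n + 1) is even. *)
Lemma th2_half tau : (0 < Im tau)%R -> th2 (tau + 1 / 2) = e (1 / 8) * th2 tau.
Proof.
  intros H. apply csum_eq. eapply has_sum_ext; [|apply (has_sum_scal (e (1 / 8)) _ _ (has_th2 tau H))].
  intros n; cbv beta. rewrite <- e_add.
  assert (exists k, n * n + n = 2 * k)%Z as [k Hk].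
  { destruct (Z.Even_or_Odd n) as [[k ->]|[k ->]].
    - exists (2 * k * k + k)%Z. ring.
    - exists (2 * k * k + 3 * k + 1)%Z. ring. }
  symmetry. apply e_shift_eq with k.
  assert (E : RtoC (IZR k) = (IZR n * IZR n + IZR n) / 2).
  { apply (f_equal (fun z => RtoC (IZR z))) in Hk. revert Hk. push. intros ->. field; auto. }
  rewrite E. field; repeat split; auto.
Qed.

Lemma th2_1 tau : (0 < Im tau)%R -> th2 (tau + 1) = Ci * th2 tau.
Proof.
  intros H. replace (tau + 1) with ((tau + 1 / 2) + 1 / 2) by (field; auto).
  rewrite !th2_half; auto; [|now rewrite Im_half].
  rewrite Cmult_assoc, <- e_add. rewrite <- e_quarter. f_equal. f_equal. field; repeat split; auto.
Qed.

Lemma Im_scal2 tau : Im (2 * tau) = (2 * Im tau)%R.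
Proof. apply im_scal_l. Qed.
Lemma Im_scal4 tau : Im (4 * tau) = (4 * Im tau)%R.
Proof. apply im_scal_l. Qed.
Lemma Im_div_R tau (x : R) : x <> 0%R -> Im (tau / x) = (Im tau / x)%R.
Proof. intros H. unfold Cdiv. rewrite <- RtoC_inv by auto. apply im_scal_r. Qed.
Lemma Im_add_R tau (x : R) : Im (tau + x) = Im tau.
Proof. rewrite Im_plus, Im_R. ring. Qed.

Ltac impos := repeat first [rewrite Im_half | rewrite Im_scal2 | rewrite Im_scal4 | rewrite Im_add_R | rewrite Im_div_R by lra]; lra.

Lemma th3_quad tau : (0 < Im tau)%R -> th3 tau = th3 (4 * tau) + th2 (4 * tau).
Proof.
  intros H. apply csum_eq. apply has_sum_parity.
  - eapply has_sum_ext; [|apply has_th3; impos]. intros k; cbv beta. f_equal. push. ring.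
  - eapply has_sum_ext; [|apply has_th2; impos]. intros k; cbv beta. f_equal. push. field; auto.
Qed.

Lemma has_sum_mult_abs {J K} (f : J -> C) (g : K -> C) :
  abs_sum f -> abs_sum g ->
  has_sum (fun p : J * K => f (fst p) * g (snd p)) (csum f * csum g).
Proof. intros Hf Hg. apply has_sum_mult; auto; now apply abs_sum_has. Qed.

Lemma th3_sq tau : (0 < Im tau)%R -> th3 tau * th3 tau = th3 (2 * tau) * th3 (2 * tau) + th2 (2 * tau) * th2 (2 * tau).
Proof.
  intros H.
  pose proof (has_sum_mult_abs _ _ (abs_sum_th3 tau H) (abs_sum_th3 tau H)) as P.
  refine (has_sum_unique _ _ _ P _). clear P.
  apply has_sum_rot.
  - eapply has_sum_ext; [|apply (has_sum_mult_abs _ _ (abs_sum_th3 (2 * tau) ltac:(impos)) (abs_sum_th3 (2 * tau) ltac:(impos)))].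
    intros [u v]; cbn [fst snd]. rewrite <- !e_add. f_equal. push. ring.
  - eapply has_sum_ext; [|apply (has_sum_mult_abs _ _ (abs_sum_th2 (2 * tau) ltac:(impos)) (abs_sum_th2 (2 * tau) ltac:(impos)))].
    intros [u v]; cbn [fst snd]. rewrite <- !e_add. f_equal. push. field; auto.
Qed.

Lemma th2_sq tau : (0 < Im tau)%R -> th2 tau * th2 tau = 2 * th2 (2 * tau) * th3 (2 * tau).
Proof.
  intros H.
  pose proof (has_sum_mult_abs _ _ (abs_sum_th2 tau H) (abs_sum_th2 tau H)) as P.
  refine (has_sum_unique _ _ _ P _). clear P.
  replace (2 * th2 (2 * tau) * th3 (2 * tau)) with (th2 (2 * tau) * th3 (2 * tau) + th3 (2 * tau) * th2 (2 * tau)) by ring.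
  apply has_sum_rot.
  - eapply has_sum_ext; [|apply (has_sum_mult_abs _ _ (abs_sum_th2 (2 * tau) ltac:(impos)) (abs_sum_th3 (2 * tau) ltac:(impos)))].
    intros [u v]; cbn [fst snd]. rewrite <- !e_add. f_equal. push. field; auto.
  (* The odd half produces 2 (u + 1)^2 + 2 (v + 1/2)^2, so u is shifted by one. *)
  - apply (has_sum_bij (fun p : Z * Z => (fst p - 1, snd p)%Z) (fun p : Z * Z => (fst p + 1, snd p)%Z)).
    { intros [x y]; cbn [fst snd]; f_equal; lia. }
    { intros [x y]; cbn [fst snd]; f_equal; lia. }
    eapply has_sum_ext; [|apply (has_sum_mult_abs _ _ (abs_sum_th3 (2 * tau) ltac:(impos)) (abs_sum_th2 (2 * tau) ltac:(impos)))].
    intros [u v]; cbn [fst snd]. rewrite <- !e_add. f_equal. push. field; auto.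
Qed.

Lemma th4_sq tau : (0 < Im tau)%R -> th4 tau * th4 tau = th3 (2 * tau) * th3 (2 * tau) - th2 (2 * tau) * th2 (2 * tau).
Proof.
  intros H. unfold th4. rewrite th3_sq by impos.
  replace (2 * (tau + 1 / 2)) with (2 * tau + 1) by (field; auto).
  rewrite th3_1, th2_1 by impos.
  replace (Ci * th2 (2 * tau) * (Ci * th2 (2 * tau))) with (Ci * Ci * (th2 (2 * tau) * th2 (2 * tau))) by ring.
  replace (Ci * Ci) with (- (1)); [ring|]. unfold Ci, Cmult, Copp, RtoC; cbn [fst snd]. f_equal; ring.
Qed.

Lemma sgn_neg_shift n : sgn (- n - 1) = - sgn n.
Proof. unfold Z.sub. rewrite sgn_add, sgn_opp. unfold sgn; simpl. ring. Qed.

(** The involution n -> - n - 1 preserves (n + 1/2)^2 and reverses the sign. *)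
Lemma has_th2_alt tau : (0 < Im tau)%R ->
  has_sum (fun n : Z => sgn n * e ((IZR n + 1 / 2) * (IZR n + 1 / 2) * tau)) 0.
Proof.
  intros H. set (f := fun n : Z => sgn n * e ((IZR n + 1 / 2) * (IZR n + 1 / 2) * tau)).
  assert (A : has_sum f (csum f)) by (apply abs_sum_has, abs_sum_sgn, abs_sum_th2; auto).
  assert (B : has_sum f (- csum f)).
  { apply (has_sum_bij (fun n : Z => (- n - 1)%Z) (fun n => (- n - 1)%Z)); [intros; lia|intros; lia|].
    eapply has_sum_ext; [|apply (has_sum_opp _ _ A)]. intros n; unfold f. rewrite sgn_neg_shift.
    replace (IZR (- n - 1) + 1 / 2) with (- (IZR n + 1 / 2)) by (push; field; auto).
    replace (- (IZR n + 1 / 2) * - (IZR n + 1 / 2) * tau) with ((IZR n + 1 / 2) * (IZR n + 1 / 2) * tau) by ring.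
    ring. }
  replace (RtoC 0) with (csum f); auto.
  pose proof (has_sum_unique _ _ _ A B) as E.
  assert (E2 : csum f + csum f = 0) by (rewrite E at 2; ring).
  replace (csum f) with ((csum f + csum f) / 2) by (field; auto). rewrite E2. field; auto.
Qed.

(** After the rotation the sign (-1)^(u - v) factors as (-1)^u (-1)^v. The half with x + y even
    gives th4(2 tau)^2, the other one the square of the vanishing alternating th2. *)
Lemma th34 tau : (0 < Im tau)%R -> th3 tau * th4 tau = th4 (2 * tau) * th4 (2 * tau).
Proof.
  intros H.
  pose proof (has_sum_mult _ _ _ _ (abs_sum_th3 tau H) (abs_sum_th4 tau H) (has_th3 tau H) (has_th4 tau H)) as P.
  refine (has_sum_unique _ _ _ P _). clear P.
  replace (th4 (2 * tau) * th4 (2 * tau)) with (th4 (2 * tau) * th4 (2 * tau) + 0 * 0) by ring.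
  assert (H2 : (0 < Im (2 * tau))%R) by impos.
  apply has_sum_rot.
  - eapply has_sum_ext; [|apply (has_sum_mult _ _ _ _ (abs_sum_th4 _ H2) (abs_sum_th4 _ H2) (has_th4 _ H2) (has_th4 _ H2))].
    intros [u v]; cbn [fst snd]. unfold Z.sub. rewrite sgn_add, sgn_opp.
    transitivity (sgn u * sgn v * (e (IZR u * IZR u * (2 * tau)) * e (IZR v * IZR v * (2 * tau)))); [ring|].
    transitivity (sgn u * sgn v * (e (IZR (u + v) * IZR (u + v) * tau) * e (IZR (u + - v) * IZR (u + - v) * tau))); [|ring].
    rewrite <- !e_add. f_equal. f_equal. push. ring.
  - pose proof (abs_sum_sgn _ (abs_sum_th2 _ H2)) as A.
    eapply has_sum_ext; [|apply (has_sum_mult _ _ _ _ A A (has_th2_alt _ H2) (has_th2_alt _ H2))].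
    intros [u v]; cbn [fst snd]. unfold Z.sub. rewrite sgn_add, sgn_opp.
    match goal with |- sgn u * ?a * (sgn v * ?b) = ?c * (_ * ?d) =>
      transitivity (sgn u * sgn v * (a * b)); [ring|]; transitivity (sgn u * sgn v * (c * d)); [|ring] end.
    rewrite <- !e_add. f_equal. f_equal. push. field; auto.
Qed.

(** * Limits at i oo, doubling, and the absence of zeros of the theta constants *)

Definition at_ioo (P : C -> Prop) : Prop := exists Y : R, forall tau, (Y < Im tau)%R -> P tau.

#[export] Instance at_ioo_filter : Filter at_ioo.
Proof.
  constructor.
  - now exists 0%R.
  - intros P Q [Y1 H1] [Y2 H2]. exists (Rmax Y1 Y2). intros tau H.
    pose proof (Rmax_l Y1 Y2). pose proof (Rmax_r Y1 Y2).
    split; [apply H1|apply H2]; lra.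
  - intros P Q HPQ [Y H]. exists Y. auto.
Qed.

Definition flim {T} (F : (T -> Prop) -> Prop) (u : T -> C) (l : C) : Prop :=
  forall eps, (0 < eps)%R -> F (fun t => (Cmod (u t - l) < eps)%R).

Section FilterLimits.

Context {T : Type} {F : (T -> Prop) -> Prop} {FF : Filter F}.

Lemma flim_const c : flim F (fun _ => c) c.
Proof.
  intros eps He. apply filter_forall. intros _. replace (c - c) with (RtoC 0) by ring. now rewrite Cmod_0.
Qed.

Lemma flim_plus u v l m : flim F u l -> flim F v m -> flim F (fun t => u t + v t) (l + m).
Proof.
  intros H1 H2 eps He. assert (He2 : (0 < eps / 2)%R) by lra.
  generalize (filter_and _ _ (H1 _ He2) (H2 _ He2)).
  apply filter_imp. intros t [A B].
  replace (u t + v t - (l + m)) with ((u t - l) + (v t - m)) by ring.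
  eapply Rle_lt_trans; [apply Cmod_triangle|]. lra.
Qed.

Lemma flim_mult u v l m : flim F u l -> flim F v m -> flim F (fun t => u t * v t) (l * m).
Proof.
  intros H1 H2 eps He.
  set (k := (Cmod l + Cmod m + 1)%R).
  pose proof (Cmod_ge_0 l). pose proof (Cmod_ge_0 m).
  set (d := Rmin 1 (eps / (2 * k))).
  assert (Hd : (0 < d)%R).
  { apply Rmin_glb_lt; [lra|]. apply Rdiv_lt_0_compat; unfold k; lra. }
  generalize (filter_and _ _ (H1 d Hd) (H2 d Hd)).
  apply filter_imp. intros t [A B].
  replace (u t * v t - l * m) with ((u t - l) * (v t - m) + ((u t - l) * m + l * (v t - m))) by ring.
  eapply Rle_lt_trans; [apply Cmod_triangle|].
  eapply Rle_lt_trans; [apply Rplus_le_compat_l, Cmod_triangle|].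
  rewrite !Cmod_mult.
  pose proof (Cmod_ge_0 (u t - l)). pose proof (Cmod_ge_0 (v t - m)).
  assert (d <= 1)%R by apply Rmin_l.
  assert (D : (d * (2 * k) <= eps)%R).
  { apply Rle_trans with (eps / (2 * k) * (2 * k))%R.
    - apply Rmult_le_compat_r; [unfold k; lra|apply Rmin_r].
    - right. field. unfold k; lra. }
  unfold k in D.
  set (a := Cmod (u t - l)) in *. set (b := Cmod (v t - m)) in *.
  set (ll := Cmod l) in *. set (mm := Cmod m) in *.
  assert (a * b <= d)%R by nra. assert (a * mm <= d * mm)%R by nra. assert (ll * b <= ll * d)%R by nra.
  assert (0 <= d * ll)%R by nra. assert (0 <= d * mm)%R by nra. nra.
Qed.

Lemma flim_opp u l : flim F u l -> flim F (fun t => - u t) (- l).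
Proof.
  intros H eps He. generalize (H eps He). apply filter_imp. intros t A.
  replace (- u t - - l) with (- (u t - l)) by ring. now rewrite Cmod_opp.
Qed.

Lemma flim_inv (u : T -> C) (l : C) : l <> 0 -> flim F u l -> flim F (fun n => / u n) (/ l).
Proof.
  intros Hl H eps He.
  assert (P : (0 < Cmod l)%R) by (now apply Cmod_gt_0).
  set (d := Rmin (Cmod l / 2) (eps * (Cmod l / 2 * Cmod l))).
  assert (Hd : (0 < d)%R).
  { apply Rmin_glb_lt; [lra|]. repeat apply Rmult_lt_0_compat; lra. }
  generalize (H d Hd). apply filter_imp. intros n Hn.
  assert (D1 : (d <= Cmod l / 2)%R) by apply Rmin_l.
  assert (D2 : (d <= eps * (Cmod l / 2 * Cmod l))%R) by apply Rmin_r.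
  assert (Q : (Cmod l / 2 <= Cmod (u n))%R).
  { pose proof (Cmod_triangle (u n) (l - u n)) as Q0. replace (u n + (l - u n)) with l in Q0 by ring.
    rewrite (Cmod_minus_sym l) in Q0. lra. }
  assert (N : u n <> 0) by (apply Cmod_gt_0; lra).
  replace (/ u n - / l) with (/ (u n * l) * (l - u n)) by (field; auto).
  rewrite Cmod_mult, Cmod_inv, Cmod_mult, Cmod_minus_sym by (now apply Cmult_neq_0).
  apply Rmult_lt_reg_l with (Cmod (u n) * Cmod l)%R; [apply Rmult_lt_0_compat; lra|].
  rewrite <- Rmult_assoc, Rinv_r, Rmult_1_l by (apply Rgt_not_eq, Rmult_lt_0_compat; lra).
  apply Rlt_le_trans with (eps * (Cmod l / 2 * Cmod l))%R; [lra|].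
  rewrite Rmult_comm. apply Rmult_le_compat_r; [lra|]. apply Rmult_le_compat_r; lra.
Qed.


End FilterLimits.

Notation lim_ioo := (flim at_ioo).

Lemma lim_ioo_ext U V L : (forall t, (0 < Im t)%R -> U t = V t) -> lim_ioo U L -> lim_ioo V L.
Proof.
  intros E H eps He. destruct (H eps He) as [Y HY]. exists (Rmax Y 0). intros tau Ht.
  pose proof (Rmax_l Y 0). pose proof (Rmax_r Y 0). rewrite <- E by lra. apply HY. lra.
Qed.

Lemma lim_ioo_scal2 U L : lim_ioo U L -> lim_ioo (fun t => U (2 * t)) L.
Proof.
  intros H eps He. destruct (H eps He) as [Y HY]. exists (Rmax Y 0). intros tau Ht.
  pose proof (Rmax_l Y 0). pose proof (Rmax_r Y 0). apply HY. rewrite Im_scal2. lra.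
Qed.

Lemma lim_ioo_half U L : lim_ioo U L -> lim_ioo (fun t => U (t + 1 / 2)) L.
Proof.
  intros H eps He. destruct (H eps He) as [Y HY]. exists Y. intros tau Ht.
  apply HY. now rewrite Im_half.
Qed.

Definition dbl (k : nat) (tau : C) : C := 2 ^ k * tau.

Lemma Im_dbl k tau : Im (dbl k tau) = (2 ^ k * Im tau)%R.
Proof. unfold dbl. rewrite <- RtoC_pow. apply im_scal_l. Qed.

Lemma dbl_S k tau : dbl (S k) tau = 2 * dbl k tau.
Proof. unfold dbl. simpl. ring. Qed.

Lemma Im_dbl_pos k tau : (0 < Im tau)%R -> (0 < Im (dbl k tau))%R.
Proof. intros H. rewrite Im_dbl. apply Rmult_lt_0_compat; auto. apply pow_lt; lra. Qed.

Lemma lim_ioo_dbl U L tau : lim_ioo U L -> (0 < Im tau)%R ->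
  forall eps, (0 < eps)%R -> exists k, (Cmod (U (dbl k tau) - L) < eps)%R.
Proof.
  intros H Ht eps He. destruct (H eps He) as [Y HY].
  destruct (Pow_x_infinity 2 ltac:(rewrite Rabs_right; lra) ((Rabs Y + 1) / Im tau)) as [k Hk].
  exists k. apply HY. rewrite Im_dbl. specialize (Hk k (Nat.le_refl _)).
  rewrite Rabs_right in Hk by (apply Rle_ge, pow_le; lra).
  pose proof (Rle_abs Y).
  apply Rmult_ge_compat_r with (r := Im tau) in Hk; [|lra].
  replace ((Rabs Y + 1) / Im tau * Im tau)%R with (Rabs Y + 1)%R in Hk by (field; lra). lra.
Qed.

Lemma lim_ioo_dbl_const U L c tau : lim_ioo U L -> (0 < Im tau)%R ->
  (forall k, U (dbl k tau) = c) -> L = c.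
Proof.
  intros H Ht Hc. apply Cmod_lt_eq. intros eps He.
  destruct (lim_ioo_dbl U L tau H Ht eps He) as [k Hk].
  rewrite Hc in Hk. now rewrite Cmod_minus_sym.
Qed.

(** W is constant along the points 2^k tau, which tend to i oo. *)
Lemma doubling_const W L : lim_ioo W L ->
  (forall tau, (0 < Im tau)%R -> W (2 * tau) = W tau) ->
  forall tau, (0 < Im tau)%R -> W tau = L.
Proof.
  intros H H2 tau Ht. symmetry. apply (lim_ioo_dbl_const W L (W tau) tau H Ht).
  induction k as [|k IH].
  - unfold dbl. simpl. f_equal. ring.
  - rewrite dbl_S, H2; auto. now apply Im_dbl_pos.
Qed.

(* Tannery's theorem at i*oo: each term of weight [w i > 0] dies out. *)
Lemma lim_ioo_sum {I} (w : I -> R) (c : I -> C) (f : C -> I -> C) (s : C -> C) S :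
  (forall i, w i = 0 \/ 0 < w i)%R ->
  (forall tau i, (0 < Im tau)%R -> (Cmod (f tau i) = Cmod (c i) * exp (- (2 * PI * (w i * Im tau))))%R) ->
  (forall tau i, w i = 0%R -> f tau i = c i) ->
  (exists M, sum_le (fun i => Cmod (c i) * exp (- (2 * PI * w i)))%R M) ->
  (forall tau, (0 < Im tau)%R -> has_sum (f tau) (s tau)) ->
  has_sum (fun i => if Req_dec_T (w i) 0 then c i else 0) S ->
  lim_ioo s S.
Proof.
  intros Hw Hf Hf0 [M HM] Hs HS.
  pose proof PI_RGT_0 as Hpi.
  refine (tannery at_ioo f s (fun i => if Req_dec_T (w i) 0 then c i else 0) S
    (fun i => Cmod (c i) * exp (- (2 * PI * w i)))%R M _ HM _ _ _ _ HS).
  - intros i. apply Rmult_le_pos; [apply Cmod_ge_0|left; apply exp_pos].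
  - exists 1%R. intros tau Ht i. rewrite Hf by lra. apply Rmult_le_compat_l; [apply Cmod_ge_0|].
    apply exp_le. destruct (Hw i) as [->|H]; [lra|].
    assert (w i * 1 <= w i * Im tau)%R by (apply Rmult_le_compat_l; lra).
    assert (2 * PI * (w i * 1) <= 2 * PI * (w i * Im tau))%R by (apply Rmult_le_compat_l; lra). lra.
  - intros i eps He. destruct (Req_dec_T (w i) 0) as [E|N].
    + exists 0%R. intros tau _. rewrite Hf0 by auto. replace (c i - c i) with (RtoC 0) by ring. now rewrite Cmod_0.
    + assert (P : (0 < w i)%R) by (destruct (Hw i); [tauto|auto]).
      pose proof (Cmod_ge_0 (c i)).
      (* Above this height 2 pi (w i) Im tau exceeds (|c i| + 1) / eps, and exp X > X finishes. *)
      exists (Rmax 0 (((Cmod (c i) + 1) / eps) / (2 * PI * w i)))%R. intros tau Ht.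
      assert (Y0 : (0 < Im tau)%R) by (eapply Rle_lt_trans; [apply Rmax_l|exact Ht]).
      assert (Y1 : (((Cmod (c i) + 1) / eps) / (2 * PI * w i) < Im tau)%R) by (eapply Rle_lt_trans; [apply Rmax_r|exact Ht]).
      replace (f tau i - 0) with (f tau i) by ring. rewrite Hf by auto.
      set (X := (2 * PI * (w i * Im tau))%R).
      assert (HX : ((Cmod (c i) + 1) / eps < X)%R).
      { assert (Q : (0 < 2 * PI * w i)%R) by (apply Rmult_lt_0_compat; lra).
        apply Rmult_lt_compat_r with (r := (2 * PI * w i)%R) in Y1; auto.
        replace ((Cmod (c i) + 1) / eps / (2 * PI * w i) * (2 * PI * w i))%R
          with ((Cmod (c i) + 1) / eps)%R in Y1 by (field; split; lra).
        unfold X. lra. }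
      assert (X0 : (0 < X)%R).
      { eapply Rlt_trans; [|exact HX]. apply Rdiv_lt_0_compat; lra. }
      rewrite exp_Ropp. pose proof (exp_ineq1 X ltac:(lra)).
      apply Rmult_lt_reg_r with (exp X); [apply exp_pos|].
      rewrite Rmult_assoc, Rinv_l by (pose proof (exp_pos X); lra).
      apply Rmult_lt_compat_r with (r := eps) in HX; auto.
      replace ((Cmod (c i) + 1) / eps * eps)%R with (Cmod (c i) + 1)%R in HX by (field; lra).
      nra.
  - intros i. destruct (Req_dec_T (w i) 0) as [E|N].
    + rewrite E. replace (- (2 * PI * 0))%R with 0%R by ring. rewrite exp_0. lra.
    + rewrite Cmod_0. apply Rmult_le_pos; [apply Cmod_ge_0|left; apply exp_pos].
  - exists 0%R. exact Hs.
Qed.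

Lemma lim_th3 : lim_ioo th3 1.
Proof.
  apply (lim_ioo_sum (fun n : Z => IZR n * IZR n)%R (fun _ => 1) (fun tau n => e (IZR n * IZR n * tau))).
  - intros n. destruct (Req_dec (IZR n) 0) as [->|H]; [left; ring|right; nra].
  - intros tau n Ht. rewrite Cmod_e, <- RtoC_mult, Im_scal_R, Cmod_1. ring.
  - intros tau n E. rewrite <- RtoC_mult, E, Cmult_0_l. apply e_0.
  - pose proof PI_RGT_0. destruct (gauss_sum_le (2 * PI) 0 ltac:(lra)) as [M HM]. exists M.
    eapply sum_le_mono; [|exact HM]. intros n; cbv beta. rewrite Cmod_1. right. rewrite Rmult_1_l. f_equal. ring.
  - intros tau Ht. now apply has_th3.
  - apply has_sum_single with 0%Z.
    + destruct (Req_dec_T (0 * 0) 0) as [|N]; auto. exfalso; apply N; ring.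
    + intros n N. destruct (Req_dec_T (IZR n * IZR n) 0) as [E|]; auto. exfalso. apply N, eq_IZR. nra.
Qed.

Lemma lim_th4 : lim_ioo th4 1.
Proof. apply (lim_ioo_half th3). exact lim_th3. Qed.

(** After division by q^(1/4) the exponents are n^2 + n, which vanish exactly for n = 0 and n = -1:
    hence the limit 2. *)
Lemma lim_th2 : lim_ioo (fun tau => e (- (tau / 4)) * th2 tau) 2.
Proof.
  apply (lim_ioo_sum (fun n : Z => IZR n * IZR n + IZR n)%R (fun _ => 1)
    (fun tau n => e (- (tau / 4)) * e ((IZR n + 1 / 2) * (IZR n + 1 / 2) * tau))).
  - intros n. destruct (Z.eq_dec n 0) as [->|N0]; [left; ring|].
    destruct (Z.eq_dec n (-1)) as [->|N1]; [left; ring|]. right.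
    rewrite <- mult_IZR, <- plus_IZR. apply IZR_lt. nia.
  - intros tau n Ht. rewrite <- e_add.
    replace (- (tau / 4) + (IZR n + 1 / 2) * (IZR n + 1 / 2) * tau) with (RtoC (IZR n * IZR n + IZR n) * tau)
      by (push; field; auto).
    rewrite Cmod_e, Im_scal_R, Cmod_1. ring.
  - intros tau n E. rewrite <- e_add.
    replace (- (tau / 4) + (IZR n + 1 / 2) * (IZR n + 1 / 2) * tau) with (RtoC (IZR n * IZR n + IZR n) * tau)
      by (push; field; auto).
    rewrite E, Cmult_0_l. apply e_0.
  - pose proof PI_RGT_0. destruct (gauss_sum_le (2 * PI) (2 * PI) ltac:(lra)) as [M HM]. exists M.
    eapply sum_le_mono; [|exact HM]. intros n; cbv beta. rewrite Cmod_1. right. rewrite Rmult_1_l. f_equal. ring.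
  - intros tau Ht. apply has_sum_scal. now apply has_th2.
  - set (f := fun n : Z => if Req_dec_T (IZR n * IZR n + IZR n) 0 then RtoC 1 else 0).
    replace (RtoC 2) with (lsum f (0%Z :: (-1)%Z :: nil)).
    + apply has_sum_finite.
      * repeat constructor; simpl; intuition congruence.
      * intros n Hn. unfold f. destruct (Req_dec_T (IZR n * IZR n + IZR n) 0) as [E|]; auto. exfalso. apply Hn.
        rewrite <- mult_IZR, <- plus_IZR in E. apply eq_IZR in E. simpl. nia.
    + unfold f. simpl. destruct (Req_dec_T (0 * 0 + 0) 0) as [|N]; [|exfalso; apply N; ring].
      destruct (Req_dec_T (-1 * -1 + -1) 0) as [|N]; [|exfalso; apply N; ring].
      rewrite <- !RtoC_plus. f_equal. ring.
Qed.

Lemma Csqr_0 (z : C) : z * z = 0 -> z = 0.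
Proof. intros H. destruct (eq_em z 0) as [|N]; auto. exfalso. now apply (Cmult_neq_0 z z). Qed.

(* A zero of th4 would propagate to all 2^k tau by th3(tau) th4(tau) = th4(2 tau)^2, against th4(i oo) = 1. *)
Lemma th4_nz tau : (0 < Im tau)%R -> th4 tau <> 0.
Proof.
  intros H E. apply C1_nz. apply (lim_ioo_dbl_const th4 1 0 tau lim_th4 H).
  induction k as [|k IH].
  - unfold dbl. simpl. now rewrite Cmult_1_l.
  - rewrite dbl_S. apply Csqr_0. rewrite <- th34 by (now apply Im_dbl_pos). rewrite IH. ring.
Qed.

Lemma th3_nz tau : (0 < Im tau)%R -> th3 tau <> 0.
Proof. intros H. rewrite <- th4_half by auto. apply th4_nz. impos. Qed.

(** By th2(tau)^2 = 2 th2(2 tau) th3(2 tau) and the absence of zeros of th3, a zero would propagate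
    to all 2^k tau, against [lim_th2]. *)
Lemma th2_nz tau : (0 < Im tau)%R -> th2 tau <> 0.
Proof.
  intros H E. apply C2_nz. apply (lim_ioo_dbl_const _ 2 0 tau lim_th2 H).
  assert (A : forall k, th2 (dbl k tau) = 0).
  { induction k as [|k IH].
    - unfold dbl. simpl. now rewrite Cmult_1_l.
    - pose proof (Im_dbl_pos k tau H) as Hk.
      pose proof (th2_sq (dbl k tau) Hk) as Q. rewrite IH, <- dbl_S in Q.
      assert (Hn : 2 * th3 (dbl (S k) tau) <> 0).
      { apply Cmult_neq_0; auto. apply th3_nz. now apply Im_dbl_pos. }
      replace (th2 (dbl (S k) tau)) with ((2 * th2 (dbl (S k) tau) * th3 (dbl (S k) tau)) / (2 * th3 (dbl (S k) tau))).
      + rewrite <- Q. field. intros E0. apply Hn. rewrite E0. ring.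
      + field. intros E0. apply Hn. rewrite E0. ring. }
  intros k. rewrite A. ring.
Qed.

(** * Kronecker's identity *)

Lemma Cmod_1_plus (z : C) : (1 - Cmod z <= Cmod (1 + z))%R.
Proof.
  pose proof (Cmod_triangle (1 + z) (- z)) as H. rewrite Cmod_opp in H.
  replace (1 + z + - z) with (RtoC 1) in H by ring. rewrite Cmod_1 in H. lra.
Qed.

Lemma Cmod_1_plus_nz (z : C) : (Cmod z < 1)%R -> 1 + z <> 0.
Proof. intros H E. pose proof (Cmod_1_plus z) as K. rewrite E, Cmod_0 in K. lra. Qed.

Lemma Cmod_e_lt1 tau : (0 < Im tau)%R -> (Cmod (e tau) < 1)%R.
Proof.
  intros H. rewrite Cmod_e, <- exp_0. apply exp_increasing.
  pose proof PI_RGT_0. assert (0 < 2 * PI * Im tau)%R by (apply Rmult_lt_0_compat; lra). lra.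
Qed.

(* Both bounds for 1 / (1 + q^n), good for n >= 0 and n <= 0 respectively. *)
Lemma inv_1q_bound tau : (0 < Im tau)%R -> exists B, (0 < B)%R /\ forall n : Z,
  1 + e (IZR n * tau) <> 0 /\ (Cmod (/ (1 + e (IZR n * tau))) <= B)%R /\
  (Cmod (/ (1 + e (IZR n * tau))) <= B * Cmod (e (- (IZR n * tau))))%R.
Proof.
  intros H. set (r := Cmod (e tau)). pose proof (Cmod_e_lt1 tau H) as Hr. fold r in Hr.
  assert (Hr0 : (0 <= r)%R) by apply Cmod_ge_0.
  assert (HB : (0 < / (1 - r))%R) by (apply Rinv_0_lt_compat; lra).
  assert (Hpos : forall m : nat, 1 + e (INR (S m) * tau) <> 0 /\
      (1 - r <= Cmod (1 + e (INR (S m) * tau)))%R /\ (Cmod (e (INR (S m) * tau)) <= 1)%R).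
  { intros m. rewrite <- e_pow.
    assert (E : (Cmod (e tau ^ S m) <= r)%R).
    { rewrite Cmod_pow. fold r. simpl. assert (r ^ m <= 1 ^ m)%R by (apply pow_incr; lra).
      rewrite pow1 in H0. nra. }
    repeat split.
    - apply Cmod_1_plus_nz. lra.
    - pose proof (Cmod_1_plus (e tau ^ S m)). lra.
    - lra. }
  exists (/ (1 - r))%R. split; auto. intros n.
  destruct (Z_lt_le_dec 0 n) as [Hn|Hn]; [|destruct (Z.eq_dec n 0) as [->|Hn0]].
  - destruct (Hpos (Z.to_nat (n - 1))) as (P1 & P2 & P3).
    rewrite INR_IZR_INZ in P1, P2, P3. replace (Z.of_nat (S (Z.to_nat (n - 1)))) with n in P1, P2, P3 by lia.
    split; auto. rewrite Cmod_inv by auto.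
    assert (Q : (/ Cmod (1 + e (IZR n * tau)) <= / (1 - r))%R) by (apply Rinv_le_contravar; lra).
    split; auto. rewrite e_opp, Cmod_inv by apply e_nz.
    eapply Rle_trans; [exact Q|]. rewrite <- (Rmult_1_r (/ (1 - r))) at 1.
    apply Rmult_le_compat_l; [lra|].
    assert (0 < Cmod (e (IZR n * tau)))%R by (apply Cmod_gt_0, e_nz).
    rewrite <- Rinv_1. apply Rinv_le_contravar; lra.
  - rewrite Cmult_0_l, Copp_0, e_0, Cmod_1.
    assert (N : 1 + 1 <> 0) by (rewrite <- RtoC_plus; intros E; apply RtoC_inj in E; lra).
    split; auto. rewrite Cmod_inv by auto.
    assert (Q : (/ Cmod (1 + 1) <= / (1 - r))%R).
    { apply Rinv_le_contravar; [lra|]. rewrite <- RtoC_plus, Cmod_R, Rabs_right by lra. lra. }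
    rewrite Rmult_1_r. auto.
  - destruct (Hpos (Z.to_nat (- n - 1))) as (P1 & P2 & P3).
    rewrite INR_IZR_INZ in P1, P2, P3. replace (Z.of_nat (S (Z.to_nat (- n - 1)))) with (- n)%Z in P1, P2, P3 by lia.
    replace (IZR (- n) * tau) with (- (IZR n * tau)) in P1, P2, P3 by (push; ring).
    pose proof (e_nz (IZR n * tau)) as Nz.
    assert (N2 : e (IZR n * tau) + 1 <> 0).
    { intros E. apply P1. rewrite e_opp.
      replace (1 + / e (IZR n * tau)) with ((e (IZR n * tau) + 1) / e (IZR n * tau)) by (field; auto).
      rewrite E. field; auto. }
    rewrite Cplus_comm. split; auto.
    replace (/ (e (IZR n * tau) + 1)) with (/ (1 + e (- (IZR n * tau))) * e (- (IZR n * tau))).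
    2: { rewrite e_opp. field; repeat split; auto; now rewrite Cplus_comm. }
    rewrite Cmod_mult, Cmod_inv by auto.
    assert (Q : (/ Cmod (1 + e (- (IZR n * tau))) <= / (1 - r))%R) by (apply Rinv_le_contravar; lra).
    pose proof (Cmod_ge_0 (e (- (IZR n * tau)))).
    assert (0 <= / Cmod (1 + e (- (IZR n * tau))))%R by (left; apply Rinv_0_lt_compat; lra).
    split; [|apply Rmult_le_compat_r; auto].
    rewrite <- (Rmult_1_r (/ (1 - r))). apply Rmult_le_compat; auto.
Qed.

Lemma e_nat_le tau (n : nat) : Cmod (e (INR n * tau)) = (Cmod (e tau) ^ n)%R.
Proof. now rewrite <- e_pow, Cmod_pow. Qed.

(** The Lambert series Sum x^n / (1 + q^n) with x = e(alpha), q = e(tau). It converges in the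
    annulus |q| < |x| < 1, whence the hypothesis 0 < Im alpha < Im tau below. *)
Definition LS (tau alpha : C) : C :=
  csum (fun n : Z => e (IZR n * alpha) / (1 + e (IZR n * tau))).

Lemma abs_sum_LS tau alpha : (0 < Im alpha < Im tau)%R ->
  abs_sum (fun n : Z => e (IZR n * alpha) / (1 + e (IZR n * tau))).
Proof.
  intros [Ha Ht]. destruct (inv_1q_bound tau) as (B & HB & Hn); [lra|].
  set (r1 := Cmod (e alpha)). set (r2 := Cmod (e (tau - alpha))).
  assert (H1 : (0 <= r1 < 1)%R) by (split; [apply Cmod_ge_0|now apply Cmod_e_lt1]).
  assert (H2 : (0 <= r2 < 1)%R).
  { split; [apply Cmod_ge_0|apply Cmod_e_lt1]. unfold Cminus. rewrite Im_plus.
    replace (Im (- alpha)) with (- Im alpha)%R by reflexivity. lra. }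
  eexists. apply sum_le_Z.
  - intros; apply Cmod_ge_0.
  - eapply sum_le_mono; [|apply (sum_le_scal B _ _ (Rlt_le _ _ HB) (sum_le_geom r1 H1))].
    intros n; cbv beta. unfold Cdiv. rewrite Cmod_mult, <- INR_IZR_INZ, e_nat_le. fold r1.
    rewrite Rmult_comm. apply Rmult_le_compat_r; [apply pow_le; lra|].
    rewrite INR_IZR_INZ. apply Hn.
  - eapply sum_le_mono; [|apply (sum_le_scal B _ _ (Rlt_le _ _ HB) (sum_le_geom r2 H2))].
    intros n; cbv beta. unfold Cdiv. rewrite Cmod_mult.
    destruct (Hn (- Z.of_nat (S n))%Z) as (_ & _ & K).
    apply Rle_trans with (Cmod (e (IZR (- Z.of_nat (S n)) * alpha)) * (B * Cmod (e (- (IZR (- Z.of_nat (S n)) * tau)))))%R.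
    { apply Rmult_le_compat_l; [apply Cmod_ge_0|exact K]. }
    rewrite (Rmult_comm (Cmod (e _))), Rmult_assoc, <- Cmod_mult, <- e_add.
    replace (- (IZR (- Z.of_nat (S n)) * tau) + IZR (- Z.of_nat (S n)) * alpha)
      with (INR (S n) * (tau - alpha)) by (push; ring).
    rewrite e_nat_le. fold r2. apply Rmult_le_compat_l; [lra|]. apply pow_decr; [lra|lia].
Qed.

Definition phi_term (tau alpha : C) (n : Z) : C := e (IZR (n * (n - 1)) / 2 * tau + IZR n * alpha).

(** A summand of the coefficient of x^M in phi(x) Sum x^n / (1 + q^n), with phi(x) = Sum (-1)^n
    q^(n(n-1)/2) x^n: index - k is taken in phi and index M + k in the Lambert series. *)
Definition c_term (tau : C) (M k : Z) : C :=
  sgn k * e (IZR (k * (k + 1)) / 2 * tau) / (1 + e (IZR (M + k) * tau)).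

Lemma Im_half_scal tau : (0 < Im tau)%R -> (0 < Im (tau / 2))%R.
Proof. intros H. rewrite Im_div_R by lra. lra. Qed.

Lemma abs_sum_phi tau alpha : (0 < Im tau)%R -> abs_sum (phi_term tau alpha).
Proof.
  intros H. eapply abs_sum_ext; [|apply (abs_sum_quad (tau / 2) (alpha - tau / 2) 0); now apply Im_half_scal].
  intros n; unfold phi_term. f_equal. push. field; auto.
Qed.

Lemma abs_sum_tri tau : (0 < Im tau)%R -> abs_sum (fun k => e (IZR (k * (k + 1)) / 2 * tau)).
Proof.
  intros H. eapply abs_sum_ext; [|apply (abs_sum_quad (tau / 2) (tau / 2) 0); now apply Im_half_scal].
  intros n; cbv beta. f_equal. push. field; auto.
Qed.

Lemma abs_sum_c tau M : (0 < Im tau)%R -> abs_sum (c_term tau M).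
Proof.
  intros H. destruct (inv_1q_bound tau H) as (B & HB & Hn).
  apply abs_sum_le with (fun k => B * (sgn k * e (IZR (k * (k + 1)) / 2 * tau))).
  - intros k. unfold c_term, Cdiv. rewrite !Cmod_mult, Cmod_R, Rabs_right by lra.
    rewrite (Rmult_comm B). apply Rmult_le_compat_l.
    + apply Rmult_le_pos; apply Cmod_ge_0.
    + apply Hn.
  - now apply abs_sum_scal, abs_sum_sgn, abs_sum_tri.
Qed.

Lemma has_sum_antisym (f : Z -> C) (h : Z -> Z) : (forall n, h (h n) = n) ->
  (forall n, f (h n) = - f n) -> abs_sum f -> has_sum f 0.
Proof.
  intros Hh Hf Ha. assert (A : has_sum f (csum f)) by (now apply abs_sum_has).
  assert (B : has_sum f (- csum f)).
  { apply (has_sum_bij h h); auto. eapply has_sum_ext; [|apply (has_sum_opp _ _ A)].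
    intros n. symmetry. apply Hf. }
  replace (RtoC 0) with (csum f); auto.
  pose proof (has_sum_unique _ _ _ A B) as E.
  assert (E2 : csum f + csum f = 0) by (rewrite E at 2; ring).
  replace (csum f) with ((csum f + csum f) / 2) by (field; auto). rewrite E2. field; auto.
Qed.

(** The involution k -> 1 - k preserves k (k - 1) and reverses the sign. *)
Lemma has_sum_tri_alt tau : (0 < Im tau)%R ->
  has_sum (fun k => sgn k * e (IZR (k * (k - 1)) / 2 * tau)) 0.
Proof.
  intros H. apply has_sum_antisym with (fun k => (1 - k)%Z).
  - intros; lia.
  - intros n. replace ((1 - n) * (1 - n - 1))%Z with (n * (n - 1))%Z by ring.
    unfold Z.sub at 1. rewrite sgn_add, sgn_opp. unfold sgn at 1; simpl. ring.
  - apply abs_sum_sgn. eapply abs_sum_ext; [|apply (abs_sum_phi tau 0 H)].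
    intros n; unfold phi_term. f_equal. ring.
Qed.

(** Writing q^(M+k) / (1 + q^(M+k)) = 1 - 1 / (1 + q^(M+k)), the difference of the two sides becomes
    Sum (-1)^k q^(k(k-1)/2), which is 0. *)
Lemma c_step tau M : (0 < Im tau)%R -> csum (c_term tau (M + 1)) = e (IZR M * tau) * csum (c_term tau M).
Proof.
  intros H. destruct (inv_1q_bound tau H) as (B & HB & Hn).
  apply csum_eq.
  apply (has_sum_bij (fun k : Z => k - 1)%Z (fun k => k + 1)%Z); [intros; lia|intros; lia|].
  replace (e (IZR M * tau) * csum (c_term tau M)) with (e (IZR M * tau) * csum (c_term tau M) - 0) by ring.
  eapply has_sum_ext; [|apply (has_sum_minus _ _ _ _ (has_sum_scal (e (IZR M * tau)) _ _ (abs_sum_has _ (abs_sum_c tau M H))) (has_sum_tri_alt tau H))].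
  intros k; unfold c_term; cbv beta.
  replace (M + 1 + (k - 1))%Z with (M + k)%Z by ring.
  replace ((k - 1) * (k - 1 + 1))%Z with (k * (k - 1))%Z by ring.
  replace (sgn (k - 1)) with (- sgn k) by (unfold Z.sub; rewrite sgn_add; unfold sgn at 3; simpl; ring).
  destruct (Hn (M + k)%Z) as (N & _).
  replace (IZR (k * (k + 1)) / 2 * tau) with (IZR (k * (k - 1)) / 2 * tau + IZR k * tau) by (push; field; auto).
  rewrite e_add. revert N. replace (IZR (M + k) * tau) with (IZR M * tau + IZR k * tau) by (push; ring).
  rewrite e_add. intros N. field; auto.
Qed.

Lemma c_formula tau M : (0 < Im tau)%R ->
  csum (c_term tau M) = e (IZR (M * (M - 1)) / 2 * tau) * csum (c_term tau 0).
Proof.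
  intros H. revert M. apply Z.bi_induction.
  - intros x y ->. tauto.
  - replace (IZR (0 * (0 - 1)) / 2 * tau) with (RtoC 0) by (simpl; field; auto). rewrite e_0. ring.
  - intros M. unfold Z.succ. rewrite c_step by auto.
    replace (IZR ((M + 1) * (M + 1 - 1)) / 2 * tau) with (IZR M * tau + IZR (M * (M - 1)) / 2 * tau)
      by (push; field; auto).
    rewrite e_add, <- Cmult_assoc. split; [now intros ->|].
    intros E. pose proof (e_nz (IZR M * tau)) as N.
    apply (f_equal (fun z => / e (IZR M * tau) * z)) in E.
    rewrite !Cmult_assoc, !Cinv_l, !Cmult_1_l in E by auto. exact E.
Qed.

(* Kronecker's identity  Sum x^n / (1 - y q^n) = c_0(y) phi(x y) / phi(x)  at y = -1, where
   phi(x) = Sum (-1)^n q^(n(n-1)/2) x^n: the coefficient of x^M in phi(x) Sum x^n / (1 + q^n) is c_M. *)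
Lemma kronecker_identity tau alpha : (0 < Im alpha < Im tau)%R ->
  csum (fun n => sgn n * phi_term tau alpha n) * LS tau alpha =
  csum (c_term tau 0) * csum (phi_term tau alpha).
Proof.
  intros Ha. assert (Ht : (0 < Im tau)%R) by lra.
  pose proof (has_sum_mult_abs _ _ (abs_sum_sgn _ (abs_sum_phi tau alpha Ht)) (abs_sum_LS tau alpha Ha)) as P.
  fold (LS tau alpha) in P.
  (* The double series is reindexed by (M, k), with M the total exponent of x, and then summed by
     rows. *)
  apply (has_sum_bij (fun p : Z * Z => (- snd p, fst p + snd p)%Z) (fun p : Z * Z => (fst p + snd p, - fst p)%Z)) in P.
  2,3: intros [x y]; cbn [fst snd]; f_equal; lia.
  refine (has_sum_unique _ _ _ (has_sum_rows _ (fun M => e (IZR M * alpha) * csum (c_term tau M)) _ P _) _).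
  - intros M. eapply has_sum_ext; [|apply (has_sum_scal (e (IZR M * alpha)) _ _ (abs_sum_has _ (abs_sum_c tau M Ht)))].
    intros k; cbn [fst snd]. unfold c_term, phi_term. rewrite sgn_opp.
    transitivity (sgn k * (e (IZR M * alpha) * e (IZR (k * (k + 1)) / 2 * tau)) / (1 + e (IZR (M + k) * tau))).
    { unfold Cdiv. ring. }
    transitivity (sgn k * (e (IZR (- k * (- k - 1)) / 2 * tau + IZR (- k) * alpha) * e (IZR (M + k) * alpha)) / (1 + e (IZR (M + k) * tau))).
    2: { unfold Cdiv. ring. }
    rewrite <- !e_add. do 3 f_equal. push. field; auto.
  - eapply has_sum_ext; [|apply (has_sum_scal _ _ _ (abs_sum_has _ (abs_sum_phi tau alpha Ht)))].
    intros M; cbv beta. rewrite (c_formula tau M) by auto. unfold phi_term. rewrite e_add. ring.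
Qed.

(** This factor is never evaluated: being of period 1, it is eliminated between the identities at
    tau and at tau + 1/2. *)
Definition C0 (tau : C) : C := csum (c_term tau 0).

Lemma C0_1 tau : (0 < Im tau)%R -> C0 (tau + 1) = C0 tau.
Proof.
  intros H. unfold C0. apply csum_ext; [|now apply abs_sum_ex, abs_sum_c].
  intros k. unfold c_term.
  assert (exists j, k * (k + 1) = 2 * j)%Z as [j Hj].
  { destruct (Z.Even_or_Odd k) as [[j ->]|[j ->]].
    - exists (2 * j * j + j)%Z. ring.
    - exists (2 * j * j + 3 * j + 1)%Z. ring. }
  rewrite Hj. f_equal.
  - f_equal. apply e_shift_eq with j. push. field; auto.
  - f_equal. apply e_shift_eq with k. push. ring.
Qed.

Definition L1 (tau : C) : C := LS (2 * tau) tau.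
Definition L2 (tau : C) : C := LS (4 * tau) tau.

(** The translation by 1/2 leaves every denominator unchanged, because 2 N is even, and multiplies
    the n-th numerator by (-1)^n: only even n survive, doubled. *)
Lemma LS_dbl (N : Z) tau : (0 < Im tau)%R -> (0 < N)%Z ->
  LS (IZR (2 * N) * tau) tau + LS (IZR (2 * N) * (tau + 1 / 2)) (tau + 1 / 2) =
  2 * LS (IZR (2 * N) * (2 * tau)) (2 * tau).
Proof.
  intros H HN.
  assert (K : forall s, (0 < Im s)%R -> (0 < Im s < Im (IZR (2 * N) * s))%R).
  { intros s Hs. rewrite Im_scal_R. split; auto. rewrite <- (Rmult_1_l (Im s)) at 1.
    apply Rmult_lt_compat_r; auto. apply IZR_lt. lia. }
  pose proof (abs_sum_has _ (abs_sum_LS _ _ (K tau H))) as A.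
  pose proof (abs_sum_has _ (abs_sum_LS _ _ (K (tau + 1 / 2) ltac:(impos)))) as B.
  pose proof (abs_sum_has _ (abs_sum_LS _ _ (K (2 * tau) ltac:(impos)))) as D.
  refine (has_sum_unique _ _ _ (has_sum_plus _ _ _ _ A B) _).
  match goal with |- has_sum _ ?s => replace s with (s + 0) by ring end.
  apply has_sum_parity.
  - eapply has_sum_ext; [|apply (has_sum_scal 2 _ _ D)]. intros k; cbv beta.
    replace (IZR (2 * k) * (IZR (2 * N) * tau)) with (IZR k * (IZR (2 * N) * (2 * tau))) by (push; ring).
    rewrite (e_shift_eq (IZR (2 * k) * (IZR (2 * N) * (tau + 1 / 2))) (IZR k * (IZR (2 * N) * (2 * tau))) (2 * k * N))
      by (push; field; auto).
    rewrite (e_shift_eq (IZR (2 * k) * (tau + 1 / 2)) (IZR k * (2 * tau)) k) by (push; field; auto).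
    replace (IZR (2 * k) * tau) with (IZR k * (2 * tau)) by (push; ring). unfold Cdiv. ring.
  - eapply has_sum_ext; [|apply has_sum_0]. intros k; cbv beta.
    rewrite (e_shift_eq (IZR (2 * k + 1) * (IZR (2 * N) * (tau + 1 / 2))) (IZR (2 * k + 1) * (IZR (2 * N) * tau)) ((2 * k + 1) * N))
      by (push; field; auto).
    replace (IZR (2 * k + 1) * (tau + 1 / 2)) with (IZR (2 * k + 1) * tau + IZR (2 * k + 1) / 2) by (push; field; auto).
    rewrite e_add, e_half_Z, sgn_odd. unfold Cdiv. ring.
Qed.

(** * Representations by m^2 + n^2 and m^2 + 2 n^2 *)

(** The double series Sum g(d) q^(d m) over d, m >= 1, with both indices shifted by one: the
    generating function of the divisor sums of g. *)
Definition lam_term (g : nat -> C) (tau : C) (p : nat * nat) : C :=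
  g (S (fst p)) * e (INR (S (fst p) * S (snd p)) * tau).
Definition Lam (g : nat -> C) (tau : C) : C := csum (lam_term g tau).

(** A growth condition that covers the characters, d for E_2 and d^3 for E_4. *)
Definition cubic (g : nat -> C) : Prop :=
  exists K, (0 <= K)%R /\ forall d, (Cmod (g (S d)) <= K * INR (S d) ^ 3)%R.

Lemma sum_le_lam (g : nat -> C) r : cubic g -> (0 <= r < 1)%R ->
  exists M, sum_le (fun p : nat * nat => Cmod (g (S (fst p))) * r ^ (S (fst p) * S (snd p)))%R M.
Proof.
  intros (K & HK & Hg) Hr. destruct (sum_le_cubic_geom r Hr) as [M HM].
  exists (K * M * / (1 - r))%R.
  pose proof (sum_le_scal K _ _ HK HM) as HM'.
  eapply sum_le_mono; [|eapply sum_le_mult; [| | |exact HM'|exact (sum_le_geom r Hr)]].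
  - intros [d m]; cbn [fst snd]. cbv beta.
    assert (0 <= r ^ d)%R by (apply pow_le; lra). assert (0 <= r ^ m)%R by (apply pow_le; lra).
    assert (r ^ (S d * S m) <= r ^ d * r ^ m)%R.
    { rewrite <- pow_add. apply pow_decr; [lra|nia]. }
    assert (0 <= r ^ (S d * S m))%R by (apply pow_le; lra).
    rewrite Rmult_assoc, Rmult_assoc, <- Rmult_assoc.
    apply Rmult_le_compat; auto. apply Cmod_ge_0.
  - intros d; cbv beta. apply Rmult_le_pos; auto. apply Rmult_le_pos; apply pow_le; [apply pos_INR|lra].
  - intros m; cbv beta. apply pow_le; lra.
  - left. apply Rinv_0_lt_compat; lra.
Qed.

Lemma abs_sum_lam g tau : cubic g -> (0 < Im tau)%R -> abs_sum (lam_term g tau).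
Proof.
  intros Hg H. destruct (sum_le_lam g (Cmod (e tau)) Hg) as [M HM].
  { split; [apply Cmod_ge_0|now apply Cmod_e_lt1]. }
  exists M. eapply sum_le_mono; [|exact HM]. intros [d m]; cbv beta. unfold lam_term; cbn [fst snd].
  rewrite Cmod_mult, e_nat_le. lra.
Qed.

Lemma has_lam g tau : cubic g -> (0 < Im tau)%R -> has_sum (lam_term g tau) (Lam g tau).
Proof. intros Hg H. now apply abs_sum_has, abs_sum_lam. Qed.

Lemma lim_lam g : cubic g -> lim_ioo (Lam g) 0.
Proof.
  intros Hg.
  apply (lim_ioo_sum (fun p : nat * nat => INR (S (fst p) * S (snd p))) (fun p => g (S (fst p))) (lam_term g)).
  - intros [d m]; cbn [fst snd]. right. apply lt_0_INR. lia.
  - intros tau [d m] H. unfold lam_term; cbn [fst snd]. rewrite Cmod_mult, Cmod_e, Im_scal_R. reflexivity.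
  - intros tau [d m] H. cbn [fst snd] in H. exfalso. assert (0 < INR (S d * S m))%R by (apply lt_0_INR; lia). lra.
  - destruct (sum_le_lam g (exp (- (2 * PI))) Hg) as [M HM].
    { split; [left; apply exp_pos|]. rewrite <- exp_0. apply exp_increasing. pose proof PI_RGT_0. lra. }
    exists M. eapply sum_le_mono; [|exact HM]. intros [d m]; cbn [fst snd]. right. f_equal.
    generalize (S d * S m)%nat as n. intros n. induction n as [|n IH].
    + simpl. rewrite Rmult_0_r, Ropp_0. apply exp_0.
    + rewrite S_INR. simpl. rewrite <- IH, <- exp_plus. f_equal. ring.
  - intros tau H. now apply has_lam.
  - eapply has_sum_ext; [|apply has_sum_0]. intros [d m]; cbn [fst snd].
    destruct (Req_dec_T (INR (S d * S m)) 0) as [E|]; auto. exfalso.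
    assert (0 < INR (S d * S m))%R by (apply lt_0_INR; lia). lra.
Qed.

(** U / V is invariant under doubling. With r its value at tau, the function U - r V vanishes at
    every 2^k tau and tends to u - r v. *)
Lemma ratio_const U V u v tau : lim_ioo U u -> lim_ioo V v ->
  (forall t, (0 < Im t)%R -> V t <> 0) ->
  (forall t, (0 < Im t)%R -> U (2 * t) * V t = U t * V (2 * t)) ->
  (0 < Im tau)%R -> U tau * v = u * V tau.
Proof.
  intros HU HV Hn Hd Ht.
  set (r := U tau / V tau).
  assert (E : u + - (r * v) = 0).
  { apply (lim_ioo_dbl_const (fun t => U t + - (r * V t)) (u + - (r * v)) 0 tau); auto.
    - apply flim_plus; auto. apply flim_opp. apply flim_mult; auto. apply flim_const.
    - assert (K : forall k, U (dbl k tau) = r * V (dbl k tau)).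
      { induction k as [|k IH].
        - unfold dbl. simpl. rewrite Cmult_1_l. unfold r. field. now apply Hn.
        - pose proof (Im_dbl_pos k tau Ht) as P. specialize (Hd _ P).
          rewrite <- dbl_S, IH in Hd.
          replace (U (dbl (S k) tau)) with (U (dbl (S k) tau) * V (dbl k tau) / V (dbl k tau)) by (field; auto).
          rewrite Hd. field; auto. }
      intros k. rewrite K. ring. }
  replace u with (r * v) by (replace u with (u + - (r * v) + r * v) by ring; rewrite E; ring).
  unfold r. field. auto.
Qed.

Lemma has_sum_nat_S (f : nat -> C) t :
  has_sum (fun n => f (S n)) t <-> has_sum f (f 0%nat + t).
Proof.
  set (f0 := fun n => match n with O => f O | S _ => RtoC 0 end).
  set (f1 := fun n => match n with O => RtoC 0 | S m => f (S m) end).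
  assert (E0 : has_sum f0 (f O)).
  { apply has_sum_single with 0%nat; auto. intros [|n] N; [tauto|auto]. }
  assert (E1 : has_sum f1 t <-> has_sum (fun n => f (S n)) t).
  { apply (has_sum_inj S f1).
    - intros x y Hxy. now inversion Hxy.
    - intros [|n] N; auto. exfalso. now apply (N n). }
  rewrite <- E1. split; intros H.
  - eapply has_sum_ext; [|apply (has_sum_plus _ _ _ _ E0 H)]. intros [|n]; simpl; ring.
  - replace t with (f 0%nat + t - f 0%nat) by ring.
    eapply has_sum_ext; [|apply (has_sum_minus _ _ _ _ H E0)]. intros [|n]; simpl; ring.
Qed.

(** * The characters modulo 4 and 8 and their Lambert series *)

Definition chi4 (n : nat) : Z := (match (n mod 4)%nat with 1%nat => 1 | 3%nat => -1 | _ => 0 end)%Z.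
Definition chi8 (n : nat) : Z := (match (n mod 8)%nat with 1%nat | 3%nat => 1 | 5%nat | 7%nat => -1 | _ => 0 end)%Z.

Lemma chi4_2 n : chi4 (2 + n) = (- chi4 n)%Z.
Proof.
  unfold chi4. rewrite Nat.Div0.add_mod. pose proof (Nat.mod_upper_bound n 4 ltac:(lia)).
  destruct (n mod 4)%nat as [|[|[|[|k]]]]; try reflexivity. lia.
Qed.

Lemma chi8_4 n : chi8 (4 + n) = (- chi8 n)%Z.
Proof.
  unfold chi8. rewrite Nat.Div0.add_mod. pose proof (Nat.mod_upper_bound n 8 ltac:(lia)).
  destruct (n mod 8)%nat as [|[|[|[|[|[|[|[|k]]]]]]]]; try reflexivity. lia.
Qed.

Lemma chi4_le n : (Rabs (IZR (chi4 n)) <= 1)%R.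
Proof.
  unfold chi4. destruct (n mod 4)%nat as [|[|[|[|k]]]]; rewrite ?Rabs_R0, ?Rabs_R1; try lra.
  rewrite Rabs_left; lra.
Qed.

Lemma chi8_le n : (Rabs (IZR (chi8 n)) <= 1)%R.
Proof.
  unfold chi8. destruct (n mod 8)%nat as [|[|[|[|[|[|[|[|k]]]]]]]]; rewrite ?Rabs_R0, ?Rabs_R1; try lra;
  rewrite Rabs_left; lra.
Qed.

Lemma cubic_bounded (g : nat -> C) : (forall n, Cmod (g n) <= 1)%R -> cubic g.
Proof.
  intros H. exists 1%R. split; [lra|]. intros d. eapply Rle_trans; [apply H|].
  rewrite Rmult_1_l. rewrite <- (pow1 3) at 1. apply pow_incr. split; [lra|].
  rewrite S_INR. pose proof (pos_INR d). lra.
Qed.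

Lemma cubic_chi4 : cubic (fun n => IZR (chi4 n)).
Proof. apply cubic_bounded. intros n. rewrite Cmod_R. apply chi4_le. Qed.
Lemma cubic_chi8 : cubic (fun n => IZR (chi8 n)).
Proof. apply cubic_bounded. intros n. rewrite Cmod_R. apply chi8_le. Qed.

Lemma abs_sum_bounded_geom (g : nat -> C) x : (forall n, Cmod (g n) <= 1)%R -> (Cmod x < 1)%R ->
  abs_sum (fun n => g (S n) * x ^ S n).
Proof.
  intros Hg Hx. pose proof (Cmod_ge_0 x). exists (/ (1 - Cmod x))%R.
  eapply sum_le_mono; [|apply (sum_le_geom (Cmod x))]; [|lra].
  intros n; cbv beta. rewrite Cmod_mult, Cmod_pow. specialize (Hg (S n)).
  assert (0 <= Cmod x ^ S n)%R by (apply pow_le; lra).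
  assert (Cmod x ^ S n <= Cmod x ^ n)%R by (apply pow_decr; [lra|lia]).
  pose proof (Cmod_ge_0 (g (S n))). nra.
Qed.

Lemma Cmod_pow_lt1 x n : (Cmod x < 1)%R -> (Cmod (x ^ S n) < 1)%R.
Proof.
  intros H. rewrite Cmod_pow. pose proof (Cmod_ge_0 x). simpl.
  assert (Cmod x ^ n <= 1 ^ n)%R by (apply pow_incr; lra). rewrite pow1 in H1. nra.
Qed.

(** [chi4] changes sign under n -> n + 2, so the sum s satisfies s = x - x^2 s. *)
Lemma has_sum_chi4 x : (Cmod x < 1)%R ->
  has_sum (fun d => IZR (chi4 (S d)) * x ^ S d) (x / (1 + x ^ 2)).
Proof.
  intros Hx. set (f := fun d => IZR (chi4 (S d)) * x ^ S d).
  assert (A : has_sum f (csum f)).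
  { apply abs_sum_has. apply (abs_sum_bounded_geom (fun n => IZR (chi4 n))); auto.
    intros n. rewrite Cmod_R. apply chi4_le. }
  assert (B : has_sum f (f 0%nat + (f 1%nat + - x ^ 2 * csum f))).
  { rewrite <- has_sum_nat_S. apply (has_sum_nat_S (fun n => f (S n))).
    eapply has_sum_ext; [|apply (has_sum_scal (- x ^ 2) _ _ A)]. intros n. unfold f.
    change (S (S (S n))) with (2 + S n)%nat. rewrite chi4_2, opp_IZR, RtoC_opp, Cpow_add_r. ring. }
  replace (x / (1 + x ^ 2)) with (csum f); auto.
  assert (N : 1 + x ^ 2 <> 0) by (now apply Cmod_1_plus_nz, Cmod_pow_lt1).
  pose proof (has_sum_unique _ _ _ A B) as E.
  assert (E2 : csum f * (1 + x ^ 2) = x).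
  { transitivity (csum f + x ^ 2 * csum f); [ring|]. rewrite E at 1. unfold f, chi4. cbn. ring. }
  transitivity (csum f * (1 + x ^ 2) / (1 + x ^ 2)); [field; auto|now rewrite E2].
Qed.

(** [chi8] changes sign under n -> n + 4, so the sum s satisfies s = x + x^3 - x^4 s. *)
Lemma has_sum_chi8 x : (Cmod x < 1)%R ->
  has_sum (fun d => IZR (chi8 (S d)) * x ^ S d) ((x + x ^ 3) / (1 + x ^ 4)).
Proof.
  intros Hx. set (f := fun d => IZR (chi8 (S d)) * x ^ S d).
  assert (A : has_sum f (csum f)).
  { apply abs_sum_has. apply (abs_sum_bounded_geom (fun n => IZR (chi8 n))); auto.
    intros n. rewrite Cmod_R. apply chi8_le. }
  assert (B : has_sum f (f 0%nat + (f 1%nat + (f 2%nat + (f 3%nat + - x ^ 4 * csum f))))).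
  { rewrite <- has_sum_nat_S. apply (has_sum_nat_S (fun n => f (S n))).
    apply (has_sum_nat_S (fun n => f (S (S n)))). apply (has_sum_nat_S (fun n => f (S (S (S n))))).
    eapply has_sum_ext; [|apply (has_sum_scal (- x ^ 4) _ _ A)]. intros n. unfold f.
    change (S (S (S (S (S n))))) with (4 + S n)%nat. rewrite chi8_4, opp_IZR, RtoC_opp, Cpow_add_r. ring. }
  replace ((x + x ^ 3) / (1 + x ^ 4)) with (csum f); auto.
  assert (N : 1 + x ^ 4 <> 0) by (now apply Cmod_1_plus_nz, Cmod_pow_lt1).
  pose proof (has_sum_unique _ _ _ A B) as E.
  assert (E2 : csum f * (1 + x ^ 4) = x + x ^ 3).
  { transitivity (csum f + x ^ 4 * csum f); [ring|]. rewrite E at 1. unfold f, chi8. cbn. ring. }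
  transitivity (csum f * (1 + x ^ 4) / (1 + x ^ 4)); [field; auto|now rewrite E2].
Qed.

Lemma lam_rows (g : nat -> C) tau (r : C -> C) : cubic g -> (0 < Im tau)%R ->
  (forall x, (Cmod x < 1)%R -> has_sum (fun d => g (S d) * x ^ S d) (r x)) ->
  has_sum (fun m => r (e (INR (S m) * tau))) (Lam g tau).
Proof.
  intros Hg H Hr. apply (has_sum_cols _ _ _ (has_lam g tau Hg H)).
  intros m. eapply has_sum_ext; [|apply Hr].
  - intros d; cbv beta. unfold lam_term; cbn [fst snd]. rewrite e_pow. do 2 f_equal. rewrite mult_INR. push. ring.
  - apply Cmod_e_lt1. rewrite im_scal_l. apply Rmult_lt_0_compat; auto. apply lt_0_INR. lia.
Qed.

Lemma has_sum_Z_sym (f : Z -> C) t : abs_sum f ->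
  has_sum (fun m : nat => f (Z.of_nat (S m)) + f (- Z.of_nat (S m))%Z) t ->
  csum f = f 0%Z + t.
Proof.
  intros A H.
  assert (A1 : abs_sum (fun m : nat => f (Z.of_nat (S m)))).
  { apply (abs_sum_inj (fun m => Z.of_nat (S m))); auto. intros; lia. }
  assert (A2 : abs_sum (fun m : nat => f (- Z.of_nat (S m))%Z)).
  { apply (abs_sum_inj (fun m => (- Z.of_nat (S m))%Z)); auto. intros; lia. }
  pose proof (abs_sum_has _ A1) as H1. pose proof (abs_sum_has _ A2) as H2.
  rewrite (has_sum_unique _ _ _ H (has_sum_plus _ _ _ _ H1 H2)).
  apply csum_eq. rewrite Cplus_assoc. apply has_sum_Z; auto.
  apply (has_sum_nat_S (fun n => f (Z.of_nat n))). exact H1.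
Qed.

Lemma Cmod_e_S tau m : (0 < Im tau)%R -> (Cmod (e (INR (S m) * tau)) < 1)%R.
Proof.
  intros H. apply Cmod_e_lt1. rewrite im_scal_l. apply Rmult_lt_0_compat; auto. apply lt_0_INR; lia.
Qed.

(** The terms n and - n of [L1] coincide, and q^n / (1 + q^(2n)) is the generating function of
    [chi4]. The term n = 0 is 1/2. *)
Lemma L1_lam tau : (0 < Im tau)%R -> L1 tau = 1 / 2 + 2 * Lam (fun n => IZR (chi4 n)) tau.
Proof.
  intros H. unfold L1, LS.
  rewrite (has_sum_Z_sym _ (2 * Lam (fun n => IZR (chi4 n)) tau)).
  - rewrite !Cmult_0_l, e_0. field; auto.
  - apply abs_sum_LS. rewrite Im_scal2. lra.
  - pose proof (lam_rows (fun n => IZR (chi4 n)) tau _ cubic_chi4 H has_sum_chi4) as P.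
    eapply has_sum_ext; [|apply (has_sum_scal 2 _ _ P)].
    intros m; cbv beta. rewrite opp_IZR, <- INR_IZR_INZ.
    pose proof (Cmod_e_S tau m H) as X. set (z := INR (S m) * tau) in *.
    replace (INR (S m) * (2 * tau)) with (z + z) by (unfold z; ring).
    replace (RtoC (- INR (S m)) * (2 * tau)) with (- (z + z)) by (unfold z; rewrite RtoC_opp; ring).
    replace (RtoC (- INR (S m)) * tau) with (- z) by (unfold z; rewrite RtoC_opp; ring).
    rewrite !e_opp, !e_add. pose proof (Cmod_1_plus_nz _ (Cmod_pow_lt1 _ 1 X)) as N.
    pose proof (e_nz z) as Nz. set (x := e z) in *. simpl in N. rewrite Cmult_1_r in N.
    simpl. field. repeat split; auto.
    rewrite Cplus_comm. auto.
Qed.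

(** The terms n and - n of [L2] add up to (x + x^3) / (1 + x^4) with x = q^n. *)
Lemma L2_lam tau : (0 < Im tau)%R -> L2 tau = 1 / 2 + Lam (fun n => IZR (chi8 n)) tau.
Proof.
  intros H. unfold L2, LS.
  rewrite (has_sum_Z_sym _ (Lam (fun n => IZR (chi8 n)) tau)).
  - rewrite !Cmult_0_l, e_0. field; auto.
  - apply abs_sum_LS. rewrite Im_scal4. lra.
  - pose proof (lam_rows (fun n => IZR (chi8 n)) tau _ cubic_chi8 H has_sum_chi8) as P.
    eapply has_sum_ext; [|exact P].
    intros m; cbv beta. rewrite opp_IZR, <- INR_IZR_INZ.
    pose proof (Cmod_e_S tau m H) as X. set (z := INR (S m) * tau) in *.
    replace (INR (S m) * (4 * tau)) with (z + z + (z + z)) by (unfold z; ring).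
    replace (RtoC (- INR (S m)) * (4 * tau)) with (- (z + z + (z + z))) by (unfold z; rewrite RtoC_opp; ring).
    replace (RtoC (- INR (S m)) * tau) with (- z) by (unfold z; rewrite RtoC_opp; ring).
    rewrite !e_opp, !e_add. pose proof (Cmod_1_plus_nz _ (Cmod_pow_lt1 _ 3 X)) as N.
    pose proof (e_nz z) as Nz. set (x := e z) in *.
    assert (N' : x * x * (x * x) + 1 <> 0).
    { intros E. apply N. rewrite <- E. ring. }
    simpl. field. repeat split; auto.
Qed.

(** With q^2 in place of q and x = q, the exponent n (n - 1) + n is n^2, so both theta series of
    Kronecker's identity become theta constants. *)
Lemma Kron1 tau : (0 < Im tau)%R -> th4 tau * L1 tau = C0 (2 * tau) * th3 tau.
Proof.
  intros H. pose proof (kronecker_identity (2 * tau) tau) as K. rewrite Im_scal2 in K.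
  specialize (K ltac:(lra)). fold (L1 tau) in K. fold (C0 (2 * tau)) in K.
  replace (csum (phi_term (2 * tau) tau)) with (th3 tau) in K.
  2: { symmetry. apply csum_eq. eapply has_sum_ext; [|apply (has_th3 tau H)].
       intros n. unfold phi_term. f_equal. push. field; auto. }
  rewrite <- K. f_equal. symmetry. apply csum_eq. eapply has_sum_ext; [|apply (has_th4 tau H)].
  intros n. unfold phi_term. do 2 f_equal. push. field; auto.
Qed.

Lemma Kron1' tau : (0 < Im tau)%R -> th3 tau * L1 (tau + 1 / 2) = C0 (2 * tau) * th4 tau.
Proof.
  intros H. rewrite <- (th4_half tau H), Kron1 by impos. fold (th4 tau). f_equal.
  replace (2 * (tau + 1 / 2)) with (2 * tau + 1) by (field; auto). apply C0_1. impos.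
Qed.

Lemma L1_dbl tau : (0 < Im tau)%R -> L1 tau + L1 (tau + 1 / 2) = 2 * L1 (2 * tau).
Proof. intros H. apply (LS_dbl 1 tau H). lia. Qed.

Lemma L2_dbl tau : (0 < Im tau)%R -> L2 tau + L2 (tau + 1 / 2) = 2 * L2 (2 * tau).
Proof. intros H. apply (LS_dbl 2 tau H). lia. Qed.

(** Jacobi's two-square theorem. Both sides satisfy 2 F(2 tau) = F(tau) + F(tau + 1/2), and for both
    F(tau + 1/2) / F(tau) is th4^2 / th3^2: for [L1] this follows by eliminating [C0]. *)
Lemma L1_th tau : (0 < Im tau)%R -> 2 * L1 tau = th3 tau * th3 tau.
Proof.
  intros H. transitivity (2 * L1 tau * 1); [ring|]. transitivity (1 * (th3 tau * th3 tau)); [|ring].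
  apply (ratio_const (fun t => 2 * L1 t) (fun t => th3 t * th3 t) 1 1); auto.
  - apply (lim_ioo_ext (fun t => 1 + 4 * Lam (fun n => IZR (chi4 n)) t)).
    + intros t Ht. rewrite L1_lam by auto. field; auto.
    + replace (RtoC 1) with (1 + 4 * 0) at 1 by ring. apply flim_plus; [apply flim_const|].
      apply flim_mult; [apply flim_const|]. apply lim_lam, cubic_chi4.
  - replace (RtoC 1) with (1 * 1) by ring. apply flim_mult; apply lim_th3.
  - intros t Ht. apply Cmult_neq_0; now apply th3_nz.
  - intros t Ht. cbv beta. rewrite <- L1_dbl by auto.
    assert (E : L1 (t + 1 / 2) * (th3 t * th3 t) = L1 t * (th4 t * th4 t)).
    { transitivity (th3 t * (th3 t * L1 (t + 1 / 2))); [ring|]. rewrite Kron1' by auto.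
      transitivity (th4 t * (th4 t * L1 t)); [|ring]. rewrite Kron1 by auto. ring. }
    transitivity (L1 t * (th3 t * th3 t) + L1 (t + 1 / 2) * (th3 t * th3 t)); [ring|].
    rewrite E, th3_sq, th4_sq by auto. ring.
Qed.

(** Ramanujan's psi(q), the sum of q^T over the triangular numbers T: as n runs through Z, n (2 n -
    1) takes each of them once. *)
Definition psi (tau : C) : C := csum (fun n : Z => e (IZR (n * (2 * n - 1)) * tau)).

Lemma abs_sum_psi tau : (0 < Im tau)%R -> abs_sum (fun n : Z => e (IZR (n * (2 * n - 1)) * tau)).
Proof.
  intros H. eapply abs_sum_ext; [|apply (abs_sum_quad (2 * tau) (- tau) 0); impos].
  intros n; cbv beta. f_equal. push. ring.
Qed.

Lemma has_psi tau : (0 < Im tau)%R -> has_sum (fun n : Z => e (IZR (n * (2 * n - 1)) * tau)) (psi tau).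
Proof. intros H. now apply abs_sum_has, abs_sum_psi. Qed.

Lemma psi_1 tau : (0 < Im tau)%R -> psi (tau + 1) = psi tau.
Proof.
  intros H. apply csum_eq. eapply has_sum_ext; [|apply (has_psi tau H)].
  intros n; cbv beta. symmetry. apply e_shift_eq with (n * (2 * n - 1))%Z. push. ring.
Qed.

Lemma sgn_odd_square n : sgn (n * (2 * n - 1)) = sgn n.
Proof.
  replace (n * (2 * n - 1))%Z with (2 * (n * n) + - n)%Z by ring.
  rewrite sgn_add, sgn_opp, sgn_even. ring.
Qed.

Lemma psi_half_term tau n : e (IZR (n * (2 * n - 1)) * (tau + 1 / 2)) = sgn n * e (IZR (n * (2 * n - 1)) * tau).
Proof.
  rewrite <- (sgn_odd_square n), <- e_half_Z, <- e_add. f_equal. push. field; auto.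
Qed.

(** (n + 1/2)^2 / 2 = 1/8 + n (n + 1) / 2, and the even n as well as the odd n run once through the
    triangular numbers. *)
Lemma th2_psi tau : (0 < Im tau)%R -> th2 (tau / 2) = 2 * e (tau / 8) * psi tau.
Proof.
  intros H. apply csum_eq.
  replace (2 * e (tau / 8) * psi tau) with (e (tau / 8) * psi tau + e (tau / 8) * psi tau) by ring.
  apply has_sum_parity.
  - apply (has_sum_bij (fun k : Z => - k)%Z (fun k : Z => - k)%Z); [intros; lia|intros; lia|].
    eapply has_sum_ext; [|apply (has_sum_scal (e (tau / 8)) _ _ (has_psi tau H))].
    intros k; cbv beta. rewrite <- e_add. f_equal. push. field; repeat split; auto.
  - apply (has_sum_bij (fun k : Z => k - 1)%Z (fun k : Z => k + 1)%Z); [intros; lia|intros; lia|].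
    eapply has_sum_ext; [|apply (has_sum_scal (e (tau / 8)) _ _ (has_psi tau H))].
    intros k; cbv beta. rewrite <- e_add. f_equal. push. field; repeat split; auto.
Qed.

Lemma psi_sq tau : (0 < Im tau)%R -> 2 * e (tau / 4) * (psi tau * psi tau) = th2 tau * th3 tau.
Proof.
  intros H. pose proof (th2_sq (tau / 2) ltac:(now apply Im_half_scal)) as E.
  replace (2 * (tau / 2)) with tau in E by (field; auto).
  rewrite th2_psi in E by auto.
  replace (tau / 4) with (tau / 8 + tau / 8) by (field; auto). rewrite e_add.
  replace (th2 tau * th3 tau) with (2 * th2 tau * th3 tau / 2) by (field; auto).
  rewrite <- E. field; auto.
Qed.

Lemma psi_sq' tau : (0 < Im tau)%R ->
  2 * e (tau / 4) * (psi (tau + 1 / 2) * psi (tau + 1 / 2)) = th2 tau * th4 tau.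
Proof.
  intros H. pose proof (psi_sq (tau + 1 / 2) ltac:(impos)) as E.
  rewrite th2_half in E by auto. fold (th4 tau) in E.
  replace ((tau + 1 / 2) / 4) with (1 / 8 + tau / 4) in E by (field; auto).
  rewrite e_add in E. pose proof (e_nz (1 / 8)).
  replace (th2 tau * th4 tau) with (e (1 / 8) * th2 tau * th4 tau / e (1 / 8)) by (field; auto).
  rewrite <- E. field; auto.
Qed.

(** With q^4 in place of q and x = q, the exponent 2 n (n - 1) + n is n (2 n - 1). *)
Lemma Kron2 tau : (0 < Im tau)%R -> psi (tau + 1 / 2) * L2 tau = C0 (4 * tau) * psi tau.
Proof.
  intros H. pose proof (kronecker_identity (4 * tau) tau) as K. rewrite Im_scal4 in K.
  specialize (K ltac:(lra)). fold (L2 tau) in K. fold (C0 (4 * tau)) in K.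
  replace (csum (phi_term (4 * tau) tau)) with (psi tau) in K.
  2: { symmetry. apply csum_eq. eapply has_sum_ext; [|apply (has_psi tau H)].
       intros n. unfold phi_term. f_equal. push. field; auto. }
  rewrite <- K. f_equal. symmetry. apply csum_eq.
  eapply has_sum_ext; [|apply (has_psi (tau + 1 / 2) ltac:(impos))].
  intros n; cbv beta. rewrite psi_half_term. unfold phi_term. do 2 f_equal. push. field; auto.
Qed.

Lemma Kron2' tau : (0 < Im tau)%R -> psi tau * L2 (tau + 1 / 2) = C0 (4 * tau) * psi (tau + 1 / 2).
Proof.
  intros H. pose proof (Kron2 (tau + 1 / 2) ltac:(impos)) as K.
  replace (tau + 1 / 2 + 1 / 2) with (tau + 1) in K by (field; auto).
  rewrite psi_1 in K by auto. rewrite K. f_equal.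
  replace (4 * (tau + 1 / 2)) with (4 * tau + 1 + 1) by (field; auto).
  rewrite !C0_1; auto; impos.
Qed.

Lemma L2_ratio tau : (0 < Im tau)%R -> L2 (tau + 1 / 2) * th3 tau = L2 tau * th4 tau.
Proof.
  intros H. set (x := 2 * e (tau / 4)).
  pose proof (th2_nz tau H) as N.
  assert (E : L2 (tau + 1 / 2) * (th2 tau * th3 tau) = L2 tau * (th2 tau * th4 tau)).
  { rewrite <- psi_sq, <- psi_sq' by auto. fold x.
    transitivity (x * psi tau * (psi tau * L2 (tau + 1 / 2))); [ring|]. rewrite Kron2' by auto.
    transitivity (x * psi (tau + 1 / 2) * (psi (tau + 1 / 2) * L2 tau)); [|ring]. rewrite Kron2 by auto. ring. }
  replace (L2 (tau + 1 / 2) * th3 tau) with (L2 (tau + 1 / 2) * (th2 tau * th3 tau) / th2 tau) by (field; auto).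
  rewrite E. field; auto.
Qed.

Lemma th34_plus tau : (0 < Im tau)%R -> th3 tau + th4 tau = 2 * th3 (4 * tau).
Proof.
  intros H. unfold th4. rewrite (th3_quad (tau + 1 / 2)) by impos.
  replace (4 * (tau + 1 / 2)) with (4 * tau + 1 + 1) by (field; auto).
  rewrite !th3_1, !th2_1 by impos. rewrite (th3_quad tau) by auto.
  replace (Ci * (Ci * th2 (4 * tau))) with (Ci * Ci * th2 (4 * tau)) by ring.
  replace (Ci * Ci) with (- (1)); [ring|]. unfold Ci, Cmult, Copp, RtoC; cbn [fst snd]. f_equal; ring.
Qed.

(** As for [L1_th]: by [L2_ratio] the quotient of [L2] at tau + 1/2 and at tau is th4 / th3, and th3
    + th4 = 2 th3(4 tau) supplies the doubling. *)
Lemma L2_th tau : (0 < Im tau)%R -> 2 * L2 tau = th3 tau * th3 (2 * tau).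
Proof.
  intros H. transitivity (2 * L2 tau * 1); [ring|]. transitivity (1 * (th3 tau * th3 (2 * tau))); [|ring].
  apply (ratio_const (fun t => 2 * L2 t) (fun t => th3 t * th3 (2 * t)) 1 1); auto.
  - apply (lim_ioo_ext (fun t => 1 + 2 * Lam (fun n => IZR (chi8 n)) t)).
    + intros t Ht. rewrite L2_lam by auto. field; auto.
    + replace (RtoC 1) with (1 + 2 * 0) at 1 by ring. apply flim_plus; [apply flim_const|].
      apply flim_mult; [apply flim_const|]. apply lim_lam, cubic_chi8.
  - replace (RtoC 1) with (1 * 1) by ring. apply flim_mult; [apply lim_th3|].
    apply (lim_ioo_scal2 th3), lim_th3.
  - intros t Ht. apply Cmult_neq_0; apply th3_nz; impos.
  - intros t Ht. cbv beta. rewrite <- L2_dbl by auto.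
    transitivity ((L2 t * th3 t + L2 (t + 1 / 2) * th3 t) * th3 (2 * t)); [ring|].
    rewrite L2_ratio by auto.
    transitivity (L2 t * (th3 t + th4 t) * th3 (2 * t)); [ring|].
    rewrite th34_plus by auto.
    replace (2 * (2 * t)) with (4 * t) by ring. ring.
Qed.

(** * Liouville's identity *)

Section Liouville.

Variable x : C.
Hypothesis Hx : (Cmod x < 1)%R.

(** U i and W k are of the shape 1 / (y^(-1) - y), a hyperbolic cosecant up to a constant, while V i
    is a hyperbolic cotangent up to affine change. This is why products of two U have simple partial
    fractions. *)
Let U (i : nat) : C := x ^ (2 * i + 1) / (1 - x ^ (2 * i + 1) * x ^ (2 * i + 1)).
Let V (i : nat) : C := x ^ (2 * i + 1) * x ^ (2 * i + 1) / (1 - x ^ (2 * i + 1) * x ^ (2 * i + 1)).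
Let W (k : nat) : C := x ^ (2 * k) / (1 - x ^ (2 * k) * x ^ (2 * k)).

Lemma one_minus_nz (y : C) : (Cmod y < 1)%R -> 1 - y * y <> 0.
Proof.
  intros H E. assert (K : y * y = 1) by (replace (y * y) with (1 - (1 - y * y)) by ring; rewrite E; ring).
  apply (f_equal Cmod) in K. rewrite Cmod_mult, Cmod_1 in K. pose proof (Cmod_ge_0 y). nra.
Qed.

Lemma inv_one_minus_le (y : C) r : (Cmod y <= r)%R -> (r < 1)%R -> (Cmod (/ (1 - y * y)) <= / (1 - r))%R.
Proof.
  intros H H1. pose proof (Cmod_ge_0 y).
  rewrite Cmod_inv by (apply one_minus_nz; lra).
  apply Rinv_le_contravar; [lra|].
  pose proof (Cmod_1_plus (- (y * y))) as K. rewrite Cmod_opp, Cmod_mult in K.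
  unfold Cminus. nra.
Qed.

Lemma pow_lt1 n : (0 < n)%nat -> (Cmod (x ^ n) <= Cmod x)%R.
Proof.
  intros H. rewrite Cmod_pow. rewrite <- (pow_1 (Cmod x)) at 2. apply pow_decr; [|lia].
  pose proof (Cmod_ge_0 x). lra.
Qed.

Lemma frac_le (y : C) : (Cmod y <= Cmod x)%R -> (Cmod (y / (1 - y * y)) <= Cmod y * / (1 - Cmod x))%R.
Proof.
  intros H. unfold Cdiv. rewrite Cmod_mult. apply Rmult_le_compat_l; [apply Cmod_ge_0|].
  apply inv_one_minus_le; lra.
Qed.

Let rho : R := (/ (1 - Cmod x))%R.

Lemma rho_pos : (0 < rho)%R.
Proof. apply Rinv_0_lt_compat. lra. Qed.

Lemma U_le i : (Cmod (U i) <= rho * Cmod x ^ i)%R.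
Proof.
  eapply Rle_trans; [apply frac_le, pow_lt1; lia|]. rewrite Rmult_comm. fold rho.
  apply Rmult_le_compat_l; [left; apply rho_pos|]. rewrite Cmod_pow.
  pose proof (Cmod_ge_0 x). apply pow_decr; [lra|lia].
Qed.

Lemma sum_le_U2 : exists M, sum_le (fun i => INR (S i) ^ 2 * Cmod (U i))%R M.
Proof.
  pose proof (Cmod_ge_0 x). destruct (sum_le_cubic_geom (Cmod x)) as [M HM]; [lra|].
  exists (rho * M)%R. eapply sum_le_mono; [|apply sum_le_scal; [left; apply rho_pos|exact HM]].
  intros i; cbv beta. pose proof (U_le i) as K.
  assert (A : (1 <= INR (S i))%R) by (rewrite S_INR; pose proof (pos_INR i); lra).
  assert (B : (0 <= INR (S i) ^ 2)%R) by (apply pow_le; lra).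
  apply Rle_trans with (INR (S i) ^ 2 * (rho * Cmod x ^ i))%R.
  - now apply Rmult_le_compat_l.
  - replace (rho * (INR (S i) ^ 3 * Cmod x ^ i))%R with (INR (S i) * (INR (S i) ^ 2 * (rho * Cmod x ^ i)))%R by ring.
    rewrite <- (Rmult_1_l (INR (S i) ^ 2 * (rho * Cmod x ^ i))) at 1.
    apply Rmult_le_compat_r; auto. apply Rmult_le_pos; auto.
    apply Rmult_le_pos; [left; apply rho_pos|apply pow_le; lra].
Qed.

Variable G : nat -> C.
Variable K : R.
Hypothesis HK : (0 <= K)%R.
Hypothesis HG : forall n, (Cmod (G n) <= K * INR (S n) ^ 2)%R.

(** The condition on [h] lets a weight of quadratic growth be dominated by (i + 1)^2 (j + 1)^2,
    which separates the variables. It holds for |i - j| and for i + j + 1. *)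
Lemma abs_sum_GUU (h : nat * nat -> nat) : (forall i j, (S (h (i, j)) <= 2 * (S i * S j))%nat) ->
  abs_sum (fun p : nat * nat => G (h p) * (U (fst p) * U (snd p))).
Proof.
  intros Hh. destruct sum_le_U2 as [M HM].
  exists (4 * K * (M * M))%R.
  assert (P : sum_le (fun p : nat * nat => INR (S (fst p)) ^ 2 * Cmod (U (fst p)) * (INR (S (snd p)) ^ 2 * Cmod (U (snd p))))%R (M * M)%R).
  { apply (sum_le_mult (fun i => INR (S i) ^ 2 * Cmod (U i))%R (fun i => INR (S i) ^ 2 * Cmod (U i))%R); auto.
    - intros; apply Rmult_le_pos; [apply pow_le, pos_INR|apply Cmod_ge_0].
    - intros; apply Rmult_le_pos; [apply pow_le, pos_INR|apply Cmod_ge_0].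
    - now apply sum_le_ge0 in HM. }
  eapply sum_le_mono; [|apply sum_le_scal; [|exact P]].
  - intros [i j]; cbn [fst snd]; cbv beta. rewrite !Cmod_mult.
    replace (4 * K * (INR (S i) ^ 2 * Cmod (U i) * (INR (S j) ^ 2 * Cmod (U j))))%R
      with (K * (2 * (INR (S i) * INR (S j))) ^ 2 * (Cmod (U i) * Cmod (U j)))%R by ring.
    apply Rmult_le_compat_r; [apply Rmult_le_pos; apply Cmod_ge_0|].
    eapply Rle_trans; [apply HG|]. apply Rmult_le_compat_l; auto.
    apply pow_incr. split; [apply pos_INR|].
    rewrite <- mult_INR. change 2%R with (INR 2). rewrite <- mult_INR. apply le_INR. apply Hh.
  - lra.
Qed.

Lemma V_abs : abs_sum V.
Proof.
  pose proof (Cmod_ge_0 x). apply abs_sum_le_R with (fun i => rho * Cmod x ^ i)%R (rho * / (1 - Cmod x))%R.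
  - intros i. apply Rle_trans with (Cmod (x ^ (2 * i + 1)) * Cmod (U i))%R.
    + right. rewrite <- Cmod_mult. f_equal. unfold V, U. unfold Cdiv. ring.
    + pose proof (U_le i). pose proof (pow_lt1 (2 * i + 1) ltac:(lia)). pose proof (Cmod_ge_0 (U i)).
      assert (Cmod (x ^ (2 * i + 1)) * Cmod (U i) <= 1 * Cmod (U i))%R by (apply Rmult_le_compat_r; lra). lra.
  - apply sum_le_scal; [left; apply rho_pos|]. apply sum_le_geom. lra.
Qed.

Lemma has_sum_shift (f : nat -> C) s k : has_sum f s ->
  has_sum (fun j => f (j + k)%nat) (s - lsum f (seq 0 k)).
Proof.
  intros H. induction k as [|k IH].
  - simpl. replace (s - 0) with s by ring. eapply has_sum_ext; [|exact H]. intros j; simpl. f_equal. lia.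
  - rewrite seq_S, lsum_app. simpl.
    apply (has_sum_ext (fun j => f (S j + k)%nat)); [intros j; f_equal; lia|].
    apply (has_sum_nat_S (fun j => f (j + k)%nat)).
    replace (f (0 + k)%nat + (s - (lsum f (seq 0 k) + (f k + 0)))) with (s - lsum f (seq 0 k)) by (simpl; ring).
    exact IH.
Qed.

Let Sk (k : nat) : C := lsum V (seq 0 k).

Lemma x_lt1 n : (0 < n)%nat -> (Cmod (x ^ n) < 1)%R.
Proof. intros H. pose proof (pow_lt1 n H). lra. Qed.

(* Partial fractions: the products U_i U_j telescope along fixed differences and along fixed sums. *)
Lemma UU_diff j k : U (j + S k) * U j = W (S k) * (V j - V (j + S k)).
Proof.
  unfold U, V, W.
  replace (x ^ (2 * (j + S k) + 1)) with (x ^ (2 * j + 1) * x ^ (2 * S k)) by (rewrite <- Cpow_add_r; f_equal; lia).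
  assert (N3 : (Cmod (x ^ (2 * j + 1) * x ^ (2 * S k)) < 1)%R).
  { rewrite <- Cpow_add_r. apply x_lt1. lia. }
  pose proof (one_minus_nz _ (x_lt1 (2 * j + 1) ltac:(lia))) as N1.
  pose proof (one_minus_nz _ (x_lt1 (2 * S k) ltac:(lia))) as N2.
  apply one_minus_nz in N3.
  set (X := x ^ (2 * j + 1)) in *. set (Z := x ^ (2 * S k)) in *. clearbody X Z. field. auto.
Qed.

Lemma UU_sum j k : (j <= k)%nat -> U (k - j) * U j = W (S k) * (V (k - j) + V j + 1).
Proof.
  intros H. unfold U, V, W.
  replace (x ^ (2 * S k)) with (x ^ (2 * (k - j) + 1) * x ^ (2 * j + 1)) by (rewrite <- Cpow_add_r; f_equal; lia).
  assert (N3 : (Cmod (x ^ (2 * (k - j) + 1) * x ^ (2 * j + 1)) < 1)%R).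
  { rewrite <- Cpow_add_r. apply x_lt1. lia. }
  pose proof (one_minus_nz _ (x_lt1 (2 * j + 1) ltac:(lia))) as N1.
  pose proof (one_minus_nz _ (x_lt1 (2 * (k - j) + 1) ltac:(lia))) as N2.
  apply one_minus_nz in N3.
  set (X := x ^ (2 * j + 1)) in *. set (Z := x ^ (2 * (k - j) + 1)) in *. clearbody X Z. field. auto.
Qed.

Let dist (p : nat * nat) : nat := (fst p - snd p + (snd p - fst p))%nat.

Let T : C := csum (fun p : nat * nat => G (dist p) * (U (fst p) * U (snd p))).
Let T' : C := csum (fun p : nat * nat => G (S (fst p + snd p)) * (U (fst p) * U (snd p))).
Let D : C := csum (fun i => U i * U i).

Lemma abs_T : abs_sum (fun p : nat * nat => G (dist p) * (U (fst p) * U (snd p))).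
Proof. apply abs_sum_GUU. intros i j. unfold dist; cbn [fst snd]. nia. Qed.

Lemma abs_T' : abs_sum (fun p : nat * nat => G (S (fst p + snd p)) * (U (fst p) * U (snd p))).
Proof. apply (abs_sum_GUU (fun p => S (fst p + snd p))). intros i j. cbn [fst snd]. nia. Qed.

Definition pair_split (y : nat + (nat * nat + nat * nat)) : nat * nat :=
  match y with
  | inl i => (i, i)
  | inr (inl (k, j)) => (j + S k, j)%nat
  | inr (inr (k, j)) => (j, j + S k)%nat
  end.
Definition pair_join (p : nat * nat) : nat + (nat * nat + nat * nat) :=
  let (i, j) := p in
  match Nat.compare i j with
  | Eq => inl i
  | Gt => inr (inl (i - j - 1, j)%nat)
  | Lt => inr (inr (j - i - 1, i)%nat)
  end.

Lemma pair_split_K y : pair_join (pair_split y) = y.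
Proof.
  destruct y as [i|[[k j]|[k j]]]; unfold pair_join, pair_split.
  - now rewrite Nat.compare_refl.
  - destruct (Nat.compare_spec (j + S k) j); try lia. do 3 f_equal. lia.
  - destruct (Nat.compare_spec j (j + S k)); try lia. do 3 f_equal. lia.
Qed.

Lemma pair_join_K p : pair_split (pair_join p) = p.
Proof.
  destruct p as [i j]; unfold pair_join.
  destruct (Nat.compare_spec i j); unfold pair_split; f_equal; lia.
Qed.

Lemma abs_U2 : abs_sum (fun i => U i * U i).
Proof.
  pose proof (Cmod_ge_0 x). apply abs_sum_le_R with (fun i => rho * rho * Cmod x ^ i)%R (rho * rho * / (1 - Cmod x))%R.
  - intros i. rewrite Cmod_mult. pose proof (U_le i). pose proof (Cmod_ge_0 (U i)). pose proof rho_pos.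
    assert (0 <= Cmod x ^ i <= 1)%R.
    { split; [apply pow_le; lra|]. rewrite <- (pow1 i). apply pow_incr. lra. }
    apply Rle_trans with (rho * (rho * Cmod x ^ i))%R; [|lra].
    apply Rmult_le_compat; auto. nra.
  - apply sum_le_scal; [pose proof rho_pos; nra|]. apply sum_le_geom. lra.
Qed.

(** The diagonal is set apart and the two triangles are equal. At fixed difference k the sum of V_j
    - V_(j+k) telescopes to the first k values of V. *)
Lemma T_split : exists X, T = G 0 * D + (X + X) /\
  has_sum (fun k => G (S k) * W (S k) * Sk (S k)) X.
Proof.
  set (f := fun p : nat * nat => G (dist p) * (U (fst p) * U (snd p))).
  set (lo := fun p : nat * nat => G (S (fst p)) * (U (snd p + S (fst p)) * U (snd p))).
  assert (Alo : abs_sum lo).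
  { eapply abs_sum_ext; [|apply (abs_sum_inj (fun p : nat * nat => (snd p + S (fst p), snd p)%nat) f); [|apply abs_T]].
    - intros [k j]. unfold f, lo, dist; cbn [fst snd]. replace (j + S k - j + (j - (j + S k)))%nat with (S k) by lia. auto.
    - intros [k j] [k' j'] E; cbn [fst snd] in E. inversion E. f_equal; lia. }
  exists (csum lo). split.
  - unfold T. fold f. apply csum_eq. apply (has_sum_bij pair_split pair_join).
    + apply pair_split_K.
    + apply pair_join_K.
    + apply has_sum_sum; [|apply has_sum_sum].
      * eapply has_sum_ext; [|apply (has_sum_scal (G 0) _ _ (abs_sum_has _ abs_U2))].
        intros i. unfold f, dist; cbn [pair_split fst snd]. now rewrite Nat.sub_diag.
      * eapply has_sum_ext; [|apply (abs_sum_has _ Alo)].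
        intros [k j]. unfold f, lo, dist; cbn [pair_split fst snd].
        replace (j + S k - j + (j - (j + S k)))%nat with (S k) by lia. auto.
      * eapply has_sum_ext; [|apply (abs_sum_has _ Alo)].
        intros [k j]. unfold f, lo, dist; cbn [pair_split fst snd].
        replace (j - (j + S k) + (j + S k - j))%nat with (S k) by lia. ring.
  - apply (has_sum_rows _ _ _ (abs_sum_has _ Alo)). intros k.
    pose proof (abs_sum_has _ V_abs) as HV.
    pose proof (has_sum_minus _ _ _ _ HV (has_sum_shift _ _ (S k) HV)) as HD.
    replace (csum V - (csum V - lsum V (seq 0 (S k)))) with (Sk (S k)) in HD by (unfold Sk; ring).
    eapply has_sum_ext; [|apply (has_sum_scal (G (S k) * W (S k)) _ _ HD)].
    intros j; unfold lo; cbn [fst snd]. rewrite UU_diff. ring.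
Qed.

Lemma lsum_rev_seq (f : nat -> C) k : lsum (fun j => f (k - j)%nat) (seq 0 (S k)) = lsum f (seq 0 (S k)).
Proof.
  rewrite <- (lsum_map (fun j => (k - j)%nat) f). apply lsum_perm, NoDup_Permutation.
  - apply NoDup_map_NoDup_ForallPairs; [|apply seq_NoDup].
    intros a b Ha Hb E. apply in_seq in Ha, Hb. lia.
  - apply seq_NoDup.
  - intros y. rewrite in_map_iff. setoid_rewrite in_seq. split.
    + intros (a & <- & Ha). lia.
    + intros Hy. exists (k - y)%nat. lia.
Qed.

Lemma lsum_const1 {I} (l : list I) : lsum (fun _ => RtoC 1) l = INR (length l).
Proof. induction l as [|a l IH]; [reflexivity|]. cbn [lsum fold_right length]. fold (lsum (fun _ : I => RtoC 1) l). rewrite IH, S_INR, RtoC_plus. ring. Qed.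

(** At fixed i + j = k there are k + 1 pairs. [UU_sum] yields each of the first k + 1 values of V
    twice, plus 1 for each pair. *)
Lemma T'_rows : has_sum (fun k => G (S k) * W (S k) * (Sk (S k) + Sk (S k) + INR (S k))) T'.
Proof.
  (* Pairs (i, j) are reindexed by (i + j, j), with 0 where the second entry exceeds the first. *)
  set (g := fun p : nat * nat => if Nat.leb (snd p) (fst p) then G (S (fst p)) * (U (fst p - snd p) * U (snd p)) else 0).
  assert (Hg : has_sum g T').
  { apply (has_sum_inj (fun p : nat * nat => (fst p + snd p, snd p)%nat)).
    - intros [a b] [c d] E; cbn [fst snd] in E. inversion E. f_equal; lia.
    - intros [k j] N. unfold g; cbn [fst snd]. destruct (Nat.leb_spec j k); auto.
      exfalso. apply (N (k - j, j)%nat). cbn [fst snd]. f_equal. lia.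
    - eapply has_sum_ext; [|apply (abs_sum_has _ abs_T')]. intros [i j]; unfold g; cbn [fst snd].
      destruct (Nat.leb_spec j (i + j)); [|lia]. now replace (i + j - j)%nat with i by lia. }
  apply (has_sum_rows _ _ _ Hg). intros k.
  replace (G (S k) * W (S k) * (Sk (S k) + Sk (S k) + INR (S k)))
    with (lsum (fun j => g (k, j)) (seq 0 (S k))).
  - apply has_sum_finite; [apply seq_NoDup|]. intros j Hj. unfold g; cbn [fst snd].
    destruct (Nat.leb_spec j k); auto. exfalso. apply Hj, in_seq. lia.
  - rewrite (lsum_ext _ (fun j => G (S k) * W (S k) * ((V (k - j) + V j) + 1))).
    + rewrite lsum_scal, lsum_plus, lsum_plus, lsum_rev_seq, lsum_const1, length_seq. reflexivity.
    + intros j Hj. apply in_seq in Hj. unfold g; cbn [fst snd]. destruct (Nat.leb_spec j k); [|lia].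
      rewrite UU_sum by lia. ring.
Qed.

(** In T' - T the partial sums of V cancel, and only the number of pairs remains as a factor k. The
    diagonal of T is compensated by the last summand. *)
Lemma liouville_G : has_sum (fun k => G (S k) * (INR (S k) * W (S k))) (T' - T + G 0 * D).
Proof.
  destruct T_split as (X & E & HX).
  replace (T' - T + G 0 * D) with (T' - (X + X)) by (rewrite E; ring).
  eapply has_sum_ext; [|apply (has_sum_minus _ _ _ _ T'_rows (has_sum_plus _ _ _ _ HX HX))].
  intros k; cbv beta. ring.
Qed.

End Liouville.

Definition Uq (x : C) (i : nat) : C := x ^ (2 * i + 1) / (1 - x ^ (2 * i + 1) * x ^ (2 * i + 1)).
Definition Wq (x : C) (k : nat) : C := x ^ (2 * k) / (1 - x ^ (2 * k) * x ^ (2 * k)).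

Definition msgn (i : nat) : C := if Nat.even i then 1 else - (1).

Lemma abs_sum_Uq_lin (x : C) (g : nat -> C) : (Cmod x < 1)%R -> (forall i, Cmod (g i) <= INR (S i) ^ 3 * 2)%R ->
  abs_sum (fun i => g i * Uq x i).
Proof.
  intros Hx Hg. pose proof (Cmod_ge_0 x). destruct (sum_le_cubic_geom (Cmod x)) as [M HM]; [lra|].
  assert (Hr : (0 < / (1 - Cmod x))%R) by (apply Rinv_0_lt_compat; lra).
  exists (2 * / (1 - Cmod x) * M)%R.
  eapply sum_le_mono; [|apply sum_le_scal; [|exact HM]]; [|lra].
  intros i; cbv beta. rewrite Cmod_mult. pose proof (U_le x Hx i) as K. fold (Uq x i) in K.
  apply Rle_trans with (INR (S i) ^ 3 * 2 * (/ (1 - Cmod x) * Cmod x ^ i))%R; [|lra].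
  apply Rmult_le_compat; auto; apply Cmod_ge_0.
Qed.

Lemma dist_even i j : Nat.even (i - j + (j - i)) = Nat.even (i + j).
Proof.
  destruct (Nat.le_ge_cases i j).
  - replace (i + j)%nat with (i - j + (j - i) + 2 * i)%nat by lia.
    rewrite (Nat.even_add (i - j + (j - i))), Nat.even_mul. simpl. now destruct (Nat.even (i - j + (j - i))).
  - replace (i + j)%nat with (i - j + (j - i) + 2 * j)%nat by lia.
    rewrite (Nat.even_add (i - j + (j - i))), Nat.even_mul. simpl. now destruct (Nat.even (i - j + (j - i))).
Qed.

Lemma Rle_sq1 n : (1 <= INR (S n) ^ 2)%R.
Proof. rewrite S_INR. pose proof (pos_INR n). nra. Qed.

(** For G the indicator of the even numbers, G(|i - j|) - G(i + j + 1) = (-1)^(i + j), so T - T' is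
    a square. With G = 1 the sums T and T' cancel; subtracting the two instances removes the
    diagonal and keeps odd k. *)
Lemma liouville_even (x : C) R : (Cmod x < 1)%R ->
  has_sum (fun i => msgn i * Uq x i) R ->
  has_sum (fun i => INR (2 * i + 1) * Wq x (2 * i + 1)) (R * R).
Proof.
  intros Hx HR.
  set (G := fun n => if Nat.even n then RtoC 1 else 0).
  assert (HG : forall n, (Cmod (G n) <= 1 * INR (S n) ^ 2)%R).
  { intros n. pose proof (Rle_sq1 n). unfold G. destruct (Nat.even n); rewrite ?Cmod_1, ?Cmod_0; lra. }
  assert (HG1 : forall n, (Cmod ((fun _ => RtoC 1) n) <= 1 * INR (S n) ^ 2)%R).
  { intros n. pose proof (Rle_sq1 n). rewrite Cmod_1. lra. }
  pose proof (liouville_G x Hx G 1 ltac:(lra) HG) as L.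
  pose proof (liouville_G x Hx (fun _ => 1) 1 ltac:(lra) HG1) as L1.
  pose proof (abs_sum_has _ (abs_T x Hx G 1 ltac:(lra) HG)) as HT.
  pose proof (abs_sum_has _ (abs_T' x Hx G 1 ltac:(lra) HG)) as HT'.
  set (T := csum (fun p : nat * nat => G (fst p - snd p + (snd p - fst p))%nat * _)) in *.
  set (T' := csum (fun p : nat * nat => G (S (fst p + snd p)) * _)) in *.
  set (D := csum (fun i : nat => _ * _)) in *.
  assert (E : T - T' = R * R).
  { refine (has_sum_unique _ _ _ (has_sum_minus _ _ _ _ HT HT') _).
    assert (A : abs_sum (fun i => msgn i * Uq x i)).
    { apply abs_sum_Uq_lin; auto. intros i. unfold msgn.
      assert (1 <= INR (S i) ^ 3)%R.
      { rewrite <- (pow1 3) at 1. apply pow_incr. rewrite S_INR. pose proof (pos_INR i). lra. }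
      destruct (Nat.even i); rewrite ?Cmod_opp, ?Cmod_1; lra. }
    eapply has_sum_ext; [|apply (has_sum_mult _ _ _ _ A A HR HR)].
    intros [i j]; cbn [fst snd]. change (x ^ (2 * i + 1) / (1 - x ^ (2 * i + 1) * x ^ (2 * i + 1))) with (Uq x i).
    change (x ^ (2 * j + 1) / (1 - x ^ (2 * j + 1) * x ^ (2 * j + 1))) with (Uq x j).
    unfold G, msgn. rewrite dist_even, Nat.even_succ, <- Nat.negb_even, Nat.even_add.
    destruct (Nat.even i), (Nat.even j); simpl; ring. }
  cbv beta in L1.
  pose proof (has_sum_minus _ _ _ _ L1 L) as L2. cbv beta in L2.
  match type of L2 with has_sum _ ?s => replace s with (R * R) in L2 end.
  2: { rewrite <- E. unfold G at 1. cbn [Nat.even]. ring. }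
  apply (has_sum_inj (fun i => 2 * i)%nat) in L2.
  - eapply has_sum_ext; [|exact L2]. intros i; cbv beta. replace (S (2 * i)) with (2 * i + 1)%nat by lia.
    replace (G (2 * i + 1)%nat) with (RtoC 0) by (unfold G; now rewrite Nat.even_add, Nat.even_mul).
    unfold Wq. ring.
  - intros a b E2; lia.
  - intros i Hi. unfold G. rewrite Nat.even_succ, <- Nat.negb_even.
    destruct (Nat.even i) eqn:Ev; simpl; [|ring].
    exfalso. apply Nat.even_spec in Ev. destruct Ev as [m Hm]. apply (Hi m). auto.
Qed.

(** For G(n) = n^2 the weight (i + j + 1)^2 - (i - j)^2 = (2 i + 1) (2 j + 1) separates, and G(0) =
    0 removes the diagonal. *)
Lemma liouville_square (x : C) R : (Cmod x < 1)%R ->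
  has_sum (fun i => INR (2 * i + 1) * Uq x i) R ->
  has_sum (fun k => INR (S k) * INR (S k) * INR (S k) * Wq x (S k)) (R * R).
Proof.
  intros Hx HR.
  set (G := fun n => INR n * INR n : C).
  assert (HG : forall n, (Cmod (G n) <= 1 * INR (S n) ^ 2)%R).
  { intros n. unfold G. rewrite <- RtoC_mult, Cmod_R, Rabs_right; [|pose proof (pos_INR n); nra].
    rewrite S_INR. pose proof (pos_INR n). nra. }
  pose proof (liouville_G x Hx G 1 ltac:(lra) HG) as L.
  pose proof (abs_sum_has _ (abs_T x Hx G 1 ltac:(lra) HG)) as HT.
  pose proof (abs_sum_has _ (abs_T' x Hx G 1 ltac:(lra) HG)) as HT'.
  set (T := csum (fun p : nat * nat => G (fst p - snd p + (snd p - fst p))%nat * _)) in *.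
  set (T' := csum (fun p : nat * nat => G (S (fst p + snd p)) * _)) in *.
  set (D := csum (fun i : nat => _ * _)) in *.
  assert (E : T' - T = R * R).
  { refine (has_sum_unique _ _ _ (has_sum_minus _ _ _ _ HT' HT) _).
    assert (A : abs_sum (fun i => INR (2 * i + 1) * Uq x i)).
    { apply abs_sum_Uq_lin; auto. intros i. rewrite Cmod_R, Rabs_right by (apply Rle_ge, pos_INR).
      rewrite plus_INR, mult_INR, (S_INR i). change (INR 2) with 2%R. change (INR 1) with 1%R.
      pose proof (pos_INR i) as P. set (n := INR i) in *.
      assert (0 <= n * n)%R by nra. assert (0 <= n * n * n)%R by nra.
      replace ((n + 1) ^ 3 * 2)%R with (2 * (n * n * n) + 6 * (n * n) + 6 * n + 2)%R by ring. lra. }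
    eapply has_sum_ext; [|apply (has_sum_mult _ _ _ _ A A HR HR)].
    intros [i j]; cbn [fst snd]. change (x ^ (2 * i + 1) / (1 - x ^ (2 * i + 1) * x ^ (2 * i + 1))) with (Uq x i).
    change (x ^ (2 * j + 1) / (1 - x ^ (2 * j + 1) * x ^ (2 * j + 1))) with (Uq x j).
    unfold G.
    replace (RtoC (INR (i - j + (j - i))) * INR (i - j + (j - i))) with ((INR i - INR j) * (INR i - INR j) : C).
    - rewrite S_INR, !plus_INR, !mult_INR. simpl. rewrite !RtoC_plus, !RtoC_mult, !RtoC_plus. ring.
    - rewrite plus_INR. destruct (Nat.le_ge_cases i j).
      + rewrite (minus_INR j i) by auto. replace (i - j)%nat with 0%nat by lia. simpl.
        rewrite RtoC_plus, RtoC_minus. ring.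
      + rewrite (minus_INR i j) by auto. replace (j - i)%nat with 0%nat by lia. simpl.
        rewrite RtoC_plus, RtoC_minus. ring. }
  rewrite E in L. replace (R * R + G 0%nat * D) with (R * R) in L by (unfold G; simpl; ring).
  eapply has_sum_ext; [|exact L]. intros k. unfold G, Wq. ring.
Qed.

(** * E_{2,2} and E_4 in theta constants *)

Lemma has_sum_geom x : (Cmod x < 1)%R -> has_sum (fun d => x ^ S d) (x / (1 - x)).
Proof.
  intros Hx. set (f := fun d => x ^ S d).
  assert (A : has_sum f (csum f)).
  { apply abs_sum_has. eapply abs_sum_ext; [|apply (abs_sum_bounded_geom (fun _ => 1) x); auto].
    - intros n; unfold f; ring.
    - intros n. rewrite Cmod_1. lra. }
  assert (B : has_sum f (f 0%nat + x * csum f)).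
  { rewrite <- has_sum_nat_S. eapply has_sum_ext; [|apply (has_sum_scal x _ _ A)]. reflexivity. }
  assert (N : 1 - x <> 0) by (apply Cmod_1_plus_nz; now rewrite Cmod_opp).
  pose proof (has_sum_unique _ _ _ A B) as E.
  replace (x / (1 - x)) with (csum f); auto.
  transitivity (csum f * (1 - x) / (1 - x)); [field; auto|].
  f_equal. transitivity (csum f - x * csum f); [ring|]. rewrite E at 1. unfold f. simpl. ring.
Qed.

Lemma lam_has g tau : cubic g -> (0 < Im tau)%R ->
  has_sum (fun d => g (S d) * (e tau ^ S d / (1 - e tau ^ S d))) (Lam g tau).
Proof.
  intros Hg H. apply (has_sum_rows _ _ _ (has_lam g tau Hg H)).
  intros d. apply has_sum_ext with (fun m => g (S d) * ((e tau ^ S d) ^ S m)).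
  - intros m. unfold lam_term; cbn [fst snd]. now rewrite <- Cpow_mult_r, e_pow.
  - apply has_sum_scal, has_sum_geom. apply Cmod_pow_lt1. now apply Cmod_e_lt1.
Qed.

Definition Vq (x : C) (d : nat) : C := x ^ S d / (1 - x ^ S d * x ^ S d).
(** Sum g(d) q^(d m) over all d and odd m; [OO] restricts d to odd values as well. *)
Definition DO (g : nat -> C) (tau : C) : C := csum (fun d => g (S d) * Vq (e tau) d).
Definition OO (g : nat -> C) (tau : C) : C := csum (fun i => g (2 * i + 1)%nat * Uq (e tau) i).

Lemma e_2 tau : e (2 * tau) = e tau * e tau.
Proof. rewrite <- e_add. f_equal. ring. Qed.

Lemma has_DO g tau : cubic g -> (0 < Im tau)%R ->
  has_sum (fun d => g (S d) * Vq (e tau) d) (DO g tau) /\ DO g tau = Lam g tau - Lam g (2 * tau).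
Proof.
  intros Hg H.
  assert (P : has_sum (fun d => g (S d) * Vq (e tau) d) (Lam g tau - Lam g (2 * tau))).
  { eapply has_sum_ext; [|apply (has_sum_minus _ _ _ _ (lam_has g tau Hg H) (lam_has g (2 * tau) Hg ltac:(impos)))].
    intros d; cbv beta. unfold Vq. rewrite e_2, Cpow_mult_l.
    pose proof (Cmod_pow_lt1 _ d (Cmod_e_lt1 tau H)) as X.
    pose proof (one_minus_nz _ X) as N1.
    assert (N2 : 1 - e tau ^ S d <> 0) by (apply Cmod_1_plus_nz; now rewrite Cmod_opp).
    set (y := e tau ^ S d) in *. clearbody y. field. auto. }
  unfold DO. rewrite (csum_eq _ _ P). auto.
Qed.

Definition npar (x : nat + nat) : nat := match x with inl k => (2 * k)%nat | inr k => (2 * k + 1)%nat end.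
Definition npar_inv (n : nat) : nat + nat := if Nat.even n then inl (Nat.div2 n) else inr (Nat.div2 n).

Lemma npar_K x : npar_inv (npar x) = x.
Proof.
  destruct x as [k|k]; unfold npar_inv, npar.
  - rewrite Nat.even_mul. cbn [Nat.even orb]. f_equal. apply Nat.div2_double.
  - rewrite Nat.even_add, Nat.even_mul. cbn [Nat.even orb Bool.eqb]. f_equal.
    rewrite Nat.add_1_r. apply Nat.div2_succ_double.
Qed.

Lemma npar_inv_K n : npar (npar_inv n) = n.
Proof.
  destruct (Nat.Even_or_Odd n) as [[k ->]|[k ->]].
  - change (2 * k)%nat with (npar (inl k)). now rewrite npar_K.
  - change (2 * k + 1)%nat with (npar (inr k)). now rewrite npar_K.
Qed.

Lemma has_sum_parity_nat (f : nat -> C) s t :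
  has_sum (fun k => f (2 * k)%nat) s -> has_sum (fun k => f (2 * k + 1)%nat) t -> has_sum f (s + t).
Proof.
  intros H1 H2. apply (has_sum_bij npar npar_inv).
  - apply npar_K.
  - apply npar_inv_K.
  - apply (has_sum_sum (fun j => f (npar j))); auto.
Qed.

Definition id1 (n : nat) : C := INR n.
Definition id3 (n : nat) : C := INR n * INR n * INR n.

Lemma cubic_id1 : cubic id1.
Proof.
  exists 1%R. split; [lra|]. intros d. unfold id1. rewrite Cmod_R, Rabs_right by (apply Rle_ge, pos_INR).
  rewrite S_INR. pose proof (pos_INR d) as P. set (n := INR d) in *.
  assert (0 <= n * n)%R by nra. assert (0 <= n * n * n)%R by nra.
  replace (1 * (n + 1) ^ 3)%R with (n * n * n + 3 * (n * n) + 3 * n + 1)%R by ring. lra.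
Qed.

Lemma cubic_id3 : cubic id3.
Proof.
  exists 1%R. split; [lra|]. intros d. unfold id3. rewrite <- !RtoC_mult, Cmod_R, Rabs_right.
  - right. ring.
  - pose proof (pos_INR (S d)). apply Rle_ge. repeat apply Rmult_le_pos; auto.
Qed.

Lemma has_OO1 tau : (0 < Im tau)%R -> has_sum (fun i => INR (2 * i + 1) * Uq (e tau) i) (OO id1 tau).
Proof.
  intros H. unfold OO, id1. apply abs_sum_has. apply abs_sum_Uq_lin; [now apply Cmod_e_lt1|].
  intros i. rewrite Cmod_R, Rabs_right by (apply Rle_ge, pos_INR).
  rewrite plus_INR, mult_INR, (S_INR i). change (INR 2) with 2%R. change (INR 1) with 1%R.
  pose proof (pos_INR i) as P. set (n := INR i) in *.
  assert (0 <= n * n)%R by nra. assert (0 <= n * n * n)%R by nra.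
  replace ((n + 1) ^ 3 * 2)%R with (2 * (n * n * n) + 6 * (n * n) + 6 * n + 2)%R by ring. lra.
Qed.

Lemma DO_OO tau : (0 < Im tau)%R -> DO id1 tau = OO id1 tau + 2 * DO id1 (2 * tau).
Proof.
  intros H. destruct (has_DO id1 tau cubic_id1 H) as [P _].
  destruct (has_DO id1 (2 * tau) cubic_id1 ltac:(impos)) as [Q _].
  refine (has_sum_unique _ _ _ P _). apply has_sum_parity_nat.
  - eapply has_sum_ext; [|apply (has_OO1 tau H)]. intros i; cbv beta. unfold id1, Vq, Uq.
    replace (S (2 * i)) with (2 * i + 1)%nat by lia. reflexivity.
  - eapply has_sum_ext; [|apply (has_sum_scal 2 _ _ Q)]. intros i; cbv beta. unfold id1, Vq.
    replace (S (2 * i + 1)) with (2 * S i)%nat by lia.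
    rewrite e_2, mult_INR, RtoC_mult, Cpow_mult_r. change (INR 2) with 2%R.
    replace (e tau ^ 2) with (e tau * e tau) by (simpl; ring). ring.
Qed.

Lemma OO_lam tau : (0 < Im tau)%R ->
  OO id1 tau = Lam id1 tau - 3 * Lam id1 (2 * tau) + 2 * Lam id1 (4 * tau).
Proof.
  intros H. pose proof (DO_OO tau H) as E.
  destruct (has_DO id1 tau cubic_id1 H) as [_ E1].
  destruct (has_DO id1 (2 * tau) cubic_id1 ltac:(impos)) as [_ E2].
  replace (2 * (2 * tau)) with (4 * tau) in E2 by ring.
  replace (OO id1 tau) with (OO id1 tau + 2 * DO id1 (2 * tau) - 2 * DO id1 (2 * tau)) by ring.
  rewrite <- E, E1, E2. ring.
Qed.

(** By [th3_sq] this is th3(tau)^2 - th3(2 tau)^2, and the two-square theorem expresses both terms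
    by Lambert series. *)
Lemma th2_DO tau : (0 < Im tau)%R ->
  th2 (2 * tau) * th2 (2 * tau) = 4 * DO (fun n => IZR (chi4 n)) tau.
Proof.
  intros H. destruct (has_DO _ tau cubic_chi4 H) as [_ ->].
  pose proof (th3_sq tau H) as E. rewrite <- !L1_th, !L1_lam in E by impos.
  replace (th2 (2 * tau) * th2 (2 * tau)) with
   (2 * (1 / 2 + 2 * Lam (fun n : nat => IZR (chi4 n)) (2 * tau)) + th2 (2 * tau) * th2 (2 * tau)
    - 2 * (1 / 2 + 2 * Lam (fun n : nat => IZR (chi4 n)) (2 * tau))) by ring.
  rewrite <- E. field; auto.
Qed.

Lemma chi4_odd i : RtoC (IZR (chi4 (2 * i + 1))) = msgn i.
Proof.
  assert (K : chi4 (2 * i + 1) = if Nat.even i then 1%Z else (-1)%Z).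
  { induction i as [|i IH]; [reflexivity|].
    replace (2 * S i + 1)%nat with (2 + (2 * i + 1))%nat by lia.
    rewrite chi4_2, IH, Nat.even_succ, <- Nat.negb_even. now destruct (Nat.even i). }
  rewrite K. unfold msgn. destruct (Nat.even i); auto. now rewrite <- RtoC_opp.
Qed.

Lemma chi4_even i : chi4 (2 * i) = 0%Z.
Proof.
  induction i as [|i IH]; [reflexivity|].
  replace (2 * S i)%nat with (2 + 2 * i)%nat by lia. now rewrite chi4_2, IH.
Qed.

Lemma has_DO_chi4 tau : (0 < Im tau)%R ->
  has_sum (fun i => msgn i * Uq (e tau) i) (DO (fun n => IZR (chi4 n)) tau).
Proof.
  intros H. destruct (has_DO _ tau cubic_chi4 H) as [P _].
  apply (has_sum_inj (fun i => 2 * i)%nat) in P.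
  - eapply has_sum_ext; [|exact P]. intros i; cbv beta. unfold Vq, Uq.
    replace (S (2 * i)) with (2 * i + 1)%nat by lia. now rewrite chi4_odd.
  - intros; lia.
  - intros d Hd. destruct (Nat.Even_or_Odd d) as [[k ->]|[k ->]].
    + exfalso. now apply (Hd k).
    + replace (S (2 * k + 1)) with (2 * S k)%nat by lia. rewrite chi4_even. ring.
Qed.

Lemma Wq_sq x n : Wq x n = (x * x) ^ n / (1 - (x * x) ^ n * (x * x) ^ n).
Proof. unfold Wq. rewrite Cpow_mult_r. now replace (x ^ 2) with (x * x) by (simpl; ring). Qed.

(** th2(tau)^2 is 4 Sum (-1)^i U_i at q^(1/2), whose square is given by [liouville_even]. *)
Lemma th2_4 tau : (0 < Im tau)%R -> th2 tau * th2 tau * (th2 tau * th2 tau) = 16 * OO id1 tau.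
Proof.
  intros H. assert (H2 : (0 < Im (tau / 2))%R) by (now apply Im_half_scal).
  pose proof (th2_DO _ H2) as E. replace (2 * (tau / 2)) with tau in E by (field; auto).
  rewrite E.
  pose proof (liouville_even _ _ (Cmod_e_lt1 _ H2) (has_DO_chi4 _ H2)) as P.
  replace (OO id1 tau) with (DO (fun n => IZR (chi4 n)) (tau / 2) * DO (fun n => IZR (chi4 n)) (tau / 2)); [ring|].
  refine (has_sum_unique _ _ _ P _). eapply has_sum_ext; [|apply (has_OO1 tau H)].
  intros i; cbv beta. rewrite Wq_sq, <- e_2. replace (2 * (tau / 2)) with tau by (field; auto). reflexivity.
Qed.

Lemma OO_sq tau : (0 < Im tau)%R -> OO id1 tau * OO id1 tau = DO id3 (2 * tau).
Proof.
  intros H.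
  pose proof (liouville_square _ _ (Cmod_e_lt1 _ H) (has_OO1 _ H)) as P.
  refine (has_sum_unique _ _ _ P _).
  destruct (has_DO id3 (2 * tau) cubic_id3 ltac:(impos)) as [Q _].
  eapply has_sum_ext; [|exact Q]. intros i; cbv beta. now rewrite Wq_sq, <- e_2.
Qed.

(** [th2_4] at tau/2 together with [th2_sq] gives th2^2 th3^2 = 4 [OO] at tau/2; squaring this calls
    for [OO_sq]. *)
Lemma th23_4 tau : (0 < Im tau)%R ->
  th2 tau * th2 tau * (th2 tau * th2 tau) * (th3 tau * th3 tau * (th3 tau * th3 tau)) = 16 * DO id3 tau.
Proof.
  intros H. assert (H2 : (0 < Im (tau / 2))%R) by (now apply Im_half_scal).
  pose proof (OO_sq _ H2) as E. pose proof (th2_4 _ H2) as E4. pose proof (th2_sq _ H2) as E2.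
  replace (2 * (tau / 2)) with tau in * by (field; auto).
  rewrite E2 in E4. rewrite <- E.
  transitivity ((2 * th2 tau * th3 tau * (2 * th2 tau * th3 tau)) * (2 * th2 tau * th3 tau * (2 * th2 tau * th3 tau)) / 16); [field; auto|].
  rewrite E4. field; auto.
Qed.

Definition th3p4 (t : C) : C := th3 t * th3 t * (th3 t * th3 t).
Definition th2p4 (t : C) : C := th2 t * th2 t * (th2 t * th2 t).

Lemma lim_lam_scal4 g : cubic g -> lim_ioo (fun t => Lam g (4 * t)) 0.
Proof.
  intros Hg. apply (lim_ioo_ext (fun t => Lam g (2 * (2 * t)))).
  - intros t _. f_equal. ring.
  - apply (lim_ioo_scal2 (fun t => Lam g (2 * t))), (lim_ioo_scal2 (Lam g)), lim_lam, Hg.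
Qed.

Lemma lim_th3_4 : lim_ioo (fun t => th3 t * th3 t * (th3 t * th3 t)) 1.
Proof.
  pose proof lim_th3 as P. pose proof (flim_mult _ _ _ _ P P) as Q. pose proof (flim_mult _ _ _ _ Q Q) as S.
  replace (1 * 1 * (1 * 1)) with (RtoC 1) in S by ring. exact S.
Qed.

Lemma lim_th2_4 : lim_ioo (fun t => th2 t * th2 t * (th2 t * th2 t)) 0.
Proof.
  apply (lim_ioo_ext (fun t => 16 * (Lam id1 t + (- (3 * Lam id1 (2 * t))) + 2 * Lam id1 (4 * t)))).
  - intros t Ht. rewrite th2_4, OO_lam by auto. ring.
  - replace (RtoC 0) with (16 * (0 + - (3 * 0) + 2 * 0)) by ring.
    apply flim_mult; [apply flim_const|]. apply flim_plus; [apply flim_plus|].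
    + apply lim_lam, cubic_id1.
    + apply flim_opp, flim_mult; [apply flim_const|]. apply (lim_ioo_scal2 (Lam id1)), lim_lam, cubic_id1.
    + apply flim_mult; [apply flim_const|]. apply lim_lam_scal4, cubic_id1.
Qed.

(** The difference W of the two sides is invariant under doubling: the Lambert side changes by 24
    [OO] = 3/2 th2^4, and with c, d at 2 tau both changes are 6 c^2 d^2. *)
Lemma E22_theta tau : (0 < Im tau)%R ->
  1 + 24 * Lam id1 tau - 48 * Lam id1 (2 * tau) =
  th3 tau * th3 tau * (th3 tau * th3 tau) + th2 tau * th2 tau * (th2 tau * th2 tau).
Proof.
  intros H.
  set (W := fun t => 1 + 24 * Lam id1 t + - (48 * Lam id1 (2 * t)) +
   - (th3 t * th3 t * (th3 t * th3 t) + th2 t * th2 t * (th2 t * th2 t))).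
  assert (E : W tau = 0).
  { apply doubling_const; auto.
    - unfold W. replace (RtoC 0) with (1 + 24 * 0 + - (48 * 0) + - (1 + 0)) by ring.
      repeat apply flim_plus; try apply flim_const.
      + apply flim_mult; [apply flim_const|]. apply lim_lam, cubic_id1.
      + apply flim_opp, flim_mult; [apply flim_const|]. apply (lim_ioo_scal2 (Lam id1)), lim_lam, cubic_id1.
      + apply flim_opp, flim_plus; [apply lim_th3_4|apply lim_th2_4].
    - intros t Ht. unfold W. replace (2 * (2 * t)) with (4 * t) by ring.
      pose proof (th2_4 t Ht) as A. rewrite OO_lam in A by auto.
      assert (B : 24 * (Lam id1 t - 3 * Lam id1 (2 * t) + 2 * Lam id1 (4 * t)) =
          3 / 2 * (th2 t * th2 t * (th2 t * th2 t))) by (rewrite A; field; auto).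
      rewrite (th3_sq t) by auto. rewrite (th2_sq t) in * by auto.
      transitivity (1 + 24 * Lam id1 t - 48 * Lam id1 (2 * t)
         - 24 * (Lam id1 t - 3 * Lam id1 (2 * t) + 2 * Lam id1 (4 * t))
       + - (th3 (2 * t) * th3 (2 * t) * (th3 (2 * t) * th3 (2 * t)) + th2 (2 * t) * th2 (2 * t) * (th2 (2 * t) * th2 (2 * t)))).
      { ring. }
      rewrite B. field; auto. }
  unfold W in E. apply Ceq_minus. rewrite <- E. ring.
Qed.


Lemma lam3_diff t : (0 < Im t)%R ->
  240 * (Lam id3 t - Lam id3 (2 * t)) = 15 * (th2p4 t * th3p4 t).
Proof.
  intros Ht. destruct (has_DO id3 t cubic_id3 Ht) as [_ <-]. unfold th2p4, th3p4. rewrite th23_4 by auto. ring.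
Qed.

(** Again by doubling: the Lambert side changes by 15 th2^4 th3^4, by [lam3_diff]. *)
Lemma E4_theta tau : (0 < Im tau)%R ->
  1 + 240 * Lam id3 tau = th3p4 tau * th3p4 tau + 14 * (th3p4 tau * th2p4 tau) + th2p4 tau * th2p4 tau.
Proof.
  intros H.
  set (W := fun t => 1 + 240 * Lam id3 t + - (th3p4 t * th3p4 t + 14 * (th3p4 t * th2p4 t) + th2p4 t * th2p4 t)).
  assert (E : W tau = 0).
  { apply doubling_const; auto.
    - pose proof lim_th3_4 as LA. fold th3p4 in LA. pose proof lim_th2_4 as LB. fold th2p4 in LB.
      unfold W. replace (RtoC 0) with (1 + 240 * 0 + - (1 * 1 + 14 * (1 * 0) + 0 * 0)) by ring.
      apply flim_plus; [apply flim_plus|]; [apply flim_const| |].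
      + apply flim_mult; [apply flim_const|]. apply lim_lam, cubic_id3.
      + apply flim_opp. apply flim_plus; [apply flim_plus|]; repeat apply flim_mult; auto; apply flim_const.
    - intros t Ht. unfold W. pose proof (lam3_diff t Ht) as K. unfold th2p4, th3p4 in *.
      rewrite (th3_sq t) in * by auto. rewrite (th2_sq t) in * by auto.
      set (c := th3 (2 * t)) in *. set (d := th2 (2 * t)) in *.
      set (X := Lam id3 t) in *. set (Y := Lam id3 (2 * t)) in *.
      replace (240 * Y) with (240 * X - 240 * (X - Y)) by ring.
      rewrite K. ring. }
  unfold W in E. apply Ceq_minus. rewrite <- E. ring.
Qed.

Lemma E4_theta_2 tau : (0 < Im tau)%R ->
  1 + 240 * Lam id3 (2 * tau) = th3p4 tau * th3p4 tau - th3p4 tau * th2p4 tau + th2p4 tau * th2p4 tau.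
Proof.
  intros H. pose proof (E4_theta tau H) as L.
  replace (1 + 240 * Lam id3 (2 * tau)) with (1 + 240 * Lam id3 tau - 240 * (Lam id3 tau - Lam id3 (2 * tau))) by ring.
  rewrite lam3_diff, L by auto. ring.
Qed.

(** * The Jacobi triple product and eta *)

Notation clim := (flim eventually).

Lemma clim_ext u v l : (forall n, u n = v n) -> clim u l -> clim v l.
Proof. intros E H eps He. destruct (H eps He) as [N HN]. exists N. intros n Hn. rewrite <- E. auto. Qed.

Lemma clim_unique u l m : clim u l -> clim u m -> l = m.
Proof.
  intros H1 H2. apply Cmod_lt_eq. intros eps He.
  destruct (H1 (eps / 2)%R) as [N1 K1]; [lra|]. destruct (H2 (eps / 2)%R) as [N2 K2]; [lra|].
  specialize (K1 (N1 + N2)%nat ltac:(lia)). specialize (K2 (N1 + N2)%nat ltac:(lia)).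
  eapply Rle_lt_trans; [apply (Cmod_tri3 _ (u (N1 + N2)%nat))|]. rewrite (Cmod_minus_sym l). lra.
Qed.

Lemma clim_sub u l (h : nat -> nat) : (forall n, n <= h n)%nat -> clim u l -> clim (fun n => u (h n)) l.
Proof.
  intros Hh H eps He. destruct (H eps He) as [N HN]. exists N. intros n Hn. apply HN. specialize (Hh n). lia.
Qed.

Lemma clim_CLim u l : clim u l -> CLim_seq u = l.
Proof.
  intros H. unfold CLim_seq.
  assert (K : forall h : C -> R, (forall x y : C, h (x - y)%C = (h x - h y)%R) -> (forall z, Rabs (h z) <= Cmod z)%R ->
     real (Lim_seq (fun n => h (u n))) = h l).
  { intros h Hm Hh. assert (L : is_lim_seq (fun n => h (u n)) (h l)).
    { apply is_lim_seq_spec. intros eps. destruct (H eps (cond_pos eps)) as [N HN].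
      exists N. intros n Hn. rewrite <- Hm. eapply Rle_lt_trans; [apply Hh|]. apply HN. lia. }
    now rewrite (is_lim_seq_unique _ _ L). }
  rewrite (K Re), (K Im); auto.
  - now destruct l.
  - intros z. eapply Rle_trans; [apply Rmax_r|]. apply Rmax_Cmod.
  - apply re_le_Cmod.
Qed.

Lemma has_sum_clim (a : nat -> C) s : has_sum a s -> clim (fun n => lsum a (seq 0 n)) s.
Proof.
  intros H eps He. destruct (H eps He) as [l0 Hl]. exists (S (list_max l0)). intros n Hn.
  apply Hl; [apply seq_NoDup|]. intros y Hy. apply in_seq. split; [lia|].
  destruct (list_max_le l0 (list_max l0)) as [L _]. specialize (L (Nat.le_refl _)).
  rewrite Forall_forall in L. specialize (L y Hy). lia.
Qed.

(** The q-Pochhammer symbol (x; x)_n; its limit [Pinf] below is (x; x)_oo. *)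
Definition pr (x : C) : nat -> C := Cprod (fun n => 1 - x ^ S n).

Lemma pr_le x n : (Cmod x < 1)%R -> (Cmod (pr x n) <= exp (/ (1 - Cmod x)))%R.
Proof.
  intros Hx. pose proof (Cmod_ge_0 x).
  apply Rle_trans with (exp (rsum (fun k => Cmod x ^ S k)%R (seq 0 n))).
  - induction n as [|n IH].
    + unfold pr; simpl. rewrite exp_0, Cmod_1. lra.
    + unfold pr in *. cbn [Cprod]. rewrite seq_S, rsum_app, Cmod_mult, exp_plus. cbn [rsum fold_right].
      apply Rmult_le_compat; auto; try apply Cmod_ge_0.
      rewrite Rplus_0_r, Nat.add_0_l. eapply Rle_trans; [apply Cmod_triangle|].
      rewrite Cmod_1, Cmod_opp, Cmod_pow. apply exp_ineq1_le.
  - apply exp_le. eapply Rle_trans; [|apply (sum_le_geom (Cmod x) ltac:(lra) (seq 0 n)), seq_NoDup].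
    apply rsum_le. intros i _. apply pow_decr; [lra|lia].
Qed.

Lemma one_minus_pow_nz x n : (Cmod x < 1)%R -> 1 - x ^ S n <> 0.
Proof. intros Hx. apply Cmod_1_plus_nz. rewrite Cmod_opp. now apply Cmod_pow_lt1. Qed.

Lemma pr_nz x n : (Cmod x < 1)%R -> pr x n <> 0.
Proof.
  intros Hx. induction n as [|n IH]; [apply C1_nz|].
  unfold pr in *. cbn [Cprod]. apply Cmult_neq_0; auto. now apply one_minus_pow_nz.
Qed.

Lemma pr_inv_le x n : (Cmod x < 1)%R -> (Cmod (/ pr x n) <= exp (/ (1 - Cmod x) * / (1 - Cmod x)))%R.
Proof.
  intros Hx. pose proof (Cmod_ge_0 x). set (r := Cmod x) in *.
  assert (Hr : (0 < / (1 - r))%R) by (apply Rinv_0_lt_compat; lra).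
  apply Rle_trans with (exp (rsum (fun k => / (1 - r) * r ^ S k)%R (seq 0 n))).
  - induction n as [|n IH].
    + unfold pr; simpl. rewrite exp_0. replace (/ RtoC 1) with (RtoC 1) by (field). rewrite Cmod_1. lra.
    + unfold pr in *. cbn [Cprod]. rewrite seq_S, rsum_app.
      replace (/ (Cprod (fun n0 : nat => 1 - x ^ S n0) n * (1 - x ^ S n)))
        with (/ (Cprod (fun n0 : nat => 1 - x ^ S n0) n) * / (1 - x ^ S n)).
      2: { field. split; [now apply one_minus_pow_nz|now apply (pr_nz x n)]. }
      rewrite Cmod_mult, exp_plus. cbn [rsum fold_right].
      apply Rmult_le_compat; auto; try apply Cmod_ge_0.
      rewrite Rplus_0_r, Nat.add_0_l. eapply Rle_trans; [|apply exp_ineq1_le].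
      rewrite Cmod_inv by (now apply one_minus_pow_nz).
      assert (P1 : (0 <= r ^ S n)%R) by (apply pow_le; lra).
      assert (P2 : (r ^ S n <= r)%R) by (rewrite <- (pow_1 r) at 2; apply pow_decr; [lra|lia]).
      pose proof (Cmod_1_plus (- x ^ S n)) as Q. rewrite Cmod_opp, Cmod_pow in Q. fold r in Q.
      change (1 + - x ^ S n) with (1 - x ^ S n) in Q.
      apply Rle_trans with (/ (1 - r ^ S n))%R.
      { apply Rinv_le_contravar; lra. }
      (* 1 / (1 - r^k) = 1 + r^k / (1 - r^k) is at most 1 + r^k / (1 - r), to which 1 + t <= exp t
         applies. *)
      replace (/ (1 - r ^ S n))%R with (1 + / (1 - r ^ S n) * r ^ S n)%R by (field; lra).
      apply Rplus_le_compat_l, Rmult_le_compat_r; auto. apply Rinv_le_contravar; lra.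
  - apply exp_le. rewrite rsum_scal. apply Rmult_le_compat_l; [lra|].
    eapply Rle_trans; [|apply (sum_le_geom r ltac:(lra) (seq 0 n)), seq_NoDup].
    apply rsum_le. intros i _. apply pow_decr; [lra|lia].
Qed.

Definition Pinf (x : C) : C := CLim_seq (pr x).

Lemma pr_clim x : (Cmod x < 1)%R -> clim (pr x) (Pinf x).
Proof.
  intros Hx. pose proof (Cmod_ge_0 x).
  (* The increments of the partial products: they are dominated by a geometric series, so the
     products converge. *)
  set (a := fun k => - (pr x k * x ^ S k)).
  assert (A : abs_sum a).
  { apply abs_sum_le_R with (fun k => exp (/ (1 - Cmod x)) * Cmod x ^ k)%R (exp (/ (1 - Cmod x)) * / (1 - Cmod x))%R.
    - intros k. unfold a. rewrite Cmod_opp, Cmod_mult, Cmod_pow.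
      apply Rmult_le_compat; [apply Cmod_ge_0|apply pow_le; lra|now apply pr_le|apply pow_decr; [lra|lia]].
    - apply sum_le_scal; [left; apply exp_pos|]. apply sum_le_geom. lra. }
  assert (E : forall n, 1 + lsum a (seq 0 n) = pr x n).
  { induction n as [|n IH]; [unfold pr; simpl; ring|].
    rewrite seq_S, lsum_app. unfold pr. cbn [Cprod lsum fold_right]. fold (pr x n).
    transitivity (1 + lsum a (seq 0 n) + a n); [simpl; ring|]. rewrite IH. unfold a. ring. }
  assert (L : clim (pr x) (1 + csum a)).
  { intros eps He. destruct (has_sum_clim _ _ (abs_sum_has _ A) eps He) as [N HN].
    exists N. intros n Hn. rewrite <- E.
    replace (1 + lsum a (seq 0 n) - (1 + csum a)) with (lsum a (seq 0 n) - csum a) by ring. auto. }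
  unfold Pinf. now rewrite (clim_CLim _ _ L).
Qed.

(** The inverses of the partial products are bounded, so the limit cannot be 0. *)
Lemma Pinf_nz x : (Cmod x < 1)%R -> Pinf x <> 0.
Proof.
  intros Hx E. pose proof (pr_clim x Hx) as L. rewrite E in L.
  set (M := exp (/ (1 - Cmod x) * / (1 - Cmod x))).
  assert (HM : (0 < M)%R) by apply exp_pos.
  destruct (L (/ M)%R) as [N HN]; [now apply Rinv_0_lt_compat|].
  specialize (HN N (Nat.le_refl _)). replace (pr x N - 0) with (pr x N) in HN by ring.
  pose proof (pr_inv_le x N Hx) as K. fold M in K.
  rewrite Cmod_inv in K by (now apply pr_nz).
  pose proof (proj1 (Cmod_gt_0 _) (pr_nz x N Hx)) as P.
  apply Rinv_le_contravar in K; [|now apply Rinv_0_lt_compat]. rewrite Rinv_inv in K. lra.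
Qed.

(* 1 / (x; x)_m, extended by 0 to m < 0. *)
Definition ip (x : C) (m : Z) : C := if (m <? 0)%Z then 0 else / pr x (Z.to_nat m).

(** The extension by 0 makes the recursion valid for all m in Z: at m = 0 the factor 1 - e(0)
    vanishes. *)
Lemma ip_step sigma m : (0 < Im sigma)%R -> ip (e sigma) (m - 1) = (1 - e (IZR m * sigma)) * ip (e sigma) m.
Proof.
  intros H. unfold ip. pose proof (Cmod_e_lt1 sigma H) as Hx.
  destruct (Z.ltb_spec m 0), (Z.ltb_spec (m - 1) 0); try lia.
  - ring.
  - replace m with 0%Z by lia. simpl. rewrite Cmult_0_l, e_0. ring.
  - replace (Z.to_nat m) with (S (Z.to_nat (m - 1))) by lia. unfold pr at 2. cbn [Cprod]. fold (pr (e sigma)).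
    change (Cprod (fun n : nat => 1 - e sigma ^ S n) (Z.to_nat (m - 1))) with (pr (e sigma) (Z.to_nat (m - 1))).
    rewrite e_pow, INR_IZR_INZ. replace (Z.of_nat (S (Z.to_nat (m - 1)))) with m by lia.
    pose proof (pr_nz (e sigma) (Z.to_nat (m - 1)) Hx) as N1.
    pose proof (one_minus_pow_nz (e sigma) (Z.to_nat (m - 1)) Hx) as N2.
    rewrite e_pow, INR_IZR_INZ in N2. replace (Z.of_nat (S (Z.to_nat (m - 1)))) with m in N2 by lia.
    field. auto.
Qed.

(** The Gaussian binomial coefficient of 2 n over n + j in base x, equal to 0 for |j| > n. *)
Definition jc (x : C) (n : nat) (j : Z) : C := pr x (2 * n) * ip x (Z.of_nat n + j) * ip x (Z.of_nat n - j).

(** Two Pascal rules in one step. [ip_step] expresses every term by the same two inverses, which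
    leaves an identity between monomials. *)
Lemma jc_step sigma n j : (0 < Im sigma)%R ->
  jc (e sigma) (S n) j = (1 + e (INR (2 * n + 1) * sigma)) * jc (e sigma) n j
   + e (IZR (Z.of_nat n + 1 - j) * sigma) * jc (e sigma) n (j - 1)
   + e (IZR (Z.of_nat n + 1 + j) * sigma) * jc (e sigma) n (j + 1).
Proof.
  intros H. unfold jc.
  replace (2 * S n)%nat with (S (S (2 * n))) by lia. unfold pr at 1. cbn [Cprod].
  change (Cprod (fun n0 : nat => 1 - e sigma ^ S n0) (2 * n)) with (pr (e sigma) (2 * n)).
  set (a := (Z.of_nat n + 1 + j)%Z). set (b := (Z.of_nat n + 1 - j)%Z).
  replace (Z.of_nat (S n) + j)%Z with a by lia. replace (Z.of_nat (S n) - j)%Z with b by lia.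
  replace (Z.of_nat n + j)%Z with (a - 1)%Z by lia. replace (Z.of_nat n - j)%Z with (b - 1)%Z by lia.
  replace (Z.of_nat n + (j - 1))%Z with (a - 1 - 1)%Z by lia. replace (Z.of_nat n - (j - 1))%Z with b by lia.
  replace (Z.of_nat n + (j + 1))%Z with a by lia. replace (Z.of_nat n - (j + 1))%Z with (b - 1 - 1)%Z by lia.
  rewrite !ip_step by auto. rewrite !e_pow.
  assert (E1 : e (INR (S (S (2 * n))) * sigma) = e (IZR a * sigma) * e (IZR b * sigma)).
  { rewrite <- e_add. f_equal. rewrite INR_IZR_INZ. replace (Z.of_nat (S (S (2 * n)))) with (a + b)%Z by lia. push. ring. }
  assert (E2 : forall c, e (IZR (c - 1) * sigma) = e (IZR c * sigma) / e sigma).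
  { intros c. rewrite <- e_minus. f_equal. push. ring. }
  assert (E3 : e (INR (S (2 * n)) * sigma) = e (IZR a * sigma) * e (IZR b * sigma) / e sigma).
  { rewrite <- E1, <- e_minus. f_equal. rewrite (S_INR (S (2 * n))). rewrite RtoC_plus. ring. }
  replace (2 * n + 1)%nat with (S (2 * n)) by lia.
  rewrite E1, E3, !E2. pose proof (e_nz sigma). field. auto.
Qed.

(** Partial products of (1 + q^(2k+1) z) (1 + q^(2k+1) / z), with z = e(alpha). *)
Definition PL (tau alpha : C) : nat -> C :=
  Cprod (fun k => (1 + e (INR (2 * k + 1) * tau + alpha)) * (1 + e (INR (2 * k + 1) * tau - alpha))).

(** The finite triple product. The next two factors multiply to 1 + q^(4n+2) + q^(2n+1) (z + 1/z),
    whose three parts shift j by 0, 1 and -1 and match [jc_step]. *)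
Lemma jacobi_finite tau alpha n : (0 < Im tau)%R ->
  has_sum (fun j : Z => e (IZR j * IZR j * tau + IZR j * alpha) * jc (e (2 * tau)) n j) (PL tau alpha n).
Proof.
  intros H. assert (H2 : (0 < Im (2 * tau))%R) by impos. induction n as [|n IH].
  - apply has_sum_single with 0%Z.
    + unfold jc, ip, pr. simpl. replace (0 * 0 * tau + 0 * alpha) with (RtoC 0) by ring. rewrite e_0. unfold PL; simpl. field.
    + intros j Hj. unfold jc, ip.
      destruct (Z.ltb_spec (Z.of_nat 0 + j) 0); [ring|].
      destruct (Z.ltb_spec (Z.of_nat 0 - j) 0); [ring|]. lia.
  - unfold PL. cbn [Cprod]. fold (PL tau alpha n).
    set (y := INR (2 * n + 1) * tau).
    pose proof (has_sum_scal (1 + e (INR (2 * n + 1) * (2 * tau))) _ _ IH) as P0.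
    assert (P1 : has_sum (fun j : Z => e (y + alpha) * (e (IZR (j - 1) * IZR (j - 1) * tau + IZR (j - 1) * alpha) * jc (e (2 * tau)) n (j - 1))) (e (y + alpha) * PL tau alpha n)).
    { apply has_sum_scal.
      apply (has_sum_bij (fun j => j - 1)%Z (fun j => j + 1)%Z) in IH; [exact IH|intros; lia|intros; lia]. }
    assert (P2 : has_sum (fun j : Z => e (y - alpha) * (e (IZR (j + 1) * IZR (j + 1) * tau + IZR (j + 1) * alpha) * jc (e (2 * tau)) n (j + 1))) (e (y - alpha) * PL tau alpha n)).
    { apply has_sum_scal.
      apply (has_sum_bij (fun j => j + 1)%Z (fun j => j - 1)%Z) in IH; [exact IH|intros; lia|intros; lia]. }
    replace (PL tau alpha n * ((1 + e (y + alpha)) * (1 + e (y - alpha))))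
      with ((1 + e (INR (2 * n + 1) * (2 * tau))) * PL tau alpha n + e (y + alpha) * PL tau alpha n + e (y - alpha) * PL tau alpha n).
    2: { replace (INR (2 * n + 1) * (2 * tau)) with ((y + alpha) + (y - alpha)) by (unfold y; ring). rewrite e_add. ring. }
    eapply has_sum_ext; [|apply (has_sum_plus _ _ _ _ (has_sum_plus _ _ _ _ P0 P1) P2)].
    intros j; cbv beta. rewrite jc_step by auto.
    rewrite !(Cmult_assoc (e _) (e _)), <- !e_add.
    replace (y + alpha + (IZR (j - 1) * IZR (j - 1) * tau + IZR (j - 1) * alpha))
      with ((IZR j * IZR j * tau + IZR j * alpha) + IZR (Z.of_nat n + 1 - j) * (2 * tau)).
    2: { unfold y. rewrite INR_IZR_INZ. replace (Z.of_nat (2 * n + 1)) with (2 * Z.of_nat n + 1)%Z by lia. push. ring. }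
    replace (y - alpha + (IZR (j + 1) * IZR (j + 1) * tau + IZR (j + 1) * alpha))
      with ((IZR j * IZR j * tau + IZR j * alpha) + IZR (Z.of_nat n + 1 + j) * (2 * tau)).
    2: { unfold y. rewrite INR_IZR_INZ. replace (Z.of_nat (2 * n + 1)) with (2 * Z.of_nat n + 1)%Z by lia. push. ring. }
    rewrite !(e_add (IZR j * IZR j * tau + IZR j * alpha)). ring.
Qed.

Lemma ip_le x m : (Cmod x < 1)%R -> (Cmod (ip x m) <= exp (/ (1 - Cmod x) * / (1 - Cmod x)))%R.
Proof.
  intros Hx. unfold ip. destruct (m <? 0)%Z; [|now apply pr_inv_le].
  rewrite Cmod_0. left. apply exp_pos.
Qed.

Lemma ip_clim x j : (Cmod x < 1)%R -> clim (fun n => ip x (Z.of_nat n + j)) (/ Pinf x).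
Proof.
  intros Hx eps He.
  destruct (flim_inv _ _ (Pinf_nz x Hx) (pr_clim x Hx) eps He) as [N HN].
  exists (N + Z.abs_nat j)%nat. intros n Hn. unfold ip.
  destruct (Z.ltb_spec (Z.of_nat n + j) 0); [lia|]. apply HN. lia.
Qed.

Lemma jc_clim x j : (Cmod x < 1)%R -> clim (fun n => jc x n j) (/ Pinf x).
Proof.
  intros Hx. pose proof (Pinf_nz x Hx) as N.
  replace (/ Pinf x) with (Pinf x * / Pinf x * / Pinf x) by (field; auto).
  unfold jc. apply flim_mult; [apply flim_mult|].
  - apply (clim_sub (pr x) _ (fun n => 2 * n)%nat); [intros; lia|]. now apply pr_clim.
  - now apply ip_clim.
  - apply (clim_ext (fun n => ip x (Z.of_nat n + - j))); [reflexivity|]. now apply ip_clim.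
Qed.

(** Dominated convergence in [jacobi_finite]: the Gaussian binomials are bounded uniformly in n and
    j, and tend to 1 / (x; x)_oo for each j. *)
Lemma jacobi_triple tau alpha : (0 < Im tau)%R ->
  clim (PL tau alpha) (/ Pinf (e (2 * tau)) * csum (fun j : Z => e (IZR j * IZR j * tau + IZR j * alpha))).
Proof.
  intros H. assert (H2 : (0 < Im (2 * tau))%R) by impos.
  pose proof (Cmod_e_lt1 _ H2) as Hx. set (x := e (2 * tau)) in *.
  assert (A : abs_sum (fun j : Z => e (IZR j * IZR j * tau + IZR j * alpha))).
  { eapply abs_sum_ext; [|apply (abs_sum_quad tau alpha 0 H)]. intros n; cbv beta. f_equal. ring. }
  set (r := (1 - Cmod x)%R).
  set (E1 := exp (/ r)). set (E2 := exp (/ r * / r)).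
  assert (P1 : (0 < E1)%R) by apply exp_pos. assert (P2 : (0 < E2)%R) by apply exp_pos.
  pose proof (proj1 (Cmod_gt_0 _) (Pinf_nz x Hx)) as Pp.
  destruct A as [M HM].
  assert (HB : (0 <= E1 * E2 * E2 + / Cmod (Pinf x))%R).
  { apply Rplus_le_le_0_compat; [|left; now apply Rinv_0_lt_compat]. repeat apply Rmult_le_pos; lra. }
  intros eps He.
  refine (tannery eventually (fun n j => e (IZR j * IZR j * tau + IZR j * alpha) * jc x n j) (PL tau alpha)
    (fun j => / Pinf x * e (IZR j * IZR j * tau + IZR j * alpha)) _
    (fun j => (E1 * E2 * E2 + / Cmod (Pinf x)) * Cmod (e (IZR j * IZR j * tau + IZR j * alpha)))%R
    ((E1 * E2 * E2 + / Cmod (Pinf x)) * M)%R _ _ _ _ _ _ _ eps He).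
  - intros j. apply Rmult_le_pos; auto. apply Cmod_ge_0.
  - now apply sum_le_scal.
  - exists 0%nat. intros n _ j. rewrite Cmod_mult, Rmult_comm. apply Rmult_le_compat_r; [apply Cmod_ge_0|].
    apply Rle_trans with (E1 * E2 * E2)%R.
    + unfold jc. rewrite !Cmod_mult. repeat apply Rmult_le_compat; try apply Rmult_le_pos; try apply Cmod_ge_0.
      * now apply pr_le.
      * now apply ip_le.
      * now apply ip_le.
    + assert (0 < / Cmod (Pinf x))%R by (now apply Rinv_0_lt_compat). lra.
  - intros j ep Hep. rewrite (Cmult_comm (/ Pinf x)). apply (flim_mult _ _ _ _ (flim_const _) (jc_clim x j Hx) ep Hep).
  - intros j. rewrite Cmod_mult, Cmod_inv by (now apply Pinf_nz). apply Rmult_le_compat_r; [apply Cmod_ge_0|].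
    assert (0 <= E1 * E2 * E2)%R by (repeat apply Rmult_le_pos; lra). lra.
  - exists 0%nat. intros n _. now apply jacobi_finite.
  - apply has_sum_scal. apply abs_sum_has. now exists M.
Qed.

Lemma Cprod_ext u v n : (forall k, u k = v k) -> Cprod u n = Cprod v n.
Proof. intros E. induction n as [|n IH]; simpl; [auto|now rewrite IH, E]. Qed.

Lemma Cprod_mult u v n : Cprod (fun k => u k * v k) n = Cprod u n * Cprod v n.
Proof. induction n as [|n IH]; simpl; [ring|rewrite IH; ring]. Qed.

Lemma Cprod_2 u n : Cprod u (2 * n) = Cprod (fun k => u (2 * k)%nat * u (2 * k + 1)%nat) n.
Proof.
  induction n as [|n IH]; [reflexivity|].
  replace (2 * S n)%nat with (S (S (2 * n))) by lia. cbn [Cprod]. rewrite IH.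
  replace (2 * n + 1)%nat with (S (2 * n)) by lia. ring.
Qed.

Definition odd_minus (x : C) : nat -> C := Cprod (fun k => 1 - x ^ (2 * k + 1)).
Definition odd_plus (x : C) : nat -> C := Cprod (fun k => 1 + x ^ (2 * k + 1)).

Lemma pr_odd x n : pr x (2 * n) = odd_minus x n * pr (x * x) n.
Proof.
  unfold pr, odd_minus. rewrite Cprod_2, <- Cprod_mult. apply Cprod_ext. intros k.
  replace (S (2 * k)) with (2 * k + 1)%nat by lia. replace (S (2 * k + 1)) with (2 * S k)%nat by lia.
  rewrite (Cpow_mult_r x 2). now replace (x ^ 2) with (x * x) by (simpl; ring).
Qed.

Lemma odd_plus_minus x n : odd_plus x n * odd_minus x n = odd_minus (x * x) n.
Proof.
  unfold odd_plus, odd_minus. rewrite <- Cprod_mult. apply Cprod_ext. intros k. rewrite Cpow_mult_l. ring.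
Qed.

(** Gauss's product, from the triple product at z = -1. Comparing [pr] at 2 n with [pr_odd]
    eliminates the product over odd exponents. *)
Lemma th4_prod tau : (0 < Im tau)%R -> th4 tau * Pinf (e (2 * tau)) = Pinf (e tau) * Pinf (e tau).
Proof.
  intros H. assert (H2 : (0 < Im (2 * tau))%R) by impos.
  pose proof (Cmod_e_lt1 _ H) as X1. pose proof (Cmod_e_lt1 _ H2) as X2.
  pose proof (jacobi_triple tau (1 / 2) H) as J.
  replace (csum (fun j : Z => e (IZR j * IZR j * tau + IZR j * (1 / 2)))) with (th4 tau) in J.
  2: { symmetry. apply csum_eq. eapply has_sum_ext; [|apply (has_th4 tau H)]. intros n; cbv beta.
       rewrite <- e_half_Z, <- e_add. f_equal. field; auto. }
  assert (E : forall n, PL tau (1 / 2) n = odd_minus (e tau) n * odd_minus (e tau) n).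
  { intros n. unfold PL, odd_minus. rewrite <- Cprod_mult. apply Cprod_ext. intros k. rewrite e_pow, e_minus, e_add, e_half.
    field. }
  pose proof (flim_mult _ _ _ _ J (flim_mult _ _ _ _ (pr_clim _ X2) (pr_clim _ X2))) as L.
  pose proof (clim_sub _ _ (fun n => 2 * n)%nat ltac:(intros; cbv beta; lia) (pr_clim _ X1)) as L1.
  pose proof (flim_mult _ _ _ _ L1 L1) as L2.
  assert (E2 : / Pinf (e (2 * tau)) * th4 tau * (Pinf (e (2 * tau)) * Pinf (e (2 * tau))) = Pinf (e tau) * Pinf (e tau)).
  { apply (clim_unique _ _ _ L). eapply clim_ext; [|exact L2]. intros n; cbv beta.
    rewrite E, pr_odd, <- e_2. ring. }
  rewrite <- E2. field. now apply Pinf_nz.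
Qed.

Lemma psi_prod tau : (0 < Im tau)%R -> psi tau * Pinf (e tau) = Pinf (e (2 * tau)) * Pinf (e (2 * tau)).
Proof.
  intros H. assert (H2 : (0 < Im (2 * tau))%R) by impos. assert (H4 : (0 < Im (2 * (2 * tau)))%R) by impos.
  pose proof (Cmod_e_lt1 _ H) as X1. pose proof (Cmod_e_lt1 _ H2) as X2. pose proof (Cmod_e_lt1 _ H4) as X4.
  pose proof (jacobi_triple (2 * tau) (- tau) H2) as J.
  replace (csum (fun j : Z => e (IZR j * IZR j * (2 * tau) + IZR j * - tau))) with (psi tau) in J.
  2: { symmetry. apply csum_eq. eapply has_sum_ext; [|apply (has_psi tau H)]. intros n; cbv beta. f_equal. push. ring. }
  (* The exponents 2 (2 k + 1) - 1 = 4 k + 1 and 2 (2 k + 1) + 1 = 4 k + 3 run through all odd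
     numbers. *)
  assert (E : forall n, PL (2 * tau) (- tau) n = odd_plus (e tau) (2 * n)).
  { intros n. unfold PL, odd_plus. rewrite Cprod_2. apply Cprod_ext. intros k. rewrite !e_pow.
    f_equal; f_equal; f_equal; rewrite ?plus_INR, ?mult_INR, ?RtoC_plus, ?RtoC_mult, ?plus_INR, ?mult_INR, ?RtoC_plus, ?RtoC_mult;
    change (INR 2) with 2%R; change (INR 1) with 1%R; ring. }
  pose proof (clim_sub _ _ (fun n => 2 * (2 * n))%nat ltac:(intros; cbv beta; lia) (pr_clim _ X1)) as L1.
  pose proof (clim_sub _ _ (fun n => 2 * n)%nat ltac:(intros; cbv beta; lia) (pr_clim _ X4)) as L4.
  pose proof (flim_mult _ _ _ _ (flim_mult _ _ _ _ J L1) L4) as L.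
  pose proof (clim_sub _ _ (fun n => 2 * (2 * n))%nat ltac:(intros; cbv beta; lia) (pr_clim _ X2)) as M1.
  pose proof (clim_sub _ _ (fun n => 2 * n)%nat ltac:(intros; cbv beta; lia) (pr_clim _ X2)) as M2.
  pose proof (flim_mult _ _ _ _ M1 M2) as M.
  assert (E2 : / Pinf (e (2 * (2 * tau))) * psi tau * Pinf (e tau) * Pinf (e (2 * (2 * tau))) = Pinf (e (2 * tau)) * Pinf (e (2 * tau))).
  { apply (clim_unique _ _ _ L). eapply clim_ext; [|exact M]. intros n; cbv beta.
    rewrite E, (pr_odd (e (2 * tau))), (pr_odd (e tau)), <- !e_2, (e_2 tau), <- odd_plus_minus. ring. }
  rewrite <- E2. field. now apply Pinf_nz.
Qed.

(** Multiplying Gauss's products gives th4 psi = (q; q)_oo (q^2; q^2)_oo, and psi^2 is th2 th3 up to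
    2 q^(1/4). The power of q agrees because 2 (1/24 + 2/24) = 1/4. *)
Lemma eta2_sq tau : (0 < Im tau)%R -> 2 * eta2 tau ^ 2 = th2 tau * th3 tau * (th4 tau * th4 tau).
Proof.
  intros H. assert (H2 : (0 < Im (2 * tau))%R) by impos.
  pose proof (Pinf_nz _ (Cmod_e_lt1 _ H)) as N1. pose proof (Pinf_nz _ (Cmod_e_lt1 _ H2)) as N2.
  assert (E : th4 tau * psi tau = Pinf (e tau) * Pinf (e (2 * tau))).
  { transitivity (th4 tau * Pinf (e (2 * tau)) * (psi tau * Pinf (e tau)) / (Pinf (e tau) * Pinf (e (2 * tau)))); [field; auto|].
    rewrite th4_prod, psi_prod by auto. field; auto. }
  rewrite <- psi_sq by auto. unfold eta2, eta.
  change (CLim_seq (Cprod (fun n : nat => 1 - e tau ^ S n))) with (Pinf (e tau)).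
  change (CLim_seq (Cprod (fun n : nat => 1 - e (2 * tau) ^ S n))) with (Pinf (e (2 * tau))).
  transitivity (2 * (e (tau / 24) * e (tau / 24) * (e (2 * tau / 24) * e (2 * tau / 24)))
     * (Pinf (e tau) * Pinf (e (2 * tau)) * (Pinf (e tau) * Pinf (e (2 * tau))))); [simpl; ring|].
  rewrite <- E, <- !e_add.
  replace (tau / 24 + tau / 24 + (2 * tau / 24 + 2 * tau / 24)) with (tau / 4); [ring|].
  field.
Qed.

(** * Partial fractions of cot and 1 / sin *)

(* 2 i sin(pi z) *)
Definition sn (z : C) : C := e (z / 2) - e (- (z / 2)).
(* - i cot(pi z) *)
Definition ct (z : C) : C := (e (z / 2) + e (- (z / 2))) / sn z.

Lemma e_cos_sin z : e z = (exp (- (2 * PI * Im z)) * cos (2 * PI * Re z), exp (- (2 * PI * Im z)) * sin (2 * PI * Re z))%R.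
Proof.
  unfold e, Cexp. destruct z as [x y].
  replace (2 * PI * Ci * (x, y)) with ((- (2 * PI * y), 2 * PI * x)%R : C)
    by (unfold Ci, Cmult, RtoC; cbn [fst snd]; f_equal; ring).
  cbn [Re Im fst snd]. unfold Cmult, RtoC; cbn [fst snd]. f_equal; ring.
Qed.

Lemma CiCi : Ci * Ci = - (1).
Proof. unfold Ci, Cmult, Copp, RtoC; cbn [fst snd]. f_equal; ring. Qed.

Lemma Ci_neq0 : Ci <> 0.
Proof. apply Ci_nz. Qed.

(** The formula 2 cot(2 x) = cot(x) + cot(x + pi/2), as a rational identity in e(z / 4) and i. *)
Lemma ct_dup z : sn z <> 0 -> ct z = (ct (z / 2) + ct ((z + 1) / 2)) / 2.
Proof.
  intros H. unfold ct, sn in *.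
  replace (z / 2 / 2) with (z / 4) by field.
  replace ((z + 1) / 2 / 2) with (z / 4 + 1 / 4) by field.
  replace (- (z / 4 + 1 / 4)) with (- (z / 4) + - (1 / 4)) by ring.
  replace (z / 2) with (z / 4 + z / 4) in * by field.
  replace (- (z / 4 + z / 4)) with (- (z / 4) + - (z / 4)) in * by ring.
  rewrite !e_add, !e_opp, e_quarter in *.
  pose proof (e_nz (z / 4)) as Nz. set (x := e (z / 4)) in *. clearbody x. pose proof Ci_neq0 as NC.
  pose proof CiCi as CC. set (I := Ci) in *. clearbody I.
  assert (Q : x * x * (x * x) - 1 <> 0).
  { intros E. apply H. transitivity ((x * x * (x * x) - 1) / (x * x)); [field; auto|]. rewrite E. field; auto. }
  assert (Q1 : x * x - 1 <> 0).
  { intros E. apply Q. transitivity ((x * x - 1) * (x * x + 1)); [ring|]. rewrite E. ring. }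
  assert (Q2 : x * x + 1 <> 0).
  { intros E. apply Q. transitivity ((x * x - 1) * (x * x + 1)); [ring|]. rewrite E. ring. }
  replace (/ I) with (- I).
  2: { transitivity (- (I * I) / I); [field; auto|]. rewrite CC. field; auto. }
  replace (x * I + / x * - I) with (I * (x * x - 1) / x) by (field; auto).
  replace (x * I - / x * - I) with (I * (x * x + 1) / x) by (field; auto).
  field. repeat split; auto.
Qed.

Lemma sn_1 z : sn (z + 1) = - sn z.
Proof.
  unfold sn. replace (- ((z + 1) / 2)) with (- (z / 2) + 1 / 2 - 1) by field.
  replace ((z + 1) / 2) with (z / 2 + 1 / 2) by field.
  rewrite e_minus, !e_add, e_half, e_1. field.
Qed.

Lemma ct_1 z : ct (z + 1) = ct z.
Proof.
  unfold ct. rewrite sn_1. replace (- ((z + 1) / 2)) with (- (z / 2) + 1 / 2 - 1) by field.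
  replace ((z + 1) / 2) with (z / 2 + 1 / 2) by field.
  rewrite e_minus, !e_add, e_half, e_1. unfold Cdiv.
  destruct (eq_em (sn z) 0) as [->|N].
  (* At a pole both sides are 0, by the convention / 0 = 0. *)
  - replace (- 0) with (RtoC 0) by ring.
    replace (/ RtoC 0) with (RtoC 0); [ring|]. unfold Cinv, RtoC; cbn [fst snd]. f_equal; unfold Rdiv; ring.
  - field; auto.
Qed.

Lemma sn_Z_add z (n : Z) : sn (z + IZR n) = sgn n * sn z.
Proof.
  unfold sn. replace ((z + IZR n) / 2) with (z / 2 + IZR n / 2) by field.
  replace (- (z / 2 + IZR n / 2)) with (- (z / 2) + IZR (- n) / 2) by (push; field).
  rewrite !e_add, !e_half_Z, sgn_opp. ring.
Qed.

Lemma Cmod_sn2 z : (Cmod (sn z) ^ 2 = (exp (PI * Im z) - exp (- (PI * Im z))) ^ 2 + 4 * sin (PI * Re z) ^ 2)%R.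
Proof.
  rewrite Cmod2_alt. unfold sn. rewrite !e_cos_sin.
  destruct z as [x y].
  assert (E1 : Im ((x, y) / 2) = (y / 2)%R) by (apply Im_div_R; lra).
  assert (E2 : Re ((x, y) / 2) = (x / 2)%R).
  { unfold Cdiv. rewrite <- RtoC_inv by lra. apply re_scal_r. }
  replace (Im (- ((x, y) / 2))) with (- (y / 2))%R by (rewrite <- E1; reflexivity).
  replace (Re (- ((x, y) / 2))) with (- (x / 2))%R by (rewrite <- E2; reflexivity).
  rewrite E1, E2. cbn [Re Im fst snd Cminus Cplus Copp].
  replace (2 * PI * - (x / 2))%R with (- (PI * x))%R by field.
  replace (2 * PI * (x / 2))%R with (PI * x)%R by field.
  replace (- (2 * PI * - (y / 2)))%R with (PI * y)%R by field.
  replace (- (2 * PI * (y / 2)))%R with (- (PI * y))%R by field.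
  rewrite cos_neg, sin_neg.
  pose proof (sin2_cos2 (PI * x)) as S. unfold Rsqr in S.
  assert (P : (exp (- (PI * y)) * exp (PI * y) = 1)%R) by (rewrite <- exp_plus, <- exp_0; f_equal; ring).
  set (a := exp (- (PI * y))) in *. set (b := exp (PI * y)) in *.
  set (c := cos (PI * x)) in *. set (s := sin (PI * x)) in *.
  assert (C2 : (c * c = 1 - s * s)%R) by lra.
  transitivity ((a - b) ^ 2 * (c * c) + (a + b) ^ 2 * (s * s))%R; [ring|]. rewrite C2.
  transitivity ((a - b) ^ 2 + 4 * (a * b) * (s * s))%R; [ring|]. rewrite P. ring.
Qed.

(** The range 3/4 is 1/2 for the residues k / 2^n plus 1/4 for Re u / 2^n in [partial_fractions_ct].
    Halving the angle keeps it below 3 pi / 8, where the cosine is at least c, and sin(2 s) = 2 sin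
    s cos s gives the constant c^2. *)
Lemma sin_lower : exists k, (0 < k <= 1)%R /\ forall t, (Rabs t <= 3 / 4)%R -> (k * Rabs t <= Rabs (sin (PI * t)))%R.
Proof.
  pose proof PI_RGT_0 as Hpi.
  set (c := cos (3 * PI / 8)).
  assert (Hc : (0 < c <= 1)%R).
  { split; [apply cos_gt_0; lra|apply COS_bound]. }
  assert (K : forall t, (0 <= t <= 3 / 4)%R -> (c * c * t <= sin (PI * t))%R).
  { intros t Ht. destruct (Req_dec t 0) as [->|N].
    { rewrite Rmult_0_r, Rmult_0_r, sin_0. lra. }
    set (s := (PI * t / 2)%R).
    assert (Hs : (0 < s <= 3 * PI / 8)%R).
    { unfold s. split; [apply Rmult_lt_0_compat; [apply Rmult_lt_0_compat; lra|lra]|]. nra. }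
    assert (C1 : (c <= cos s)%R) by (apply cos_decr_1; lra).
    destruct (MVT_cor2 sin cos 0 s ltac:(lra) ltac:(intros; apply derivable_pt_lim_sin)) as (d & E & Hd).
    rewrite sin_0 in E.
    assert (C2 : (c <= cos d)%R) by (apply cos_decr_1; lra).
    replace (PI * t)%R with (2 * s)%R by (unfold s; field). rewrite sin_2a.
    assert (S1 : (c * s <= sin s)%R) by nra.
    assert (t <= 2 * s)%R.
    { unfold s. pose proof PI2_3_2. nra. }
    assert (0 <= c * s)%R by nra.
    assert (c * s * c <= sin s * cos s)%R by (apply Rmult_le_compat; lra). nra. }
  exists (c * c)%R. split; [nra|]. intros t Ht.
  destruct (Rle_dec 0 t) as [P|P].
  - rewrite (Rabs_right t) in * by lra. eapply Rle_trans; [apply K; lra|apply Rle_abs].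
  - rewrite (Rabs_left t) in * by lra. replace (PI * t)%R with (- (PI * - t))%R by ring.
    rewrite sin_neg, Rabs_Ropp. eapply Rle_trans; [apply K; lra|apply Rle_abs].
Qed.

Lemma sn_lower : exists c, (0 < c)%R /\ forall z, (Rabs (Re z) <= 3 / 4)%R -> (c * Cmod z <= Cmod (sn z))%R.
Proof.
  destruct sin_lower as (k & Hk & K). exists k. split; [lra|]. intros z Hz.
  pose proof PI_RGT_0 as Hpi. pose proof PI2_3_2.
  apply Rsqr_incr_0; try apply Cmod_ge_0.
  2: { apply Rmult_le_pos; [lra|apply Cmod_ge_0]. }
  rewrite !Rsqr_pow2, Cmod_sn2, Rpow_mult_distr, Cmod2_alt.
  specialize (K _ Hz).
  assert (S : (k ^ 2 * Re z ^ 2 <= sin (PI * Re z) ^ 2)%R).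
  { rewrite <- Rpow_mult_distr. rewrite <- (pow2_abs (k * Re z)), <- (pow2_abs (sin _)).
    apply pow_incr. split; [apply Rabs_pos|]. rewrite Rabs_mult, (Rabs_right k) by lra. exact K. }
  assert (T : (Im z ^ 2 <= (exp (PI * Im z) - exp (- (PI * Im z))) ^ 2)%R).
  { assert (G : forall t, (0 <= t)%R -> (t <= exp (PI * t) - exp (- (PI * t)))%R).
    { intros t Ht. pose proof (exp_ineq1_le (PI * t)).
      assert (exp (- (PI * t)) <= exp 0)%R by (apply exp_le; nra). rewrite exp_0 in *. nra. }
    destruct (Rle_dec 0 (Im z)) as [P|P].
    - apply pow_incr. split; auto.
    - replace (Im z ^ 2)%R with ((- Im z) ^ 2)%R by ring.
      replace ((exp (PI * Im z) - exp (- (PI * Im z))) ^ 2)%R with ((exp (PI * - Im z) - exp (- (PI * - Im z))) ^ 2)%R.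
      + apply pow_incr. split; [lra|]. apply G. lra.
      + replace (- (PI * - Im z))%R with (PI * Im z)%R by ring. replace (PI * - Im z)%R with (- (PI * Im z))%R by ring. ring. }
  assert (0 <= Im z ^ 2)%R by apply pow2_ge_0. assert (0 <= sin (PI * Re z) ^ 2)%R by apply pow2_ge_0.
  assert (k ^ 2 <= 1)%R by nra. nra.
Qed.

Lemma Cmod_le_sum z : (Cmod z <= Rabs (Re z) + Rabs (Im z))%R.
Proof.
  destruct z as [x y]. replace ((x, y) : C) with (x + Ci * y) by (unfold Ci, Cmult, Cplus, RtoC; cbn [fst snd]; f_equal; ring).
  eapply Rle_trans; [apply Cmod_triangle|]. rewrite Cmod_mult, Cmod_Ci, !Cmod_R.
  right. unfold Ci, Cmult, Cplus, RtoC, Re, Im; cbn [fst snd]. rewrite Rmult_1_l. f_equal; f_equal; ring.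
Qed.

Lemma derivable_halving (F : R -> R) l : derivable_pt_lim F 0 l -> F 0%R = 0%R ->
  forall eps, (0 < eps)%R -> eventually (fun n => (Rabs (2 ^ n * F (/ 2 ^ n) - l) < eps)%R).
Proof.
  intros H H0 eps He. destruct (H eps He) as [d Hd].
  destruct (pow_lt_1_zero (/ 2) ltac:(rewrite Rabs_right; lra) d (cond_pos d)) as [N HN].
  exists N. intros n Hn. specialize (HN n Hn). rewrite pow_inv in HN.
  assert (P : (0 < 2 ^ n)%R) by (apply pow_lt; lra).
  specialize (Hd (/ 2 ^ n)%R ltac:(apply Rinv_neq_0_compat; lra) HN).
  rewrite Rplus_0_l, H0 in Hd.
  replace (2 ^ n * F (/ 2 ^ n) - l)%R with ((F (/ 2 ^ n) - 0) / / 2 ^ n - l)%R by (field; lra). exact Hd.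
Qed.

(** The derivative at h = 0 of h -> sn(h z), taken along h = 2^(-n). *)
Lemma sn_scale_clim z : clim (fun n => 2 ^ n * sn (z / 2 ^ n)) (2 * PI * Ci * z).
Proof.
  destruct z as [x y].
  set (Fr := fun h : R => (exp (- (PI * h * y)) * cos (PI * h * x) - exp (PI * h * y) * cos (PI * h * x))%R).
  set (Fi := fun h : R => (exp (- (PI * h * y)) * sin (PI * h * x) + exp (PI * h * y) * sin (PI * h * x))%R).
  assert (E : forall h : R, sn (h * (x, y)) = (Fr h, Fi h)).
  { intros h. unfold sn. rewrite !e_cos_sin.
    assert (I1 : Im (h * (x, y) / 2) = (h * y / 2)%R) by (rewrite Im_div_R, im_scal_l by lra; reflexivity).
    assert (R1 : Re (h * (x, y) / 2) = (h * x / 2)%R).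
    { unfold Cdiv. rewrite <- RtoC_inv by lra. now rewrite re_scal_r, re_scal_l. }
    change (Im (- (h * (x, y) / 2))) with (- Im (h * (x, y) / 2))%R.
    change (Re (- (h * (x, y) / 2))) with (- Re (h * (x, y) / 2))%R.
    rewrite I1, R1. unfold Fr, Fi, Cminus, Cplus, Copp; cbn [fst snd].
    replace (2 * PI * - (h * x / 2))%R with (- (PI * h * x))%R by field.
    replace (2 * PI * (h * x / 2))%R with (PI * h * x)%R by field.
    replace (- (2 * PI * - (h * y / 2)))%R with (PI * h * y)%R by field.
    replace (- (2 * PI * (h * y / 2)))%R with (- (PI * h * y))%R by field.
    rewrite cos_neg, sin_neg. f_equal; ring. }
  assert (Dr : derivable_pt_lim Fr 0 (- (2 * PI * y))%R).
  { apply is_derive_Reals. unfold Fr. auto_derive; auto.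
    rewrite !Rmult_0_r, !Rmult_0_l, Ropp_0, exp_0, cos_0, sin_0. ring. }
  assert (Di : derivable_pt_lim Fi 0 (2 * PI * x)%R).
  { apply is_derive_Reals. unfold Fi. auto_derive; auto.
    rewrite !Rmult_0_r, !Rmult_0_l, Ropp_0, exp_0, cos_0, sin_0. ring. }
  intros eps He.
  assert (He2 : (0 < eps / 2)%R) by lra.
  assert (F0 : Fr 0%R = 0%R).
  { unfold Fr. rewrite !Rmult_0_r, !Rmult_0_l, Ropp_0, exp_0, cos_0. ring. }
  assert (G0 : Fi 0%R = 0%R).
  { unfold Fi. rewrite !Rmult_0_r, !Rmult_0_l, sin_0. ring. }
  generalize (filter_and _ _ (derivable_halving _ _ Dr F0 _ He2) (derivable_halving _ _ Di G0 _ He2)).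
  apply filter_imp. intros n [A B].
  assert (P : (2 ^ n)%R <> 0%R) by (apply pow_nonzero; lra).
  replace ((x, y) / 2 ^ n) with (RtoC (/ 2 ^ n) * (x, y)).
  2: { rewrite RtoC_inv, RtoC_pow by auto. unfold Cdiv. ring. }
  rewrite E. eapply Rle_lt_trans; [apply Cmod_le_sum|].
  rewrite <- RtoC_pow.
  replace (Re ((2 ^ n)%R * (Fr (/ 2 ^ n)%R, Fi (/ 2 ^ n)%R) - 2 * PI * Ci * (x, y)))
    with (2 ^ n * Fr (/ 2 ^ n) - - (2 * PI * y))%R
    by (unfold Re, Cminus, Cplus, Copp, Cmult, Ci, RtoC; cbn [fst snd]; ring).
  replace (Im ((2 ^ n)%R * (Fr (/ 2 ^ n)%R, Fi (/ 2 ^ n)%R) - 2 * PI * Ci * (x, y)))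
    with (2 ^ n * Fi (/ 2 ^ n) - (2 * PI * x))%R
    by (unfold Im, Cminus, Cplus, Copp, Cmult, Ci, RtoC; cbn [fst snd]; ring).
  lra.
Qed.

(** The symmetric residues modulo 2^n. Each step adjoins to k its other lift modulo the next power,
    as the duplication formula does; and |k| <= 2^(n-1) keeps k / 2^n within the range of
    [sn_lower]. *)
Fixpoint residues (n : nat) : list Z :=
  match n with
  | O => 0%Z :: nil
  | S m => residues m ++ map (fun k => if (k <? 0)%Z then (k + 2 ^ Z.of_nat m)%Z else (k - 2 ^ Z.of_nat m)%Z) (residues m)
  end.

Lemma residues_spec n k : In k (residues n) <-> (- 2 ^ Z.of_nat n <= 2 * k < 2 ^ Z.of_nat n)%Z.
Proof.
  revert k. induction n as [|n IH]; intros k.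
  - change (2 ^ Z.of_nat 0)%Z with 1%Z. cbn [residues In]. split; [intros [<-|[]]; lia|intros H; left; lia].
  - cbn [residues]. rewrite in_app_iff, in_map_iff, Nat2Z.inj_succ, Z.pow_succ_r by lia.
    assert (P : (0 < 2 ^ Z.of_nat n)%Z) by (apply Z.pow_pos_nonneg; lia).
    rewrite IH. set (N := (2 ^ Z.of_nat n)%Z) in *. split.
    + intros [H|(j & E & Hj)]; [lia|]. apply IH in Hj. fold N in Hj. destruct (Z.ltb_spec j 0); lia.
    + intros H. destruct (Z_le_gt_dec (- N) (2 * k)); [destruct (Z_lt_le_dec (2 * k) N)|]; [left; lia| |]; right.
      * exists (k - N)%Z. rewrite IH. fold N. destruct (Z.ltb_spec (k - N) 0); lia.
      * exists (k + N)%Z. rewrite IH. fold N. destruct (Z.ltb_spec (k + N) 0); lia.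
Qed.

Lemma residues_NoDup n : NoDup (residues n).
Proof.
  induction n as [|n IH]; [constructor; [intros []|constructor]|].
  cbn [residues]. assert (P : (0 < 2 ^ Z.of_nat n)%Z) by (apply Z.pow_pos_nonneg; lia).
  apply NoDup_app; auto.
  - apply NoDup_map_NoDup_ForallPairs; auto. intros a b Ha Hb. apply residues_spec in Ha, Hb.
    destruct (Z.ltb_spec a 0), (Z.ltb_spec b 0); lia.
  - intros a Ha Hm. apply in_map_iff in Hm. destruct Hm as (b & E & Hb). apply residues_spec in Ha, Hb.
    destruct (Z.ltb_spec b 0); lia.
Qed.

Lemma C2pow_nz n : 2 ^ n <> 0.
Proof. apply Cpow_nz. auto. Qed.

Lemma RtoC_IZR_pow n : RtoC (IZR (2 ^ Z.of_nat n)) = 2 ^ n.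
Proof. rewrite <- pow_IZR, RtoC_pow. reflexivity. Qed.

Lemma lsum_ext_all {I} (f g : I -> C) l : (forall i, f i = g i) -> lsum f l = lsum g l.
Proof. intros H. apply lsum_ext. auto. Qed.

Lemma sn_dup z : sn z = sn (z / 2) * (e (z / 4) + e (- (z / 4))).
Proof.
  unfold sn. replace (z / 2 / 2) with (z / 4) by field.
  replace (z / 2) with (z / 4 + z / 4) by field. replace (- (z / 4 + z / 4)) with (- (z / 4) + - (z / 4)) by ring.
  rewrite !e_add. ring.
Qed.

Lemma sn_div_pow u n k : sn u <> 0 -> sn ((u + IZR k) / 2 ^ n) <> 0.
Proof.
  intros H. induction n as [|n IH].
  - replace ((u + IZR k) / 2 ^ 0) with (u + IZR k) by (simpl; field).
    rewrite sn_Z_add. apply Cmult_neq_0; auto.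
    intros E. pose proof (sgn_sq k) as S. rewrite E in S. apply C1_nz. rewrite <- S. ring.
  - intros E. apply IH. rewrite sn_dup.
    replace ((u + IZR k) / 2 ^ n / 2) with ((u + IZR k) / 2 ^ S n).
    + rewrite E. ring.
    + simpl. field. apply C2pow_nz.
Qed.

Lemma ct_residues u n : sn u <> 0 ->
  ct u = lsum (fun k => ct ((u + IZR k) / 2 ^ n) / 2 ^ n) (residues n).
Proof.
  intros H. induction n as [|n IH].
  - simpl. replace ((u + 0) / 1) with u by field. field.
  - rewrite IH. cbn [residues]. rewrite lsum_app, lsum_map, <- lsum_plus. apply lsum_ext_all.
    intros k. pose proof (C2pow_nz n) as N.
    rewrite ct_dup by (now apply sn_div_pow).
    replace ((u + IZR k) / 2 ^ n / 2) with ((u + IZR k) / 2 ^ S n) by (simpl; field; auto).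
    (* Duplication yields the index k + 2^n; for k >= 0 the period 1 of [ct] brings it back to k -
       2^n. *)
    set (k' := if (k <? 0)%Z then (k + 2 ^ Z.of_nat n)%Z else (k - 2 ^ Z.of_nat n)%Z).
    assert (E : ct (((u + IZR k) / 2 ^ n + 1) / 2) = ct ((u + IZR k') / 2 ^ S n)).
    { unfold k'. destruct (k <? 0)%Z.
      - f_equal. push. rewrite RtoC_IZR_pow. simpl. field; auto.
      - rewrite <- (ct_1 ((u + IZR (k - _)) / _)). f_equal. push. rewrite RtoC_IZR_pow. simpl. field; auto. }
    rewrite E. simpl. field; auto.
Qed.

Lemma ct_diff u v : sn u <> 0 -> sn v <> 0 -> ct u - ct v = 2 * sn (v - u) / (sn u * sn v).
Proof.
  intros Hu Hv. unfold ct.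
  replace ((e (u / 2) + e (- (u / 2))) / sn u - (e (v / 2) + e (- (v / 2))) / sn v)
   with (((e (u / 2) + e (- (u / 2))) * sn v - (e (v / 2) + e (- (v / 2))) * sn u) / (sn u * sn v)) by (field; auto).
  f_equal. unfold sn.
  replace ((v - u) / 2) with (v / 2 + - (u / 2)) by field.
  replace (- (v / 2 + - (u / 2))) with (- (v / 2) + u / 2) by ring.
  rewrite !e_add. ring.
Qed.

Lemma sum_le_inv_sq : sum_le (fun n : nat => / (INR (S n)) ^ 2)%R 2.
Proof.
  apply sum_le_nat.
  - intros n. left. apply Rinv_0_lt_compat, pow_lt, lt_0_INR. lia.
  - intros n. apply Rle_trans with (2 - 2 * / INR (S n))%R.
    + induction n as [|n IH]; [simpl; lra|].
      rewrite seq_S, rsum_app. cbn [rsum fold_right]. rewrite Nat.add_0_l, Rplus_0_r.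
      apply Rle_trans with (2 - 2 * / INR (S n) + / INR (S n) ^ 2)%R; [lra|].
      rewrite (S_INR (S n)). assert (P : (1 <= INR (S n))%R) by (rewrite S_INR; pose proof (pos_INR n); lra).
      set (t := INR (S n)) in *.
      assert (Q : (2 - 2 * / (t + 1) - (2 - 2 * / t + / t ^ 2) = (t - 1) / (t ^ 2 * (t + 1)))%R) by (field; lra).
      assert (0 <= (t - 1) / (t ^ 2 * (t + 1)))%R; [|lra].
      apply Rmult_le_pos; [lra|]. left. apply Rinv_0_lt_compat. apply Rmult_lt_0_compat; [apply pow_lt|]; lra.
    + assert (0 < / INR (S n))%R by (apply Rinv_0_lt_compat, lt_0_INR; lia). lra.
Qed.

Lemma sum_le_Z_inv_sq : sum_le (fun k : Z => / (1 + Rabs (IZR k)) ^ 2)%R 4.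
Proof.
  replace 4%R with (2 + 2)%R by ring. apply sum_le_Z.
  - intros k. left. apply Rinv_0_lt_compat, pow_lt. pose proof (Rabs_pos (IZR k)). lra.
  - eapply sum_le_mono; [|exact sum_le_inv_sq]. intros n; cbv beta.
    rewrite <- INR_IZR_INZ, Rabs_right by (apply Rle_ge, pos_INR). rewrite S_INR. right. f_equal. f_equal. ring.
  - eapply sum_le_mono; [|exact sum_le_inv_sq]. intros n; cbv beta.
    rewrite opp_IZR, Rabs_Ropp, <- INR_IZR_INZ, Rabs_right by (apply Rle_ge, pos_INR).
    apply Rinv_le_contravar.
    + apply pow_lt, lt_0_INR. lia.
    + apply pow_incr. pose proof (pos_INR (S n)). lra.
Qed.

Lemma list_min_pos {I} (a : I -> R) (l : list I) : (forall i, 0 < a i)%R ->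
  exists d, (0 < d)%R /\ forall i, In i l -> (d <= a i)%R.
Proof.
  intros H. induction l as [|x l (d & Hd & IH)].
  - exists 1%R. split; [lra|]. intros i [].
  - exists (Rmin d (a x)). split; [now apply Rmin_glb_lt|].
    intros i [<-|Hi]; [apply Rmin_r|]. eapply Rle_trans; [apply Rmin_l|auto].
Qed.

Lemma shift_lower (u : C) : (forall k : Z, u + IZR k <> 0) ->
  exists d, (0 < d)%R /\ forall k : Z, (d * (1 + Rabs (IZR k)) <= Cmod (u + IZR k))%R.
Proof.
  (* For |k| >= 2 |u| + 1 the triangle inequality suffices, with constant 1/4; finitely many k
     remain, for which a minimum is taken. *)
  intros H. set (K := Z.to_nat (up (2 * Cmod u + 1))).
  assert (HK : (2 * Cmod u + 1 <= INR K)%R).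
  { unfold K. destruct (archimed (2 * Cmod u + 1)) as [A _]. pose proof (Cmod_ge_0 u).
    rewrite INR_IZR_INZ, Z2Nat.id; [lra|]. apply le_IZR. lra. }
  set (l := map (fun n => (Z.of_nat n - Z.of_nat K)%Z) (seq 0 (2 * K + 1))).
  destruct (list_min_pos (fun k : Z => Cmod (u + IZR k) / (1 + Rabs (IZR k)))%R l) as (d & Hd & L).
  { intros k. apply Rdiv_lt_0_compat; [apply Cmod_gt_0, H|]. pose proof (Rabs_pos (IZR k)); lra. }
  exists (Rmin d (1 / 4)). split; [apply Rmin_glb_lt; lra|]. intros k.
  pose proof (Rabs_pos (IZR k)) as Pk.
  destruct (in_dec Z.eq_dec k l) as [Hi|Hn].
  - specialize (L k Hi). apply Rle_trans with (d * (1 + Rabs (IZR k)))%R.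
    + apply Rmult_le_compat_r; [lra|apply Rmin_l].
    + apply Rmult_le_compat_r with (r := (1 + Rabs (IZR k))%R) in L; [|lra].
      replace (Cmod (u + IZR k) / (1 + Rabs (IZR k)) * (1 + Rabs (IZR k)))%R with (Cmod (u + IZR k)) in L by (field; lra).
      exact L.
  - assert (A : (INR K <= Rabs (IZR k))%R).
    { rewrite Rabs_Zabs, INR_IZR_INZ. apply IZR_le.
      destruct (Z_le_gt_dec (Z.of_nat K) (Z.abs k)); auto. exfalso. apply Hn.
      apply in_map_iff. exists (Z.to_nat (k + Z.of_nat K)). split; [lia|]. apply in_seq. lia. }
    pose proof (Cmod_triangle (u + IZR k) (- u)) as T. replace (u + IZR k + - u) with (RtoC (IZR k)) in T by ring.
    rewrite Cmod_opp, Cmod_R in T. pose proof (Cmod_ge_0 u).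
    apply Rle_trans with (1 / 4 * (1 + Rabs (IZR k)))%R.
    + apply Rmult_le_compat_r; [lra|apply Rmin_r].
    + assert (1 <= Rabs (IZR k))%R by lra. lra.
Qed.

Lemma sn_Z_nz u : sn u <> 0 -> forall k : Z, u + IZR k <> 0.
Proof.
  intros H k E. apply H. replace u with (0 + IZR (- k)).
  - rewrite sn_Z_add. unfold sn. replace (0 / 2) with (RtoC 0) by field. rewrite Copp_0, e_0. ring.
  - replace u with (u + IZR k - IZR k) by ring. rewrite E. push. ring.
Qed.

Lemma Cmod_sn_le (t : R) : (Cmod (sn t) <= 8 * Rabs t)%R.
Proof.
  apply Rsqr_incr_0; [|apply Cmod_ge_0|pose proof (Rabs_pos t); lra].
  rewrite !Rsqr_pow2, Cmod_sn2, re_RtoC, im_RtoC.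
  replace (PI * 0)%R with 0%R by ring. rewrite Ropp_0.
  assert (S : (Rabs (sin (PI * t)) <= 4 * Rabs t)%R).
  { assert (G : forall a, (0 <= a)%R -> (Rabs (sin a) <= a)%R).
    { intros a Ha. destruct (Req_dec a 0) as [->|N]; [rewrite sin_0, Rabs_R0; lra|].
      destruct (MVT_cor2 sin cos 0 a ltac:(lra) ltac:(intros; apply derivable_pt_lim_sin)) as (d & E & _).
      rewrite sin_0, !Rminus_0_r in E. rewrite E, Rabs_mult, (Rabs_right a) by lra.
      assert (Rabs (cos d) <= 1)%R by (apply Rabs_le, COS_bound). nra. }
    pose proof PI_4. pose proof PI_RGT_0.
    destruct (Rle_dec 0 t) as [P|P].
    - rewrite (Rabs_right t) by lra. eapply Rle_trans; [apply G; nra|nra].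
    - rewrite (Rabs_left t) by lra. replace (PI * t)%R with (- (PI * - t))%R by ring.
      rewrite sin_neg, Rabs_Ropp. eapply Rle_trans; [apply G; nra|nra]. }
  rewrite <- (pow2_abs (sin _)). pose proof (Rabs_pos (sin (PI * t))). pose proof (Rabs_pos t).
  replace ((exp 0 - exp 0) ^ 2)%R with 0%R by ring. nra.
Qed.

Lemma Re_div_R z (x : R) : x <> 0%R -> Re (z / x) = (Re z / x)%R.
Proof. intros H. unfold Cdiv. rewrite <- RtoC_inv by auto. apply re_scal_r. Qed.

(* pi cot(pi u) - pi cot(pi (u + 1/2)), from the duplication formula of cot and dominated convergence. *)
Lemma partial_fractions_ct u : sn u <> 0 -> sn (u + 1 / 2) <> 0 ->
  has_sum (fun k : Z => / ((u + IZR k) * (u + 1 / 2 + IZR k))) (2 * PI * Ci * (ct u - ct (u + 1 / 2))).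
Proof.
  intros Hu Hv. set (v := u + 1 / 2) in *.
  destruct (shift_lower u (sn_Z_nz u Hu)) as (d1 & Hd1 & L1).
  destruct (shift_lower v (sn_Z_nz v Hv)) as (d2 & Hd2 & L2).
  destruct sn_lower as (c & Hc & Hsn).
  pose proof PI_RGT_0 as Hpi.
  assert (NPI : 2 * PI * Ci <> 0).
  { apply Cmult_neq_0; [|apply Ci_neq0]. rewrite <- RtoC_mult. intros E. apply RtoC_inj in E. lra. }
  (* The n-fold duplication formula as a sum over all of Z, extended by 0, so that its total is ct u
     - ct v for every n. *)
  set (f := fun (n : nat) (k : Z) => if in_dec Z.eq_dec k (residues n) then
      (ct ((u + IZR k) / 2 ^ n) - ct ((v + IZR k) / 2 ^ n)) / 2 ^ n else 0).
  assert (Hf : forall n, has_sum (f n) (ct u - ct v)).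
  { intros n. rewrite (ct_residues u n Hu), (ct_residues v n Hv).
    replace (lsum (fun k : Z => ct ((u + IZR k) / 2 ^ n) / 2 ^ n) (residues n)
        - lsum (fun k : Z => ct ((v + IZR k) / 2 ^ n) / 2 ^ n) (residues n)) with (lsum (f n) (residues n)).
    - apply has_sum_finite; [apply residues_NoDup|]. intros k Hk. unfold f.
      destruct (in_dec Z.eq_dec k (residues n)); tauto.
    - transitivity (lsum (fun k : Z => ct ((u + IZR k) / 2 ^ n) / 2 ^ n + - (1) * (ct ((v + IZR k) / 2 ^ n) / 2 ^ n)) (residues n)).
      + apply lsum_ext. intros k Hk. unfold f. destruct (in_dec Z.eq_dec k (residues n)); [|tauto].
        field. apply C2pow_nz.
      + rewrite lsum_plus, lsum_scal. ring. }
  assert (Ef : forall n k, In k (residues n) -> f n k =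
     2 * (2 ^ n * sn (1 / 2 / 2 ^ n)) / ((2 ^ n * sn ((u + IZR k) / 2 ^ n)) * (2 ^ n * sn ((v + IZR k) / 2 ^ n)))).
  { intros n k Hk. unfold f. destruct (in_dec Z.eq_dec k (residues n)); [|tauto].
    rewrite ct_diff by (now apply sn_div_pow). pose proof (C2pow_nz n).
    replace ((v + IZR k) / 2 ^ n - (u + IZR k) / 2 ^ n) with (1 / 2 / 2 ^ n) by (unfold v; field; auto).
    field. repeat split; auto; now apply sn_div_pow. }
  set (a := fun k : Z => / (2 * PI * Ci) * / ((u + IZR k) * (v + IZR k))).
  set (B := (8 / (c * c * d1 * d2))%R).
  set (B2 := (/ (2 * PI) * / (d1 * d2))%R).
  assert (HB : (0 < B)%R) by (apply Rdiv_lt_0_compat; [lra|repeat apply Rmult_lt_0_compat; lra]).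
  assert (HB2 : (0 < B2)%R) by (apply Rmult_lt_0_compat; apply Rinv_0_lt_compat; [lra|now apply Rmult_lt_0_compat]).
  set (g := fun k : Z => ((B + B2) * / (1 + Rabs (IZR k)) ^ 2)%R).
  assert (Hg0 : forall k, (0 < / (1 + Rabs (IZR k)) ^ 2)%R).
  { intros k. apply Rinv_0_lt_compat, pow_lt. pose proof (Rabs_pos (IZR k)). lra. }
  assert (HM : sum_le g ((B + B2) * 4)%R) by (apply sum_le_scal; [lra|apply sum_le_Z_inv_sq]).
  assert (Hdom : eventually (fun n => forall k, (Cmod (f n k) <= g k)%R)).
  { destruct (pow_lt_1_zero (/ 2) ltac:(rewrite Rabs_right; lra) (/ (4 * (Rabs (Re u) + 1))) ) as [N HN].
    { pose proof (Rabs_pos (Re u)). apply Rinv_0_lt_compat. lra. }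
    exists N. intros n Hn k. specialize (HN n Hn).
    assert (P : (0 < 2 ^ n)%R) by (apply pow_lt; lra).
    destruct (in_dec Z.eq_dec k (residues n)) as [Hk|Hk].
    2: { unfold f. destruct (in_dec Z.eq_dec k (residues n)); [tauto|]. rewrite Cmod_0. unfold g.
         specialize (Hg0 k). nra. }
    rewrite (Ef n k Hk). rewrite pow_inv, Rabs_right in HN by (left; now apply Rinv_0_lt_compat).
    pose proof (Rabs_pos (Re u)) as Pu. pose proof (Rabs_pos (IZR k)) as Pk.
    assert (Hur : ((Rabs (Re u) + 1 / 2) / 2 ^ n <= 1 / 4)%R).
    { apply Rmult_le_reg_r with (2 ^ n)%R; auto.
      replace ((Rabs (Re u) + 1 / 2) / 2 ^ n * 2 ^ n)%R with (Rabs (Re u) + 1 / 2)%R by (field; lra).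
      apply Rmult_lt_compat_r with (r := (2 ^ n * (4 * (Rabs (Re u) + 1)))%R) in HN; [|apply Rmult_lt_0_compat; lra].
      replace (/ 2 ^ n * (2 ^ n * (4 * (Rabs (Re u) + 1))))%R with (4 * (Rabs (Re u) + 1))%R in HN by (field; lra).
      replace (/ (4 * (Rabs (Re u) + 1)) * (2 ^ n * (4 * (Rabs (Re u) + 1))))%R with (2 ^ n)%R in HN by (field; lra). lra. }
    assert (Hkr : (Rabs (IZR k) / 2 ^ n <= 1 / 2)%R).
    { apply residues_spec in Hk. apply Rmult_le_reg_r with (2 ^ n)%R; auto.
      replace (Rabs (IZR k) / 2 ^ n * 2 ^ n)%R with (Rabs (IZR k)) by (field; lra).
      rewrite pow_IZR. rewrite Rabs_Zabs.
      assert (Q : (IZR (2 * Z.abs k) <= IZR (2 ^ Z.of_nat n))%R) by (apply IZR_le; lia).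
      rewrite mult_IZR in Q. lra. }
    assert (RE : forall w, (Rabs (Re w) <= Rabs (Re u) + 1 / 2)%R ->
      (c * Cmod (w + IZR k) <= Cmod (2 ^ n * sn ((w + IZR k) / 2 ^ n)))%R).
    { intros w Hw. specialize (Hsn ((w + IZR k) / 2 ^ n)).
      assert (Hre : (Rabs (Re ((w + IZR k) / 2 ^ n)) <= 3 / 4)%R).
      { rewrite <- RtoC_pow, Re_div_R by lra. unfold Rdiv. rewrite Rabs_mult, (Rabs_right (/ _)) by (left; now apply Rinv_0_lt_compat).
        replace (Re (w + IZR k)) with (Re w + IZR k)%R by reflexivity.
        pose proof (Rabs_triang (Re w) (IZR k)) as T.
        apply Rle_trans with ((Rabs (Re u) + 1 / 2 + Rabs (IZR k)) * / 2 ^ n)%R.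
        - apply Rmult_le_compat_r; [left; now apply Rinv_0_lt_compat|lra].
        - unfold Rdiv in *. lra. }
      specialize (Hsn Hre). rewrite Cmod_mult, Cmod_pow, Cmod_R, (Rabs_right 2) by lra.
      apply Rmult_le_compat_l with (r := (2 ^ n)%R) in Hsn; [|lra].
      eapply Rle_trans; [|exact Hsn]. right.
      rewrite Cmod_div by apply C2pow_nz. rewrite Cmod_pow, Cmod_R, (Rabs_right 2) by lra. field. lra. }
    assert (U1 := RE u ltac:(lra)).
    assert (V1 : (c * Cmod (v + IZR k) <= Cmod (2 ^ n * sn ((v + IZR k) / 2 ^ n)))%R).
    { apply RE. replace (Re v) with (Re u + 1 / 2)%R.
      - eapply Rle_trans; [apply Rabs_triang|]. rewrite (Rabs_right (1 / 2)) by lra. lra.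
      - unfold v. replace (1 / 2) with (RtoC (1 / 2)) by (now rewrite RtoC_div by lra). reflexivity. }
    specialize (L1 k). specialize (L2 k).
    set (X := 2 ^ n * sn ((u + IZR k) / 2 ^ n)) in *. set (Y := 2 ^ n * sn ((v + IZR k) / 2 ^ n)) in *.
    assert (X0 : (c * d1 * (1 + Rabs (IZR k)) <= Cmod X)%R) by (eapply Rle_trans; [|exact U1]; rewrite Rmult_assoc; apply Rmult_le_compat_l; lra).
    assert (Y0 : (c * d2 * (1 + Rabs (IZR k)) <= Cmod Y)%R) by (eapply Rle_trans; [|exact V1]; rewrite Rmult_assoc; apply Rmult_le_compat_l; lra).
    assert (XX : (0 < c * d1 * (1 + Rabs (IZR k)))%R) by (repeat apply Rmult_lt_0_compat; lra).
    assert (YY : (0 < c * d2 * (1 + Rabs (IZR k)))%R) by (repeat apply Rmult_lt_0_compat; lra).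
    assert (X1 : X <> 0) by (apply Cmod_gt_0; lra). assert (Y1 : Y <> 0) by (apply Cmod_gt_0; lra).
    rewrite Cmod_div, !Cmod_mult by (now apply Cmult_neq_0).
    assert (Z : (Cmod 2 * (Cmod (2 ^ n) * Cmod (sn (1 / 2 / 2 ^ n))) <= 8)%R).
    { rewrite Cmod_pow, Cmod_R, (Rabs_right 2) by lra.
      replace (1 / 2 / 2 ^ n) with (RtoC (/ (2 * 2 ^ n))).
      2: { rewrite RtoC_inv, RtoC_mult, RtoC_pow by lra. field. apply C2pow_nz. }
      pose proof (Cmod_sn_le (/ (2 * 2 ^ n))) as Q.
      rewrite (Rabs_right (/ _)) in Q by (left; apply Rinv_0_lt_compat; lra).
      apply Rle_trans with (2 * (2 ^ n * (8 * / (2 * 2 ^ n))))%R.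
      - apply Rmult_le_compat_l; [lra|]. apply Rmult_le_compat_l; lra.
      - right. field. lra. }
    unfold g. apply Rle_trans with (B * / (1 + Rabs (IZR k)) ^ 2)%R.
    2: { specialize (Hg0 k). nra. }
    unfold Rdiv. apply Rle_trans with (8 * / ((c * d1 * (1 + Rabs (IZR k))) * (c * d2 * (1 + Rabs (IZR k)))))%R.
    - apply Rmult_le_compat; auto.
      + repeat apply Rmult_le_pos; apply Cmod_ge_0.
      + left. apply Rinv_0_lt_compat, Rmult_lt_0_compat; lra.
      + apply Rinv_le_contravar; [apply Rmult_lt_0_compat; lra|]. apply Rmult_le_compat; lra.
    - right. unfold B. field. repeat split; lra. }
  assert (Hlim : forall k eps, (0 < eps)%R -> eventually (fun n => (Cmod (f n k - a k) < eps)%R)).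
  { intros k eps He.
    assert (N1 := sn_Z_nz u Hu k). assert (N2 := sn_Z_nz v Hv k).
    assert (C1 : clim (fun n => 2 * (2 ^ n * sn (1 / 2 / 2 ^ n)) * / ((2 ^ n * sn ((u + IZR k) / 2 ^ n)) * (2 ^ n * sn ((v + IZR k) / 2 ^ n))))
        (2 * (2 * PI * Ci * (1 / 2)) * / ((2 * PI * Ci * (u + IZR k)) * (2 * PI * Ci * (v + IZR k))))).
    { apply flim_mult.
      - apply flim_mult; [apply flim_const|apply sn_scale_clim].
      - apply flim_inv.
        + repeat apply Cmult_neq_0; auto; try apply Ci_neq0; intros E; apply RtoC_inj in E; lra.
        + apply flim_mult; apply sn_scale_clim. }
    destruct (C1 eps He) as [N HN].
    assert (exists N', forall n, (N' <= n)%nat -> In k (residues n)) as [N' HN'].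
    { exists (S (Z.abs_nat k)). intros n Hn. apply residues_spec.
      assert (2 * Z.abs k < 2 ^ Z.of_nat n)%Z; [|lia].
      apply Z.lt_le_trans with (2 ^ (Z.abs k + 1))%Z.
      - rewrite Z.pow_add_r by lia. assert (Z.abs k < 2 ^ Z.abs k)%Z by (apply Z.pow_gt_lin_r; lia). lia.
      - apply Z.pow_le_mono_r; lia. }
    exists (N + N')%nat. intros n Hn. rewrite (Ef n k) by (apply HN'; lia).
    specialize (HN n ltac:(lia)). unfold a.
    replace (/ (2 * PI * Ci) * / ((u + IZR k) * (v + IZR k)))
      with (2 * (2 * PI * Ci * (1 / 2)) * / (2 * PI * Ci * (u + IZR k) * (2 * PI * Ci * (v + IZR k)))).
    - exact HN.
    - assert (NP : RtoC PI <> 0) by (intros E; apply RtoC_inj in E; lra). pose proof Ci_neq0.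
      field. auto. }
  assert (Ha : forall k, (Cmod (a k) <= g k)%R).
  { intros k. assert (N1 := sn_Z_nz u Hu k). assert (N2 := sn_Z_nz v Hv k). unfold a, g.
    specialize (L1 k). specialize (L2 k). pose proof (Rabs_pos (IZR k)) as Pk.
    rewrite Cmod_mult, !Cmod_inv, !Cmod_mult, Cmod_Ci, !Cmod_R, (Rabs_right 2), (Rabs_right PI), Rmult_1_r by (auto || lra || now apply Cmult_neq_0).
    apply Rle_trans with (B2 * / (1 + Rabs (IZR k)) ^ 2)%R.
    2: { specialize (Hg0 k). nra. }
    unfold B2. rewrite Rmult_assoc. apply Rmult_le_compat_l; [left; apply Rinv_0_lt_compat; lra|].
    rewrite <- Rinv_mult. apply Rinv_le_contravar.
    - apply Rmult_lt_0_compat; [apply Rmult_lt_0_compat; lra|apply pow_lt; lra].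
    - apply Rle_trans with (d1 * (1 + Rabs (IZR k)) * (d2 * (1 + Rabs (IZR k))))%R; [right; ring|].
      apply Rmult_le_compat; auto; apply Rmult_le_pos; lra. }
  assert (Aa : abs_sum a) by (apply (abs_sum_le_R a g _ Ha HM)).
  pose proof (abs_sum_has a Aa) as HA.
  assert (T : forall eps, (0 < eps)%R -> eventually (fun n : nat => (Cmod ((ct u - ct v) - csum a) < eps)%R)).
  { refine (tannery eventually f (fun _ => ct u - ct v) a (csum a) g _ _ HM Hdom Hlim Ha _ HA).
    - intros k. specialize (Hg0 k). unfold g. nra.
    - exists 0%nat. auto. }
  assert (E : ct u - ct v = csum a).
  { apply Cmod_lt_eq. intros eps He. destruct (T eps He) as [N HN]. apply (HN N). lia. }
  rewrite E. eapply has_sum_ext; [|apply (has_sum_scal (2 * PI * Ci) _ _ HA)].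
  intros k; cbv beta. unfold a. assert (N1 := sn_Z_nz u Hu k). assert (N2 := sn_Z_nz v Hv k).
  assert (NP : RtoC PI <> 0) by (intros E1; apply RtoC_inj in E1; lra). pose proof Ci_neq0.
  field. auto.
Qed.

(** * The inversion tau -> - 1 / (4 tau) *)

Lemma Cdiv_neq_0 (a b : C) : a <> 0 -> b <> 0 -> a / b <> 0.
Proof.
  intros Ha Hb E. apply Ha. transitivity (a / b * b); [field; auto|]. rewrite E. ring.
Qed.

Lemma sn_half_eq u : sn (u + 1 / 2) = Ci * (e (u / 2) + e (- (u / 2))).
Proof.
  unfold sn. replace ((u + 1 / 2) / 2) with (u / 2 + 1 / 4) by field.
  replace (- (u / 2 + 1 / 4)) with (- (u / 2) + - (1 / 4)) by ring.
  rewrite !e_add, (e_opp (1 / 4)), e_quarter.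
  replace (/ Ci) with (- Ci); [ring|].
  pose proof Ci_neq0. transitivity (- (Ci * Ci) / Ci); [field; auto|]. rewrite CiCi. field; auto.
Qed.

(** 1 / sin w is half the difference of the cotangents at w/2 and w/2 + pi/2, so
    [partial_fractions_ct] applies with u = w / 2. The factor 1/4 clears the halves in the
    denominators. *)
Lemma partial_fractions_csc w : sn w <> 0 ->
  has_sum (fun k : Z => / (w + IZR (2 * k)) - / (w + IZR (2 * k + 1))) (2 * PI * Ci / sn w).
Proof.
  intros H. pose proof (sn_dup w) as D.
  assert (Eh : sn (w / 2 + 1 / 2) = Ci * (e (w / 4) + e (- (w / 4)))).
  { rewrite sn_half_eq. replace (w / 2 / 2) with (w / 4) by field. reflexivity. }
  assert (Hu : sn (w / 2) <> 0) by (intros E; apply H; rewrite D, E; ring).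
  assert (Hs : e (w / 4) + e (- (w / 4)) <> 0) by (intros E; apply H; rewrite D, E; ring).
  pose proof Ci_neq0 as NC.
  assert (Hv : sn (w / 2 + 1 / 2) <> 0) by (rewrite Eh; now apply Cmult_neq_0).
  pose proof (partial_fractions_ct (w / 2) Hu Hv) as P.
  rewrite ct_diff in P by auto.
  replace (w / 2 + 1 / 2 - w / 2) with (0 + 1 / 2) in P by field.
  rewrite sn_half_eq in P. replace (0 / 2) with (RtoC 0) in P by field. rewrite Copp_0, e_0 in P.
  apply (has_sum_scal (1 / 4)) in P.
  replace (2 * PI * Ci / sn w) with (1 / 4 * (2 * PI * Ci * (2 * (Ci * (1 + 1)) / (sn (w / 2) * sn (w / 2 + 1 / 2))))).
  2: { rewrite D, Eh. field. auto. }
  eapply has_sum_ext; [|exact P]. intros k; cbv beta.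
  pose proof (sn_Z_nz w H (2 * k)) as N1. pose proof (sn_Z_nz w H (2 * k + 1)) as N2.
  replace (w + IZR (2 * k)) with (2 * (w / 2 + IZR k)) in * by (push; field).
  replace (w + IZR (2 * k + 1)) with (2 * (w / 2 + 1 / 2 + IZR k)) in * by (push; field).
  assert (M1 : w / 2 + IZR k <> 0) by (intros E; apply N1; rewrite E; ring).
  assert (M2 : w / 2 + 1 / 2 + IZR k <> 0) by (intros E; apply N2; rewrite E; ring).
  set (A := w / 2 + IZR k) in *.
  replace (w / 2 + 1 / 2 + IZR k) with (A + 1 / 2) in * by (unfold A; ring). clearbody A.
  assert (M3 : A * 2 + 1 <> 0).
  { intros E. apply M2. transitivity ((A * 2 + 1) / 2); [field|]. rewrite E. field. }
  field. auto.
Qed.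

Lemma has_sum_pair (f : Z -> C) : abs_sum f ->
  has_sum (fun j => f (2 * j)%Z + f (2 * j + 1)%Z) (csum f).
Proof.
  intros A.
  assert (A1 : abs_sum (fun j => f (2 * j)%Z)) by (apply (abs_sum_inj (fun j => (2 * j)%Z)); auto; intros; lia).
  assert (A2 : abs_sum (fun j => f (2 * j + 1)%Z)) by (apply (abs_sum_inj (fun j => (2 * j + 1)%Z)); auto; intros; lia).
  pose proof (abs_sum_has _ A1) as H1. pose proof (abs_sum_has _ A2) as H2.
  rewrite (csum_eq f _ (has_sum_parity f _ _ H1 H2)). now apply has_sum_plus.
Qed.

(** A lattice shifted by 1/2, so that it avoids 0. *)
Definition den (tau : C) (m n : Z) : C := 2 * IZR m * tau + IZR n + 1 / 2.

Lemma den_lower tau : (0 < Im tau)%R -> exists c, (0 < c)%R /\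
  forall m n, (c * (1 + Rabs (IZR m) + Rabs (IZR n)) <= Cmod (den tau m n))%R.
Proof.
  intros H. set (x := Re tau). set (y := Im tau) in *.
  (* The 4 settles m = 0. For m <> 0 the imaginary part gives |m| <= D / (2 y), the real part then
     bounds |n|, and 3/2 + |m| <= 5/2 |m| produces 5 / (4 y). *)
  set (K := (4 + Rabs x / y + 5 / (4 * y))%R).
  assert (P1 : (0 <= Rabs x / y)%R) by (apply Rmult_le_pos; [apply Rabs_pos|left; now apply Rinv_0_lt_compat]).
  assert (P2 : (0 < 5 / (4 * y))%R) by (apply Rdiv_lt_0_compat; lra).
  assert (HK : (0 < K)%R) by (unfold K; lra).
  exists (/ K)%R. split; [now apply Rinv_0_lt_compat|]. intros m n.
  assert (RI : den tau m n = (2 * IZR m * x + IZR n + 1 / 2, 2 * IZR m * y)%R).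
  { unfold den. rewrite <- RtoC_div by lra. unfold x, y. destruct tau as [a b].
    unfold Cplus, Cmult, RtoC, Re, Im; cbn [fst snd]. f_equal; field. }
  set (D := Cmod (den tau m n)).
  assert (B1 : (Rabs (2 * IZR m * x + IZR n + 1 / 2) <= D)%R).
  { unfold D. rewrite RI. apply (re_le_Cmod (_, _)). }
  assert (B2 : (Rabs (2 * IZR m * y) <= D)%R).
  { unfold D. rewrite RI. eapply Rle_trans; [apply Rmax_r|]. apply (Rmax_Cmod (_, _)). }
  clearbody D.
  apply Rmult_le_reg_l with K; auto. rewrite <- Rmult_assoc, Rinv_r, Rmult_1_l by lra.
  destruct (Z.eq_dec m 0) as [->|Hm].
  - replace (2 * 0 * x + IZR n + 1 / 2)%R with (IZR n + 1 / 2)%R in B1 by ring.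
    rewrite Rabs_R0, Rplus_0_r.
    assert (Q : (1 + Rabs (IZR n) <= 4 * Rabs (IZR n + 1 / 2))%R).
    { destruct (Z_le_gt_dec 0 n) as [Hn|Hn].
      - assert (0 <= IZR n)%R by (apply IZR_le; lia). rewrite !Rabs_right by lra. lra.
      - assert (IZR n <= -1)%R by (apply IZR_le; lia). rewrite !Rabs_left by lra. lra. }
    assert (0 <= D)%R by (pose proof (Rabs_pos (IZR n + 1 / 2)); lra).
    unfold K. nra.
  - rewrite !Rabs_mult, (Rabs_right 2), (Rabs_right y) in B2 by lra.
    assert (M1 : (1 <= Rabs (IZR m))%R) by (rewrite Rabs_Zabs; apply IZR_le; lia).
    assert (N1 : (Rabs (IZR n) <= D + 1 / 2 + 2 * Rabs (IZR m) * Rabs x)%R).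
    { replace (IZR n) with ((2 * IZR m * x + IZR n + 1 / 2) + (- (1 / 2) + - (2 * IZR m * x)))%R at 1 by ring.
      eapply Rle_trans; [apply Rabs_triang|].
      pose proof (Rabs_triang (- (1 / 2)) (- (2 * IZR m * x))) as T.
      rewrite !Rabs_Ropp, !Rabs_mult, (Rabs_right (1 / 2)), (Rabs_right 2) in T by lra. lra. }
    assert (M2 : (Rabs (IZR m) <= D / (2 * y))%R).
    { apply Rmult_le_reg_r with (2 * y)%R; [lra|]. replace (D / (2 * y) * (2 * y))%R with D by (field; lra). lra. }
    assert (N2 : (2 * Rabs (IZR m) * Rabs x <= Rabs x / y * D)%R).
    { replace (Rabs x / y * D)%R with (2 * (D / (2 * y)) * Rabs x)%R by (field; lra).
      apply Rmult_le_compat_r; [apply Rabs_pos|lra]. }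
    assert (E : (5 / (4 * y) * D = 5 / 2 * (D / (2 * y)))%R) by (field; lra).
    assert (0 <= D)%R. { assert (0 <= 2 * Rabs (IZR m) * y)%R by (repeat apply Rmult_le_pos; lra). lra. }
    unfold K. nra.
Qed.

Lemma sum_le_inv_cube s : (1 <= s)%R -> sum_le (fun n : nat => / (s + INR n) ^ 3)%R (2 / s ^ 2).
Proof.
  intros Hs. apply sum_le_nat.
  - intros n. left. apply Rinv_0_lt_compat, pow_lt. pose proof (pos_INR n). lra.
  - intros n. apply Rle_trans with (2 / s ^ 2 - 2 / (s + INR n) ^ 2)%R.
    + induction n as [|n IH]; [simpl; rewrite Rplus_0_r; lra|].
      rewrite seq_S, rsum_app. cbn [rsum fold_right]. rewrite Nat.add_0_l, Rplus_0_r, S_INR.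
      assert (P : (1 <= s + INR n)%R) by (pose proof (pos_INR n); lra).
      replace (s + (INR n + 1))%R with (s + INR n + 1)%R by ring.
      set (t := (s + INR n)%R) in *.
      assert (Q : (2 / t ^ 2 - 2 / (t + 1) ^ 2 - / t ^ 3 = (3 * t ^ 2 - 1) / (t ^ 3 * (t + 1) ^ 2))%R) by (field; lra).
      assert (0 <= (3 * t ^ 2 - 1) / (t ^ 3 * (t + 1) ^ 2))%R; [|lra].
      apply Rmult_le_pos; [nra|]. left. apply Rinv_0_lt_compat. apply Rmult_lt_0_compat; apply pow_lt; lra.
    + assert (0 < 2 / (s + INR n) ^ 2)%R.
      { apply Rdiv_lt_0_compat; [lra|]. apply pow_lt. pose proof (pos_INR n). lra. }
      lra.
Qed.

Lemma sum_le_cube2 : sum_le (fun p : Z * Z => / (1 + Rabs (IZR (fst p)) + Rabs (IZR (snd p))) ^ 3)%R 16.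
Proof.
  apply sum_le_prod with (m := fun j => (4 * / (1 + Rabs (IZR j)) ^ 2)%R).
  - intros [j k]; cbn [fst snd]. left. apply Rinv_0_lt_compat, pow_lt.
    pose proof (Rabs_pos (IZR j)). pose proof (Rabs_pos (IZR k)). lra.
  - intros j; cbn [fst snd]. pose proof (Rabs_pos (IZR j)) as Pj. set (s := (1 + Rabs (IZR j))%R) in *.
    assert (Hs : (1 <= s)%R) by (unfold s; lra).
    replace (4 * / s ^ 2)%R with (2 / s ^ 2 + 2 / s ^ 2)%R by (field; lra).
    apply (sum_le_Z (fun k : Z => / (s + Rabs (IZR k)) ^ 3)%R).
    + intros k. left. apply Rinv_0_lt_compat, pow_lt. pose proof (Rabs_pos (IZR k)). lra.
    + eapply sum_le_mono; [|apply (sum_le_inv_cube s Hs)]. intros n; cbv beta.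
      rewrite <- INR_IZR_INZ, Rabs_right by (apply Rle_ge, pos_INR). lra.
    + eapply sum_le_mono; [|apply (sum_le_inv_cube s Hs)]. intros n; cbv beta.
      rewrite opp_IZR, Rabs_Ropp, <- INR_IZR_INZ, Rabs_right by (apply Rle_ge, pos_INR).
      pose proof (pos_INR n). rewrite S_INR. apply Rinv_le_contravar; [apply pow_lt; lra|].
      apply pow_incr. lra.
  - replace 16%R with (4 * 4)%R by ring. apply sum_le_scal; [lra|apply sum_le_Z_inv_sq].
Qed.

(** A mixed second difference of 1 / z over a 2 x 2 block: it decays like |z|^(-3), whereas the
    single terms are not absolutely summable over the lattice. *)
Definition block (tau : C) (p : Z * Z) : C :=
  / den tau (2 * fst p) (2 * snd p) - / den tau (2 * fst p) (2 * snd p + 1)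
  - (/ den tau (2 * fst p + 1) (2 * snd p) - / den tau (2 * fst p + 1) (2 * snd p + 1)).

Lemma abs_sum_block tau : (0 < Im tau)%R -> abs_sum (block tau).
Proof.
  intros H. destruct (den_lower tau H) as (c & Hc & L).
  assert (Nz : forall m n, den tau m n <> 0).
  { intros m n. apply Cmod_gt_0. eapply Rlt_le_trans; [|apply L].
    pose proof (Rabs_pos (IZR m)). pose proof (Rabs_pos (IZR n)). apply Rmult_lt_0_compat; lra. }
  set (g := fun p : Z * Z => (4 * Cmod tau / c ^ 3 * / (1 + Rabs (IZR (fst p)) + Rabs (IZR (snd p))) ^ 3)%R).
  pose proof (Cmod_ge_0 tau) as Pt.
  apply (abs_sum_le_R _ g (4 * Cmod tau / c ^ 3 * 16)%R).
  2: { apply sum_le_scal; [|apply sum_le_cube2]. apply Rmult_le_pos; [lra|]. left. apply Rinv_0_lt_compat, pow_lt; lra. }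
  intros [j k]. unfold block, g; cbn [fst snd].
  set (s := (1 + Rabs (IZR j) + Rabs (IZR k))%R).
  assert (Hs : (1 <= s)%R) by (unfold s; pose proof (Rabs_pos (IZR j)); pose proof (Rabs_pos (IZR k)); lra).
  assert (L' : forall m n, (Z.abs j <= Z.abs m)%Z -> (Z.abs k <= Z.abs n)%Z -> (Cmod (/ den tau m n) <= / (c * s))%R).
  { intros m n Hm Hn. rewrite Cmod_inv by auto. apply Rinv_le_contravar; [apply Rmult_lt_0_compat; lra|].
    eapply Rle_trans; [|apply L]. apply Rmult_le_compat_l; [lra|]. unfold s. rewrite !Rabs_Zabs.
    apply IZR_le in Hm, Hn. lra. }
  set (z1 := den tau (2 * j) (2 * k)). set (z2 := den tau (2 * j) (2 * k + 1)).
  set (z3 := den tau (2 * j + 1) (2 * k)). set (z4 := den tau (2 * j + 1) (2 * k + 1)).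
  assert (E : / z1 - / z2 - (/ z3 - / z4) = 2 * tau * (/ z2 * / z3 * / z4) + 2 * tau * (/ z1 * / z2 * / z3)).
  { assert (N1 : z1 <> 0) by apply Nz. assert (N2 : z2 <> 0) by apply Nz.
    assert (N3 : z3 <> 0) by apply Nz. assert (N4 : z4 <> 0) by apply Nz.
    assert (E2 : z2 = z1 + 1) by (unfold z1, z2, den; push; ring).
    assert (E3 : z3 = z1 + 2 * tau) by (unfold z1, z3, den; push; ring).
    assert (E4 : z4 = z1 + 2 * tau + 1) by (unfold z1, z4, den; push; ring).
    rewrite E2, E3, E4 in *. clearbody z1. field. auto. }
  rewrite E. eapply Rle_trans; [apply Cmod_triangle|]. rewrite !Cmod_mult, Cmod_R, (Rabs_right 2) by lra.
  assert (I1 : (Cmod (/ z1) <= / (c * s))%R) by (apply L'; lia).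
  assert (I2 : (Cmod (/ z2) <= / (c * s))%R) by (apply L'; lia).
  assert (I3 : (Cmod (/ z3) <= / (c * s))%R) by (apply L'; lia).
  assert (I4 : (Cmod (/ z4) <= / (c * s))%R) by (apply L'; lia).
  assert (T : forall a b d : C, (Cmod a <= / (c * s))%R -> (Cmod b <= / (c * s))%R -> (Cmod d <= / (c * s))%R ->
     (Cmod a * Cmod b * Cmod d <= / (c * s) * / (c * s) * / (c * s))%R).
  { intros a b d Ha Hb Hd. repeat apply Rmult_le_compat; auto; repeat apply Rmult_le_pos; apply Cmod_ge_0. }
  pose proof (T _ _ _ I2 I3 I4) as T1. pose proof (T _ _ _ I1 I2 I3) as T2.
  replace (4 * Cmod tau / c ^ 3 * / s ^ 3)%R with
    (2 * Cmod tau * (/ (c * s) * / (c * s) * / (c * s)) + 2 * Cmod tau * (/ (c * s) * / (c * s) * / (c * s)))%R by (field; lra).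
  apply Rplus_le_compat; (apply Rmult_le_compat_l; [lra|auto]).
Qed.

(** The cosecant expansion at w = 2 m tau + 1/2; the shift by 1/2 turns the sine into a cosine,
    hence the sign in 1 + q^(2m). *)
Lemma row_sum tau m : (0 < Im tau)%R ->
  has_sum (fun k => / den tau m (2 * k) - / den tau m (2 * k + 1))
    (2 * PI * (e (IZR m * tau) / (1 + e (IZR m * (2 * tau))))).
Proof.
  intros H. destruct (inv_1q_bound (2 * tau) ltac:(impos)) as (B & _ & HB).
  destruct (HB m) as (N & _).
  set (w := 2 * IZR m * tau + 1 / 2).
  assert (Es : sn w = Ci * (1 + e (IZR m * (2 * tau))) / e (IZR m * tau)).
  { unfold w. rewrite sn_half_eq. replace (2 * IZR m * tau / 2) with (IZR m * tau) by field.
    replace (IZR m * (2 * tau)) with (IZR m * tau + IZR m * tau) by ring. rewrite e_add, e_opp.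
    field. apply e_nz. }
  pose proof Ci_neq0 as NC. pose proof (e_nz (IZR m * tau)) as Ne.
  assert (Hw : sn w <> 0).
  { rewrite Es. apply Cdiv_neq_0; auto. now apply Cmult_neq_0. }
  pose proof (partial_fractions_csc w Hw) as P.
  replace (2 * PI * (e (IZR m * tau) / (1 + e (IZR m * (2 * tau))))) with (2 * PI * Ci / sn w).
  2: { rewrite Es. field. auto. }
  eapply has_sum_ext; [|exact P]. intros k; unfold den, w; cbv beta.
  f_equal; f_equal; ring.
Qed.

Lemma e_odd_nz u n : (0 < Im u)%R -> 1 - e ((2 * IZR n + 1) * u) <> 0.
Proof.
  intros H E.
  assert (E1 : e ((2 * IZR n + 1) * u) = 1) by (transitivity (1 - (1 - e ((2 * IZR n + 1) * u))); [ring|rewrite E; ring]).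
  apply (f_equal Cmod) in E1. rewrite Cmod_e, Cmod_1 in E1.
  replace (2 * IZR n + 1) with (RtoC (IZR (2 * n + 1))) in E1 by (push; ring).
  rewrite Im_scal_R in E1. rewrite <- exp_0 in E1. apply exp_inv in E1.
  pose proof PI_RGT_0. assert (IZR (2 * n + 1) <> 0)%R by (apply not_0_IZR; lia).
  assert (Q : (2 * PI * (IZR (2 * n + 1) * Im u) = 0)%R) by lra.
  apply Rmult_integral in Q. destruct Q as [Q|Q]; [lra|]. apply Rmult_integral in Q. destruct Q; lra.
Qed.

Definition inv4 (tau : C) : C := - (1) / (4 * tau).

Lemma H_nz tau : (0 < Im tau)%R -> tau <> 0.
Proof. intros H E. rewrite E in H. simpl in H. lra. Qed.

Lemma Im_neg_inv tau : (0 < Im tau)%R -> (0 < Im (- / tau))%R.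
Proof.
  intros H. destruct tau as [x y]. unfold Im, Cinv, Copp in *; cbn [fst snd] in *.
  unfold Rdiv. rewrite Ropp_mult_distr_l, Ropp_involutive.
  apply Rmult_lt_0_compat; auto. apply Rinv_0_lt_compat. nra.
Qed.

Lemma Im_inv4 tau : (0 < Im tau)%R -> (0 < Im (inv4 tau))%R.
Proof.
  intros H. unfold inv4. replace (- (1) / (4 * tau)) with (- / (4 * tau)).
  - apply Im_neg_inv. impos.
  - field. now apply H_nz.
Qed.

Definition csc_term (u : C) (n : Z) : C := e ((IZR n + 1 / 2) * u) / (1 - e ((2 * IZR n + 1) * u)).

(** Dividing by 2 tau exchanges the roles of m and n: the terms become 1 / (w + m) with w = (n +
    1/2) / (2 tau), and w / 2 = - (n + 1/2) u for u = -1 / (4 tau). *)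
Lemma col_sum tau n : (0 < Im tau)%R ->
  has_sum (fun j => / den tau (2 * j) n - / den tau (2 * j + 1) n)
    (PI * Ci / tau * csc_term (inv4 tau) n).
Proof.
  intros H. pose proof (H_nz tau H) as Nt. set (u := inv4 tau). pose proof (Im_inv4 tau H) as Hu. fold u in Hu.
  set (w := (IZR n + 1 / 2) / (2 * tau)).
  assert (Ew : w / 2 = - ((IZR n + 1 / 2) * u)) by (unfold w, u, inv4; field; auto).
  pose proof (e_odd_nz u n Hu) as N1.
  assert (Es : sn w = (1 - e ((2 * IZR n + 1) * u)) / e ((IZR n + 1 / 2) * u)).
  { unfold sn. rewrite Ew.
    replace (- - ((IZR n + 1 / 2) * u)) with ((IZR n + 1 / 2) * u) by ring.
    replace ((2 * IZR n + 1) * u) with ((IZR n + 1 / 2) * u + (IZR n + 1 / 2) * u) by field.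
    rewrite e_opp, e_add. field. apply e_nz. }
  pose proof (e_nz ((IZR n + 1 / 2) * u)) as Ne.
  assert (Hw : sn w <> 0).
  { rewrite Es. now apply Cdiv_neq_0. }
  pose proof (has_sum_scal (/ (2 * tau)) _ _ (partial_fractions_csc w Hw)) as P.
  replace (PI * Ci / tau * csc_term u n) with (/ (2 * tau) * (2 * PI * Ci / sn w)).
  2: { rewrite Es. unfold csc_term. field. auto. }
  eapply has_sum_ext; [|exact P]. intros j; cbv beta.
  pose proof (sn_Z_nz w Hw (2 * j)) as M1. pose proof (sn_Z_nz w Hw (2 * j + 1)) as M2.
  replace (den tau (2 * j) n) with (2 * tau * (w + IZR (2 * j))) by (unfold den, w; field; auto).
  replace (den tau (2 * j + 1) n) with (2 * tau * (w + IZR (2 * j + 1))) by (unfold den, w; field; auto).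
  field. auto.
Qed.

Lemma L1_half_sum tau : (0 < Im tau)%R ->
  abs_sum (fun m => sgn m * (e (IZR m * tau) / (1 + e (IZR m * (2 * tau))))) /\
  csum (fun m => sgn m * (e (IZR m * tau) / (1 + e (IZR m * (2 * tau))))) = L1 (tau + 1 / 2).
Proof.
  intros H.
  pose proof (abs_sum_LS (2 * tau) tau ltac:(rewrite Im_scal2; lra)) as A. split; [now apply abs_sum_sgn|].
  unfold L1, LS. apply csum_ext.
  2: { apply abs_sum_ex, abs_sum_LS. rewrite Im_scal2, Im_half. lra. }
  intros m.
  replace (IZR m * (tau + 1 / 2)) with (IZR m / 2 + IZR m * tau) by field.
  rewrite e_add, e_half_Z.
  rewrite (e_shift_eq (IZR m * (2 * (tau + 1 / 2))) (IZR m * (2 * tau)) m) by field. unfold Cdiv. ring.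
Qed.

Lemma sgn_msgn n : sgn (Z.of_nat n) = msgn n.
Proof.
  unfold sgn, msgn. induction n as [|n IH]; [reflexivity|].
  rewrite Nat2Z.inj_succ, Z.even_succ, <- Z.negb_even, Nat.even_succ, <- Nat.negb_even.
  destruct (Z.even (Z.of_nat n)), (Nat.even n); simpl in *; auto.
Qed.

(** The terms n and - n - 1 coincide, so the sum is twice the one over n >= 0, which [th2_DO] at u /
    2 evaluates. *)
Lemma csc_sum u : (0 < Im u)%R ->
  abs_sum (fun n => sgn n * csc_term u n) /\ csum (fun n => sgn n * csc_term u n) = th2 u * th2 u / 2.
Proof.
  intros H. assert (H2 : (0 < Im (u / 2))%R) by (now apply Im_half_scal).
  pose proof (has_DO_chi4 (u / 2) H2) as P.
  pose proof (th2_DO (u / 2) H2) as E. replace (2 * (u / 2)) with u in E by field.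
  assert (A : abs_sum (fun i => msgn i * Uq (e (u / 2)) i)).
  { apply abs_sum_Uq_lin; [now apply Cmod_e_lt1|]. intros i. unfold msgn.
    assert (1 <= INR (S i) ^ 3)%R.
    { rewrite <- (pow1 3) at 1. apply pow_incr. rewrite S_INR. pose proof (pos_INR i). lra. }
    destruct (Nat.even i); rewrite ?Cmod_opp, ?Cmod_1; lra. }
  assert (E1 : forall n : nat, sgn (Z.of_nat n) * csc_term u (Z.of_nat n) = msgn n * Uq (e (u / 2)) n).
  { intros n. rewrite sgn_msgn. unfold csc_term, Uq. rewrite e_pow, <- e_add.
    rewrite plus_INR, mult_INR. change (INR 2) with 2%R. change (INR 1) with 1%R.
    do 2 f_equal; [|f_equal]; f_equal; push; field. }
  assert (E2 : forall n : nat, sgn (- Z.of_nat (S n)) * csc_term u (- Z.of_nat (S n)) = msgn n * Uq (e (u / 2)) n).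
  { intros n. rewrite <- E1.
    replace (- Z.of_nat (S n))%Z with (- Z.of_nat n - 1)%Z by lia. rewrite sgn_neg_shift. unfold csc_term.
    replace ((IZR (- Z.of_nat n - 1) + 1 / 2) * u) with (- ((IZR (Z.of_nat n) + 1 / 2) * u)) by (push; field).
    replace ((2 * IZR (- Z.of_nat n - 1) + 1) * u) with (- ((2 * IZR (Z.of_nat n) + 1) * u)) by (push; field).
    pose proof (e_odd_nz u (Z.of_nat n) H) as N. revert N.
    replace ((2 * IZR (Z.of_nat n) + 1) * u) with ((IZR (Z.of_nat n) + 1 / 2) * u + (IZR (Z.of_nat n) + 1 / 2) * u) by field.
    rewrite !e_opp, e_add. pose proof (e_nz ((IZR (Z.of_nat n) + 1 / 2) * u)) as Ne.
    set (y := e ((IZR (Z.of_nat n) + 1 / 2) * u)) in *. intros N.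
    assert (N' : y * y - 1 <> 0) by (intros E0; apply N; transitivity (- (y * y - 1)); [ring|rewrite E0; ring]).
    field. auto. }
  split.
  - destruct A as [M HM]. exists (M + M)%R. apply sum_le_Z.
    + intros; apply Cmod_ge_0.
    + eapply sum_le_mono; [|exact HM]. intros n; cbv beta. rewrite E1. lra.
    + eapply sum_le_mono; [|exact HM]. intros n; cbv beta. rewrite E2. lra.
  - apply csum_eq. rewrite E.
    replace (4 * DO (fun n : nat => IZR (chi4 n)) (u / 2) / 2) with
     (DO (fun n : nat => IZR (chi4 n)) (u / 2) + DO (fun n : nat => IZR (chi4 n)) (u / 2)) by field.
    apply has_sum_Z.
    + eapply has_sum_ext; [|exact P]. intros n. symmetry. apply E1.
    + eapply has_sum_ext; [|exact P]. intros n. symmetry. apply E2.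
Qed.

(* Both sides are the lattice sum of (-1)^(m+n) / (2 m tau + n + 1/2), summed by rows and by columns;
   grouping 2 x 2 blocks makes it absolutely convergent. *)
Lemma th2_inv tau : (0 < Im tau)%R ->
  th2 (inv4 tau) * th2 (inv4 tau) = - (2 * Ci * tau) * (th4 tau * th4 tau).
Proof.
  intros H. pose proof (abs_sum_has _ (abs_sum_block tau H)) as HB. set (S := csum (block tau)) in *.
  assert (R : S = PI * (th4 tau * th4 tau)).
  { set (rho := fun m => 2 * PI * (e (IZR m * tau) / (1 + e (IZR m * (2 * tau))))).
    assert (H1 : has_sum (fun j => rho (2 * j)%Z - rho (2 * j + 1)%Z) S).
    { apply (has_sum_rows _ _ _ HB). intros j. unfold block; cbn [fst snd]. apply has_sum_minus; apply row_sum; auto. }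
    destruct (L1_half_sum tau H) as [A E].
    pose proof (has_sum_scal (2 * PI) _ _ (has_sum_pair _ A)) as H2. rewrite E in H2.
    replace (PI * (th4 tau * th4 tau)) with (2 * PI * L1 (tau + 1 / 2)).
    2: { unfold th4. rewrite <- L1_th by impos. ring. }
    apply (has_sum_unique _ _ _ H1). eapply has_sum_ext; [|exact H2].
    intros j; cbv beta. rewrite sgn_even, sgn_odd. unfold rho. ring. }
  assert (T : S = PI * Ci / tau * (th2 (inv4 tau) * th2 (inv4 tau) / 2)).
  { set (sg := fun n => PI * Ci / tau * csc_term (inv4 tau) n).
    assert (H1 : has_sum (fun k => sg (2 * k)%Z - sg (2 * k + 1)%Z) S).
    { apply (has_sum_cols _ _ _ HB). intros k. unfold block; cbn [fst snd].
      eapply has_sum_ext; [|apply (has_sum_minus _ _ _ _ (col_sum tau (2 * k) H) (col_sum tau (2 * k + 1) H))].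
      intros j; cbv beta. ring. }
    destruct (csc_sum (inv4 tau) (Im_inv4 tau H)) as [A E].
    pose proof (has_sum_scal (PI * Ci / tau) _ _ (has_sum_pair _ A)) as H2. rewrite E in H2.
    apply (has_sum_unique _ _ _ H1). eapply has_sum_ext; [|exact H2].
    intros j; cbv beta. rewrite sgn_even, sgn_odd. unfold sg. ring. }
  pose proof (H_nz tau H) as Nt. pose proof Ci_neq0 as NC. pose proof PI_RGT_0.
  assert (NP : RtoC PI <> 0) by (intros E1; apply RtoC_inj in E1; lra).
  rewrite R in T.
  assert (Q : th2 (inv4 tau) * th2 (inv4 tau) = 2 * tau / (PI * Ci) * (PI * (th4 tau * th4 tau))).
  { rewrite T. field. auto. }
  rewrite Q.
  replace (- (2 * Ci * tau)) with (2 * tau * - (Ci * Ci) / Ci) by (field; auto).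
  rewrite CiCi. field. auto.
Qed.

(** Classically the principal square root of - 2 i tau. Only its square, and later the product of
    two of its values, are determined. *)
Definition th_factor (tau : C) : C := th3 (inv4 tau) / th3 tau.

Lemma inv4_half tau : (0 < Im tau)%R -> inv4 tau / 2 = inv4 (2 * tau).
Proof. intros H. unfold inv4. field. now apply H_nz. Qed.

(** This is [th2_inv] at 2 tau, rewritten by [th2_sq] on the left and [th34] on the right. *)
Lemma th23_inv tau : (0 < Im tau)%R ->
  th2 (inv4 tau) * th3 (inv4 tau) = - (2 * Ci * tau) * (th3 tau * th4 tau).
Proof.
  intros H. pose proof (Im_inv4 tau H) as Hi.
  pose proof (th2_sq (inv4 tau / 2) (Im_half_scal _ Hi)) as E.
  replace (2 * (inv4 tau / 2)) with (inv4 tau) in E by field.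
  rewrite inv4_half, th2_inv, <- th34 in E by (auto; impos).
  transitivity (2 * th2 (inv4 tau) * th3 (inv4 tau) / 2); [field|]. rewrite <- E. field.
Qed.

Lemma th3_inv tau : (0 < Im tau)%R -> th3 (inv4 tau) = th_factor tau * th3 tau.
Proof. intros H. unfold th_factor. field. now apply th3_nz. Qed.

(** The square of [th23_inv] divided by [th2_inv]. *)
Lemma th_factor_sq tau : (0 < Im tau)%R -> th_factor tau * th_factor tau = - (2 * Ci * tau).
Proof.
  intros H. pose proof (th23_inv tau H) as E1. pose proof (th2_inv tau H) as E2.
  pose proof (th3_nz tau H) as N3. pose proof (th4_nz tau H) as N4. pose proof (H_nz tau H) as Nt.
  set (k := - (2 * Ci * tau)) in *.
  assert (Nk : k <> 0).
  { unfold k. intros E. apply Nt. transitivity (- (2 * Ci * tau) * Ci / 2).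
    - replace (- (2 * Ci * tau) * Ci / 2) with (- (Ci * Ci) * tau) by field. rewrite CiCi. ring.
    - rewrite E. field. }
  assert (Q : k * (th4 tau * th4 tau) * (th3 (inv4 tau) * th3 (inv4 tau)) = k * k * (th3 tau * th3 tau) * (th4 tau * th4 tau)).
  { rewrite <- E2. transitivity (th2 (inv4 tau) * th3 (inv4 tau) * (th2 (inv4 tau) * th3 (inv4 tau))); [ring|]. rewrite E1. ring. }
  unfold th_factor.
  transitivity (k * (th4 tau * th4 tau) * (th3 (inv4 tau) * th3 (inv4 tau)) / (k * (th4 tau * th4 tau) * (th3 tau * th3 tau))).
  { field. auto. }
  rewrite Q. field. auto.
Qed.

Lemma th_factor_nz tau : (0 < Im tau)%R -> th_factor tau <> 0.
Proof.
  intros H. apply Cdiv_neq_0; apply th3_nz; auto. now apply Im_inv4.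
Qed.

Lemma th2_inv_factor tau : (0 < Im tau)%R -> th2 (inv4 tau) = th_factor tau * th4 tau.
Proof.
  intros H. pose proof (th23_inv tau H) as E. rewrite <- th_factor_sq, th3_inv in E by auto.
  pose proof (th_factor_nz tau H) as N. pose proof (th3_nz tau H) as N3.
  transitivity (th2 (inv4 tau) * (th_factor tau * th3 tau) / (th_factor tau * th3 tau)); [field; auto|].
  rewrite E. field. auto.
Qed.

(** * Continuity in tau and the sign of the multiplier *)

Definition at_point (z : C) (P : C -> Prop) : Prop :=
  exists d, (0 < d)%R /\ forall w, (Cmod (w - z) < d)%R -> P w.

#[export] Instance at_point_filter z : Filter (at_point z).
Proof.
  constructor.
  - exists 1%R. split; [lra|auto].
  - intros P Q (d1 & H1 & K1) (d2 & H2 & K2). exists (Rmin d1 d2).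
    split; [now apply Rmin_glb_lt|]. intros w Hw.
    split; [apply K1|apply K2]; (eapply Rlt_le_trans; [exact Hw|]); [apply Rmin_l|apply Rmin_r].
  - intros P Q HPQ (d & H & K). exists d. auto.
Qed.

Lemma continuity_pt_eps (f : R -> R) x eps : continuity_pt f x -> (0 < eps)%R ->
  exists d, (0 < d)%R /\ forall y, (Rabs (y - x) < d)%R -> (Rabs (f y - f x) < eps)%R.
Proof.
  intros H He. destruct (H eps He) as (d & Hd & K). exists d. split; auto. intros y Hy.
  destruct (Req_dec x y) as [->|N].
  - now rewrite Rminus_diag, Rabs_R0.
  - apply (K y). repeat split; auto.
Qed.

Lemma e_cont_0 eps : (0 < eps)%R -> at_point 0 (fun z => (Cmod (e z - 1) < eps)%R).
Proof.
  intros He. set (ep := Rmin 1 (eps / 8)). assert (Hep : (0 < ep)%R) by (apply Rmin_glb_lt; lra).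
  assert (E1 : (ep <= 1)%R) by apply Rmin_l. assert (E2 : (ep <= eps / 8)%R) by apply Rmin_r.
  destruct (continuity_pt_eps exp 0 ep (derivable_continuous_pt _ _ (derivable_pt_exp 0)) Hep) as (d1 & H1 & K1).
  destruct (continuity_pt_eps cos 0 ep (continuity_cos 0) Hep) as (d2 & H2 & K2).
  destruct (continuity_pt_eps sin 0 ep (continuity_sin 0) Hep) as (d3 & H3 & K3).
  pose proof PI_RGT_0 as Hpi.
  set (d := (Rmin d1 (Rmin d2 d3) / (2 * PI))%R).
  assert (D0 : (0 < Rmin d1 (Rmin d2 d3))%R) by (repeat apply Rmin_glb_lt; auto).
  exists d. split; [apply Rdiv_lt_0_compat; lra|]. intros z Hz.
  replace (z - 0) with z in Hz by ring.
  assert (B : forall t, (Rabs t <= Cmod z)%R -> (Rabs (2 * PI * t - 0) < Rmin d1 (Rmin d2 d3))%R).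
  { intros t Ht. rewrite Rminus_0_r, Rabs_mult, (Rabs_right (2 * PI)) by lra.
    apply Rle_lt_trans with (2 * PI * Cmod z)%R; [apply Rmult_le_compat_l; lra|].
    apply Rmult_lt_compat_l with (r := (2 * PI)%R) in Hz; [|lra].
    unfold d in Hz. replace (2 * PI * (Rmin d1 (Rmin d2 d3) / (2 * PI)))%R with (Rmin d1 (Rmin d2 d3)) in Hz by (field; lra). exact Hz. }
  pose proof (B (Re z) (re_le_Cmod z)) as BR.
  assert (BI : (Rabs (2 * PI * (- Im z) - 0) < Rmin d1 (Rmin d2 d3))%R).
  { apply B. rewrite Rabs_Ropp. eapply Rle_trans; [apply Rmax_r|apply Rmax_Cmod]. }
  pose proof (Rmin_l d1 (Rmin d2 d3)). pose proof (Rmin_r d1 (Rmin d2 d3)).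
  pose proof (Rmin_l d2 d3). pose proof (Rmin_r d2 d3).
  specialize (K1 (2 * PI * - Im z)%R ltac:(lra)). specialize (K2 (2 * PI * Re z)%R ltac:(lra)). specialize (K3 (2 * PI * Re z)%R ltac:(lra)).
  rewrite exp_0 in K1. rewrite cos_0 in K2. rewrite sin_0, Rminus_0_r in K3.
  rewrite e_cos_sin. replace (- (2 * PI * Im z))%R with (2 * PI * - Im z)%R by ring.
  set (r := exp (2 * PI * - Im z)) in *. set (c := cos (2 * PI * Re z)) in *. set (s := sin (2 * PI * Re z)) in *.
  eapply Rle_lt_trans; [apply Cmod_le_sum|]. unfold Cminus, Cplus, Copp, RtoC, Re, Im; cbn [fst snd].
  rewrite Ropp_0, Rplus_0_r.
  apply Rabs_def2 in K1. apply Rabs_def2 in K2. apply Rabs_def2 in K3.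
  assert (A1 : (Rabs (r * c + -1) <= 3 * ep)%R).
  { replace (r * c + -1)%R with ((r - 1) * (c - 1) + (r - 1) + (c - 1))%R by ring. apply Rabs_le. nra. }
  assert (A2 : (Rabs (r * s) <= 2 * ep)%R) by (apply Rabs_le; nra).
  change (Rabs (r * c + -1) + Rabs (r * s) < eps)%R. lra.
Qed.

Lemma flim_id z : flim (at_point z) (fun w => w) z.
Proof. intros eps He. exists eps. auto. Qed.

Lemma flim_minus_pt z w : flim (at_point z) (fun t => t - w) (z - w).
Proof. apply (flim_plus (fun t => t) (fun _ => - w)); [apply flim_id|apply flim_const]. Qed.

Lemma flim_comp {T} (F : (T -> Prop) -> Prop) {FF : Filter F} (u : T -> C) (z : C) (f : C -> C) l :
  flim F u z -> flim (at_point z) f l -> flim F (fun t => f (u t)) l.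
Proof.
  intros Hu Hf eps He. destruct (Hf eps He) as (d & Hd & K).
  generalize (Hu d Hd). apply filter_imp. auto.
Qed.

Lemma flim_e z : flim (at_point z) e (e z).
Proof.
  assert (H : flim (at_point z) (fun w => e z * e (w - z)) (e z * 1)).
  { apply flim_mult; [apply flim_const|]. apply (flim_comp _ (fun w => w - z) 0 e 1).
    - replace (RtoC 0) with (z - z) by ring. apply flim_minus_pt.
    - exact e_cont_0. }
  intros eps He. generalize (H eps He). apply filter_imp. intros w Hw.
  rewrite <- e_add in Hw. replace (z + (w - z)) with w in Hw by ring. now rewrite Cmult_1_r in Hw.
Qed.

(** Dominated convergence on the half-plane Im w > Im z / 2. *)
Lemma th3_continuous z : (0 < Im z)%R -> flim (at_point z) th3 (th3 z).
Proof.
  intros H. pose proof PI_RGT_0.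
  destruct (gauss_sum_le (2 * PI * (Im z / 2)) 0) as [M HM].
  { apply Rmult_lt_0_compat; lra. }
  refine (tannery (at_point z) (fun w (n : Z) => e (IZR n * IZR n * w)) th3 (fun n : Z => e (IZR n * IZR n * z)) (th3 z)
    (fun n : Z => exp (- (2 * PI * (Im z / 2) * IZR n ^ 2 + 0 * IZR n))) M _ HM _ _ _ _ (has_th3 z H)).
  - intros n. left. apply exp_pos.
  - exists (Im z / 2)%R. split; [lra|]. intros w Hw n.
    rewrite <- RtoC_mult, Cmod_e, Im_scal_R. apply exp_le.
    assert (Q : (Im z / 2 <= Im w)%R).
    { assert (K : (Rabs (Im (w - z)) <= Cmod (w - z))%R) by (eapply Rle_trans; [apply Rmax_r|apply Rmax_Cmod]).
      replace (Im (w - z)) with (Im w - Im z)%R in K by reflexivity.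
      assert (L : (Rabs (Im w - Im z) < Im z / 2)%R) by lra. apply Rabs_def2 in L. lra. }
    assert (N : (0 <= IZR n * IZR n)%R) by nra.
    assert (IZR n * IZR n * (Im z / 2) <= IZR n * IZR n * Im w)%R by (apply Rmult_le_compat_l; auto).
    nra.
  - intros n eps He. revert eps He.
    change (flim (at_point z) (fun w => e (IZR n * IZR n * w)) (e (IZR n * IZR n * z))).
    apply (flim_comp _ (fun w => IZR n * IZR n * w) (IZR n * IZR n * z) e); [|apply flim_e].
    apply (flim_mult (fun _ => IZR n * IZR n)); [apply flim_const|apply flim_id].
  - intros n. rewrite <- RtoC_mult, Cmod_e, Im_scal_R. apply exp_le.
    assert (N : (0 <= IZR n * IZR n)%R) by nra.
    assert (IZR n * IZR n * (Im z / 2) <= IZR n * IZR n * Im z)%R by (apply Rmult_le_compat_l; lra).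
    nra.
  - exists (Im z / 2)%R. split; [lra|]. intros w Hw. apply has_th3.
    assert (K : (Rabs (Im (w - z)) <= Cmod (w - z))%R) by (eapply Rle_trans; [apply Rmax_r|apply Rmax_Cmod]).
    replace (Im (w - z)) with (Im w - Im z)%R in K by reflexivity.
    assert (L : (Rabs (Im w - Im z) < Im z / 2)%R) by lra. apply Rabs_def2 in L. lra.
Qed.

(** On the imaginary axis all terms are positive reals, so the sum is real and nonnegative; [th3_nz]
    excludes 0. *)
Lemma th3_imag (y : R) : (0 < y)%R -> exists r, (0 < r)%R /\ th3 (Ci * y) = r.
Proof.
  intros Hy. assert (H : (0 < Im (Ci * y))%R) by (unfold Ci, Cmult, RtoC, Im; cbn [fst snd]; lra).
  pose proof (has_th3 _ H) as P.
  assert (E : forall n : Z, e (IZR n * IZR n * (Ci * y)) = RtoC (exp (- (2 * PI * (IZR n * IZR n * y))))).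
  { intros n. rewrite e_cos_sin.
    replace (IZR n * IZR n * (Ci * y)) with ((0, IZR n * IZR n * y)%R : C)
      by (unfold Ci, Cmult, RtoC; cbn [fst snd]; f_equal; ring).
    cbn [Re Im fst snd]. rewrite Rmult_0_r, cos_0, sin_0. unfold RtoC. f_equal; ring. }
  destruct (abs_sum_th3 _ H) as [M HM].
  destruct (has_sum_nonneg (fun n : Z => exp (- (2 * PI * (IZR n * IZR n * y)))) M) as [r Hr].
  { intros n. left. apply exp_pos. }
  { eapply sum_le_mono; [|exact HM]. intros n; cbv beta. rewrite E, Cmod_R, Rabs_right; [lra|].
    left. apply exp_pos. }
  assert (Er : th3 (Ci * y) = r).
  { apply (has_sum_unique _ _ _ P). eapply has_sum_ext; [|exact Hr]. intros n. now rewrite E. }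
  exists r. split; auto.
  assert (r <> 0%R) by (intros E0; apply (th3_nz _ H); now rewrite Er, E0).
  assert (0 <= r)%R; [|lra].
  apply Rnot_lt_le. intros Hn. destruct (Hr (- r)%R ltac:(lra)) as [l0 Hl].
  specialize (Hl (union l0 nil) (union_NoDup _ _) (union_l _ _)).
  assert (E1 : forall (g : Z -> R) l, lsum (fun i => RtoC (g i)) l = RtoC (rsum g l)).
  { intros g l1. induction l1 as [|x l1 IH]; simpl; auto. rewrite IH. now rewrite RtoC_plus. }
  rewrite E1, <- RtoC_minus, Cmod_R in Hl. apply Rabs_def2 in Hl.
  pose proof (rsum_ge0 (fun n : Z => exp (- (2 * PI * (IZR n * IZR n * y)))) (union l0 nil)) as G.
  assert (0 <= rsum (fun n : Z => exp (- (2 * PI * (IZR n * IZR n * y)))) (union l0 nil))%R.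
  { apply G. intros n. left. apply exp_pos. }
  lra.
Qed.

(* th_factor (tau/2) * th_factor (tau/4) is a square root of -tau^2/2; continuity along the segment
   from i to tau, where it starts at a positive value, decides between the two. *)
Lemma th_factor_prod tau : (0 < Im tau)%R ->
  th_factor (tau / 2) * th_factor (tau / 4) = - (Ci * tau) / sqrt 2.
Proof.
  intros H.
  (* N / D is the quotient of the two sides of the goal; [Sq] and [Pm] show that it is 1 or -1 at
     each point. *)
  set (N := fun s => th3 (inv4 (s / 2)) * th3 (inv4 (s / 4))).
  set (D := fun s => - (Ci * s) / sqrt 2 * (th3 (s / 2) * th3 (s / 4))).
  assert (Hs2 : (0 < sqrt 2)%R) by (apply sqrt_lt_R0; lra).
  assert (Ns2 : RtoC (sqrt 2) <> 0) by (intros E; apply RtoC_inj in E; lra).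
  assert (S2 : RtoC (sqrt 2) * sqrt 2 = 2) by (rewrite <- RtoC_mult, sqrt_sqrt by lra; reflexivity).
  assert (I4 : forall s, (0 < Im s)%R -> (0 < Im (s / 2))%R /\ (0 < Im (s / 4))%R).
  { intros s Hs. rewrite !Im_div_R by lra. lra. }
  assert (DN : forall s, (0 < Im s)%R -> D s <> 0).
  { intros s Hs. destruct (I4 s Hs) as [A B]. unfold D. pose proof (H_nz s Hs). pose proof Ci_neq0.
    apply Cmult_neq_0; [apply Cdiv_neq_0; auto|apply Cmult_neq_0; now apply th3_nz].
    intros E. apply (Cmult_neq_0 Ci s); auto. transitivity (- - (Ci * s)); [ring|]. rewrite E. ring. }
  assert (Sq : forall s, (0 < Im s)%R -> N s * N s = D s * D s).
  { intros s Hs. destruct (I4 s Hs) as [A B]. unfold N, D. rewrite !th3_inv by auto.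
    transitivity (th_factor (s / 2) * th_factor (s / 2) * (th_factor (s / 4) * th_factor (s / 4)) * (th3 (s / 2) * th3 (s / 4) * (th3 (s / 2) * th3 (s / 4)))); [ring|].
    rewrite !th_factor_sq by auto.
    transitivity (Ci * Ci * s * s / (sqrt 2 * sqrt 2) * (th3 (s / 2) * th3 (s / 4) * (th3 (s / 2) * th3 (s / 4)))).
    - rewrite S2. field.
    - field. auto. }
  assert (Pm : forall s, (0 < Im s)%R -> N s = D s \/ N s = - D s).
  { intros s Hs. specialize (Sq s Hs).
    destruct (eq_em (N s - D s) 0) as [E|E]; [left; now apply Ceq_minus|right].
    apply Ceq_minus. replace (N s - - D s) with (N s + D s) by ring.
    transitivity ((N s - D s) * (N s + D s) / (N s - D s)); [field; auto|].
    replace ((N s - D s) * (N s + D s)) with (N s * N s - D s * D s) by ring. rewrite Sq. field. auto. }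
  assert (Main : N tau = D tau).
  2: { destruct (I4 tau H) as [A B]. unfold N, D in Main. rewrite !th3_inv in Main by auto.
       pose proof (th3_nz _ A). pose proof (th3_nz _ B).
       transitivity (th_factor (tau / 2) * th3 (tau / 2) * (th_factor (tau / 4) * th3 (tau / 4)) / (th3 (tau / 2) * th3 (tau / 4))); [field; auto|].
       rewrite Main. field. auto. }
  assert (NC : forall s, (0 < Im s)%R -> flim (at_point s) N (N s)).
  { intros s Hs. pose proof (H_nz s Hs). destruct (I4 s Hs) as [A B].
    assert (K : forall c : C, c <> 0 -> (0 < Im (inv4 (s / c)))%R -> flim (at_point s) (fun t => th3 (inv4 (t / c))) (th3 (inv4 (s / c)))).
    { intros c Hc Hp. apply (flim_comp _ (fun t => inv4 (t / c)) (inv4 (s / c)) th3); [|now apply th3_continuous].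
      unfold inv4. apply (flim_mult (fun _ => - (1))); [apply flim_const|]. apply flim_inv.
      - apply Cmult_neq_0; auto. now apply Cdiv_neq_0.
      - apply (flim_mult (fun _ => 4)); [apply flim_const|]. apply flim_mult; [apply flim_id|apply flim_const]. }
    apply flim_mult; apply K; auto; now apply Im_inv4. }
  assert (DC : forall s, (0 < Im s)%R -> flim (at_point s) D (D s)).
  { intros s Hs. destruct (I4 s Hs) as [A B].
    assert (K : forall c : C, (0 < Im (s / c))%R -> flim (at_point s) (fun t => th3 (t / c)) (th3 (s / c))).
    { intros c Hp. apply (flim_comp _ (fun t => t / c) (s / c) th3); [|now apply th3_continuous].
      apply flim_mult; [apply flim_id|apply flim_const]. }
    apply flim_mult; [|apply flim_mult; now apply K].
    apply (flim_mult (fun t => - (Ci * t))); [|apply flim_const].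
    apply flim_opp, (flim_mult (fun _ => Ci)); [apply flim_const|apply flim_id]. }
  set (path := fun t : R => Ci + t * (tau - Ci)).
  assert (Hp : forall t, (0 <= t <= 1)%R -> (0 < Im (path t))%R).
  { intros t Ht. unfold path. rewrite Im_plus, Im_scal_R.
    replace (Im (tau - Ci)) with (Im tau - 1)%R by reflexivity. replace (Im Ci) with 1%R by reflexivity. nra. }
  set (phi := fun t : R => Re (N (path t) / D (path t))).
  assert (phiC : forall t, (0 <= t <= 1)%R -> continuity_pt (fun t => - phi t)%R t).
  { intros t Ht. specialize (Hp t Ht).
    assert (Q : flim (at_point (path t)) (fun s => N s / D s) (N (path t) / D (path t))).
    { apply flim_mult; [now apply NC|]. apply flim_inv; [now apply DN|now apply DC]. }
    intros eps He. destruct (Q eps He) as (d & Hd & K).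
    pose proof (Cmod_ge_0 (tau - Ci)) as Pc.
    exists (d / (Cmod (tau - Ci) + 1))%R. split; [apply Rdiv_lt_0_compat; lra|].
    intros u [_ Hu]. change (Rabs (u - t) < d / (Cmod (tau - Ci) + 1))%R in Hu.
    change (Rabs (- phi u - - phi t) < eps)%R.
    replace (- phi u - - phi t)%R with (- (phi u - phi t))%R by ring. rewrite Rabs_Ropp.
    replace (phi u - phi t)%R with (Re (N (path u) / D (path u) - N (path t) / D (path t))) by reflexivity.
    eapply Rle_lt_trans; [apply re_le_Cmod|]. apply K.
    replace (path u - path t) with (RtoC (u - t) * (tau - Ci)) by (unfold path; rewrite RtoC_minus; ring).
    rewrite Cmod_mult, Cmod_R.
    apply Rle_lt_trans with (Rabs (u - t) * (Cmod (tau - Ci) + 1))%R.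
    { apply Rmult_le_compat_l; [apply Rabs_pos|lra]. }
    apply Rmult_lt_compat_r with (r := (Cmod (tau - Ci) + 1)%R) in Hu; [|lra].
    replace (d / (Cmod (tau - Ci) + 1) * (Cmod (tau - Ci) + 1))%R with d in Hu by (field; lra). exact Hu. }
  assert (phi_pm : forall t, (0 <= t <= 1)%R -> phi t = 1%R \/ (phi t = -1)%R /\ N (path t) = - D (path t)).
  { intros t Ht. specialize (Hp t Ht). pose proof (DN _ Hp) as Dz. unfold phi.
    destruct (Pm _ Hp) as [E|E]; rewrite E; [left|right; split; auto].
    - replace (D (path t) / D (path t)) with (RtoC 1) by (field; auto). reflexivity.
    - replace (- D (path t) / D (path t)) with (RtoC (-1)) by (field; auto). reflexivity. }
  (* At s = i the points inv4(i/2) = i/2 and inv4(i/4) = i are again imaginary and - (i i) / sqrt 2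
     is positive, so N and D are both positive. *)
  assert (phi0 : phi 0%R = 1%R).
  { destruct (phi_pm 0%R ltac:(lra)) as [|[_ E]]; auto. exfalso.
    unfold path in E. replace (Ci + 0 * (tau - Ci)) with Ci in E by ring. unfold N, D in E.
    pose proof Ci_neq0 as Nc.
    replace (inv4 (Ci / 2)) with (Ci * (1 / 2)%R) in E.
    2: { unfold inv4. rewrite <- CiCi, RtoC_div by lra. field. auto. }
    replace (inv4 (Ci / 4)) with (Ci * 1%R) in E.
    2: { unfold inv4. rewrite <- CiCi. field. auto. }
    replace (Ci / 2) with (Ci * (1 / 2)%R) in E by (rewrite RtoC_div by lra; field).
    replace (Ci / 4) with (Ci * (1 / 4)%R) in E by (rewrite RtoC_div by lra; field).
    destruct (th3_imag (1 / 2) ltac:(lra)) as (a & Ha & Ea). destruct (th3_imag 1 ltac:(lra)) as (b & Hb & Eb).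
    destruct (th3_imag (1 / 4) ltac:(lra)) as (c & Hc & Ec). rewrite Ea, Eb, Ec, CiCi in E.
    replace (- - (1) / sqrt 2) with (RtoC (1 / sqrt 2)) in E by (rewrite RtoC_div by lra; field; auto).
    rewrite <- !RtoC_mult, <- RtoC_opp in E. apply RtoC_inj in E.
    assert (0 < a * b)%R by nra. assert (0 < 1 / sqrt 2 * (a * c))%R.
    { apply Rmult_lt_0_compat; [apply Rdiv_lt_0_compat; lra|nra]. }
    lra. }
  assert (path1 : path 1%R = tau) by (unfold path; ring).
  rewrite <- path1.
  destruct (phi_pm 1%R ltac:(lra)) as [E|[E _]].
  - destruct (Pm _ (Hp 1%R ltac:(lra))) as [|E2]; auto. exfalso. unfold phi in E. rewrite E2 in E.
    replace (- D (path 1%R) / D (path 1%R)) with (RtoC (-1)) in E.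
    + rewrite re_RtoC in E. lra.
    + field. apply DN, Hp. lra.
  (* A change of sign of phi would force a zero, while phi takes only the values 1 and -1. The sign
     of - phi fits the hypotheses of the intermediate value theorem. *)
  - exfalso. destruct (IVT_interv (fun t => - phi t)%R 0 1 phiC ltac:(lra) ltac:(lra) ltac:(lra)) as (t & Ht & Ez).
    destruct (phi_pm t Ht) as [Et|[Et _]]; lra.
Qed.

(** * The q-series as Lambert series *)

Import QuadraticResidues.

Lemma residue_test (c p x : nat) : (0 < p)%nat ->
  ((Z.of_nat x ^ 2 - - Z.of_nat c) mod Z.of_nat p =? 0)%Z = true <-> is_true (div.dvdn p (ssrnat.addn (ssrnat.expn x 2) c)).
Proof.
  intros Hp. rewrite dvdn_divide, Z.eqb_eq.
  change (ssrnat.addn (ssrnat.expn x 2) c) with (x * x + c)%nat.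
  replace (Z.of_nat x ^ 2 - - Z.of_nat c)%Z with (Z.of_nat (x * x + c)) by lia.
  rewrite Z.mod_divide by lia. split.
  - intros [k Hk]. exists (Z.to_nat k). nia.
  - intros [k Hk]. exists (Z.of_nat k). lia.
Qed.

Lemma legendre_value (c p : nat) (P : Prop) : (0 < p)%nat -> ~ Nat.divide p c ->
  ((exists2 x : nat, is_true (ssrnat.leq (S x) p) & is_true (div.dvdn p (ssrnat.addn (ssrnat.expn x 2) c))) <-> P) ->
  legendre (- Z.of_nat c) p = if ClassicalEpsilon.excluded_middle_informative P then 1%Z else (-1)%Z.
Proof.
  intros Hp Hc HP. unfold legendre.
  destruct (Z.eqb_spec ((- Z.of_nat c) mod Z.of_nat p) 0) as [E|_].
  { exfalso. apply Hc. apply Z.mod_divide in E; [|lia]. destruct E as [k Hk].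
    exists (Z.to_nat (- k)). nia. }
  destruct (existsb _ (List.seq 0 p)) eqn:E; destruct (ClassicalEpsilon.excluded_middle_informative P) as [Y|N]; auto; exfalso.
  - apply N, HP. apply existsb_exists in E. destruct E as (x & Hx & Ex). apply in_seq in Hx.
    exists x; [|now apply residue_test]. apply (ssrbool.introT ssrnat.ltP). lia.
  - apply HP in Y. destruct Y as [x Hx Dx].
    assert (T : existsb (fun x => ((Z.of_nat x ^ 2 - - Z.of_nat c) mod Z.of_nat p =? 0)%Z) (List.seq 0 p) = true).
    { apply existsb_exists. exists x. split; [|now apply residue_test].
      apply in_seq. apply (ssrbool.elimT ssrnat.ltP) in Hx. lia. }
    rewrite T in E. discriminate.
Qed.

Lemma prime_not_divide_pow2 (p k : nat) : is_true (prime.prime p) -> p <> 2%nat -> ~ Nat.divide p (ssrnat.expn 2 k).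
Proof.
  intros Hp H2 D. apply dvdn_divide in D.
  pose proof (@odd_prime_dvd_pow2 p k Hp (odd_modulo Hp H2)) as Q. now rewrite D in Q.
Qed.

Lemma prime_pos (p : nat) : is_true (prime.prime p) -> (0 < p)%nat.
Proof. intros Hp. apply (ssrbool.elimT ssrnat.ltP). now apply prime.prime_gt0. Qed.

Lemma odd_std (p : nat) : is_true (prime.prime p) -> p <> 2%nat -> exists k, p = (2 * k + 1)%nat.
Proof.
  intros Hp H2. pose proof (odd_modulo Hp H2) as O. destruct (Nat.Even_or_Odd p) as [[k E]|[k E]]; [|now exists k].
  exfalso. rewrite E in O. change (2 * k)%nat with (ssrnat.muln 2 k) in O. rewrite ssrnat.oddM in O. discriminate.
Qed.

Lemma kronecker_prime_m4 (p : nat) : is_true (prime.prime p) -> kronecker_prime (-4) p = chi4 p.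
Proof.
  intros Hp. unfold kronecker_prime. destruct (Nat.eqb_spec p 2) as [->|H2]; [reflexivity|].
  pose proof (prime_pos p Hp) as P0.
  change (-4)%Z with (- Z.of_nat 4)%Z.
  rewrite (legendre_value 4 p _ P0 (prime_not_divide_pow2 p 2 Hp H2) (@residue_m4 p Hp (odd_modulo Hp H2))).
  destruct (odd_std p Hp H2) as [k Hk].
  rewrite modn_modulo by reflexivity. unfold chi4.
  pose proof (Nat.mod_upper_bound p 4 ltac:(lia)) as B. pose proof (Nat.div_mod p 4 ltac:(lia)) as E.
  destruct (ClassicalEpsilon.excluded_middle_informative (p mod 4 = 1)%nat) as [->|N]; auto.
  destruct (p mod 4)%nat as [|[|[|[|m]]]]; try lia; auto.
Qed.

Lemma kronecker_prime_m8 (p : nat) : is_true (prime.prime p) -> kronecker_prime (-8) p = chi8 p.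
Proof.
  intros Hp. unfold kronecker_prime. destruct (Nat.eqb_spec p 2) as [->|H2]; [reflexivity|].
  pose proof (prime_pos p Hp) as P0.
  change (-8)%Z with (- Z.of_nat 8)%Z.
  rewrite (legendre_value 8 p _ P0 (prime_not_divide_pow2 p 3 Hp H2) (@residue_m8 p Hp (odd_modulo Hp H2))).
  destruct (odd_std p Hp H2) as [k Hk].
  rewrite modn_modulo by reflexivity. unfold chi8.
  pose proof (Nat.mod_upper_bound p 8 ltac:(lia)) as B. pose proof (Nat.div_mod p 8 ltac:(lia)) as E.
  destruct (ClassicalEpsilon.excluded_middle_informative (p mod 8 = 1 \/ p mod 8 = 3)%nat) as [[->| ->]|N]; auto.
  destruct (p mod 8)%nat as [|[|[|[|[|[|[|[|m]]]]]]]]; try lia; auto; exfalso; apply N; auto.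
Qed.

Lemma chi4_mult m n : chi4 (m * n) = (chi4 m * chi4 n)%Z.
Proof.
  unfold chi4. rewrite Nat.Div0.mul_mod.
  pose proof (Nat.mod_upper_bound m 4 ltac:(lia)). pose proof (Nat.mod_upper_bound n 4 ltac:(lia)).
  destruct (m mod 4)%nat as [|[|[|[|k]]]], (n mod 4)%nat as [|[|[|[|l]]]]; try lia; reflexivity.
Qed.

Lemma chi8_mult m n : chi8 (m * n) = (chi8 m * chi8 n)%Z.
Proof.
  unfold chi8. rewrite Nat.Div0.mul_mod.
  pose proof (Nat.mod_upper_bound m 8 ltac:(lia)). pose proof (Nat.mod_upper_bound n 8 ltac:(lia)).
  destruct (m mod 8)%nat as [|[|[|[|[|[|[|[|k]]]]]]]], (n mod 8)%nat as [|[|[|[|[|[|[|[|l]]]]]]]]; try lia; reflexivity.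
Qed.

Lemma kronecker_m4 n : kronecker (-4) (S n) = chi4 (S n).
Proof. apply kronecker_fold; auto using chi4_mult, kronecker_prime_m4. Qed.

Lemma kronecker_m8 n : kronecker (-8) (S n) = chi8 (S n).
Proof. apply kronecker_fold; auto using chi8_mult, kronecker_prime_m8. Qed.

(** The double series [Lam] is grouped according to the product d m; the indices are shifted by one
    throughout. *)
Lemma has_sum_qseries (g : nat -> C) tau : cubic g -> (0 < Im tau)%R ->
  has_sum (fun n => lsum g (prime.divisors (S n)) * e tau ^ S n) (Lam g tau).
Proof.
  intros Hg H. set (p := fun q : nat * nat => (S (fst q) * S (snd q) - 1)%nat).
  apply (has_sum_fibre p _ _ _ (has_lam g tau Hg H)). intros n.
  (* The fibre over n, listed through the divisors d of n + 1 with their codivisors. *)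
  set (l := map (fun d => (Nat.pred d, Nat.pred (S n / d))) (prime.divisors (S n))).
  assert (Hd : forall d, In d (prime.divisors (S n)) -> exists d' m', d = S d' /\ (S n / d = S m')%nat /\ S n = (d * S m')%nat).
  { intros d Hd. apply In_divisors in Hd. destruct Hd as [m Hm].
    destruct d as [|d']; [lia|]. destruct m as [|m']; [lia|]. exists d', m'. split; auto.
    assert (E : (S n / S d' = S m')%nat) by (rewrite Hm; apply Nat.div_mul; lia). split; auto. lia. }
  replace (lsum g (prime.divisors (S n)) * e tau ^ S n)
    with (lsum (fun i => if eq_em (p i) n then lam_term g tau i else 0) l).
  - apply has_sum_finite.
    + apply NoDup_map_NoDup_ForallPairs; [|apply NoDup_divisors].
      intros a b Ha Hb E. destruct (Hd a Ha) as (a' & _ & -> & _). destruct (Hd b Hb) as (b' & _ & -> & _).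
      inversion E. auto.
    + intros [d m] Hn. destruct (eq_em (p (d, m)) n) as [E|]; auto. exfalso. apply Hn.
      unfold p in E; cbn [fst snd] in E. apply in_map_iff. exists (S d).
      assert (En : S n = (S m * S d)%nat) by lia. split.
      * rewrite En, Nat.div_mul by lia. reflexivity.
      * apply In_divisors. now exists (S m).
  - unfold l. rewrite lsum_map. rewrite <- (Cmult_comm (e tau ^ S n)), <- lsum_scal. apply lsum_ext.
    intros d Hin. destruct (Hd d Hin) as (d' & m' & -> & E1 & E2). rewrite E1. cbn [Nat.pred].
    destruct (eq_em (p (d', m')) n) as [E|N].
    + unfold lam_term; cbn [fst snd]. rewrite <- E2, <- e_pow. ring.
    + exfalso. apply N. unfold p; cbn [fst snd]. lia.
Qed.

Lemma lsum_kronecker (D : Z) (chi : nat -> Z) n :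
  (forall d, kronecker D (S d) = chi (S d)) ->
  RtoC (IZR (kronecker_divisor_sum D (S n))) = lsum (fun d => IZR (chi d)) (prime.divisors (S n)).
Proof.
  intros HK. unfold kronecker_divisor_sum.
  (* The symbol agrees with the character at positive arguments only; the divisors are positive. *)
  assert (Hp : forall d, In d (prime.divisors (S n)) -> exists d', d = S d').
  { intros d Hd. apply In_divisors in Hd. destruct Hd as [m Hm]. destruct d; [lia|]. now exists d. }
  induction (prime.divisors (S n)) as [|d l IH]; [reflexivity|].
  cbn [map fold_right lsum]. rewrite plus_IZR, RtoC_plus. fold (lsum (fun d => RtoC (IZR (chi d))) l).
  rewrite IH by (intros; apply Hp; now right).
  destruct (Hp d (or_introl eq_refl)) as [d' ->]. now rewrite HK.
Qed.

Lemma lsum_sigma (k n : nat) :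
  RtoC (INR (Defs.sigma k (S n))) = lsum (fun d => RtoC (INR d ^ k)) (prime.divisors (S n)).
Proof.
  unfold Defs.sigma. induction (prime.divisors (S n)) as [|d l IH]; [reflexivity|].
  cbn [map fold_right lsum]. fold (lsum (fun d => RtoC (INR d ^ k)) l).
  now rewrite plus_INR, RtoC_plus, IH, pow_INR.
Qed.

Lemma E1m4_th tau : (0 < Im tau)%R -> E1m4 tau = th3 tau * th3 tau / 4.
Proof.
  intros H. unfold E1m4, qseries.
  rewrite (CSeries_has_sum _ (Lam (fun n => IZR (chi4 n)) tau)).
  - rewrite <- L1_th, L1_lam by auto. field.
  - eapply has_sum_ext; [|apply (has_sum_qseries _ tau cubic_chi4 H)]. intros n; cbv beta.
    rewrite <- (lsum_kronecker (-4) chi4); [reflexivity|apply kronecker_m4].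
Qed.

Lemma E1m8_th tau : (0 < Im tau)%R -> E1m8 tau = th3 tau * th3 (2 * tau) / 2.
Proof.
  intros H. unfold E1m8, qseries.
  rewrite (CSeries_has_sum _ (Lam (fun n => IZR (chi8 n)) tau)).
  - rewrite <- L2_th, L2_lam by auto. field.
  - eapply has_sum_ext; [|apply (has_sum_qseries _ tau cubic_chi8 H)]. intros n; cbv beta.
    rewrite <- (lsum_kronecker (-8) chi8); [reflexivity|apply kronecker_m8].
Qed.

Lemma E2_lam tau : (0 < Im tau)%R -> E2 tau = 1 - 24 * Lam id1 tau.
Proof.
  intros H. unfold E2, qseries.
  rewrite (CSeries_has_sum _ (- (24) * Lam id1 tau)); [ring|].
  eapply has_sum_ext; [|apply (has_sum_scal (- (24)) _ _ (has_sum_qseries _ tau cubic_id1 H))]. intros n; cbv beta.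
  rewrite lsum_sigma. rewrite (lsum_ext_all (fun d => RtoC (INR d ^ 1)) id1); [ring|].
  intros d. unfold id1. now rewrite pow_1.
Qed.

Lemma E4_lam tau : (0 < Im tau)%R -> E4 tau = 1 + 240 * Lam id3 tau.
Proof.
  intros H. unfold E4, qseries.
  rewrite (CSeries_has_sum _ (240 * Lam id3 tau)); [ring|].
  eapply has_sum_ext; [|apply (has_sum_scal 240 _ _ (has_sum_qseries _ tau cubic_id3 H))]. intros n; cbv beta.
  rewrite lsum_sigma. rewrite (lsum_ext_all (fun d => RtoC (INR d ^ 3)) id3); [ring|].
  intros d. unfold id3. rewrite <- !RtoC_mult. f_equal. ring.
Qed.

Lemma E22_th tau : (0 < Im tau)%R -> E22 tau = th3p4 tau + th2p4 tau.
Proof.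
  intros H. unfold E22. rewrite !E2_lam by impos. unfold th3p4, th2p4. rewrite <- E22_theta by auto. ring.
Qed.

Lemma E24_th tau : (0 < Im tau)%R ->
  E24 tau = th3p4 tau * th3p4 tau - 6 * (th3p4 tau * th2p4 tau) + th2p4 tau * th2p4 tau.
Proof.
  intros H. unfold E24. rewrite !E4_lam by impos. rewrite E4_theta_2, E4_theta by auto. field.
Qed.

(** Since -1 = e(1/2) and i = e(1/4), integer powers of either sign become values of [e]. *)
Lemma Cpowz_e z j : Cpowz (e z) j = e (IZR j * z).
Proof.
  destruct j as [|p|p]; unfold Cpowz.
  - rewrite Cmult_0_l. now rewrite e_0.
  - rewrite e_pow, INR_IZR_INZ, positive_nat_Z. reflexivity.
  - rewrite e_pow, <- e_opp, INR_IZR_INZ, positive_nat_Z. f_equal.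
    replace (IZR (Z.neg p)) with (- IZR (Z.pos p))%R by (rewrite <- opp_IZR; reflexivity). rewrite RtoC_opp. ring.
Qed.

Lemma Cpowz_m1 j : Cpowz (-1) j = sgn j.
Proof.
  replace (RtoC (-1)) with (e (1 / 2)) by (rewrite e_half; ring).
  rewrite Cpowz_e, <- e_half_Z. f_equal. field.
Qed.

Lemma Cpowz_Ci j : Cpowz Ci j = e (IZR j / 4).
Proof. rewrite <- e_quarter, Cpowz_e. f_equal. field. Qed.

(** The two last values of [E1m4] differ by (th3^2 - th4^2) / 4 at tau / 2, which is th2(tau)^2 /
    2. *)
Lemma f2_th j tau : (0 < Im tau)%R ->
  f2 j tau = th3 tau * th3 tau + sgn j * Ci * (th2 tau * th2 tau).
Proof.
  intros H. assert (H2 := Im_half_scal tau H). unfold f2. rewrite Cpowz_m1.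
  assert (H3 : (0 < Im (tau / 2 + 1 / 2))%R) by (now rewrite Im_half).
  replace ((tau + 1) / 2) with (tau / 2 + 1 / 2) by field.
  rewrite !E1m4_th by auto. fold (th4 (tau / 2)).
  rewrite th4_sq, (th3_sq (tau / 2)) by auto.
  replace (2 * (tau / 2)) with tau by field. field.
Qed.

Lemma th4_quad tau : (0 < Im tau)%R -> th4 tau = th3 (4 * tau) - th2 (4 * tau).
Proof.
  intros H. pose proof (th34_plus tau H) as E. rewrite (th3_quad tau H) in E.
  transitivity (th3 (4 * tau) + th2 (4 * tau) + th4 tau - (th3 (4 * tau) + th2 (4 * tau))); [ring|].
  rewrite E. ring.
Qed.

(* [g_form I] is g_{2,j} for I = i^j, with (a, b, c, d) the theta constants th3, th2 at tau and 2 tau. *)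
Definition g_form (I a b c d : C) : C := a * c - I * I * (a * d) - I * (b * c) - I * I * I * (b * d).

Lemma th23_shift (r : nat) tau : (0 < Im tau)%R ->
  th3 (tau + INR r) = th3 tau /\ th2 (tau + INR r) = Ci ^ r * th2 tau.
Proof.
  intros H. induction r as [|r [IH1 IH2]].
  - simpl. rewrite Cplus_0_r. split; [auto|ring].
  - rewrite S_INR, RtoC_plus, Cplus_assoc, th3_1, th2_1 by (now rewrite Im_add_R).
    rewrite IH1, IH2. split; auto. simpl. ring.
Qed.

Lemma E1m8_shift (r : nat) tau : (0 < Im tau)%R ->
  E1m8 ((tau + INR r) / 4) = (th3 tau + Ci ^ r * th2 tau) * (th3 (2 * tau) + Ci ^ (2 * r) * th2 (2 * tau)) / 2.
Proof.
  intros H. assert (H' : (0 < Im (tau + INR r))%R) by (now rewrite Im_add_R).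
  assert (H4 : (0 < Im ((tau + INR r) / 4))%R) by (rewrite Im_div_R by lra; lra).
  rewrite E1m8_th by auto. rewrite (th3_quad ((tau + INR r) / 4)) by auto.
  rewrite (th3_quad (2 * ((tau + INR r) / 4))) by impos.
  replace (4 * ((tau + INR r) / 4)) with (tau + INR r) by field.
  replace (4 * (2 * ((tau + INR r) / 4))) with (2 * tau + INR (2 * r)).
  2: { rewrite mult_INR, RtoC_mult. change (INR 2) with 2%R. field. }
  destruct (th23_shift r tau H) as [-> ->]. destruct (th23_shift (2 * r) (2 * tau) ltac:(impos)) as [-> ->]. reflexivity.
Qed.

Lemma Ci_pow_e (j : Z) : e (IZR j / 4) = Ci ^ Z.to_nat (j mod 4).
Proof.
  rewrite <- e_quarter, e_pow. pose proof (Z.mod_pos_bound j 4 ltac:(lia)).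
  apply e_shift_eq with (j / 4)%Z. rewrite INR_IZR_INZ, Z2Nat.id by lia.
  rewrite (Z.div_mod j 4) at 1 by lia. push. field.
Qed.

Lemma sum_n_3 (u : nat -> C) : sum_n u 3 = u 0%nat + u 1%nat + u 2%nat + u 3%nat.
Proof. rewrite !sum_Sn, sum_O. reflexivity. Qed.

Lemma delta4_coef (i : nat) j : (i < 4)%nat ->
  RtoC (IZR (1 - 2 * delta4 (Z.of_nat i) j)) = if Nat.eqb i (Z.to_nat (j mod 4)) then - (1) else 1.
Proof.
  intros Hi. unfold delta4.
  pose proof (Z.mod_pos_bound j 4 ltac:(lia)) as B. pose proof (Z.div_mod j 4 ltac:(lia)) as D.
  destruct (Nat.eqb_spec i (Z.to_nat (j mod 4))) as [E|N]; destruct (Z.eqb_spec ((Z.of_nat i - j) mod 4) 0) as [E'|N'].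
  - change (1 - 2 * 1)%Z with (-1)%Z. ring.
  - exfalso. apply N'. replace (Z.of_nat i - j)%Z with ((- (j / 4)) * 4)%Z by lia. apply Z.mod_mul. lia.
  - exfalso. apply Z.mod_divide in E'; [|lia]. destruct E' as [q Hq]. apply N. lia.
  - reflexivity.
Qed.

(** With I = i^j, the four products (a + i^r b) (c + i^(2r) d) / 2 add up to 2 a c, as the powers of
    i cancel. The coefficient -1 at r = j then subtracts (a + I b) (c + I^2 d). *)
Lemma g2_th j tau : (0 < Im tau)%R ->
  g2 j tau = g_form (Cpowz Ci j) (th3 tau) (th2 tau) (th3 (2 * tau)) (th2 (2 * tau)).
Proof.
  intros H. unfold g2. rewrite Cpowz_Ci, Ci_pow_e, sum_n_3.
  rewrite !E1m8_shift by auto. rewrite !delta4_coef by lia.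
  set (a := th3 tau). set (b := th2 tau). set (c := th3 (2 * tau)). set (d := th2 (2 * tau)).
  pose proof CiCi as CC. set (I := Ci) in *. clearbody I a b c d.
  pose proof (Z.mod_pos_bound j 4 ltac:(lia)) as B.
  assert (R : (Z.to_nat (j mod 4) < 4)%nat) by lia. revert R. generalize (Z.to_nat (j mod 4)) as r. intros r R.
  destruct r as [|[|[|[|r]]]]; [| | | |lia]; cbn [Nat.eqb]; unfold g_form; simpl Cpow; field [CC].
Qed.

Lemma g_form_sq I a b c d : I * I * I * I = 1 -> a * a = c * c + d * d -> b * b = 2 * d * c ->
  g_form I a b c d * g_form I a b c d =
  a * a * (a * a) + b * b * (b * b) - 2 * I * (b * a * (c * c - d * d)).
Proof. intros HI Ha Hb. unfold g_form. ring [HI Ha Hb]. Qed.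

(** * The functions f_{2,j} and g_{2,j} *)

Lemma sgn_S j : sgn (j + 1) = - sgn j.
Proof. rewrite sgn_add. unfold sgn at 2; simpl. ring. Qed.

Lemma eta2_sq_cd tau : (0 < Im tau)%R ->
  eta2 tau ^ 2 = th2 tau * th3 tau * (th3 (2 * tau) * th3 (2 * tau) - th2 (2 * tau) * th2 (2 * tau)) / 2.
Proof.
  intros H. rewrite <- th4_sq, <- eta2_sq by auto. field.
Qed.

(** With s = (-1)^j, the odd part of (a^2 + s i b^2)^4 is 4 s i a^2 b^2 (a^4 - b^4), and a^4 - b^4 =
    (c^2 - d^2)^2 makes it 16 s i eta_2^4. *)
Lemma f2_pow4 j tau : (0 < Im tau)%R -> f2 j tau ^ 4 = F2 (j + 1) tau.
Proof.
  intros H. unfold F2. rewrite Cpowz_m1, sgn_S, E24_th, f2_th by auto.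
  replace (eta2 tau ^ 4) with (eta2 tau ^ 2 * eta2 tau ^ 2) by (simpl; ring).
  rewrite eta2_sq_cd by auto. unfold th3p4, th2p4.
  pose proof (th3_sq tau H) as Ha. pose proof (th2_sq tau H) as Hb.
  pose proof CiCi as CC. pose proof (sgn_sq j) as S.
  set (a := th3 tau) in *. set (b := th2 tau) in *. set (c := th3 (2 * tau)) in *. set (d := th2 (2 * tau)) in *.
  set (s := sgn j) in *. set (I := Ci) in *. clearbody a b c d s I.
  simpl Cpow. field [Ha Hb CC S].
Qed.

Lemma f2_mul j tau : (0 < Im tau)%R -> f2 j tau * f2 (j + 1) tau = E22 tau.
Proof.
  intros H. rewrite E22_th, !f2_th, sgn_S by auto. unfold th3p4, th2p4.
  pose proof CiCi as CC. pose proof (sgn_sq j) as S.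
  set (a := th3 tau) in *. set (b := th2 tau) in *. set (s := sgn j) in *. set (I := Ci) in *. clearbody a b s I.
  ring [CC S].
Qed.

Lemma E1m4_1 tau : E1m4 (tau + 1) = E1m4 tau.
Proof. unfold E1m4, qseries. rewrite e_add, e_1, Cmult_1_r. reflexivity. Qed.

Lemma E1m8_1 tau : E1m8 (tau + 1) = E1m8 tau.
Proof. unfold E1m8, qseries. rewrite e_add, e_1, Cmult_1_r. reflexivity. Qed.

Lemma f2_1 j tau : f2 j (tau + 1) = f2 (j + 1) tau.
Proof.
  unfold f2. rewrite !Cpowz_m1, sgn_S, E1m4_1.
  replace ((tau + 1 + 1) / 2) with (tau / 2 + 1) by field. rewrite E1m4_1. ring.
Qed.

Lemma inv_two_inv4 tau : (0 < Im tau)%R -> -1 / (2 * tau) = inv4 (tau / 2).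
Proof. intros H. pose proof (H_nz tau H). unfold inv4. field. auto. Qed.

(** At -1 / (2 tau) the squares a^2 and b^2 become k^2 (c + d)^2 = k^2 (a^2 + b^2) and k^2 (c - d)^2
    = k^2 (a^2 - b^2), where k^2 = - i tau is the square of the multiplier. *)
Lemma f2_inv j tau : (0 < Im tau)%R ->
  f2 j (-1 / (2 * tau)) = (Cpowz (-1) j - Ci) * tau * f2 (j + 1) tau.
Proof.
  intros H. pose proof (H_nz tau H) as Nt. assert (H2 := Im_half_scal tau H).
  rewrite inv_two_inv4, Cpowz_m1, !f2_th, sgn_S by (auto; now apply Im_inv4).
  rewrite th3_inv, th2_inv_factor by auto.
  pose proof (th_factor_sq (tau / 2) H2) as F.
  rewrite (th4_quad (tau / 2)), (th3_quad (tau / 2)) by auto.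
  replace (4 * (tau / 2)) with (2 * tau) by field.
  pose proof (th3_sq tau H) as Ha. pose proof (th2_sq tau H) as Hb.
  pose proof CiCi as CC. pose proof (sgn_sq j) as S.
  assert (F2 : th_factor (tau / 2) * th_factor (tau / 2) = - (Ci * tau)) by (rewrite F; field).
  set (a := th3 tau) in *. set (b := th2 tau) in *. set (c := th3 (2 * tau)) in *. set (d := th2 (2 * tau)) in *.
  set (s := sgn j) in *. set (k := th_factor (tau / 2)) in *. set (I := Ci) in *. clearbody a b c d s k I.
  ring [Ha Hb CC S F2].
Qed.

Lemma sgn_cases j : sgn j = 1 \/ sgn j = - (1).
Proof. unfold sgn. destruct (Z.even j); auto. Qed.

(** With s = (-1)^j and t = (s + i) / 2, inversion followed by translation by s fixes t, and the
    transformation laws give f = - s i f there. *)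
Lemma f2_zero j : f2 j ((Cpowz (-1) j + Ci) / 2) = 0.
Proof.
  rewrite Cpowz_m1. set (t := (sgn j + Ci) / 2).
  pose proof CiCi as CC. pose proof (sgn_sq j) as S.
  assert (Ht : (0 < Im t)%R).
  { unfold t. rewrite Im_div_R, Im_plus by lra. replace (Im Ci) with 1%R by reflexivity.
    destruct (sgn_cases j) as [->| ->]; unfold Im, Copp, RtoC; cbn [fst snd]; lra. }
  pose proof (f2_inv (j + 1) t Ht) as E. rewrite Cpowz_m1, sgn_S in E.
  assert (Nt : t <> 0) by (now apply H_nz).
  (* Since |t|^2 = 1/2, inversion is t -> - conj(t), the translation by - s. *)
  assert (E1 : -1 / (2 * t) = t - sgn j).
  { transitivity ((-1 + 2 * t * (sgn j - t)) / (2 * t) + (t - sgn j)); [field; auto|].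
    replace (-1 + 2 * t * (sgn j - t)) with (RtoC 0); [field; auto|].
    unfold t. field [CC S]. }
  assert (E2 : f2 (j + 1) (t - sgn j) = f2 j t).
  { assert (P : forall i s, f2 (i + 1) (s - 1) = f2 i s).
    { intros i s. rewrite <- f2_1. replace (s - 1 + 1 ) with s by ring.
      unfold f2. rewrite !Cpowz_m1. reflexivity. }
    assert (P2 : forall i s, f2 (i + 1 + 1) s = f2 i s).
    { intros i s. unfold f2. rewrite !Cpowz_m1, !sgn_S.
      replace (- - sgn i) with (sgn i) by ring. reflexivity. }
    destruct (sgn_cases j) as [->| ->].
    - apply P.
    - replace (t - - (1)) with (t + 1) by ring. rewrite f2_1. apply P2. }
  rewrite E1, E2 in E.
  assert (P2 : f2 (j + 1 + 1) t = f2 j t).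
  { unfold f2. rewrite !Cpowz_m1, !sgn_S. replace (- - sgn j) with (sgn j) by ring. reflexivity. }
  rewrite P2 in E.
  assert (K : (1 + sgn j * Ci) * f2 j t = 0).
  { transitivity (f2 j t - (- sgn j * Ci) * f2 j t); [ring|]. rewrite E at 1.
    replace ((- sgn j - Ci) * t) with (- sgn j * Ci); [ring|]. unfold t. field [CC S]. }
  (* (1 - s i) (1 + s i) = 2, so the factor 1 + s i can be cancelled. *)
  assert (K2 : 2 * f2 j t = (1 - sgn j * Ci) * ((1 + sgn j * Ci) * f2 j t)) by ring [CC S].
  rewrite K in K2. transitivity (2 * f2 j t / 2); [field|]. rewrite K2. field.
Qed.

Lemma g2_sq j tau : (0 < Im tau)%R -> g2 j tau ^ 2 = G2 j tau.
Proof.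
  intros H. unfold G2. rewrite E22_th, g2_th, eta2_sq_cd by auto. unfold th3p4, th2p4.
  simpl Cpow. rewrite Cmult_1_r, g_form_sq.
  - field.
  - rewrite Cpowz_Ci, <- !e_add, <- (e_Z j). f_equal. field.
  - now apply th3_sq.
  - rewrite th2_sq by auto. reflexivity.
Qed.

Lemma Cpowz_Ci_nat (k : nat) : Cpowz Ci (Z.of_nat k) = Ci ^ k.
Proof. rewrite Cpowz_Ci, <- e_quarter, e_pow, INR_IZR_INZ. f_equal. field. Qed.

Lemma g2_prod tau : (0 < Im tau)%R -> Cprod (fun k : nat => g2 (Z.of_nat k) tau) 4 = E24 tau.
Proof.
  intros H. rewrite E24_th by auto. cbn [Cprod]. rewrite !g2_th, !Cpowz_Ci_nat by auto.
  unfold th3p4, th2p4, g_form. simpl Cpow.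
  pose proof (th3_sq tau H) as Ha. pose proof (th2_sq tau H) as Hb. pose proof CiCi as CC.
  set (a := th3 tau) in *. set (b := th2 tau) in *. set (c := th3 (2 * tau)) in *. set (d := th2 (2 * tau)) in *.
  set (I := Ci) in *. clearbody a b c d I. ring [Ha Hb CC].
Qed.

Lemma g2_mod4 i j tau : (i mod 4 = j mod 4)%Z -> g2 i tau = g2 j tau.
Proof.
  intros E. unfold g2. apply sum_n_ext. intros k. do 4 f_equal. unfold delta4.
  assert (Q : ((Z.of_nat k - i) mod 4 = (Z.of_nat k - j) mod 4)%Z).
  { rewrite (Zminus_mod _ i), (Zminus_mod _ j), E. reflexivity. }
  now rewrite Q.
Qed.

(** The four arguments are permuted cyclically, the last one returning to the first by the period 1
    of [E1m8]. *)
Lemma g2_1 j tau : g2 j (tau + 1) = g2 (j + 1) tau.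
Proof.
  unfold g2. rewrite !sum_n_3.
  assert (D : forall i, delta4 (i + 1) (j + 1) = delta4 i j) by (intros i; unfold delta4; replace (i + 1 - (j + 1))%Z with (i - j)%Z by ring; reflexivity).
  assert (D4 : delta4 3 j = delta4 0 (j + 1)).
  { unfold delta4. replace (3 - j)%Z with (0 - (j + 1) + 1 * 4)%Z by ring. now rewrite Z.mod_add by lia. }
  change (Z.of_nat 0) with 0%Z. change (Z.of_nat 1) with (0 + 1)%Z. change (Z.of_nat 2) with (0 + 1 + 1)%Z.
  change (Z.of_nat 3) with (0 + 1 + 1 + 1)%Z.
  rewrite !D. change (0 + 1 + 1 + 1)%Z with 3%Z. rewrite D4.
  change (INR 0) with 0%R. change (INR 1) with 1%R. change (INR 2) with (1 + 1)%R. change (INR 3) with (1 + 1 + 1)%R.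
  rewrite !RtoC_plus.
  replace ((tau + 1 + (1 + 1 + 1)) / 4) with (tau / 4 + 1) by field. rewrite E1m8_1.
  replace ((tau + 1 + 0) / 4) with ((tau + 1) / 4) by field.
  replace ((tau + 1 + 1) / 4) with ((tau + (1 + 1)) / 4) by field.
  replace ((tau + 1 + (1 + 1)) / 4) with ((tau + (1 + 1 + 1)) / 4) by field.
  replace ((tau + 0) / 4) with (tau / 4) by field. ring.
Qed.

Lemma eps_Ci j : exists r : nat, (r < 4)%nat /\ Cpowz Ci j = Ci ^ r /\ eps j = if Nat.eqb r 0 then 1 else - (1).
Proof.
  pose proof (Z.mod_pos_bound j 4 ltac:(lia)) as B. exists (Z.to_nat (j mod 4)). split; [lia|].
  rewrite Cpowz_Ci, Ci_pow_e. split; auto. unfold eps.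
  destruct (Z.eqb_spec (j mod 4) 0) as [->|N]; [reflexivity|].
  destruct (Nat.eqb_spec (Z.to_nat (j mod 4)) 0); [lia|]. ring.
Qed.

(** Inversion sends (a, b) to k (c + d, c - d) and (c, d) to l (a + b, a - b). On these [g_form] is
    -2 eps times its former value, and k l = - sqrt(-2) tau / 2 by [th_factor_prod]. *)
Lemma g2_inv j tau : (0 < Im tau)%R ->
  g2 j (-1 / (2 * tau)) = eps j * sqrtm2 * tau * g2 j tau.
Proof.
  intros H. pose proof (H_nz tau H) as Nt. assert (H2 := Im_half_scal tau H).
  assert (H4 : (0 < Im (tau / 4))%R) by (rewrite Im_div_R by lra; lra).
  rewrite inv_two_inv4, !g2_th by (auto; now apply Im_inv4).
  replace (2 * inv4 (tau / 2)) with (inv4 (tau / 4)) by (unfold inv4; field; auto).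
  rewrite !th3_inv, !th2_inv_factor by auto.
  rewrite !th4_quad, (th3_quad (tau / 2)), (th3_quad (tau / 4)) by auto.
  replace (4 * (tau / 2)) with (2 * tau) by field. replace (4 * (tau / 4)) with tau by field.
  pose proof (th_factor_prod tau H) as F.
  assert (Hs2 : (0 < sqrt 2)%R) by (apply sqrt_lt_R0; lra).
  assert (Ns2 : RtoC (sqrt 2) <> 0) by (intros E; apply RtoC_inj in E; lra).
  assert (S2 : RtoC (sqrt 2) * sqrt 2 = 2) by (rewrite <- RtoC_mult, sqrt_sqrt by lra; reflexivity).
  assert (F' : th_factor (tau / 2) * th_factor (tau / 4) = - (sqrtm2 * tau) / 2).
  { rewrite F. unfold sqrtm2. rewrite <- S2. field. auto. }
  destruct (eps_Ci j) as (r & Hr & -> & ->).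
  pose proof CiCi as CC.
  set (a := th3 tau) in *. set (b := th2 tau) in *. set (c := th3 (2 * tau)) in *. set (d := th2 (2 * tau)) in *.
  set (k := th_factor (tau / 2)) in *. set (l := th_factor (tau / 4)) in *. set (q := sqrtm2) in *.
  transitivity (k * l * g_form (Ci ^ r) (c + d) (c - d) (a + b) (a - b)); [unfold g_form; ring|].
  rewrite F'. set (I := Ci) in *. clearbody a b c d k l q I.
  destruct r as [|[|[|[|r]]]]; [| | | |lia]; cbn [Nat.eqb]; unfold g_form; simpl Cpow; field [CC].
Qed.

(** The point t = sqrt(-2) / 2 is fixed by tau -> -1 / (2 tau), and for j = 0 the law reads g(t) =
    sqrt(-2) t g(t) = - g(t). Translations carry this zero to the others. *)
Lemma g2_zero j : g2 j (4 - IZR j + sqrtm2 / 2) = 0.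
Proof.
  assert (Hs2 : (0 < sqrt 2)%R) by (apply sqrt_lt_R0; lra).
  assert (S2 : RtoC (sqrt 2) * sqrt 2 = 2) by (rewrite <- RtoC_mult, sqrt_sqrt by lra; reflexivity).
  set (t := sqrtm2 / 2).
  assert (It : Im t = (sqrt 2 / 2)%R).
  { unfold t. rewrite Im_div_R by lra. unfold sqrtm2, Ci, Cmult, RtoC, Im; cbn [fst snd]. field. }
  assert (Ht : (0 < Im t)%R) by (rewrite It; lra).
  assert (Q : sqrtm2 * sqrtm2 = - (2)).
  { unfold sqrtm2. transitivity (Ci * Ci * (sqrt 2 * sqrt 2)); [ring|]. rewrite CiCi, S2. ring. }
  assert (Nq : sqrtm2 <> 0) by (intros E; rewrite E in Q; apply C2_nz; transitivity (- (- (2))); [ring|rewrite <- Q; ring]).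
  assert (Z0 : g2 0 t = 0).
  { pose proof (g2_inv 0 t Ht) as E.
    replace (-1 / (2 * t)) with t in E.
    2: { unfold t. transitivity (sqrtm2 * sqrtm2 / (2 * sqrtm2)); [field; auto|]. rewrite Q. field. auto. }
    replace (eps 0 * sqrtm2 * t) with (- (1)) in E.
    2: { unfold eps; simpl. unfold t. transitivity (sqrtm2 * sqrtm2 / 2); [rewrite Q; field|field]. }
    transitivity ((g2 0 t + g2 0 t) / 2); [field|]. rewrite E at 1. field. }
  assert (P : forall n : Z, g2 (4 - n) (t + IZR n) = 0).
  { assert (step : forall n, g2 (4 - (n + 1)) (t + IZR (n + 1)) = g2 (4 - n) (t + IZR n)).
    { intros n. replace (t + IZR (n + 1)) with (t + IZR n + 1) by (push; ring). rewrite g2_1. f_equal. ring. }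
    apply Z.bi_induction.
    - intros x y ->. tauto.
    - replace (t + 0) with t by ring. rewrite (g2_mod4 _ 0) by reflexivity. exact Z0.
    - intros n. unfold Z.succ. rewrite step. tauto. }
  specialize (P (4 - j)%Z). replace (4 - (4 - j))%Z with j in P by ring.
  replace (4 - IZR j + t) with (t + IZR (4 - j)) by (push; ring). exact P.
Qed.

Theorem mainTheorem4 :
  (forall j : Z,
     (forall tau : C, (0 < Im tau)%R -> f2 j tau ^ 4 = F2 (j + 1) tau) /\
     (forall tau : C, (0 < Im tau)%R -> f2 j tau * f2 (j + 1) tau = E22 tau) /\
     f2 j ((Cpowz (- 1) j + Ci) / 2) = 0 /\
     (forall tau : C, (0 < Im tau)%R -> f2 j (tau + 1) = f2 (j + 1) tau) /\
     (forall tau : C, (0 < Im tau)%R ->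
        f2 j (- 1 / (2 * tau)) = (Cpowz (- 1) j - Ci) * tau * f2 (j + 1) tau)) /\
  (forall j : Z,
     (forall tau : C, (0 < Im tau)%R -> g2 j tau ^ 2 = G2 j tau) /\
     (forall tau : C, (0 < Im tau)%R ->
        Cprod (fun k : nat => g2 (Z.of_nat k) tau) 4 = E24 tau) /\
     g2 j (4 - IZR j + sqrtm2 / 2) = 0 /\
     (forall tau : C, (0 < Im tau)%R -> g2 j (tau + 1) = g2 (j + 1) tau) /\
     (forall tau : C, (0 < Im tau)%R ->
        g2 j (- 1 / (2 * tau)) = eps j * sqrtm2 * tau * g2 j tau)).
Proof.
  split; intros j.
  - split; [intros; now apply f2_pow4|]. split; [intros; now apply f2_mul|].
    split; [apply f2_zero|]. split; [intros; apply f2_1|]. intros; now apply f2_inv.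
  - split; [intros; now apply g2_sq|]. split; [intros; now apply g2_prod|].
    split; [apply g2_zero|]. split; [intros; apply g2_1|]. intros; now apply g2_inv.
Qed.
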